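(* In coordinates in which the Weyl chamber of both $Sp(6,\mathbb{C})$ and $Spin(7,\mathbb{C})$ is $\Delta=\{(x,y,z)\in\mathbb{R}^3: x\ge y\ge z\ge 0\}$, the two polyhedral cones $D_3(B_3)$ and $D_3(C_3)$ in $\Delta^3\subset\mathbb{R}^9$ are equal, and this cone has precisely $102$ facets and precisely $51$ edges (extremal rays).
   Context: Let $G$ be a connected complex semisimple Lie group, $K$ a maximal compact subgroup, $X=G/K$ with base point $o=eK$, $\mathfrak{g}=\mathfrak{k}\oplus\mathfrak{p}$ the Cartan decomposition, $\mathfrak{a}\subset\mathfrak{p}$ a maximal abelian subspace, $\Delta\subset\mathfrak{a}$ a closed Weyl chamber. For $x_1,x_2\in X$ there is a unique $\delta\in\Delta$ such that some $g\in G$ maps $x_1$ to $o$ and $x_2$ to $\exp(\delta)o$; put $d_\Delta(x_1,x_2)=\delta$. The set $D_3(X)\subset\Delta^3$ consists of the $(v_1,v_2,v_3)$ for which there are $x_1,x_2,x_3\in X$ with $d_\Delta(x_1,x_2)=v_1$, $d_\Delta(x_2,x_3)=v_2$, $d_\Delta(x_3,x_1)=v_3$. It is known to be a polyhedral cone. $D_3(C_3)$ denotes $D_3(X)$ for $G=Sp(6,\mathbb{C})$, with coordinates $(x,y,z)$ on $\mathfrak{a}$ in which the simple roots are $x-y,\ y-z,\ 2z$; $D_3(B_3)$ denotes $D_3(X)$ for $G=Spin(7,\mathbb{C})$, with coordinates in which the simple roots are $x-y,\ y-z,\ z$. *)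

(* Defs.v *)
From mathcomp Require Import all_boot all_order all_algebra.
From mathcomp Require Import all_classical all_reals all_analysis.
From mathcomp Require Import complex mxtens.

Set Implicit Arguments.
Unset Strict Implicit.
Unset Printing Implicit Defensive.

Import Order.TTheory GRing.Theory Num.Theory.
Import numFieldNormedType.Exports.

Local Open Scope classical_set_scope.
Local Open Scope ring_scope.

(* The chamber x >= y >= z >= 0 in a = R^3. *)
Definition chamber (R : realType) : set 'rV[R]_3 :=
  [set v | [/\ v 0 1 <= v 0 0, v 0 2 <= v 0 1 & 0 <= v 0 2]].

Definition mexp (R : realType) (n : nat) (A : 'M[R]_n.+1) : 'M[R]_n.+1 :=
  limn (series (fun k : nat => k`!%:R^-1 *: A ^+ k)).

(* G is a complex matrix group, given as a set of matrices, such that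
   G `&` U(n) is a maximal compact subgroup; [a] embeds R^3 as a maximal abelian
   subspace of the Hermitian part p of its Lie algebra.  Here a consists of real
   matrices. *)
Section SymmetricSpace.
Variables (R : realType) (n : nat) (G : set 'M[R[i]]_n.+1).
Variable a : 'rV[R]_3 -> 'M[R]_n.+1.

Definition max_compact : set 'M[R[i]]_n.+1 :=
  G `&` [set k | k \is unitarymx].

Definition translate (g : 'M[R[i]]_n.+1) (x : set 'M[R[i]]_n.+1) :
  set 'M[R[i]]_n.+1 := [set g *m h | h in x].

(* The points of X = G/K are the left cosets g K; the base point is K itself. *)
Definition sym_space : set (set 'M[R[i]]_n.+1) :=
  [set translate g max_compact | g in G].

Definition expa (v : 'rV[R]_3) : 'M[R[i]]_n.+1 :=
  map_mx (real_complex R) (mexp (a v)).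

(* The graph of the function d_Delta: d_Delta(x1, x2) = v. *)
Definition dDelta (x1 x2 : set 'M[R[i]]_n.+1) (v : 'rV[R]_3) : Prop :=
  chamber v /\ exists2 g, G g &
    translate g x1 = max_compact /\
    translate g x2 = translate (expa v) max_compact.

(* R^9 is modelled as the space of 3 x 3 matrices, whose rows are v_1, v_2, v_3. *)
Definition D3 : set 'M[R]_3 :=
  [set v | exists x1 x2 x3,
     [/\ sym_space x1, sym_space x2 & sym_space x3] /\
     [/\ dDelta x1 x2 (row 0 v), dDelta x2 x3 (row 1 v)
       & dDelta x3 x1 (row 2 v)]].

End SymmetricSpace.

(* Sp(6,C), with a the diagonal matrices diag(x, y, z, -x, -y, -z), so that the
   simple roots are x - y, y - z, 2z. *)
Section Sp6.
Variable R : realType.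

Definition symp_form : 'M[R[i]]_(3 + 3) := block_mx 0 1%:M (- 1%:M) 0.

Definition Sp6 : set 'M[R[i]]_(3 + 3) :=
  [set g | g^T *m symp_form *m g = symp_form].

Definition cartan_Sp6 (v : 'rV[R]_3) : 'M[R]_(3 + 3) :=
  diag_mx (row_mx v (- v)).

Definition D3_C3 : set 'M[R]_3 := D3 (n := 5) Sp6 cartan_Sp6.

End Sp6.

(* Spin(7,C) as the subgroup of the Clifford algebra of (C^7, sum_k v_k ^ 2)
   formed by the products of an even number of vectors v with
   sum_k v_k ^ 2 = 1, realized on spinors: Spin(7,C) lies in the even part of the
   Clifford algebra, which the spin representation on C^8 = C^2 (x) C^2 (x) C^2
   maps isomorphically onto M_8(C).  The images of the basis vectors are given by
   tensor products of Pauli matrices. *)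
Section Spin7.
Variable R : realType.

Definition pauli_x (F : nzRingType) : 'M[F]_(1 + 1) :=
  block_mx 0 1%:M 1%:M 0.
Definition pauli_y : 'M[R[i]]_(1 + 1) :=
  block_mx 0 (- 'i%C)%:M ('i%C)%:M 0.
Definition pauli_z (F : nzRingType) : 'M[F]_(1 + 1) :=
  block_mx 1%:M 0 0 (- 1%:M).

Definition gammas : seq 'M[R[i]]_(2 * 2 * 2) :=
  let one := 1%:M : 'M[R[i]]_2 in
  let sx := pauli_x R[i] : 'M[R[i]]_2 in
  let sy := pauli_y : 'M[R[i]]_2 in
  let sz := pauli_z R[i] : 'M[R[i]]_2 in
  [:: sx *t one *t one; sy *t one *t one;
      sz *t sx *t one; sz *t sy *t one;
      sz *t sz *t sx; sz *t sz *t sy;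
      sz *t sz *t sz].

Definition clifford (v : 'rV[R[i]]_7) : 'M[R[i]]_(2 * 2 * 2) :=
  \sum_(k < 7) v 0 k *: gammas`_k.

Definition Spin7 : set 'M[R[i]]_(2 * 2 * 2) :=
  [set g | exists s : seq 'rV[R[i]]_7,
     [/\ ~~ odd (size s),
         forall v, v \in s -> \sum_(k < 7) v 0 k ^+ 2 = 1
       & g = \prod_(v <- s) clifford v]].

(* The element (x e_12 + y e_34 + z e_56) / 2 of the Lie algebra, where
   e_jk = - i gamma_j gamma_k.  It acts on C^7 by commutators, with eigenvalues
   x, y, z, 0, -x, -y, -z, so that the simple roots are x - y, y - z, z. *)
Definition cartan_Spin7 (v : 'rV[R]_3) : 'M[R]_(2 * 2 * 2) :=
  let one := 1%:M : 'M[R]_2 in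
  let sz := pauli_z R : 'M[R]_2 in
  2^-1 *: (v 0 0 *: (sz *t one *t one) + v 0 1 *: (one *t sz *t one)
           + v 0 2 *: (one *t one *t sz)).

Definition D3_B3 : set 'M[R]_3 := D3 (n := 7) Spin7 cartan_Spin7.

End Spin7.

Arguments D3_C3 R : clear implicits.
Arguments D3_B3 R : clear implicits.

Section Cones.
Variables (R : realType) (V : vectType R).

Definition polyhedral_cone (C : set V) : Prop :=
  exists s : seq 'Hom(V, R^o),
    C = [set v | forall f, f \in s -> 0 <= (f v : R)].

(* A face is cut out by a linear form that is nonnegative on C; C itself is a
   face (f = 0). *)
Definition face (C F : set V) : Prop :=
  exists2 f : 'Hom(V, R^o), (forall v, C v -> 0 <= (f v : R)) &
    F = C `&` [set v | f v = 0].

(* The linear span of S has dimension d. *)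
Definition span_dim (S : set V) (d : nat) : Prop :=
  exists U : {vspace V},
    [/\ \dim U = d, S `<=` [set v | v \in U]
      & forall W : {vspace V}, S `<=` [set v | v \in W] -> (U <= W)%VS].

Definition facet (C F : set V) : Prop :=
  face C F /\ exists d, span_dim C d.+1 /\ span_dim F d.

Definition edge (C F : set V) : Prop := face C F /\ span_dim F 1.

End Cones.

(* Main.v *)
(* Let n = 6 or 7, and let G be the group of the complex n x n matrices g with
   g J g^T = J, where J is antidiagonal with entries 1, except that for n = 6 the last
   three rows carry a minus sign. Sp(6,C) is conjugate to this group for n = 6, and
   Spin(7,C) acts on C^7 through it for n = 7. Moving the triangle by isometries,
   v = (v_1, v_2, v_3) lies in D_3 if and only if e^v_1 a e^v_2 b e^v_3 is unitary for
   some unitary a, b in G. In both cases this happens exactly for v in one explicit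
   cone, with 102 inequalities and 51 rays, related by double description over Z.

   Necessity. Each inequality is a Horn inequality for the singular values of n x n
   matrices, obtained from a subspace in Schubert position with respect to three flags.

   Sufficiency. By compactness it is enough to take v in the interior. Attach to v_i a
   flag F_i, and let phi_i move a positive matrix y in G by - 2 v_i in the Cholesky
   frame adapted to F_i. A fixed point of Phi = phi_3 phi_2 phi_1 is a triangle. The
   map y |-> (Phi y)^t, t < 1, is a strict contraction for the Thompson metric, and
   at its fixed point y the sum of the Busemann functions of the pairs (F_i, v_i) is
   bounded above independently of t. If that sum is proper, the fixed points stay in a
   compact set as t tends to 1. The sum is a linear function of v, so it is enough to
   bound it below for v on each of the 51 rays. There it is a sum of logarithms of volumes of
   flag subspaces, and Fischer's inequality together with the self-duality of y bounds it
   below as soon as suitable flag subspaces and orthogonals of such span C^n: this is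
   the invertibility of an integer matrix. *)
From Stdlib Require Import ZArith.
From HB Require Import structures.
From mathcomp Require Import all_boot all_order all_algebra.
From mathcomp Require Import all_classical all_reals all_analysis.
From mathcomp Require Import complex mxtens spectral sesquilinear ring lra zify.
From mathcomp.zify Require Import ssrZ.
Require Import Defs.

Set Implicit Arguments.
Unset Strict Implicit.
Unset Printing Implicit Defensive.

Import Order.TTheory GRing.Theory Num.Theory.
Import numFieldNormedType.Exports.

Local Open Scope classical_set_scope.
Local Open Scope ring_scope.
Local Open Scope sesquilinear_scope.

(** * Positive definite matrices *)

Section Hermitian.
Variable C : numClosedFieldType.

(** $\Phi$ itself is only nonexpansive, hence the detour through powers. Strict contraction comes
    from the Loewner-Heinz inequality for the exponents $1-2^{-m}$ alone, which repeated midpoints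
    with the exponent 1 reach. The bound on the Busemann sum $b$ comes from the energy $E(y)$, the
    sum of the squares of the logarithms of the eigenvalues of $y$, a squared distance to the base
    point. Each $\phi_i$ is a flow of finite length along a Busemann direction, and a
    first-variation estimate yields $E(\Phi y) \le E(y) - 4b(y) + K$. If $y = (\Phi y)^t$, then
    $E(y) = t^2 E(\Phi y) \le E(\Phi y)$, so $b(y) \le K/4$ for every $t < 1$. A Picard iterate
    close enough to the fixed point serves as well. The form $J$ is antidiagonal because $g \mapsto
    J g^{-T} J^T$ then preserves lower triangular matrices: Cholesky factors of elements of the
    group stay in the group, and flags given by elements of the group are self-dual. In the double
    description every step checks that the tight sets of the current rays are pairwise incomparable;
    from this the soundness of the combinatorial adjacency test is proved. *)

Definition qf n (A : 'M[C]_n) (x : 'rV[C]_n) : C := (x *m A *m x^t*) 0 0.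

Definition pd n (A : 'M[C]_n) :=
  A^t* = A /\ forall x : 'rV[C]_n, x != 0 -> 0 < qf A x.

Definition lepd n (A B : 'M[C]_n) := forall x, qf A x <= qf B x.

Lemma trCM m n p (A : 'M[C]_(m, n)) (B : 'M[C]_(n, p)) :
  (A *m B)^t* = B^t* *m A^t*.
Proof. by rewrite trmx_mul map_mxM. Qed.

Lemma trC1 n : (1%:M : 'M[C]_n)^t* = 1%:M.
Proof. by rewrite trmx1 map_mx1. Qed.

Lemma trCE m n (A : 'M[C]_(m, n)) i j : A^t* i j = (A j i)^*.
Proof. by rewrite !mxE. Qed.

Lemma trCB m n (A B : 'M[C]_(m, n)) : (A - B)^t* = A^t* - B^t*.
Proof. by rewrite linearB /= map_mxB. Qed.

Lemma trCZ m n (a : C) (A : 'M[C]_(m, n)) : (a *: A)^t* = a^* *: A^t*.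
Proof. by rewrite linearZ /= map_mxZ. Qed.

Lemma qf_congr m n (g : 'M[C]_(m, n)) (A : 'M[C]_n) x :
  qf (g *m A *m g^t*) x = qf A (x *m g).
Proof. by rewrite /qf trCM !mulmxA. Qed.

Lemma qfZ n (a : C) (A : 'M[C]_n) x : qf (a *: A) x = a * qf A x.
Proof. by rewrite /qf -scalemxAr -scalemxAl !mxE. Qed.

Lemma qfZr n (a : C) (A : 'M[C]_n) x : qf A (a *: x) = `|a| ^+ 2 * qf A x.
Proof.
by rewrite /qf trCZ -!scalemxAl -scalemxAr scalerA !mxE -normCK.
Qed.

Lemma qf0 n (A : 'M[C]_n) : qf A 0 = 0.
Proof. by rewrite /qf !mul0mx mxE. Qed.

Lemma qf_diag n (d : 'rV[C]_n) x :
  qf (diag_mx d) x = \sum_i d 0 i * `|x 0 i| ^+ 2.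
Proof.
rewrite /qf mxE; apply: eq_bigr => i _.
by rewrite mul_mx_diag trCE mxE normCK; ring.
Qed.

Lemma qf1 n (x : 'rV[C]_n) : qf 1%:M x = \sum_i `|x 0 i| ^+ 2.
Proof.
rewrite -diag_const_mx qf_diag; apply: eq_bigr => i _.
by rewrite mxE mul1r.
Qed.

Lemma qf1_ge0 n (x : 'rV[C]_n) : 0 <= qf 1%:M x.
Proof. by rewrite qf1 sumr_ge0 // => i _; rewrite exprn_ge0. Qed.

Lemma qf1_gt0 n (x : 'rV[C]_n) : x != 0 -> 0 < qf 1%:M x.
Proof.
move=> x0; rewrite lt_neqAle qf1_ge0 andbT eq_sym.
apply: contra x0 => /eqP; rewrite qf1 => /eqP.
rewrite psumr_eq0; last by move=> i _; rewrite exprn_ge0.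
move=> /allP h; apply/eqP/rowP => i; rewrite mxE.
by have := h i (mem_index_enum _); rewrite expf_eq0 /= normr_eq0 => /eqP.
Qed.

Lemma pd_ge0 n (A : 'M[C]_n) x : pd A -> 0 <= qf A x.
Proof.
case=> _ h; have [->|x0] := eqVneq x 0; first by rewrite qf0.
exact/ltW/h.
Qed.

Lemma pd1 n : pd (1%:M : 'M[C]_n).
Proof. by split; [exact: trC1|exact: qf1_gt0]. Qed.

Lemma pd_congr n (g A : 'M[C]_n) : g \in unitmx -> pd A ->
  pd (g *m A *m g^t*).
Proof.
move=> gu [hA pA]; split.
  by rewrite !trCM trmxCK hA mulmxA.
move=> x x0; rewrite qf_congr pA //.
apply: contra x0 => /eqP h.
by rewrite -(mulmxK gu x) h mul0mx.
Qed.

Lemma pd_mulC n (g : 'M[C]_n) : g \in unitmx -> pd (g *m g^t*).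
Proof. by move=> gu; have := pd_congr gu (pd1 n); rewrite mulmx1. Qed.

Lemma pd_unit n (A : 'M[C]_n) : pd A -> A \in unitmx.
Proof.
case=> _ h; rewrite -row_free_unit -kermx_eq0.
apply/eqP/row_matrixP => i; rewrite row0.
apply/eqP; apply/negPn/negP => /h.
by rewrite /qf -row_mul mulmx_ker row0 mul0mx mxE ltxx.
Qed.

Lemma trC_inv n (A : 'M[C]_n) : (invmx A)^t* = invmx (A^t*).
Proof. by rewrite trmx_inv map_invmx. Qed.

Lemma unitmx_trC n (A : 'M[C]_n) : (A^t* \in unitmx) = (A \in unitmx).
Proof. by rewrite map_unitmx unitmx_tr. Qed.

Lemma pd_inv n (A : 'M[C]_n) : pd A -> pd (invmx A).
Proof.
move=> pA; have u := pd_unit pA.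
have ui : invmx A \in unitmx by rewrite unitmx_inv.
have := pd_congr ui pA.
by rewrite mulVmx // mul1mx trC_inv (proj1 pA).
Qed.

(* Completing the square: 0 <= qf A^-1 (x - u A) for u = x B^-1. *)
Lemma lepd_inv n (A B : 'M[C]_n) : pd A -> pd B -> lepd A B ->
  lepd (invmx B) (invmx A).
Proof.
move=> pA pB hAB x.
have uA := pd_unit pA; have uB := pd_unit pB.
set u := x *m invmx B.
have xE : x = u *m B by rewrite /u mulmxKV.
have e1 : qf (invmx B) x = qf B u.
  by rewrite /qf [in LHS]xE trCM (proj1 pB) mulmxK // mulmxA.
have := pd_ge0 (x - u *m A) (pd_inv pA).
rewrite {1}/qf trCB trCM (proj1 pA) !mulmxBl !mulmxBr.
rewrite -[x *m invmx A *m (A *m _)]mulmxA mulKmx //.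
rewrite (mulmxK uA u).
have -> : x *m u^t* = u *m B *m u^t* by rewrite -xE.
have -> : u *m x^t* = u *m B *m u^t*.
  by rewrite [in LHS]xE trCM (proj1 pB) mulmxA.
rewrite mulmxA (_ : forall M N P Q : 'M[C]_1,
  (M - N - (P - Q)) 0 0 = M 0 0 - N 0 0 - (P 0 0 - Q 0 0)); last first.
  by move=> M N P Q; rewrite !mxE.
rewrite -![(_ *m _ *m _^t*) 0 0]/(qf _ _) => h.
have h2 := hAB u; rewrite e1.
have h3 : 0 <= qf (invmx A) x - qf B u - (qf B u - qf A u) + (qf B u - qf A u).
  by rewrite addr_ge0 // subr_ge0.
by rewrite subrK subr_ge0 in h3.
Qed.

Definition ltp n (L : 'M[C]_n) := is_trig_mx L /\ forall i, 0 < L i i.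

Lemma ltp_unit n (L : 'M[C]_n) : ltp L -> L \in unitmx.
Proof.
case=> tL pL; rewrite unitmxE det_trig // unitfE.
by apply/prodf_neq0 => i _; rewrite gt_eqF.
Qed.

Lemma trig_mul n (L M : 'M[C]_n) : is_trig_mx L -> is_trig_mx M ->
  is_trig_mx (L *m M) /\ forall i, (L *m M) i i = L i i * M i i.
Proof.
move=> /is_trig_mxP tL /is_trig_mxP tM; split.
  apply/is_trig_mxP => i j ij; rewrite mxE big1 // => k _.
  have [ik|ki] := ltnP i k; first by rewrite tL ?mul0r.
  by rewrite tM ?mulr0 //; apply: leq_ltn_trans ij.
move=> i; rewrite mxE (bigD1 i) //= big1 ?addr0 // => k.
rewrite neq_ltn => /orP[ki|ik]; last by rewrite tL ?mul0r.
by rewrite tM ?mulr0.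
Qed.

Lemma trig_inv n (L : 'M[C]_n) : is_trig_mx L -> (forall i, L i i != 0) ->
  is_trig_mx (invmx L) /\ forall i, (invmx L) i i = (L i i)^-1.
Proof.
move=> tL nL.
have Lu : L \in unitmx.
  by rewrite unitmxE det_trig // unitfE; apply/prodf_neq0.
move/is_trig_mxP: tL => tL.
have e i j : \sum_k L i k * (invmx L) k j = (i == j)%:R.
  by have /matrixP/(_ i j) := mulmxV Lu; rewrite !mxE.
have t : forall m (i j : 'I_n), (i < m)%N -> (i < j)%N -> (invmx L) i j = 0.
  elim=> // m IH i j im ij.
  have := e i j; rewrite (bigD1 i) //= big1 ?addr0.
    move=> /eqP; rewrite (_ : (i == j) = false); last first.
      by apply/negbTE; rewrite neq_ltn ij.
    by rewrite mulf_eq0 (negbTE (nL i)) => /eqP.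
  move=> k; rewrite neq_ltn => /orP[ki|ik]; last by rewrite tL ?mul0r.
  rewrite IH ?mulr0 //; first exact: leq_trans ki im.
  exact: ltn_trans ij.
have tI : is_trig_mx (invmx L).
  by apply/is_trig_mxP => i j ij; apply: (t i.+1).
split=> // i.
have tL' : is_trig_mx L by apply/is_trig_mxP.
have [_ /(_ i)] := trig_mul tL' tI.
rewrite mulmxV // mxE eqxx => h.
by apply: (mulfI (nL i)); rewrite -h divff.
Qed.

Lemma ltp_mul n (L M : 'M[C]_n) : ltp L -> ltp M -> ltp (L *m M).
Proof.
move=> [tL pL] [tM pM]; have [t d] := trig_mul tL tM; split=> // i.
by rewrite d mulr_gt0.
Qed.

Lemma ltp_inv n (L : 'M[C]_n) : ltp L -> ltp (invmx L).
Proof.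
move=> [tL pL]; have [i|t d] := @trig_inv n L tL; first by rewrite gt_eqF.
by split=> // i; rewrite d invr_gt0.
Qed.

Lemma conj_gt0 (x : C) : 0 < x -> x^* = x.
Proof. by move=> /gtr0_real /CrealP. Qed.

(** The inverse $L^*$ is lower triangular as well, so $L$ is diagonal, and its positive entries of
    modulus one are 1. *)
Lemma ltp_unitary n (L : 'M[C]_n) : ltp L -> L \is unitarymx -> L = 1%:M.
Proof.
move=> pL uL; have e := invmx_unitary uL.
have [tI dI] := ltp_inv pL.
case: pL => tL dL.
apply/matrixP => i j; rewrite mxE.
have [ij|ji|ij] := ltngtP i j.
- rewrite (is_trig_mxP tL) // (_ : (i == j) = false) //.
  by apply/negbTE; rewrite neq_ltn ij.
- have := is_trig_mxP tI j i ji; rewrite e trCE => /eqP.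
  rewrite conjC_eq0 => /eqP->; rewrite (_ : (i == j) = false) //.
  by apply/negbTE; rewrite neq_ltn ji orbT.
move/val_inj: ij => <-; rewrite eqxx.
have := (trig_inv tL (fun i => lt0r_neq0 (dL i))).2 i.
rewrite e trCE conj_gt0 // => h.
have : L i i ^+ 2 = 1 by rewrite expr2 {1}h mulVf ?gt_eqF.
move=> /eqP; rewrite sqrf_eq1 => /orP[/eqP//|/eqP h1].
by have := dL i; rewrite h1 ltr0N1.
Qed.

Lemma ltp_uniq n (L M : 'M[C]_n) : ltp L -> ltp M ->
  L *m L^t* = M *m M^t* -> L = M.
Proof.
move=> pL pM e.
have uM := ltp_unit pM.
have pT : ltp (invmx M *m L) by apply: ltp_mul => //; apply: ltp_inv.
have : invmx M *m L = 1%:M.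
  apply: ltp_unitary => //; apply/unitarymxP.
  rewrite trCM trC_inv mulmxA -(mulmxA _ L) e mulKmx // mulmxV //.
  by rewrite unitmx_trC.
by move=> h; rewrite -(mulKVmx uM L) h mulmx1.
Qed.

(** Induction on the size through the Schur complement of the corner entry $a$. Its positivity is
    that of $A$ on the vectors $y = (-a^{-1}xc, x)$, for which the first entry of $yA$ vanishes. *)
Lemma cholesky n (A : 'M[C]_n) : pd A -> exists2 L, ltp L & A = L *m L^t*.
Proof.
elim: n A => [A _|n IH].
  by exists 1%:M; [split; [apply/is_trig_mxP|]; case|apply/matrixP; case].
rewrite -[n.+1]/(1 + n)%N => A pA.
set a := A 0 0.
have a0 : 0 < a.
  have := (proj2 pA) (delta_mx 0 0); rewrite /qf -rowE.
  have -> : (delta_mx 0 0 : 'rV[C]_(1 + n))^t* = delta_mx 0 0.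
    by rewrite trmx_delta map_delta_mx.
  rewrite -colE !mxE; apply; apply/negP => /eqP/rowP/(_ 0).
  by rewrite !mxE /= => /eqP; rewrite oner_eq0.
set B := drsubmx A; set c := dlsubmx A.
have cE : ursubmx A = c^t*.
  apply/matrixP => i j; rewrite !mxE -[in LHS](proj1 pA) trCE.
  by [].
have aE : ulsubmx A = a%:M.
  apply/matrixP => i j; rewrite !mxE !ord1 eqxx mulr1n.
  by congr (A _ _); apply/val_inj.
have AE : A = block_mx a%:M (c^t*) c B by rewrite -cE -aE submxK.
have hB : B^t* = B by apply/matrixP=> i j; rewrite trCE !mxE -[in RHS](proj1 pA) trCE.
have ar : a^* = a by rewrite conj_gt0.
have pB : pd (B - a^-1 *: (c *m c^t*)).
  split.
    by rewrite trCB trCZ trCM trmxCK hB (@conj_gt0 a^-1) // invr_gt0.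
  move=> x x0.
  set y := row_mx (- a^-1 *: (x *m c)) x : 'rV[C]_(1 + n).
  have := (proj2 pA) y; rewrite /qf {1}AE /y mul_row_block.
  rewrite tr_row_mx map_col_mx mul_row_col.
  have -> : - a^-1 *: (x *m c) *m a%:M + x *m c = 0.
    by rewrite mul_mx_scalar scalerA mulrN mulfV ?gt_eqF // scaleN1r addNr.
  rewrite mul0mx add0r -scalemxAl mulmxBr -scalemxAr mulmxA.
  rewrite [- a^-1 *: (x *m c *m _)]scaleNr [_ + x *m B]addrC; apply.
  apply: contra x0 => /eqP/(congr1 rsubmx); rewrite row_mxKr => ->.
  by apply/eqP/rowP => i; rewrite !mxE.
have [L pL LE] := IH _ pB.
have sa : sqrtC a * sqrtC a = a by rewrite -expr2 sqrtCK.
have s0 : 0 < sqrtC a by rewrite sqrtC_gt0.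
exists (block_mx (sqrtC a)%:M 0 ((sqrtC a)^-1 *: c) L).
  case: pL => tL dL; split.
    apply/is_trig_mxP => i j; case: (split_ordP i) => i' ->;
      case: (split_ordP j) => j' ->; rewrite ?(block_mxEul, block_mxEur, block_mxEdl, block_mxEdr) //=.
    - by rewrite !ord1.
    - by rewrite mxE.
    - by rewrite !ord1.
    - by rewrite ltn_add2l => h; rewrite (is_trig_mxP tL).
  move=> i; case: (split_ordP i) => i' ->.
    by rewrite block_mxEul mxE eqxx.
  by rewrite block_mxEdr.
rewrite tr_block_mx map_block_mx mulmx_block !trmx0 !map_mx0 !mulmx0 !mul0mx !addr0.
rewrite -/(c^t*) tr_scalar_mx map_scalar_mx /= conj_gt0 // -scalar_mxM sa.
rewrite trCZ (@conj_gt0 (sqrtC a)^-1) ?invr_gt0 //.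
rewrite -scalemxAr mul_scalar_mx scalerA mulVf ?gt_eqF // scale1r.
rewrite mul_mx_scalar scalerA mulfV ?gt_eqF // scale1r.
rewrite -scalemxAl -scalemxAr scalerA -invfM sa -LE addrC subrK.
exact: AE.
Qed.

End Hermitian.

(* A complex field over R seen abstractly, to keep unification from unfolding
   the construction of C. *)
Record real_part (R : realType) (C : numClosedFieldType) := RealPart {
  cR : {rmorphism R -> C};
  rp : C -> R;
  cR_le : forall x y, (cR x <= cR y) = (x <= y);
  rpK : forall z, z \is Num.real -> cR (rp z) = z }.

(** * Spectral calculus, real powers and the Loewner-Heinz inequality *)

Section Spectral.
Variables (R : realType) (C : numClosedFieldType) (rc : real_part R C).
Local Notation cR := (cR rc).
Local Notation rp := (rp rc).
Implicit Types (n : nat).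

Lemma cR_inj : injective cR.
Proof. exact: fmorph_inj. Qed.

Lemma lecR x y : (cR x <= cR y) = (x <= y). Proof. exact: cR_le. Qed.

Lemma cR_ge0 x : (0 <= cR x) = (0 <= x).
Proof. by rewrite -(rmorph0 cR) cR_le. Qed.

Lemma cR_gt0 x : (0 < cR x) = (0 < x).
Proof. by rewrite !lt_def cR_ge0 fmorph_eq0. Qed.

Lemma cR_real x : cR x \is Num.real.
Proof.
by rewrite realE cR_ge0 -oppr_ge0 -rmorphN cR_ge0 oppr_ge0 le_total.
Qed.

Lemma cRK x : rp (cR x) = x.
Proof. by apply: cR_inj; rewrite rpK ?cR_real. Qed.

Definition nsq (z : C) : R := rp (`|z| ^+ 2).

Lemma nsqE (z : C) : `|z| ^+ 2 = cR (nsq z).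
Proof. by rewrite rpK // rpredX // normr_real. Qed.

Lemma nsq_ge0 z : 0 <= nsq z.
Proof. by rewrite -cR_ge0 -nsqE exprn_ge0. Qed.

Lemma nsq_cR x : nsq (cR x) = x ^+ 2.
Proof. by apply: cR_inj; rewrite -nsqE rmorphXn real_normK ?cR_real. Qed.

Lemma nsq0 : nsq 0 = 0.
Proof. by rewrite -(rmorph0 cR) nsq_cR expr0n. Qed.

Lemma real_complex_sum (I : Type) (r : seq I) (P : pred I) (F : I -> R) :
  cR (\sum_(i <- r | P i) F i) = \sum_(i <- r | P i) cR (F i).
Proof. exact: (raddf_sum cR). Qed.

Lemma real_complexM (x y : R) : cR (x * y) = cR x * cR y.
Proof. exact: rmorphM. Qed.

Lemma real_complexV (x : R) : cR x^-1 = (cR x)^-1.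
Proof. exact: (fmorphV cR). Qed.

Lemma conj_real_complex (x : R) : (cR x)^* = cR x.
Proof. by apply/CrealP/cR_real. Qed.

Definition expd n (d : 'rV[R]_n) : 'M[C]_n :=
  diag_mx (\row_i cR (expR (d 0 i))).

Lemma expdD n (d e : 'rV[R]_n) : expd d *m expd e = expd (d + e).
Proof.
rewrite mulmx_diag; congr diag_mx; apply/rowP => i.
by rewrite !mxE expRD real_complexM.
Qed.

Lemma expd0 n : expd (0 : 'rV[R]_n) = 1%:M.
Proof.
rewrite -diag_const_mx; congr diag_mx; apply/rowP => i.
by rewrite !mxE expR0 rmorph1.
Qed.

Lemma expd_trC n (d : 'rV[R]_n) : (expd d)^t* = expd d.
Proof.
rewrite tr_diag_mx map_diag_mx; congr diag_mx; apply/rowP => i.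
by rewrite !mxE /= conj_real_complex.
Qed.

Lemma expdN n (d : 'rV[R]_n) : expd d *m expd (- d) = 1%:M.
Proof. by rewrite expdD subrr expd0. Qed.

Lemma expd_unit n (d : 'rV[R]_n) : expd d \in unitmx.
Proof. by have [u _] := mulmx1_unit (expdN d); exact: u. Qed.

Lemma invmx_eq n (A B : 'M[C]_n) : A *m B = 1%:M -> invmx A = B.
Proof.
move=> h; have [uA _] := mulmx1_unit h.
by rewrite -(mulKmx uA B) h mulmx1.
Qed.

Lemma invmx_expd n (d : 'rV[R]_n) : invmx (expd d) = expd (- d).
Proof. exact/invmx_eq/expdN. Qed.

Lemma qf_expd n (d : 'rV[R]_n) x :
  qf (expd d) x = cR (\sum_i expR (d 0 i) * nsq (x 0 i)).
Proof.
rewrite qf_diag real_complex_sum; apply: eq_bigr => i _.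
by rewrite mxE real_complexM -nsqE.
Qed.

Lemma qf1_nsq n (x : 'rV[C]_n) : qf 1%:M x = cR (\sum_i nsq (x 0 i)).
Proof.
by rewrite -expd0 qf_expd; under eq_bigr do rewrite mxE expR0 mul1r.
Qed.

(** The exponential of the Hermitian matrix $U^* \mathrm{diag}(d) U$ for unitary $U$; by [pd_hexp]
    every positive matrix has this form. *)
Definition hexp n (U : 'M[C]_n) (d : 'rV[R]_n) := U^t* *m expd d *m U.

Lemma qf_hexp n (U : 'M[C]_n) (d : 'rV[R]_n) x :
  qf (hexp U d) x = cR (\sum_i expR (d 0 i) * nsq ((x *m U^t*) 0 i)).
Proof. by rewrite -qf_expd -qf_congr trmxCK. Qed.

Lemma unitary_trCmul n (U : 'M[C]_n) : U \is unitarymx -> U^t* *m U = 1%:M.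
Proof. by move=> /unitarymxP/mulmx1C. Qed.

Lemma unitary_mulC n (U : 'M[C]_n) : U \is unitarymx -> U *m U^t* = 1%:M.
Proof. by move=> /unitarymxP. Qed.

Lemma hexpD n (U : 'M[C]_n) (d e : 'rV[R]_n) : U \is unitarymx ->
  hexp U d *m hexp U e = hexp U (d + e).
Proof.
move=> uU; rewrite /hexp !mulmxA -(mulmxA _ U) unitary_mulC // mulmx1.
by rewrite -(mulmxA _ (expd d)) expdD.
Qed.

Lemma hexp0 n (U : 'M[C]_n) : U \is unitarymx -> hexp U 0 = 1%:M.
Proof. by move=> uU; rewrite /hexp expd0 mulmx1 unitary_trCmul. Qed.

Lemma hexp_trC n (U : 'M[C]_n) d : (hexp U d)^t* = hexp U d.
Proof. by rewrite /hexp !trCM trmxCK expd_trC mulmxA. Qed.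

Lemma invmx_hexp n (U : 'M[C]_n) d : U \is unitarymx ->
  invmx (hexp U d) = hexp U (- d).
Proof. by move=> uU; apply: invmx_eq; rewrite hexpD // subrr hexp0. Qed.

Lemma hexp_pd n (U : 'M[C]_n) d : U \is unitarymx -> pd (hexp U d).
Proof.
move=> uU.
have h : d = 2^-1 *: d + 2^-1 *: d.
  by rewrite -scalerDl -[X in X + X]mul1r -splitr scale1r.
rewrite h -hexpD // -[X in _ *m X]hexp_trC; apply: pd_mulC.
have e : hexp U (2^-1 *: d) *m hexp U (- (2^-1 *: d)) = 1%:M.
  by rewrite hexpD // subrr hexp0.
by have [u _] := mulmx1_unit e; exact: u.
Qed.

Lemma row_hexp n (U : 'M[C]_n) d j : U \is unitarymx ->
  row j U *m hexp U d = cR (expR (d 0 j)) *: row j U.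
Proof.
move=> uU; rewrite -row_mul /hexp !mulmxA unitary_mulC // mul1mx.
by apply/rowP => k; rewrite mxE /expd mul_diag_mx !mxE.
Qed.

Lemma pd_hexp n (A : 'M[C]_n) : pd A ->
  exists U d, U \is unitarymx /\ A = hexp U d.
Proof.
move=> pA.
have hA : A \is hermsymmx.
  by apply/is_hermitianmxP; rewrite expr0 scale1r (proj1 pA).
have /orthomx_spectralP := hermitian_normalmx hA.
set U := spectralmx A; set s := spectral_diag A.
have uU : U \is unitarymx by apply: spectral_unitarymx.
rewrite invmx_unitary // => AE.
exists U, (\row_j ln (rp (s 0 j))); split=> //.
rewrite [LHS]AE /hexp; congr (_ *m _ *m _); congr diag_mx.
apply/rowP => j; rewrite !mxE.
have : 0 < qf A (row j U).
  apply: (proj2 pA); apply/negP => /eqP h.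
  have := unitary_mulC uU => /matrixP/(_ j j); rewrite !mxE eqxx.
  rewrite big1; first by move=> /esym/eqP; rewrite oner_eq0.
  by move=> k _; move/rowP/(_ k): h; rewrite !mxE => ->; rewrite mul0r.
rewrite AE -{2}[U]trmxCK qf_congr -row_mul unitary_mulC // qf_diag.
rewrite (bigD1 j) //= big1 ?addr0; last first.
  by move=> k kj; rewrite !mxE eq_sym (negbTE kj) normr0 expr0n mulr0.
rewrite !mxE eqxx normr1 expr1n mulr1 => s0.
by rewrite lnK ?rpK ?gtr0_real // posrE -cR_gt0 rpK ?gtr0_real.
Qed.

(** With $W = VU^*$ the hypothesis says that $d_j = e_i$ wherever $W_{ij} \ne 0$, so the same $W$
    intertwines the scaled exponents. This makes real powers well defined. *)
Lemma hexp_scale_uniq n (U V : 'M[C]_n) d e t :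
  U \is unitarymx -> V \is unitarymx -> hexp U d = hexp V e ->
  hexp U (t *: d) = hexp V (t *: e).
Proof.
move=> uU uV h; set W := V *m U^t*.
have hW : W *m expd d = expd e *m W.
  have := congr1 (fun M => V *m M *m U^t*) h.
  rewrite /hexp !mulmxA -(mulmxA _ U) unitary_mulC // mulmx1.
  by rewrite unitary_mulC // mul1mx -/W -mulmxA.
have : W *m expd (t *: d) = expd (t *: e) *m W.
  apply/matrixP => i j; move/matrixP/(_ i j): hW.
  rewrite /expd !mul_mx_diag !mul_diag_mx !mxE.
  set w := \sum_k _.
  have [->|w0] := eqVneq w 0; first by rewrite !mulr0 !mul0r.
  move=> h1; have /cR_inj/expR_inj : cR (expR (d 0 j)) = cR (expR (e 0 i)).
    by apply: (mulfI w0); rewrite h1 mulrC.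
  by move=> ->; rewrite mulrC.
rewrite /W => h2.
have := congr1 (fun M => V^t* *m M *m U) h2.
rewrite /hexp !mulmxA unitary_trCmul // mul1mx => ->.
by rewrite -!mulmxA unitary_trCmul // mulmx1.
Qed.

(** The real power $A^t$ from a chosen spectral decomposition; a matrix without one is returned
    unchanged. *)
Definition pw n (t : R) (A : 'M[C]_n) : 'M[C]_n :=
  if pselect (exists p : 'M[C]_n * 'rV[R]_n,
    p.1 \is unitarymx /\ A = hexp p.1 p.2) is left h
  then let p := projT1 (cid h) in hexp p.1 (t *: p.2) else A.

Lemma pwE n t (U : 'M[C]_n) d : U \is unitarymx ->
  pw t (hexp U d) = hexp U (t *: d).
Proof.
move=> uU; rewrite /pw; case: pselect => [h|]; last first.
  by case; exists (U, d).
by case: cid => -[V e] /= [uV hV]; apply: hexp_scale_uniq.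
Qed.

(** Up to normalization, the squared distance from the identity in the symmetric space of positive
    matrices. The value 0 is a default. *)
Definition lognorm n (A : 'M[C]_n) : R :=
  if pselect (exists p : 'M[C]_n * 'rV[R]_n,
    p.1 \is unitarymx /\ A = hexp p.1 p.2) is left h
  then let p := projT1 (cid h) in \sum_j p.2 0 j ^+ 2 else 0.

Lemma unitary_row_nsq n (W : 'M[C]_n) j : W \is unitarymx ->
  \sum_k nsq (W j k) = 1.
Proof.
move=> /unitary_mulC/matrixP/(_ j j); rewrite !mxE eqxx => h.
apply: cR_inj; rewrite real_complex_sum rmorph1 -[RHS]h.
by apply: eq_bigr => k _; rewrite -nsqE normCK trCE.
Qed.

Lemma nsq_conj (z : C) : nsq (z^*) = nsq z.
Proof. by apply: cR_inj; rewrite -!nsqE norm_conjC. Qed.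

Lemma unitary_col_nsq n (W : 'M[C]_n) k : W \is unitarymx ->
  \sum_j nsq (W j k) = 1.
Proof.
rewrite -trmxC_unitary => /(unitary_row_nsq k) <-.
by apply: eq_bigr => j _; rewrite trCE nsq_conj.
Qed.

(* Jensen in the form x <= e^x - 1, against the doubly stochastic matrix
   |U V^*|^2. *)
Lemma lognorm_jensen n (U V : 'M[C]_n) (L H : 'rV[R]_n) (c : 'I_n -> R) :
  U \is unitarymx -> V \is unitarymx ->
  (forall j, 0 <= L 0 j ->
     qf (hexp V (- H)) (row j U) <= cR (expR (- L 0 j) * (1 + c j))) ->
  (forall j, L 0 j < 0 ->
     qf (hexp V H) (row j U) <= cR (expR (L 0 j) * (1 + c j))) ->
  \sum_j L 0 j ^+ 2 <= \sum_j H 0 j ^+ 2 + \sum_j 2 * `|L 0 j| * c j.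
Proof.
move=> uU uV hp hn.
set W := U *m V^t*.
have uW : W \is unitarymx by rewrite mul_unitarymx // trmxC_unitary.
have -> : \sum_j H 0 j ^+ 2 = \sum_j \sum_k nsq (W j k) * H 0 k ^+ 2.
  rewrite exchange_big /=; apply: eq_bigr => k _.
  by rewrite -mulr_suml unitary_col_nsq // mul1r.
rewrite -big_split /=; apply: ler_sum => j _.
have eL : L 0 j ^+ 2 = \sum_k nsq (W j k) * L 0 j ^+ 2.
  by rewrite -mulr_suml unitary_row_nsq // mul1r.
rewrite {1}eL addrC -lerBlDr -sumrB.
have rowW k : (row j U *m V^t*) 0 k = W j k by rewrite -row_mul mxE.
(* $2L(L-H) - (L^2-H^2) = (L-H)^2 \ge 0$. The factor $L_j$ stays outside, and its sign decides which
   hypothesis applies. *)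
have step : \sum_k (nsq (W j k) * L 0 j ^+ 2 - nsq (W j k) * H 0 k ^+ 2) <=
    2 * (L 0 j * \sum_k nsq (W j k) * (L 0 j - H 0 k)).
  rewrite mulr_sumr mulr_sumr; apply: ler_sum => k _.
  have := nsq_ge0 (W j k); have := sqr_ge0 (L 0 j - H 0 k); nra.
apply: (le_trans step); rewrite -mulrA; apply: ler_wpM2l => //.
have [L0|L0] := leP 0 (L 0 j).
  rewrite ger0_norm //; apply: ler_wpM2l => //.
  have := hp j L0; rewrite qf_hexp lecR => h.
  have h2 : \sum_k nsq (W j k) * (L 0 j - H 0 k) <=
     \sum_k nsq (W j k) * (expR (L 0 j - H 0 k) - 1).
    apply: ler_sum => k _; apply: ler_wpM2l; first exact: nsq_ge0.
    by rewrite lerBrDl expR_ge1Dx.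
  apply: (le_trans h2).
  under eq_bigr do rewrite mulrBr mulr1.
  rewrite sumrB unitary_row_nsq // lerBlDl.
  have := ler_wpM2l (expR_ge0 (L 0 j)) h.
  rewrite mulrA -expRD subrr expR0 mul1r; apply: le_trans.
  rewrite mulr_sumr; apply: ler_sum => k _.
  have -> : (- H) 0 k = - H 0 k by rewrite mxE.
  by rewrite rowW expRD le_eqVlt; apply/orP; left; apply/eqP; ring.
rewrite ltr0_norm // -[leLHS]mulrNN.
apply: ler_wpM2l; first by rewrite oppr_ge0 ltW.
have := hn j L0; rewrite qf_hexp lecR => h.
have h2 : - \sum_k nsq (W j k) * (L 0 j - H 0 k) <=
     \sum_k nsq (W j k) * (expR (H 0 k - L 0 j) - 1).
  rewrite -sumrN; apply: ler_sum => k _; rewrite -mulrN.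
  apply: ler_wpM2l; first exact: nsq_ge0.
  by rewrite opprB lerBrDl expR_ge1Dx.
apply: (le_trans h2).
under eq_bigr do rewrite mulrBr mulr1.
rewrite sumrB unitary_row_nsq // lerBlDl.
have := ler_wpM2l (expR_ge0 (- L 0 j)) h.
rewrite mulrA -expRD addNr expR0 mul1r; apply: le_trans.
rewrite mulr_sumr; apply: ler_sum => k _.
by rewrite rowW expRD le_eqVlt; apply/orP; left; apply/eqP; ring.
Qed.

Lemma qf1_row_unitary n (U : 'M[C]_n) j : U \is unitarymx ->
  qf 1%:M (row j U) = 1.
Proof.
move=> uU; rewrite qf1_nsq -(rmorph1 cR); congr (cR _).
by rewrite -(unitary_row_nsq j uU); apply: eq_bigr => k _; rewrite mxE.
Qed.

Lemma qf_row_hexp n (U : 'M[C]_n) d j : U \is unitarymx ->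
  qf (hexp U d) (row j U) = cR (expR (d 0 j)).
Proof.
move=> uU; rewrite /qf row_hexp // -scalemxAl mxE.
by have := qf1_row_unitary j uU; rewrite /qf mulmx1 => ->; rewrite mulr1.
Qed.

(** Independence of the decomposition: the Jensen estimate with [c = 0], in both directions. *)
Lemma lognormE n (U : 'M[C]_n) d : U \is unitarymx ->
  lognorm (hexp U d) = \sum_j d 0 j ^+ 2.
Proof.
have main (V W : 'M[C]_n) (p q : 'rV[R]_n) : V \is unitarymx -> W \is unitarymx ->
    hexp V p = hexp W q -> \sum_j p 0 j ^+ 2 <= \sum_j q 0 j ^+ 2.
  move=> uV uW h.
  apply: (le_trans (@lognorm_jensen n V W p q (fun=> 0) uV uW _ _)) => [j _|j _|].
  - by rewrite addr0 mulr1 -invmx_hexp // -h invmx_hexp // qf_row_hexp // mxE.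
  - by rewrite addr0 mulr1 -h qf_row_hexp.
  - by rewrite gerDl big1 // => j _; rewrite mulr0.
move=> uU; rewrite /lognorm; case: pselect => [h|]; last first.
  by case; exists (U, d).
case: cid => -[V e] /= [uV hV]; apply/eqP; rewrite eq_le.
by rewrite (main V U) // (main U V).
Qed.

Lemma lepd_scale n (A B : 'M[C]_n) (c : R) : 0 <= c -> lepd A B ->
  lepd (cR c *: A) (cR c *: B).
Proof. by move=> c0 h x; rewrite !qfZ ler_wpM2l // cR_ge0. Qed.

Lemma lepd_trans n (A B D : 'M[C]_n) : lepd A B -> lepd B D -> lepd A D.
Proof. by move=> h1 h2 x; apply: le_trans (h1 x) (h2 x). Qed.

Lemma lepd_congr n (g A B : 'M[C]_n) : lepd A B ->
  lepd (g *m A *m g^t*) (g *m B *m g^t*).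
Proof. by move=> h x; rewrite !qf_congr. Qed.

Lemma hexp_le1 n (U : 'M[C]_n) (d : 'rV[R]_n) : U \is unitarymx ->
  (forall j, d 0 j <= 0) -> lepd (hexp U d) 1%:M.
Proof.
move=> uU h x; rewrite -(hexp0 uU) !qf_hexp lecR; apply: ler_sum => j _.
by apply: ler_wpM2r; [exact: nsq_ge0|rewrite ler_expR mxE].
Qed.

Lemma nsq_sum_unitary n (U : 'M[C]_n) (x : 'rV[C]_n) : U \is unitarymx ->
  qf 1%:M (x *m U) = qf 1%:M x.
Proof. by move=> uU; rewrite -qf_congr mulmx1 unitary_mulC. Qed.

(** A one-parameter group $p \mapsto A^p$, reduced to the algebra that the midpoint argument
    uses. *)
Record power_group n (P : R -> 'M[C]_n) : Prop := PowerGroup {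
  pg_add : forall p q, P p *m P q = P (p + q);
  pg_0 : P 0 = 1%:M;
  pg_trC : forall p, (P p)^t* = P p;
  pg_pd : forall p, pd (P p) }.

Lemma hexp_power_group n (U : 'M[C]_n) (d : 'rV[R]_n) : U \is unitarymx ->
  power_group (fun t => hexp U (t *: d)).
Proof.
move=> uU; split=> [p q||p|p].
- by rewrite (hexpD _ _ uU) scalerDl.
- by rewrite scale0r (hexp0 uU).
- exact: hexp_trC.
- exact: hexp_pd.
Qed.

Lemma pd_power_group n (A : 'M[C]_n) : pd A ->
  exists P, [/\ power_group P, P 1 = A, P (-1) = invmx A & forall t, pw t A = P t].
Proof.
move=> /pd_hexp[U [d [uU ->]]]; exists (fun t => hexp U (t *: d)); split.
- exact: hexp_power_group.
- by rewrite scale1r.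
- by rewrite scaleN1r (invmx_hexp _ uU).
- by move=> t; rewrite (pwE _ _ uU).
Qed.

Lemma pd_le1 n (M : 'M[C]_n) : pd M ->
  (forall (x : 'rV[C]_n) (c : R), x != 0 -> x *m M = cR (expR c) *: x -> c <= 0) ->
  lepd M 1%:M.
Proof.
move=> /pd_hexp[U [d [uU ->]]] h; apply: (hexp_le1 uU) => j.
apply: (h (row j U)); last exact: row_hexp.
apply/negP => /eqP r0; have := qf1_row_unitary j uU.
by rewrite r0 qf0 => /esym/eqP; rewrite oner_eq0.
Qed.

(* A^s <= B^s for s = (1 + t) / 2: the positive matrix B^(-s/2) A^s B^(-s/2) is
   similar to the product of the contractions B^(-t/2) A^(t/2) and
   A^(1/2) B^(-1/2), so its eigenvalues are at most 1. *)
Lemma power_group_mid n (Ap Bp : R -> 'M[C]_n) (t s : R) :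
  power_group Ap -> power_group Bp -> s = (1 + t) / 2 ->
  lepd (Ap t) (Bp t) -> lepd (Bp (-1)) (Ap (-1)) ->
  lepd (Ap s) (Bp s).
Proof.
move=> [ApD Ap0 Apt Appd] [BpD Bp0 Bpt Bppd] sE hT hI.
have Bpu r : Bp r \in unitmx by exact: pd_unit (Bppd r).
pose M := Bp (- (s / 2)) *m Ap s *m Bp (- (s / 2)).
have pM : pd M.
  by have := pd_congr (Bpu (- (s / 2))) (Appd s); rewrite Bpt.
have BB r (x : 'rV[C]_n) : x *m Bp r *m Bp (- r) = x.
  by rewrite -mulmxA BpD subrr Bp0 mulmx1.
have M1 : lepd M 1%:M.
  apply: (pd_le1 pM) => y c y0 hy.
  pose x := y *m Bp (- (s / 2 - t / 2)).
  have x0 : x != 0.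
    apply/negP => /eqP h; move/negP: y0; apply; apply/eqP.
    by rewrite -(mulmxK (Bpu (- (s / 2 - t / 2))) y) -/x h mul0mx.
  have hx : x *m (Bp (- (t / 2)) *m Ap (t / 2)) *m (Ap 2^-1 *m Bp (- 2^-1)) =
      cR (expR c) *: x.
    have e1 : - 2^-1 = - (s / 2) + - (s / 2 - t / 2) by rewrite sE; lra.
    have e2 : - (t / 2) = (s / 2 - t / 2) + - (s / 2) by lra.
    have e3 : t / 2 + 2^-1 = s by rewrite sE; lra.
    have -> : x *m (Bp (- (t / 2)) *m Ap (t / 2)) *m (Ap 2^-1 *m Bp (- 2^-1)) =
        x *m (Bp (- (t / 2)) *m Ap s *m Bp (- 2^-1)).
      by rewrite -e3 -ApD !mulmxA.
    rewrite e2 e1 -(BpD (s / 2 - t / 2)) -(BpD (- (s / 2))).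
    have -> : x *m (Bp (s / 2 - t / 2) *m Bp (- (s / 2)) *m Ap s *m
        (Bp (- (s / 2)) *m Bp (- (s / 2 - t / 2)))) =
        x *m Bp (s / 2 - t / 2) *m M *m Bp (- (s / 2 - t / 2)).
      by rewrite /M !mulmxA.
    have -> : x *m Bp (s / 2 - t / 2) = y.
      by have := BB (- (s / 2 - t / 2)) y; rewrite opprK.
    by rewrite hy -scalemxAl.
  have n1 (z : 'rV[C]_n) : qf 1%:M (z *m (Bp (- (t / 2)) *m Ap (t / 2))) <= qf 1%:M z.
    rewrite mulmxA -qf_congr mulmx1 Apt ApD -splitr.
    apply: (le_trans (hT _)); rewrite -qf_congr Bpt BpD BpD.
    have -> : - (t / 2) + t - t / 2 = 0 by lra.
    by rewrite Bp0.
  have n2 (z : 'rV[C]_n) : qf 1%:M (z *m (Ap 2^-1 *m Bp (- 2^-1))) <= qf 1%:M z.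
    rewrite mulmxA -qf_congr mulmx1 Bpt BpD.
    have -> : - 2^-1 - 2^-1 = -1 :> R by lra.
    apply: (le_trans (hI _)); rewrite -qf_congr Apt ApD ApD.
    have -> : 2^-1 - 1 + 2^-1 = 0 :> R by lra.
    by rewrite Ap0.
  have : qf 1%:M (cR (expR c) *: x) <= qf 1%:M x.
    by rewrite -hx; apply: le_trans (n2 _) (n1 _).
  rewrite qfZr -[leRHS]mul1r ler_pM2r ?qf1_gt0 //.
  rewrite nsqE nsq_cR -[X in _ <= X](rmorph1 cR) lecR.
  rewrite -expRM_natl -[leRHS]expR0 ler_expR.
  by rewrite pmulr_rle0.
have := lepd_congr (Bp (s / 2)) M1.
rewrite Bpt mulmx1 BpD -splitr /M !mulmxA BpD subrr Bp0 mul1mx.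
by rewrite -mulmxA BpD addNr Bp0 mulmx1.
Qed.

(** Starting from the exponent 0, each midpoint with the exponent 1 leads from $1-2^{-m}$ to
    $1-2^{-m-1}$. The exponent 1 enters through the reversed comparison of the inverses. *)
Lemma loewner_heinz n m (A B : 'M[C]_n) : pd A -> pd B -> lepd A B ->
  lepd (pw (1 - 2^-1 ^+ m) A) (pw (1 - 2^-1 ^+ m) B).
Proof.
move=> pA pB AB; have := lepd_inv pA pB AB.
have [P [gP P1 PN PE]] := pd_power_group pA.
have [Q [gQ Q1 QN QE]] := pd_power_group pB.
rewrite PE QE -PN -QN => hI.
elim: m => [|m IH]; first by rewrite expr0 subrr (pg_0 gP) (pg_0 gQ).
apply: (power_group_mid gP gQ _ IH hI).
by rewrite exprS; lra.
Qed.

End Spectral.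

(** * The Thompson metric and the first variation of the energy *)

Section LogNorm.
Variables (R : realType) (C : numClosedFieldType) (rc : real_part R C).
Local Notation cR := (cR rc).
Local Notation rp := (rp rc).
Local Notation nsq := (nsq rc).
Local Notation expd := (expd rc).
Local Notation hexp := (hexp rc).
Local Notation pw := (pw rc).
Local Notation lognorm := (lognorm rc).
Implicit Types (n : nat).

(** On positive matrices, distance at most [r] in the Thompson metric, the largest absolute
    logarithm of an eigenvalue of $AB^{-1}$. *)
Definition near n (r : R) (A B : 'M[C]_n) :=
  lepd A (cR (expR r) *: B) /\ lepd B (cR (expR r) *: A).

Lemma near_sym n r (A B : 'M[C]_n) : near r A B -> near r B A.
Proof. by case. Qed.

Lemma scale_expR_add n (r s : R) (A : 'M[C]_n) :
  cR (expR r) *: (cR (expR s) *: A) = cR (expR (r + s)) *: A.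
Proof. by rewrite scalerA expRD real_complexM. Qed.

Lemma lepd_exp_trans n r s (A B D : 'M[C]_n) :
  lepd A (cR (expR r) *: B) -> lepd B (cR (expR s) *: D) ->
  lepd A (cR (expR (r + s)) *: D).
Proof.
move=> h1 h2; apply: (lepd_trans h1); rewrite -scale_expR_add.
by apply: lepd_scale; [exact: expR_ge0|exact: h2].
Qed.

Lemma near_trans n r s (A B D : 'M[C]_n) :
  near r A B -> near s B D -> near (r + s) A D.
Proof.
move=> [h1 h2] [h3 h4]; split; first exact: lepd_exp_trans h1 h3.
have -> : r + s = s + r by rewrite addrC.
exact: lepd_exp_trans h4 h2.
Qed.

Lemma lepd_wexp n (r s : R) (A B : 'M[C]_n) : pd B -> r <= s ->
  lepd A (cR (expR r) *: B) -> lepd A (cR (expR s) *: B).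
Proof.
move=> pB rs h x; apply: (le_trans (h x)); rewrite !qfZ.
by apply: ler_wpM2r; [exact: pd_ge0|rewrite lecR ler_expR].
Qed.

Lemma near_w n (r s : R) (A B : 'M[C]_n) : pd A -> pd B -> r <= s ->
  near r A B -> near s A B.
Proof. by move=> pA pB rs [h1 h2]; split; apply: lepd_wexp rs _. Qed.

Lemma near_congr n r (g A B : 'M[C]_n) : near r A B ->
  near r (g *m A *m g^t*) (g *m B *m g^t*).
Proof.
by case=> h1 h2; split; move: (lepd_congr g h1) (lepd_congr g h2);
  rewrite -!scalemxAr -!scalemxAl.
Qed.

Lemma near_refl n (A : 'M[C]_n) : near 0 A A.
Proof. by split=> x; rewrite expR0 rmorph1 scale1r. Qed.

Lemma expd_le n (d : 'rV[R]_n) (r : R) : (forall j, d 0 j <= r) ->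
  lepd (expd d) (cR (expR r) *: 1%:M).
Proof.
move=> h x; rewrite qfZ qf_expd (qf1_nsq rc) -real_complexM lecR mulr_sumr.
by apply: ler_sum => j _; rewrite ler_wpM2r ?nsq_ge0 // ler_expR.
Qed.

Lemma expd_ge n (d : 'rV[R]_n) (r : R) : (forall j, - r <= d 0 j) ->
  lepd 1%:M (cR (expR r) *: expd d).
Proof.
move=> h x; rewrite qfZ qf_expd (qf1_nsq rc) -real_complexM lecR mulr_sumr.
apply: ler_sum => j _; rewrite mulrA -expRD.
rewrite -[leLHS]mul1r; apply: ler_wpM2r; first exact: nsq_ge0.
by rewrite -expR0 ler_expR -lerBlDl sub0r.
Qed.

Lemma expd_near n (d : 'rV[R]_n) (r : R) : (forall j, `|d 0 j| <= r) ->
  near r (expd d) 1%:M.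
Proof.
move=> h; split.
  by apply: expd_le => j; apply: le_trans (h j); exact: ler_norm.
by apply: expd_ge => j; have := h j; rewrite ler_norml => /andP[].
Qed.

Lemma expd_near_congr n (d : 'rV[R]_n) (b : 'M[C]_n) (r : R) :
  (forall j, `|d 0 j| <= r) ->
  near r (b *m expd d *m b^t*) (b *m b^t*).
Proof.
move=> h; have := near_congr b (expd_near h).
by rewrite mulmx1.
Qed.

Lemma near1_eig n (U : 'M[C]_n) (d : 'rV[R]_n) (r : R) : U \is unitarymx ->
  near r (hexp U d) 1%:M -> forall j, `|d 0 j| <= r.
Proof.
move=> uU [h1 h2] j; rewrite ler_norml; apply/andP; split.
  have := h2 (row j U); rewrite qfZ qf_row_hexp // (qf1_row_unitary rc) //.
  rewrite -real_complexM -expRD -[X in X <= _](rmorph1 cR) lecR -expR0 ler_expR.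
  by rewrite -lerBlDl sub0r.
have := h1 (row j U); rewrite qfZ qf_row_hexp // (qf1_row_unitary rc) // mulr1.
by rewrite lecR ler_expR.
Qed.

Lemma eig_near1 n (U : 'M[C]_n) (d : 'rV[R]_n) (r : R) : U \is unitarymx ->
  (forall j, `|d 0 j| <= r) -> near r (hexp U d) 1%:M.
Proof.
move=> uU h; have := expd_near_congr (U^t*) h.
by rewrite trmxCK unitary_trCmul.
Qed.

(** Scaling $B$ by $e^r$ scales $B^t$ by $e^{tr}$, so Loewner-Heinz contracts the metric by the
    factor $t$. *)
Lemma pw_near n m r (A B : 'M[C]_n) : pd A -> pd B -> near r A B ->
  near ((1 - 2^-1 ^+ m) * r) (pw (1 - 2^-1 ^+ m) A) (pw (1 - 2^-1 ^+ m) B).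
Proof.
have main (A' B' : 'M[C]_n) : pd A' -> pd B' -> lepd A' (cR (expR r) *: B') ->
    lepd (pw (1 - 2^-1 ^+ m) A') (cR (expR ((1 - 2^-1 ^+ m) * r)) *: pw (1 - 2^-1 ^+ m) B').
  move=> pA pB h.
  have [V [b [uV BE]]] := pd_hexp rc pB.
  have sc s : cR (expR s) *: hexp V b = hexp V (b + const_mx s).
    rewrite /hexp scalemxAl scalemxAr; congr (_ *m _).
    congr (_ *m _); apply/matrixP => i j; rewrite !mxE mulrnAr -real_complexM -expRD addrC.
    by [].
  have pB' : pd (cR (expR r) *: B') by rewrite BE sc; apply: hexp_pd.
  have := loewner_heinz rc m pA pB' h.
  rewrite BE sc !pwE //.
  suff -> : cR (expR ((1 - 2^-1 ^+ m) * r)) *: hexp V ((1 - 2^-1 ^+ m) *: b)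
     = hexp V ((1 - 2^-1 ^+ m) *: (b + const_mx r)) by [].
  rewrite /hexp scalemxAl scalemxAr; congr (_ *m _).
  congr (_ *m _); apply/matrixP => i j; rewrite !mxE mulrnAr -real_complexM -expRD.
  by rewrite addrC mulrDr.
by move=> pA pB [h1 h2]; split; apply: main.
Qed.

Lemma expR_sum_ord n (d : 'I_n -> R) : expR (\sum_j d j) = \prod_j expR (d j).
Proof.
by elim/big_rec2: _ => [|j y x _ <-]; [rewrite expR0|rewrite expRD].
Qed.

Lemma det_hexp n (U : 'M[C]_n) (d : 'rV[R]_n) : U \is unitarymx ->
  \det (hexp U d) = cR (expR (\sum_j d 0 j)).
Proof.
move=> uU; rewrite /hexp !det_mulmx mulrAC -det_mulmx unitary_trCmul // det1 mul1r.
rewrite det_diag expR_sum_ord rmorph_prod; apply: eq_bigr => j _.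
by rewrite mxE.
Qed.

(** The logarithm of the squared diagonal entry, so that the sum over [k] is $\log\det bb^*$ for
    triangular [b]. *)
Definition ldiag n (b : 'M[C]_n) k : R := 2 * ln (rp (b k k)).

Lemma gt0_real_complex (z : C) : 0 < z -> 0 < rp z /\ z = cR (rp z).
Proof.
move=> z0; have zr : z \is Num.real by rewrite gtr0_real.
by rewrite -(cR_gt0 rc) rpK.
Qed.

Lemma det_ltp n (b : 'M[C]_n) : ltp b ->
  \det (b *m b^t*) = cR (expR (\sum_k ldiag b k)).
Proof.
move=> pb; case: (pb) => tb db.
rewrite det_mulmx det_map_mx det_tr det_trig // rmorph_prod -big_split /=.
rewrite expR_sum_ord rmorph_prod; apply: eq_bigr => k _.
have [h ->] := gt0_real_complex (db k).
rewrite /ldiag /= conj_real_complex -real_complexM; congr (cR _).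
by rewrite mulrDl mul1r expRD lnK.
Qed.

Lemma sum_eig_ltp n (U : 'M[C]_n) d b : U \is unitarymx -> ltp b ->
  hexp U d = b *m b^t* -> \sum_j d 0 j = \sum_k ldiag b k.
Proof.
move=> uU pb h; have := det_ltp pb; rewrite -h det_hexp //.
by move=> /cR_inj/expR_inj.
Qed.

Lemma ldiag_inv n (b : 'M[C]_n) k : ltp b -> ldiag (invmx b) k = - ldiag b k.
Proof.
case=> tb db; have [|_ d] := trig_inv tb; first by move=> i; rewrite gt_eqF.
have [h bE] := gt0_real_complex (db k).
rewrite /ldiag d; have -> : rp (b k k)^-1 = (rp (b k k))^-1.
  by rewrite {1}bE -real_complexV cRK.
by rewrite lnV ?mulrN // posrE.
Qed.

(* Sum of the first m diagonal entries of log (b^* b), diagonalizing the leading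
   block of (b^* b)^-1, which is the product of the leading blocks of b^-1 and
   b^-*. *)
Lemma trace_log_minor m p (W : 'M[C]_(m + p)) (L : 'rV[R]_(m + p)) b :
  W \is unitarymx -> ltp b -> invmx b *m (invmx b)^t* = hexp W (- L) ->
  \sum_(k < m) ldiag b (lshift p k) <=
  \sum_(k < m) \sum_j L 0 j * nsq (W j (lshift p k)).
Proof.
move=> uW pb hb.
have pbi := ltp_inv pb.
set b1 := ulsubmx (invmx b).
have pb1 : ltp b1.
  case: pbi => t d; split; last by move=> i; rewrite !mxE.
  by apply/is_trig_mxP => i j ij; rewrite !mxE (is_trig_mxP t).
have bE : invmx b = block_mx b1 0 (dlsubmx (invmx b)) (drsubmx (invmx b)).
  rewrite -[LHS]submxK; congr block_mx; apply/matrixP => i j.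
  rewrite !mxE (is_trig_mxP (proj1 pbi)) //=.
  by apply: leq_trans (ltn_ord i) _; rewrite leq_addr.
have [F [c [uF FE]]] := pd_hexp rc (pd_mulC (ltp_unit pb1)).
pose x i : 'rV[C]_(m + p) := row_mx (row i F) 0.
have qx i : qf (hexp W (- L)) (x i) = cR (expR (c 0 i)).
  rewrite -hb -[invmx b *m _]mulmx1 -mulmxA mulmx1.
  have -> : qf (invmx b *m (invmx b)^t*) (x i) = qf 1%:M (x i *m invmx b).
    by rewrite -qf_congr mulmx1.
  have -> : x i *m invmx b = row_mx (row i F *m b1) 0.
    by rewrite bE /x mul_row_block !mul0mx !mulmx0 !addr0.
  rewrite -(qf_row_hexp rc c i uF) -FE.
  have -> : qf (b1 *m b1^t*) (row i F) = qf 1%:M (row i F *m b1).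
    by rewrite -qf_congr mulmx1.
  rewrite /qf !mulmx1 tr_row_mx map_col_mx mul_row_col mul0mx addr0.
  by [].
pose pp i j := nsq ((x i *m W^t*) 0 j).
have pp1 i : \sum_j pp i j = 1.
  apply: (@cR_inj _ _ rc); rewrite -(qf1_nsq rc) nsq_sum_unitary ?trmxC_unitary //.
  rewrite rmorph1 -[RHS](qf1_row_unitary rc i uF) /qf !mulmx1 /x.
  by rewrite tr_row_mx map_col_mx mul_row_col mul0mx addr0.
(* Jensen for the probability weights [pp i], as $e^{c_i} = \sum_j p_{ij} e^{-L_j}$. *)
have jen i : - \sum_j pp i j * L 0 j <= c 0 i.
  have := qx i; rewrite qf_hexp => /cR_inj h.
  have : \sum_j pp i j * (- L 0 j - c 0 i) <= \sum_j pp i j * (expR (- L 0 j - c 0 i) - 1).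
    apply: ler_sum => j _; apply: ler_wpM2l; first exact: nsq_ge0.
    by rewrite lerBrDl expR_ge1Dx.
  have -> : \sum_j pp i j * (expR (- L 0 j - c 0 i) - 1) = 0.
    under eq_bigr do rewrite mulrBr mulr1 expRD mulrA.
    rewrite sumrB pp1 -mulr_suml.
    under eq_bigr => j _ do rewrite mulrC -[- L 0 j](_ : (- L) 0 j = _) ?mxE //.
    by rewrite [X in X * _](_ : _ = expR (c 0 i)) -?expRD ?subrr ?expR0 ?subrr // -h;
       apply: eq_bigr => j _; rewrite mxE.
  under eq_bigr do rewrite mulrBr mulrN.
  by rewrite sumrB sumrN -mulr_suml pp1 mul1r subr_le0.
have sc : \sum_i c 0 i = - \sum_(k < m) ldiag b (lshift p k).
  rewrite (sum_eig_ltp uF pb1 (esym FE)) -sumrN; apply: eq_bigr => k _.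
  by rewrite -ldiag_inv // /ldiag !mxE.
(* The rows of [F] are an orthonormal basis of the space of the first [m] coordinates, so summing
   over them no longer depends on [F]. *)
have spp j : \sum_i pp i j = \sum_(k < m) nsq (W j (lshift p k)).
  pose z : 'rV[C]_m := \row_k (W j (lshift p k)).
  have e i : (x i *m W^t*) 0 j = ((z *m F^t*) 0 i)^*.
    rewrite !mxE big_split_ord /= [X in _ + X]big1 ?addr0 => [|k _]; last first.
      by rewrite row_mxEr mxE mul0r.
    rewrite rmorph_sum; apply: eq_bigr => k _.
    by rewrite row_mxEl !mxE rmorphM /= conjCK mulrC.
  rewrite /pp; under eq_bigr do rewrite e nsq_conj.
  apply: (@cR_inj _ _ rc); rewrite -(qf1_nsq rc) nsq_sum_unitary ?trmxC_unitary //.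
  by rewrite (qf1_nsq rc); congr (cR _); apply: eq_bigr => k _; rewrite mxE.
rewrite -lerN2 -sc exchange_big -sumrN /=.
have -> : \sum_j - \sum_(k < m) L 0 j * nsq (W j (lshift p k)) =
    \sum_i - \sum_j pp i j * L 0 j.
  rewrite !sumrN; congr (- _); rewrite [RHS]exchange_big; apply: eq_bigr => j _.
  by rewrite -mulr_sumr -mulr_suml spp mulrC.
by apply: ler_sum => i _.
Qed.

Lemma abel_nat (f w : nat -> R) n :
  (forall m, (m <= n)%N -> 0 <= \sum_(k < m) f k) ->
  (forall k, (k < n)%N -> w k.+1 <= w k) ->
  w n * \sum_(k < n.+1) f k <= \sum_(k < n.+1) w k * f k.
Proof.
elim: n => [|n IH] hf hw; first by rewrite !big_ord1.
rewrite big_ord_recr [in leRHS]big_ord_recr /= mulrDr lerD2r.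
apply: le_trans (IH _ _) => [|m mn|k kn].
- by apply: ler_wpM2r; [exact: hf|exact: hw].
- by apply: hf; exact: leqW.
- by apply: hw; exact: ltnW.
Qed.

Lemma abel_ord n (f w : 'I_n -> R) :
  (forall m, (m <= n)%N -> 0 <= \sum_(k < n | (k < m)%N) f k) ->
  \sum_k f k = 0 ->
  (forall i j : 'I_n, (i <= j)%N -> w j <= w i) ->
  0 <= \sum_k w k * f k.
Proof.
case: n f w => [|n] f w hf h0 hw; first by rewrite big_ord0.
pose f' k := f (inord k); pose w' k := w (inord k).
have e m : (m <= n.+1)%N -> \sum_(k < m) f' k = \sum_(k < n.+1 | (k < m)%N) f k.
  move=> mn; rewrite (big_ord_widen _ f' mn).
  by apply: eq_bigr => k _; rewrite /f' inord_val.
have := @abel_nat f' w' n.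
rewrite (e n.+1) // (eq_bigl xpredT) => [|k]; last by rewrite ltn_ord.
rewrite h0 mulr0 (eq_bigr (fun k => w k * f k)) => [|k _]; last first.
  by rewrite /w' /f' inord_val.
apply=> [m mn|k kn]; first by rewrite e; [apply: hf|]; apply: leq_trans mn _.
by apply: hw; rewrite !inordK // ltnW.
Qed.

(** Abel summation: the inequalities for the leading minors get the nonnegative weights $w_k -
    w_{k+1}$, and for the full matrix both sides equal $\log\det bb^*$. *)
Lemma trace_log_weight n (U W : 'M[C]_n) (L w : 'rV[R]_n) b :
  U \is unitarymx -> W \is unitarymx -> ltp b ->
  hexp U L = b *m b^t* -> invmx b *m (invmx b)^t* = hexp W (- L) ->
  (forall i j : 'I_n, (i <= j)%N -> w 0 j <= w 0 i) ->
  \sum_k w 0 k * ldiag b k <= \sum_k w 0 k * \sum_j L 0 j * nsq (W j k).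
Proof.
move=> uU uW pb h1 h2 hw.
rewrite -subr_ge0 -sumrB; under eq_bigr do rewrite -mulrBr.
apply: abel_ord => [m mn||//]; last first.
  rewrite sumrB exchange_big /=; under eq_bigr do rewrite -mulr_sumr unitary_row_nsq // mulr1.
  by rewrite (sum_eig_ltp uU pb h1) subrr.
rewrite sumrB subr_ge0.
have nE : n = (m + (n - m))%N by rewrite subnKC.
move: (n - m)%N nE => p nE {mn}; subst n.
have e (f : 'I_(m + p) -> R) : \sum_(k < m + p | (k < m)%N) f k = \sum_(k < m) f (lshift p k).
  rewrite big_mkcond big_split_ord /= [X in _ + X]big1 ?addr0 => [|k _]; last first.
    by rewrite ltnNge leq_addr.
  by apply: eq_bigr => k _; rewrite ltn_ord.
by rewrite !e; apply: trace_log_minor.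
Qed.

Lemma expR_quad (x : R) : `|x| <= 2^-1 -> expR x <= 1 + x + 2 * x ^+ 2.
Proof.
rewrite ler_norml => /andP[h1 h2].
have h := expR_ge1Dx (- x).
have : expR x * (1 - x) <= 1.
  rewrite -[leRHS]expR0 -(subrr x) expRD.
  by apply: ler_wpM2l => //; exact: expR_ge0.
have : (1 + x + 2 * x ^+ 2) * (1 - x) >= 1 by nra.
move=> h3 h4; rewrite -(@ler_pM2r _ (1 - x)); first exact: le_trans h3.
by lra.
Qed.

(** One short step of the flow, from $b e^{2w} b^*$ to $bb^*$. If $bb^* = U^* e^L U$, then $Ub =
    e^{L/2} W$ with $W$ unitary, and the starting form takes the value $e^{L_j} \sum_k e^{2w_k}
    |W_{jk}|^2$ on the $j$-th eigenvector of the final one. Jensen compares the energies, and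
    [trace_log_weight] controls the linear term. *)
Lemma lognorm_step n (b : 'M[C]_n) (w : 'rV[R]_n) (e r : R) :
  ltp b -> (forall i j : 'I_n, (i <= j)%N -> w 0 j <= w 0 i) ->
  (forall k, `|w 0 k| <= e) -> e <= 4^-1 -> near r (b *m b^t*) 1%:M ->
  lognorm (b *m b^t*) <= lognorm (b *m expd (2 *: w) *m b^t*)
    - 4 * (\sum_k w 0 k * ldiag b k) + 16 * e ^+ 2 * r *+ n.
Proof.
move=> pb hw we e4 hr.
have bu := ltp_unit pb.
have [U [L [uU qE]]] := pd_hexp rc (pd_mulC bu).
pose E s := expd (s *: L).
have ED s t : E s *m E t = E (s + t) by rewrite /E expdD scalerDl.
have E0 : E 0 = 1%:M by rewrite /E scale0r expd0.
have Et s : (E s)^t* = E s by apply: expd_trC.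
pose W := E (- 2^-1) *m U *m b.
have UqU : U *m (b *m b^t*) *m U^t* = E 1.
  rewrite qE /hexp !mulmxA unitary_mulC // mul1mx -mulmxA unitary_mulC // mulmx1.
  by rewrite /E scale1r.
have uW : W \is unitarymx.
  apply/unitarymxP; rewrite /W !trCM Et -!mulmxA (mulmxA b) (mulmxA U) (mulmxA (U *m _)).
  rewrite UqU !ED; have -> : - 2^-1 + (1 - 2^-1) = 0 :> R by lra.
  by rewrite E0.
have UbE : U *m b = E 2^-1 *m W.
  by rewrite /W !mulmxA ED subrr E0 mul1mx.
have bE : b = U^t* *m E 2^-1 *m W.
  by rewrite -mulmxA -UbE mulmxA unitary_trCmul // mul1mx.
clearbody W.
have biE : invmx b = W^t* *m E (- 2^-1) *m U.
  apply: invmx_eq; rewrite bE !mulmxA -(mulmxA _ W) unitary_mulC // mulmx1.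
  by rewrite -(mulmxA _ (E 2^-1)) ED subrr E0 mulmx1 unitary_trCmul.
have YE : invmx b *m (invmx b)^t* = hexp W (- L).
  rewrite biE !trCM trmxCK Et !mulmxA -(mulmxA _ U) (unitary_mulC uU) mulmx1.
  have EL : E (- 2^-1 - 2^-1) = expd (- L).
    have h : - 2^-1 - 2^-1 = -1 :> R by lra.
    by rewrite /E h scaleN1r.
  by rewrite -(mulmxA (W^t*)) ED EL.
have py : pd (b *m expd (2 *: w) *m b^t*).
  apply: pd_congr => //.
  have -> : expd (2 *: w) = hexp 1%:M (2 *: w) by rewrite /hexp trC1 mul1mx mulmx1.
  by apply: hexp_pd; apply/unitarymxP; rewrite trC1 mulmx1.
have [V [H [uV yE]]] := pd_hexp rc py.
have rU j : row j U *m b = cR (expR (2^-1 * L 0 j)) *: row j W.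
  rewrite -row_mul UbE; apply/rowP => k; rewrite mxE /E /expd mul_diag_mx !mxE.
  by [].
have rUi j : row j U *m (invmx b)^t* = cR (expR (- (2^-1 * L 0 j))) *: row j W.
  have -> : row j U *m (invmx b)^t* = row j (U *m (invmx b)^t*) by rewrite row_mul.
  rewrite biE !trCM trmxCK Et !mulmxA unitary_mulC // mul1mx.
  by apply/rowP => k; rewrite mxE /E /expd mul_diag_mx !mxE mulNr.
have qE1 (d : 'rV[R]_n) (c : R) j : qf (expd d) (cR (expR (2^-1 * c)) *: row j W) =
    cR (expR c * \sum_k expR (d 0 k) * nsq (W j k)).
  rewrite qfZr (nsqE rc) qf_expd -real_complexM; congr (cR (_ * _)).
    rewrite nsq_cR -expRM_natl; congr expR; rewrite mulr_natl.
    by lra.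
  by apply: eq_bigr => k _; rewrite mxE.
pose c (s : R) j := \sum_k expR (s * 2 * w 0 k) * nsq (W j k) - 1.
rewrite qE lognormE // yE lognormE //.
have := @lognorm_jensen _ _ rc n U V L H
  (fun j => if 0 <= L 0 j then c (-1) j else c 1 j) uU uV.
move=> /(_ _ _)/le_trans; apply.
- move=> j L0; rewrite L0.
  rewrite -invmx_hexp // -yE.
  have -> : invmx (b *m expd (2 *: w) *m b^t*) =
      (invmx b)^t* *m expd (- (2 *: w)) *m (invmx b)^t*^t*.
    apply: invmx_eq; rewrite trmxCK -!mulmxA (mulmxA (b^t*)) trC_inv mulmxV ?unitmx_trC //.
    by rewrite mul1mx (mulmxA (expd _)) expdN mul1mx mulmxV.
  rewrite qf_congr rUi -mulrN qE1 lecR ler_wpM2l ?expR_ge0 // /c addrC subrK.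
  by apply: ler_sum => k _; rewrite !mxE mulN1r mulNr.
- move=> j L0; rewrite leNgt L0 /= -yE qf_congr rU qE1.
  rewrite lecR ler_wpM2l ?expR_ge0 // /c addrC subrK.
  by apply: ler_sum => k _; rewrite !mxE mul1r.
rewrite -addrA lerD2l.
have hW := trace_log_weight uU uW pb (esym qE) YE hw.
apply: (@le_trans _ _ (- 4 * (\sum_k w 0 k * \sum_j L 0 j * nsq (W j k)) + 16 * e ^+ 2 * r *+ n)); last first.
  by rewrite lerD2r mulNr lerN2; apply: ler_wpM2l.
have -> : - 4 * (\sum_k w 0 k * \sum_j L 0 j * nsq (W j k)) + 16 * e ^+ 2 * r *+ n =
   \sum_j (- 4 * (L 0 j * \sum_k w 0 k * nsq (W j k)) + 16 * e ^+ 2 * r).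
  rewrite big_split /= sumr_const card_ord; congr (_ + _).
  rewrite -mulr_sumr; congr (_ * _).
  under eq_bigr do rewrite mulr_sumr.
  rewrite exchange_big /=; apply: eq_bigr => j _.
  by rewrite mulr_sumr; apply: eq_bigr => k _; rewrite mulrCA.
(* As $|2w_k| \le 2e \le 1/2$, the quadratic bound on the exponential applies and leaves the error
   $2(2e)^2 = 8e^2$. *)
have cb s j : `|s| = 1 -> c s j <= 2 * s * (\sum_k w 0 k * nsq (W j k)) + 8 * e ^+ 2.
  move=> s1; rewrite /c lerBlDr.
  have -> : 2 * s * (\sum_k w 0 k * nsq (W j k)) + 8 * e ^+ 2 + 1 =
     \sum_k (1 + s * 2 * w 0 k + 8 * e ^+ 2) * nsq (W j k).
    transitivity (2 * s * (\sum_k w 0 k * nsq (W j k)) +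
        8 * e ^+ 2 * (\sum_k nsq (W j k)) + \sum_k nsq (W j k)).
      by rewrite unitary_row_nsq // mulr1.
    rewrite !mulr_sumr -!big_split /=; apply: eq_bigr => k _; ring.
  apply: ler_sum => k _; apply: ler_wpM2r; first exact: nsq_ge0.
  have hk := we k.
  have n2 : `|s * 2 * w 0 k| <= 2 * e.
    by rewrite !normrM s1 mul1r normr_nat; apply: ler_wpM2l.
  have : expR (s * 2 * w 0 k) <= 1 + s * 2 * w 0 k + 2 * (s * 2 * w 0 k) ^+ 2.
    by apply: expR_quad; apply: (le_trans n2); lra.
  move=> h; apply: (le_trans h); rewrite lerD2l.
  rewrite -(real_normK (num_real (s * 2 * w 0 k))).
  have := normr_ge0 (s * 2 * w 0 k); move: n2; set z := `|_|; nra.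
have hL : forall j, `|L 0 j| <= r by apply: near1_eig uU _; rewrite -qE.
apply: ler_sum => j _.
have := hL j; have := sqr_ge0 e.
set S := \sum_k _ => e2.
have [L0|L0] := leP 0 (L 0 j).
  rewrite ger0_norm // => Lr.
  have := cb (-1) j; rewrite normrN1 -/S => /(_ erefl) hc.
  have := ler_wpM2l (mulr_ge0 (ler0n _ 2) L0) hc; nra.
rewrite ltr0_norm // => Lr.
have := cb 1 j; rewrite normr1 -/S => /(_ erefl) hc.
have L1 : 0 <= - L 0 j by rewrite oppr_ge0 ltW.
have := ler_wpM2l (mulr_ge0 (ler0n _ 2) L1) hc; nra.
Qed.

End LogNorm.

(** * Flows along flags: nonexpansiveness and decrease of the energy *)

Section Phi.
Variables (R : realType) (C : numClosedFieldType) (rc : real_part R C).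
Local Notation cR := (cR rc).
Local Notation rp := (rp rc).
Local Notation nsq := (nsq rc).
Local Notation expd := (expd rc).
Local Notation hexp := (hexp rc).
Local Notation pw := (pw rc).
Local Notation lognorm := (lognorm rc).
Local Notation near := (near rc).
Local Notation ldiag := (ldiag rc).
Implicit Types (n : nat).

Definition decreasing n (v : 'rV[R]_n) :=
  forall i j : 'I_n, (i <= j)%N -> v 0 j <= v 0 i.

(** A bound on the squared operator norm, for the action on row vectors. *)
Definition contr n (c : C) (T : 'M[C]_n) :=
  forall x : 'rV[C]_n, qf 1%:M (x *m T) <= c * qf 1%:M x.

Lemma norm_convex (a b : R) (x y : C) : 0 <= a -> 0 <= b -> a + b = 1 ->
  `|cR a * x + cR b * y| ^+ 2 <= cR a * `|x| ^+ 2 + cR b * `|y| ^+ 2.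
Proof.
move=> a0 b0 ab.
have h1 : `|cR a * x + cR b * y| <= cR a * `|x| + cR b * `|y|.
  apply: (le_trans (ler_normD _ _)); rewrite !normrM.
  by rewrite (@ger0_norm _ (cR a)) ?cR_ge0 // (@ger0_norm _ (cR b)) ?cR_ge0.
apply: (@le_trans _ _ ((cR a * `|x| + cR b * `|y|) ^+ 2)).
  by rewrite lerXn2r ?nnegrE ?normr_ge0 // addr_ge0 // mulr_ge0 ?cR_ge0.
rewrite -subr_ge0.
have bE : cR b = 1 - cR a by rewrite -(rmorph1 cR) -ab rmorphD /= addrC addKr.
have -> : cR a * `|x| ^+ 2 + cR b * `|y| ^+ 2 - (cR a * `|x| + cR b * `|y|) ^+ 2
   = cR a * cR b * (`|x| - `|y|) ^+ 2 by rewrite bE; ring.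
apply: mulr_ge0; first by apply: mulr_ge0; rewrite cR_ge0.
by rewrite real_exprn_even_ge0 // rpredB ?normr_real.
Qed.

Lemma contr_convex n c (S T : 'M[C]_n) (a b : R) : 0 <= a -> 0 <= b -> a + b = 1 ->
  contr c S -> contr c T -> contr c (cR a *: S + cR b *: T).
Proof.
move=> a0 b0 ab hS hT x.
have h : qf 1%:M (x *m (cR a *: S + cR b *: T)) <=
    cR a * qf 1%:M (x *m S) + cR b * qf 1%:M (x *m T).
  rewrite !qf1 !mulr_sumr -big_split /=; apply: ler_sum => i _.
  rewrite mulmxDr -!scalemxAr (_ : forall A B : 'rV[C]_n, (cR a *: A + cR b *: B) 0 i =
    cR a * A 0 i + cR b * B 0 i); last by move=> A B; rewrite !mxE.
  exact: norm_convex.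
apply: (le_trans h).
have -> : c * qf 1%:M x = cR a * (c * qf 1%:M x) + cR b * (c * qf 1%:M x).
  by rewrite -mulrDl -rmorphD ab rmorph1 mul1r.
by apply: lerD; apply: ler_wpM2l; rewrite ?cR_ge0.
Qed.

Lemma contr_sign n c (T : 'M[C]_n) (s : 'I_n -> bool) : contr c T ->
  contr c (diag_mx (\row_i (-1) ^+ s i) *m T *m diag_mx (\row_i (-1) ^+ s i)).
Proof.
move=> h x; set Q := diag_mx _.
have e (y : 'rV[C]_n) : qf 1%:M (y *m Q) = qf 1%:M y.
  rewrite !qf1; apply: eq_bigr => i _.
  by rewrite /Q mul_mx_diag !mxE mulrC normrMsign.
by rewrite !mulmxA e -[X in _ <= _ * X]e.
Qed.

Definition tail_row n (m : nat) (t : R) : 'rV[R]_n := \row_k (if (m < k)%N then t else 0).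

(* Conjugation by this diagonal matrix multiplies the lower left block of T by
   e^t <= 1, a convex combination of T and of T with that block negated. *)
Lemma contr_tail n c (T : 'M[C]_n) m t : t <= 0 -> is_trig_mx T -> contr c T ->
  contr c (expd (tail_row n m t) *m T *m expd (- tail_row n m t)).
Proof.
move=> t0 /is_trig_mxP tT hT.
have e1 : 0 <= expR t by exact: expR_ge0.
have e2 : expR t <= 1 by rewrite -expR0 ler_expR.
have -> : expd (tail_row n m t) *m T *m expd (- tail_row n m t) =
   cR ((1 + expR t) / 2) *: T + cR ((1 - expR t) / 2) *:
   (diag_mx (\row_(i < n) (-1) ^+ (m < i)%N) *m T *m diag_mx (\row_(i < n) (-1) ^+ (m < i)%N)).
  apply/matrixP => i j.
  rewrite /expd !mul_mx_diag !mul_diag_mx !mxE.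
  have [ij|ji] := ltnP i j; first by rewrite tT // !(mulr0, mul0r, addr0).
  have s1 : (1 + expR t) / 2 + (1 - expR t) / 2 = 1 by lra.
  have s2 : cR ((1 + expR t) / 2) + cR ((1 - expR t) / 2) = 1.
    by rewrite -rmorphD /= s1 rmorph1.
  have s3 : cR ((1 + expR t) / 2) - cR ((1 - expR t) / 2) = cR (expR t).
    by rewrite -rmorphB /=; congr (cR _); lra.
  case: (ltnP m i) => mi; case: (ltnP m j) => mj.
  - rewrite /= expr1 mulrN1 mulN1r opprK -mulrDl s2 mul1r.
    by rewrite mulrAC -real_complexM -expRD subrr expR0 rmorph1 mul1r.
  - rewrite /= expr1 expr0 mulr1 oppr0 expR0 rmorph1 mulr1 mulN1r mulrN -mulrBl.
    by rewrite s3.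
  - by have := leq_trans (leq_trans mj ji) mi; rewrite ltnn.
  - rewrite /= expr0 mulr1 mul1r oppr0 expR0 rmorph1 mulr1 mul1r -mulrDl s2.
    by rewrite mul1r.
apply: contr_convex => //; try lra.
exact: contr_sign.
Qed.

Lemma expd_conj_trig n (v : 'rV[R]_n) (T : 'M[C]_n) : is_trig_mx T ->
  is_trig_mx (expd v *m T *m expd (- v)).
Proof.
move=> tT; have td (w : 'rV[R]_n) : is_trig_mx (expd w) by apply: diag_mx_is_trig.
have [h _] := trig_mul (td v) tT.
by have [h2 _] := trig_mul h (td (- v)).
Qed.

(** A decreasing [v] is a constant plus tails of nonpositive height; conjugation by a constant is
    trivial, and each tail is covered by [contr_tail]. *)
Lemma contr_conj n c (v : 'rV[R]_n) (T : 'M[C]_n) : decreasing v -> is_trig_mx T ->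
  contr c T -> contr c (expd v *m T *m expd (- v)).
Proof.
case: n v T => [|n] v T dv tT hT.
  by rewrite [expd v *m T *m _](_ : _ = T) //; apply/matrixP; case.
pose P (w : 'rV[R]_n.+1) := forall S, is_trig_mx S -> contr c S ->
  contr c (expd w *m S *m expd (- w)).
suff : P v by apply.
have PD (w w' : 'rV[R]_n.+1) : P w -> P w' -> P (w + w').
  move=> h h' S tS cS.
  have := h' _ (expd_conj_trig w tS) (h _ tS cS).
  by rewrite !mulmxA expdD -mulmxA expdD -opprD [w' + w]addrC.
have P0 : P 0.
  by move=> S tS cS; rewrite oppr0 expd0 mulmx1 mul1mx.
have Pc a : P (const_mx a).
  move=> S tS cS.
  rewrite [X in contr c X](_ : _ = S) //.
  apply/matrixP => i j; rewrite /expd mul_mx_diag mul_diag_mx !mxE.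
  by rewrite mulrAC -real_complexM -expRD subrr expR0 rmorph1 mul1r.
pose w m := v 0 (inord m).
have -> : v = const_mx (v 0 0) + \sum_(m < n) tail_row n.+1 m (w m.+1 - w m).
  apply/rowP => k; rewrite !mxE summxE.
  have -> : \sum_(m < n) tail_row n.+1 m (w m.+1 - w m) 0 k =
     \sum_(m < k) (w m.+1 - w m).
    rewrite (big_ord_widen n (fun m => w m.+1 - w m)); last by rewrite -ltnS.
    by rewrite [RHS]big_mkcond; apply: eq_bigr => m _; rewrite mxE.
  rewrite -(big_mkord xpredT (fun m => w m.+1 - w m)) telescope_sumr //.
  have i0 : inord 0 = 0 :> 'I_n.+1 by apply/val_inj; rewrite /= inordK.
  by rewrite /w i0 inord_val [RHS]addrC subrK.
apply: (PD _ _ (Pc _)); apply: (big_ind P P0 PD) => m _ S tS cS.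
apply: (contr_tail _ _ tS cS); rewrite subr_le0; apply: dv.
by rewrite !inordK //; apply: leq_trans (ltn_ord m) _ => //; exact: leqW.
Qed.

(** Made total by choice, with the value 0 where no factor exists. *)
Definition chol n (y : 'M[C]_n) : 'M[C]_n :=
  if pselect (exists L, ltp L /\ y = L *m L^t*) is left h then projT1 (cid h) else 0.

Lemma cholP n (y : 'M[C]_n) : pd y -> ltp (chol y) /\ chol y *m (chol y)^t* = y.
Proof.
move=> /cholesky[L h1 h2]; rewrite /chol; case: pselect => [h|]; last first.
  by case; exists L.
by case: cid => M /= [hM ->].
Qed.

Lemma chol_eq n (L : 'M[C]_n) : ltp L -> chol (L *m L^t*) = L.
Proof.
move=> pL; have [h1 h2] := cholP (pd_mulC (ltp_unit pL)).
exact: ltp_uniq h2.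
Qed.

Lemma lepd_chol n (c : R) (L M : 'M[C]_n) : ltp L -> ltp M ->
  lepd (L *m L^t*) (cR c *: (M *m M^t*)) -> contr (cR c) (invmx M *m L).
Proof.
move=> pL pM h x; have uM := ltp_unit pM.
have := lepd_congr (invmx M) h => /(_ x).
rewrite -scalemxAr -scalemxAl.
have -> : invmx M *m (M *m M^t*) *m (invmx M)^t* = 1%:M.
  by rewrite mulKmx // -trCM mulVmx // trC1.
rewrite qfZ; apply: le_trans.
have -> : invmx M *m (L *m L^t*) *m (invmx M)^t* =
   (invmx M *m L) *m 1%:M *m (invmx M *m L)^t*.
  by rewrite mulmx1 trCM !mulmxA.
by rewrite qf_congr.
Qed.

Lemma contr_lepd n (c : R) (T : 'M[C]_n) : contr (cR c) T ->
  lepd (T *m T^t*) (cR c *: 1%:M).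
Proof. by move=> h x; rewrite qfZ -[T in T *m _]mulmx1 qf_congr. Qed.

(** Write $L = MT$ with $T$ lower triangular. The hypothesis bounds the norm of $T$, and the flow
    replaces $T$ by $e^v T e^{-v}$, which obeys the same bound by [contr_conj]. *)
Lemma lepd_flow n (c : R) (L M : 'M[C]_n) (v : 'rV[R]_n) :
  decreasing v -> ltp L -> ltp M ->
  lepd (L *m L^t*) (cR c *: (M *m M^t*)) ->
  lepd (L *m expd (- (2 *: v)) *m L^t*) (cR c *: (M *m expd (- (2 *: v)) *m M^t*)).
Proof.
move=> dv pL pM h; have uM := ltp_unit pM.
have [T TE] : exists T, T = invmx M *m L by exists (invmx M *m L).
have [tT _] := ltp_mul (ltp_inv pM) pL.
have := contr_lepd (contr_conj dv tT (lepd_chol pL pM h)); rewrite -TE.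
move=> /(lepd_congr (M *m expd (- v))).
rewrite -scalemxAr -scalemxAl mulmx1 !trCM !expd_trC.
have e2 : expd (- v) *m expd (- v) = expd (- (2 *: v)).
  by rewrite expdD -opprD scaler_nat mulr2n.
have -> : M *m expd (- v) *m (expd (- v) *m M^t*) = M *m expd (- (2 *: v)) *m M^t*.
  by rewrite -e2 !mulmxA.
have MT : M *m T = L by rewrite TE mulKVmx.
have -> : M *m expd (- v) *m (expd v *m T *m expd (- v) *m (expd (- v) *m (T^t* *m expd v)))
    *m (expd (- v) *m M^t*) =
    M *m (expd (- v) *m expd v) *m T *m (expd (- v) *m expd (- v)) *m T^t*
     *m (expd v *m expd (- v)) *m M^t*.
  by rewrite !mulmxA.
rewrite e2 !expdD subrr addNr expd0 !mulmx1 MT.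
by rewrite -[X in lepd X](mulmxA) -trCM MT.
Qed.

(** The squared diagonal entry of $M^{-1}L$ is at most the squared norm of its row, hence at most
    $e^c$. *)
Lemma ldiag_contr n (c : R) (L M : 'M[C]_n) k : ltp L -> ltp M ->
  lepd (L *m L^t*) (cR (expR c) *: (M *m M^t*)) -> ldiag L k - ldiag M k <= c.
Proof.
move=> pL pM h.
have := lepd_chol pL pM h (delta_mx 0 k).
have pT := ltp_mul (ltp_inv pM) pL.
have -> : qf 1%:M (delta_mx 0 k : 'rV[C]_n) = 1.
  rewrite qf1 (bigD1 k) //= big1 ?addr0; last first.
    by move=> i ik; rewrite mxE (negbTE ik) andbF normr0 expr0n.
  by rewrite mxE !eqxx normr1 expr1n.
rewrite mulr1 -rowE (qf1_nsq rc) lecR => h2.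
have h3 : nsq ((invmx M *m L) k k) <= expR c.
  move: h2; move: (invmx M *m L) => T; apply: le_trans.
  rewrite (bigD1 k) //= mxE lerDl; apply: sumr_ge0 => i _; exact: nsq_ge0.
have [TL tL] := pL; have [TM tM] := pM.
have [tMi dMi] := trig_inv TM (fun i => lt0r_neq0 (tM i)).
have [_ d] := trig_mul tMi TL.
have [l0 lE] := gt0_real_complex rc (tL k).
have [m0 mE] := gt0_real_complex rc (tM k).
move: h3; rewrite d dMi lE mE -real_complexV -real_complexM nsq_cR => h3.
rewrite /ldiag -mulrBr -ln_div ?posrE // mulrC mulr_natr -lnXn ?divr_gt0 //.
rewrite -[c]expRK ler_ln ?posrE ?expR_gt0 ?exprn_gt0 ?divr_gt0 //.
by rewrite [X in X ^+ 2]mulrC.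
Qed.

Lemma near_ldiag n (c : R) (y z : 'M[C]_n) k : pd y -> pd z -> near c y z ->
  `|ldiag (chol y) k - ldiag (chol z) k| <= c.
Proof.
move=> py pz [h1 h2].
have [ly ey] := cholP py; have [lz ez] := cholP pz.
rewrite ler_norml; apply/andP; split.
  by rewrite -lerN2 opprK opprB; apply: ldiag_contr => //; rewrite ey ez.
by apply: ldiag_contr => //; rewrite ey ez.
Qed.

(** [k] carries the flag to the coordinate flag. If $kyk^* = LL^*$, then $L$ moves to $Le^{-v}$,
    which gives the factor 2 on the form itself. *)
Definition phi n (k : 'M[C]_n) (v : 'rV[R]_n) (y : 'M[C]_n) : 'M[C]_n :=
  let L := chol (k *m y *m k^t*) in
  k^t* *m (L *m expd (- (2 *: v)) *m L^t*) *m k.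

Lemma expd_pd n (v : 'rV[R]_n) : pd (expd v).
Proof.
have u1 : (1%:M : 'M[C]_n) \is unitarymx by apply/unitarymxP; rewrite trC1 mulmx1.
by have := hexp_pd rc v u1; rewrite /hexp trC1 mul1mx mulmx1.
Qed.

Section Unitary.
Variables (n : nat) (k : 'M[C]_n).
Hypothesis uk : k \is unitarymx.

Lemma pd_uconj y : pd y -> pd (k *m y *m k^t*).
Proof. by move=> py; apply: pd_congr py; exact: unitarymx_unit. Qed.

Lemma uconjK y : k^t* *m (k *m y *m k^t*) *m k = y.
Proof.
rewrite !mulmxA (unitary_trCmul uk) mul1mx -mulmxA (unitary_trCmul uk).
by rewrite mulmx1.
Qed.

Lemma near_uconj r y z : near r y z -> near r (k *m y *m k^t*) (k *m z *m k^t*).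
Proof. exact: near_congr. Qed.

Lemma near_uconjV r y z : near r y z -> near r (k^t* *m y *m k) (k^t* *m z *m k).
Proof. by move/(near_congr (k^t*)); rewrite trmxCK. Qed.

Lemma lognorm_uconj y : pd y -> lognorm (k^t* *m y *m k) = lognorm y.
Proof.
move=> /(pd_hexp rc)[U [d [uU ->]]]; rewrite (lognormE _ _ uU).
have -> : k^t* *m hexp U d *m k = hexp (U *m k) d.
  by rewrite /hexp trCM !mulmxA.
by rewrite lognormE // mul_unitarymx.
Qed.

Lemma phi_pd (v : 'rV[R]_n) y : pd y -> pd (phi k v y).
Proof.
move=> py; rewrite /phi; have [lL _] := cholP (pd_uconj py).
rewrite -[X in _ *m X]trmxCK; apply: pd_congr.
  by rewrite unitmx_trC; exact: unitarymx_unit.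
by apply: pd_congr; [exact: ltp_unit|exact: expd_pd].
Qed.

Lemma phi_near (v : 'rV[R]_n) r y z : decreasing v -> pd y -> pd z -> near r y z ->
  near r (phi k v y) (phi k v z).
Proof.
move=> dv py pz h; rewrite /phi; apply: near_uconjV.
have [ly ey] := cholP (pd_uconj py); have [lz ez] := cholP (pd_uconj pz).
have [h1 h2] := near_uconj h.
by split; apply: lepd_flow => //; rewrite ey ez.
Qed.

Lemma phi_move (v : 'rV[R]_n) V y : pd y -> (forall i, `|v 0 i| <= V) ->
  near (2 * V) (phi k v y) y.
Proof.
move=> py hV; rewrite -[X in near _ _ X]uconjK /phi; apply: near_uconjV.
have [ly ey] := cholP (pd_uconj py); rewrite -[X in near _ _ X]ey.
apply: expd_near_congr => i; rewrite !mxE normrN normrM normr_nat.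
by rewrite ler_wpM2l.
Qed.

End Unitary.

Lemma pd_near1 n (y : 'M[C]_n) : pd y -> exists2 r, 0 <= r & near r y 1%:M.
Proof.
move=> /(pd_hexp rc)[U [d [uU ->]]].
exists (\sum_i `|d 0 i|); first by apply: sumr_ge0.
apply: eig_near1 => // j; rewrite (bigD1 j) //= lerDl; exact: sumr_ge0.
Qed.

Lemma ltp_expd n (w : 'rV[R]_n) : ltp (expd w).
Proof.
split; first exact: diag_mx_is_trig.
by move=> i; rewrite /expd !mxE eqxx mulr1n cR_gt0 expR_gt0.
Qed.

Lemma ldiag_expd n (L : 'M[C]_n) (w : 'rV[R]_n) k : ltp L ->
  ldiag (L *m expd w) k = ldiag L k + 2 * w 0 k.
Proof.
move=> pL; have [_ d] := trig_mul (proj1 pL) (proj1 (ltp_expd w)).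
rewrite /ldiag d /expd !mxE eqxx mulr1n.
have [l0 lE] := gt0_real_complex rc (proj2 pL k).
rewrite {1}lE -real_complexM cRK lnM ?posrE ?expR_gt0 // expRK.
by rewrite mulrDr.
Qed.

Lemma flow_trC n (L : 'M[C]_n) (w : 'rV[R]_n) (s : R) :
  (L *m expd (s *: w)) *m (L *m expd (s *: w))^t* = L *m expd (s *: (2 *: w)) *m L^t*.
Proof.
have -> : s *: (2 *: w) = s *: w + s *: w by rewrite -scalerDr scaler_nat mulr2n.
by rewrite trCM expd_trC !mulmxA -(mulmxA L) expdD.
Qed.

(** In [m] steps of length [v / m] the second-order errors add up to $O(1/m)$. Along the flow
    [ldiag] is shifted by [2 * s * v] with $-1 \le s \le 0$, which accounts for the term in $\sum_k
    v_k^2$. *)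
Lemma lognorm_flow n (L : 'M[C]_n) (v : 'rV[R]_n) (V r : R) (m : nat) :
  (0 < m)%N -> ltp L -> decreasing v -> (forall k, `|v 0 k| <= V) ->
  V / m%:R <= 4^-1 -> near r (L *m L^t*) 1%:M -> 0 <= r ->
  lognorm (L *m expd (- (2 *: v)) *m L^t*) <= lognorm (L *m L^t*)
    - 4 * (\sum_k v 0 k * ldiag L k) + 8 * (\sum_k v 0 k ^+ 2)
    + 16 * V ^+ 2 * (r + 2 * V) *+ n / m%:R.
Proof.
move=> m0 pL dv hV Vm hr r0.
have m1 : 0 < m%:R :> R by rewrite ltr0n.
pose q (j : nat) := L *m expd (- (j%:R / m%:R) *: (2 *: v)) *m L^t*.
pose A := \sum_k v 0 k * ldiag L k; pose B := \sum_k v 0 k ^+ 2.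
pose D := 16 * V ^+ 2 * (r + 2 * V) *+ n.
have B0 : 0 <= B by apply: sumr_ge0 => k _; exact: sqr_ge0.
have step j : (j < m)%N -> lognorm (q j.+1) <=
    lognorm (q j) - 4 * A / m%:R + 8 * B / m%:R + D / m%:R ^+ 2.
  move=> jm; pose s := - (j.+1%:R / m%:R) : R.
  have sm : `|s| <= 1.
    rewrite normrN ger0_norm ?divr_ge0 // ?ler0n //.
    by rewrite ler_pdivrMr // mul1r ler_nat.
  pose b := L *m expd (s *: v).
  have pb : ltp b by apply: ltp_mul => //; exact: ltp_expd.
  pose w := m%:R^-1 *: v : 'rV[R]_n.
  have bE : b *m b^t* = q j.+1 by rewrite /b flow_trC.
  have bE2 : b *m expd (2 *: w) *m b^t* = q j.
    rewrite /b trCM expd_trC !mulmxA -(mulmxA L) expdD -(mulmxA L) expdD.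
    rewrite /q (_ : s *: v + 2 *: w + s *: v = - (j%:R / m%:R) *: (2 *: v)) //.
    apply/rowP => k; rewrite !mxE /s.
    by rewrite -natr1; field; rewrite pnatr_eq0 -lt0n.
  have nb : near (r + 2 * V) (b *m b^t*) 1%:M.
    rewrite [r + _]addrC; apply: near_trans hr; rewrite bE /q.
    apply: expd_near_congr => k; rewrite !mxE normrM normrM normr_nat.
    rewrite -[2 * V]mul1r; apply: ler_pM.
    - exact: normr_ge0.
    - by apply: mulr_ge0.
    - exact: sm.
    - by apply: ler_wpM2l.
  have dw : decreasing w.
    by move=> i k ik; rewrite !mxE; apply: ler_wpM2l; [rewrite invr_ge0 ler0n|exact: dv].
  have wV k : `|w 0 k| <= V / m%:R.
    by rewrite mxE normrM ger0_norm ?invr_ge0 ?ler0n // mulrC ler_wpM2r ?invr_ge0 ?ler0n.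
  have := lognorm_step pb dw wV Vm nb.
  rewrite bE bE2 => /le_trans; apply.
  have -> : \sum_k w 0 k * ldiag b k = A / m%:R + 2 * s * (B / m%:R).
    rewrite /A /B !mulr_suml mulr_sumr -big_split /=; apply: eq_bigr => k _.
    by rewrite ldiag_expd // !mxE; ring.
  have -> : 16 * (V / m%:R) ^+ 2 * (r + 2 * V) *+ n = D / m%:R ^+ 2.
    rewrite /D -(mulr_natr (16 * (V / m%:R) ^+ 2 * (r + 2 * V))).
    rewrite -(mulr_natr (16 * V ^+ 2 * (r + 2 * V))).
    by field; rewrite pnatr_eq0 -lt0n.
  rewrite lerD2r -!addrA lerD2l.
  have : - s * (B / m%:R) <= 1 * (B / m%:R).
    apply: ler_wpM2r; first by rewrite divr_ge0 // ler0n.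
    by apply: le_trans sm; rewrite -normrN ler_norm.
  by rewrite mul1r !mulrDr -!mulrA; lra.
have [Z ZE] : exists Z, Z = - 4 * A / m%:R + 8 * B / m%:R + D / m%:R ^+ 2 by eexists.
have step' j : (j < m)%N -> lognorm (q j.+1) <= lognorm (q j) + Z.
  move=> jm; apply: (le_trans (step j jm)); rewrite ZE le_eqVlt; apply/orP; left.
  by apply/eqP; ring.
have all j : (j <= m)%N -> lognorm (q j) <= lognorm (q 0) + j%:R * Z.
  elim: j => [|j IH] jm; first by rewrite mul0r addr0.
  apply: (le_trans (step' j jm)); rewrite -[j.+1%:R]natr1 mulrDl mul1r addrA lerD2r.
  exact: IH (ltnW jm).
have := all m (leqnn m).
have -> : q m = L *m expd (- (2 *: v)) *m L^t*.
  by rewrite /q divff ?scaleN1r // pnatr_eq0 -lt0n.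
have -> : q 0 = L *m L^t*.
  by rewrite /q mul0r oppr0 scale0r expd0 mulmx1.
move=> /le_trans; apply; rewrite -!addrA lerD2l le_eqVlt; apply/orP; left.
by apply/eqP; rewrite -/A -/B -/D ZE; field; rewrite pnatr_eq0 -lt0n.
Qed.

Lemma lognorm_flow_lim n (L : 'M[C]_n) (v : 'rV[R]_n) :
  ltp L -> decreasing v ->
  lognorm (L *m expd (- (2 *: v)) *m L^t*) <= lognorm (L *m L^t*)
    - 4 * (\sum_k v 0 k * ldiag L k) + 8 * (\sum_k v 0 k ^+ 2).
Proof.
move=> pL dv.
pose V := \sum_k `|v 0 k|.
have V0 : 0 <= V by apply: sumr_ge0.
have hV k : `|v 0 k| <= V by rewrite /V (bigD1 k) //= lerDl; exact: sumr_ge0.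
have [r r0 hr] := pd_near1 (pd_mulC (ltp_unit pL)).
set X := leLHS; set Y := leRHS; pose D := 16 * V ^+ 2 * (r + 2 * V) *+ n.
have D0 : 0 <= D.
  apply: mulrn_wge0; apply: mulr_ge0; last by apply: addr_ge0 => //; exact: mulr_ge0.
  by apply: mulr_ge0 => //; exact: sqr_ge0.
apply/ler_addgt0Pr => e e0.
(* Large enough for steps of size at most 1/4 and for a total error of at most [e]. *)
pose m := (Num.bound (4 * V) + Num.bound (D / e)).+1.
have m0 : 0 < m%:R :> R by rewrite ltr0n.
have m1 : 4 * V <= m%:R.
  have := archi_boundP (mulr_ge0 (ler0n R 4) V0) => /ltW /le_trans; apply.
  by rewrite ler_nat /m; apply: leqW; exact: leq_addr.
have m2 : D / e <= m%:R.
  have := archi_boundP (divr_ge0 D0 (ltW e0)) => /ltW /le_trans; apply.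
  by rewrite ler_nat /m; apply: leqW; exact: leq_addl.
have Vm : V / m%:R <= 4^-1 by rewrite ler_pdivrMr //; lra.
have := @lognorm_flow n L v V r m isT pL dv hV Vm hr r0.
move=> /le_trans; apply; rewrite lerD2l -/D ler_pdivrMr //.
by move: m2; rewrite ler_pdivrMr // mulrC.
Qed.

Lemma phi_lognorm n (k : 'M[C]_n) (v : 'rV[R]_n) y : k \is unitarymx ->
  pd y -> decreasing v ->
  lognorm (phi k v y) <= lognorm y
    - 4 * (\sum_i v 0 i * ldiag (chol (k *m y *m k^t*)) i) + 8 * (\sum_i v 0 i ^+ 2).
Proof.
move=> uk py dv; have pk := pd_uconj uk py.
have [lL eL] := cholP pk.
rewrite -{2}(uconjK uk y) (lognorm_uconj uk pk) /phi (lognorm_uconj uk).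
  by rewrite -{3}eL; exact: lognorm_flow_lim.
by apply: pd_congr; [exact: ltp_unit|exact: expd_pd].
Qed.

End Phi.

(** * Busemann functions and approximate triangles *)

Section FixedPoint.
Variables (R : realType) (C : numClosedFieldType) (rc : real_part R C).
Local Notation cR := (cR rc).
Local Notation rp := (rp rc).
Local Notation nsq := (nsq rc).
Local Notation expd := (expd rc).
Local Notation hexp := (hexp rc).
Local Notation pw := (pw rc).
Local Notation lognorm := (lognorm rc).
Local Notation near := (near rc).
Local Notation ldiag := (ldiag rc).
Local Notation phi := (phi rc).
Variables (n : nat) (s : 'I_n -> bool).

Definition antidiag : 'M[C]_n :=
  \matrix_(i, j) ((-1) ^+ s i *+ (j == rev_ord i)).
Local Notation J := antidiag.

Definition isom (g : 'M[C]_n) := g *m J *m g^T = J.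

Lemma antidiag_trC : J^t* = J^T.
Proof.
apply/matrixP => i j; rewrite !mxE rmorphMn rmorphXn /= rmorphN1.
by [].
Qed.

Lemma antidiag_mulT : J *m J^T = 1%:M.
Proof.
apply/matrixP => i j; rewrite !mxE (bigD1 (rev_ord i)) //= big1 ?addr0.
  rewrite !mxE eqxx mulr1n (inj_eq rev_ord_inj) eq_sym.
  have [->|] := eqVneq i j; last by rewrite mulr0n mulr0.
  by rewrite mulr1n -expr2 sqrr_sign.
by move=> k ki; rewrite mxE (negbTE ki) mulr0n mul0r.
Qed.

Lemma antidiag_Tmul : J^T *m J = 1%:M.
Proof. exact: mulmx1C antidiag_mulT. Qed.

Lemma isom1 : isom 1%:M.
Proof. by rewrite /isom trmx1 mulmx1 mul1mx. Qed.

Lemma isomM g h : isom g -> isom h -> isom (g *m h).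
Proof.
rewrite /isom => hg hh.
by rewrite trmx_mul -!mulmxA (mulmxA J) (mulmxA h) (mulmxA h) hh mulmxA.
Qed.

Lemma isom_theta g : isom g -> g *m (J *m g^T *m J^T) = 1%:M.
Proof. by rewrite /isom => h; rewrite !mulmxA h antidiag_mulT. Qed.

Lemma isom_unit g : isom g -> g \in unitmx.
Proof. by move=> /isom_theta h; have [u _] := mulmx1_unit h; exact: u. Qed.

Lemma isom_inv g : isom g -> invmx g = J *m g^T *m J^T.
Proof. by move=> /isom_theta/invmx_eq. Qed.

Lemma theta_isom g : g *m (J *m g^T *m J^T) = 1%:M -> isom g.
Proof.
rewrite /isom => h.
by rewrite -[RHS]mul1mx -h -!mulmxA antidiag_Tmul mulmx1 !mulmxA.
Qed.

Lemma isom_tr g : isom g -> isom g^T.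
Proof.
move=> /isom_theta/mulmx1C/(congr1 trmx).
rewrite trmx1 !trmx_mul !trmxK /isom trmxK !mulmxA => h.
by rewrite -[RHS]mul1mx -h -!mulmxA antidiag_Tmul mulmx1.
Qed.

Lemma antidiag_TtrC : (J^T)^t* = J.
Proof. by rewrite -antidiag_trC trmxCK. Qed.

Lemma trC_tr (A : 'M[C]_n) : (A^T)^t* = (A^t*)^T.
Proof. by apply/matrixP => i j; rewrite !mxE. Qed.

Lemma isom_trC g : isom g -> isom (g^t*).
Proof.
move=> /isom_tr; rewrite /isom trmxK => h.
have h2 : g^T *m J^T *m g = J^T.
  by have := congr1 trmx h; rewrite !trmx_mul trmxK mulmxA.
have := congr1 (fun M : 'M[C]_n => M^t*) h2.
by rewrite !trCM antidiag_TtrC trC_tr mulmxA.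
Qed.

Lemma isom_invmx g : isom g -> isom (invmx g).
Proof.
move=> h; have u := isom_unit h; rewrite /isom -{1}h !mulmxA mulVmx // mul1mx.
by rewrite -mulmxA -trmx_mul mulVmx // trmx1 mulmx1.
Qed.

Lemma isom_congr g y : isom g -> isom y -> isom (g *m y *m g^t*).
Proof. by move=> hg hy; apply: isomM; [exact: isomM|exact: isom_trC]. Qed.

Lemma antidiag_conjE (L : 'M[C]_n) i j :
  (J *m L^T *m J^T) i j = (-1) ^+ s i * L (rev_ord j) (rev_ord i) * (-1) ^+ s j.
Proof.
rewrite mxE (bigD1 (rev_ord j)) //= big1 ?addr0; last first.
  move=> k kj; have -> : J^T k j = 0 by rewrite !mxE (negbTE kj).
  by rewrite mulr0.
have -> : J^T (rev_ord j) j = (-1) ^+ s j by rewrite !mxE eqxx.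
congr (_ * _).
rewrite mxE (bigD1 (rev_ord i)) //= big1 ?addr0; last first.
  by move=> k ki; rewrite mxE (negbTE ki) mulr0n mul0r.
by rewrite !mxE eqxx mulr1n.
Qed.

(** Up to signs, this is the reflection in the antidiagonal, which preserves lower triangularity;
    the signs square away on the diagonal. *)
Lemma antidiag_ltp (L : 'M[C]_n) : ltp L -> ltp (J *m L^T *m J^T).
Proof.
case=> /is_trig_mxP tL dL.
split.
  apply/is_trig_mxP => i j ij; rewrite antidiag_conjE tL ?mulr0 ?mul0r //=.
  by have := ltn_ord j; lia.
by move=> i; rewrite antidiag_conjE mulrAC -expr2 sqrr_sign mul1r.
Qed.

Lemma fixed_theta g : g \in unitmx -> J *m (invmx g)^T *m J^T = g -> isom g.
Proof.
move=> u h; apply: theta_isom; rewrite -{1}h !mulmxA.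
rewrite -(mulmxA _ J^T J) antidiag_Tmul mulmx1 -(mulmxA J) -trmx_mul mulmxV //.
by rewrite trmx1 mulmx1 antidiag_mulT.
Qed.

(** The involution $g \mapsto J g^{-T} J^T$ has the group as its fixed points, preserves [ltp] and
    fixes [y]; by uniqueness it fixes the Cholesky factor. *)
Lemma chol_isom y : pd y -> isom y -> isom (chol y).
Proof.
move=> py hy; have [lL eL] := cholP py.
have [L LE] : exists L, L = chol y by exists (chol y).
rewrite -!LE in lL eL *; have uL := ltp_unit lL.
apply: (fixed_theta uL); apply: ltp_uniq (lL) _; first exact/antidiag_ltp/ltp_inv.
rewrite eL !trCM antidiag_trC antidiag_TtrC trC_tr.
rewrite !mulmxA -(mulmxA _ J^T J) antidiag_Tmul mulmx1.
rewrite -(mulmxA J) -trmx_mul trC_inv.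
have -> : invmx (L^t*) *m invmx L = invmx y.
  symmetry; apply: invmx_eq; rewrite -eL !mulmxA -(mulmxA L) mulmxV ?unitmx_trC //.
  by rewrite mulmx1 mulmxV.
by rewrite -(isom_inv (isom_invmx hy)) invmxK.
Qed.

Lemma expd_tr (d : 'rV[R]_n) : (expd d)^T = expd d.
Proof. by rewrite /expd tr_diag_mx. Qed.

(** The involution turns a spectral decomposition [(U, d)] of [y] into a second one, [(V, - d)], and
    both give the same power. *)
Lemma pw_isom t y : pd y -> isom y -> isom (pw t y).
Proof.
move=> py hy; have [U [d [uU yE]]] := pd_hexp rc py.
pose V := (U^t*)^T *m J^T.
have hV e : hexp V (- e) = J *m (invmx (hexp U e))^T *m J^T.
  rewrite (invmx_hexp _ _ uU) /hexp /V trCM antidiag_TtrC trC_tr trmxCK.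
  by rewrite !trmx_mul expd_tr !mulmxA.
have uV : V \is unitarymx.
  apply/unitarymxP; rewrite /V trCM antidiag_TtrC trC_tr trmxCK.
  rewrite !mulmxA -(mulmxA _ J^T) antidiag_Tmul mulmx1 -trmx_mul.
  by rewrite (unitary_mulC uU) trmx1.
have yV : hexp U d = hexp V (- d).
  rewrite hV -yE -(isom_inv (isom_invmx hy)) invmxK.
  by [].
have := hexp_scale_uniq t uU uV yV.
rewrite yE (pwE _ _ _ uU) scalerN hV => h.
by apply: fixed_theta; [exact/pd_unit/hexp_pd|rewrite -h].
Qed.

Lemma phi_isom k (v : 'rV[R]_n) y : k \is unitarymx -> isom k -> isom (expd v) ->
  pd y -> isom y -> isom (phi k v y).
Proof.
move=> uk hk hv py hy; rewrite /phi.
have hL : isom (chol (k *m y *m k^t*)).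
  by apply: chol_isom; [exact: pd_uconj|exact: isom_congr].
rewrite -[X in _ *m X](trmxCK k); apply: isom_congr; first exact: isom_trC.
apply: isom_congr => //.
have -> : expd (- (2 *: v)) = invmx (expd v) *m invmx (expd v).
  by rewrite invmx_expd expdD -opprD scaler_nat mulr2n.
by apply: isomM; exact: isom_invmx.
Qed.

(* Follow the flow from y = g g^* and remember the cosets. *)
Lemma phi_factor k (v : 'rV[R]_n) g : k \is unitarymx -> isom k -> isom g ->
  exists a, [/\ a \is unitarymx, isom a &
    phi k v (g *m g^t*) = (g *m a *m expd (- v)) *m (g *m a *m expd (- v))^t*].
Proof.
move=> uk hk hg; have ug := isom_unit hg.
have py := pd_mulC ug.
have hL : isom (chol (k *m (g *m g^t*) *m k^t*)).
  apply: chol_isom; first exact: pd_uconj.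
  by apply: isom_congr => //; apply: isomM => //; exact: isom_trC.
have [_ eL] := cholP (pd_uconj uk py).
rewrite /phi; move: (chol _) hL eL => L hL eL.
exists (invmx g *m (k^t* *m L)); split.
- apply/unitarymxP; rewrite !trCM trmxCK.
  have -> : invmx g *m (k^t* *m L) *m (L^t* *m k *m (invmx g)^t*) =
      invmx g *m (k^t* *m (L *m L^t*) *m k) *m (invmx g)^t* by rewrite !mulmxA.
  rewrite eL uconjK // mulKmx // -trCM mulVmx // trC1.
  by [].
- by apply: isomM; [exact: isom_invmx|apply: isomM => //; exact: isom_trC].
have -> : g *m (invmx g *m (k^t* *m L)) = k^t* *m L by rewrite mulKVmx.
rewrite !trCM trmxCK expd_trC !mulmxA -(mulmxA _ (expd (- v)) (expd (- v))) expdD.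
by rewrite -opprD scaler_nat mulr2n.
Qed.

Lemma geometric_small (t r e : R) : 0 <= t < 1 -> 0 < e -> 0 <= r ->
  exists j, t ^+ j * r < e.
Proof.
move=> /andP[t0 t1] e0 r0.
have h : `|t| < 1 by rewrite ger0_norm.
have e1 : 0 < e / (r + 1) by rewrite divr_gt0 // ltr_wpDl.
have /cvgrPdist_lt/(_ _ e1)[N _ hN] := cvg_expr h.
exists N; have := hN N (leqnn N); rewrite /= sub0r normrN ger0_norm ?exprn_ge0 //.
rewrite ltr_pdivlMr ?ltr_wpDl // => /le_lt_trans; apply.
by apply: ler_wpM2l; [exact: exprn_ge0|rewrite lerDl].
Qed.

Section Iteration.
Variables (k1 k2 k3 : 'M[C]_n) (v1 v2 v3 : 'rV[R]_n).
Hypotheses (u1 : k1 \is unitarymx) (u2 : k2 \is unitarymx) (u3 : k3 \is unitarymx).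
Hypotheses (i1 : isom k1) (i2 : isom k2) (i3 : isom k3).
Hypotheses (d1 : decreasing v1) (d2 : decreasing v2) (d3 : decreasing v3).
Hypotheses (e1 : isom (expd v1)) (e2 : isom (expd v2)) (e3 : isom (expd v3)).

Definition Phi y := phi k3 v3 (phi k2 v2 (phi k1 v1 y)).

(** Up to normalization, the Busemann function of the boundary point with flag [k] and direction
    [v]. *)
Definition busemann (k : 'M[C]_n) (v : 'rV[R]_n) y :=
  \sum_i v 0 i * ldiag (chol (k *m y *m k^t*)) i.

Definition busemann3 y := busemann k1 v1 y + busemann k2 v2 y + busemann k3 v3 y.

Lemma Phi_pd y : pd y -> pd (Phi y).
Proof. by move=> py; do 3 apply: phi_pd => //. Qed.

Lemma Phi_isom y : pd y -> isom y -> isom (Phi y).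
Proof.
move=> py hy; have p1 := phi_pd rc u1 v1 py; have p2 := phi_pd rc u2 v2 p1.
apply: phi_isom => //; apply: phi_isom => //; exact: phi_isom.
Qed.

Lemma Phi_near r y z : pd y -> pd z -> near r y z -> near r (Phi y) (Phi z).
Proof.
move=> py pz h; have p1 := phi_pd rc u1 v1 py; have q1 := phi_pd rc u1 v1 pz.
have p2 := phi_pd rc u2 v2 p1; have q2 := phi_pd rc u2 v2 q1.
apply: phi_near => //; apply: phi_near => //; exact: phi_near.
Qed.

Lemma busemann_near k (v : 'rV[R]_n) V r y z : k \is unitarymx ->
  (forall i, `|v 0 i| <= V) -> pd y -> pd z -> near r y z -> 0 <= r ->
  busemann k v y <= busemann k v z + V * r *+ n.
Proof.
move=> uk hV py pz h r0.
rewrite -lerBlDl -sumrB -[X in _ *+ X]card_ord -sumr_const; apply: ler_sum => i _.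
rewrite -mulrBr; apply: (le_trans (ler_norm _)); rewrite normrM.
apply: ler_pM => //.
exact: near_ldiag (pd_uconj uk py) (pd_uconj uk pz) (near_uconj k h).
Qed.

(** The second and third flows evaluate their Busemann functions at points displaced by at most
    [2 * V] and [4 * V]; the Lipschitz bound brings them back to [y]. *)
Lemma Phi_lognorm V y : (forall i, `|v1 0 i| <= V) -> (forall i, `|v2 0 i| <= V) ->
  (forall i, `|v3 0 i| <= V) -> 0 <= V -> pd y ->
  lognorm (Phi y) <= lognorm y - 4 * busemann3 y +
   (8 * (\sum_i v1 0 i ^+ 2) + 8 * (\sum_i v2 0 i ^+ 2) + 8 * (\sum_i v3 0 i ^+ 2)
    + 4 * (V * (2 * V) *+ n) + 4 * (V * (2 * V + 2 * V) *+ n)).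
Proof.
move=> h1 h2 h3 V0 py.
have p1 := phi_pd rc u1 v1 py; have p2 := phi_pd rc u2 v2 p1.
have m1 := phi_move rc u1 py h1; have m2 := phi_move rc u2 p1 h2.
have V2 : 0 <= 2 * V by apply: mulr_ge0.
have b2 := busemann_near u2 h2 py p1 (near_sym m1) V2.
have b3 := busemann_near u3 h3 py p2 (near_sym (near_trans m2 m1)) (addr_ge0 V2 V2).
have l1 := phi_lognorm rc u1 py d1; have l2 := phi_lognorm rc u2 p1 d2.
have l3 := phi_lognorm rc u3 p2 d3.
move: l1 l2 l3; rewrite -!/(busemann _ _ _) /Phi /busemann3.
move: (lognorm _) (lognorm _) (lognorm _) (lognorm _) => a b c d.
move: b2 b3; move: (V * _ *+ n) (V * _ *+ n) => s1 s2.
move: (busemann _ _ _) (busemann _ _ _) (busemann _ _ _) (busemann _ _ _) (busemann _ _ _).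
move: (\sum_i _) (\sum_i _) (\sum_i _) => x1 x2 x3 c1 c2 c3 c4 c5.
lra.
Qed.

Lemma pw1 t : pw t 1%:M = (1%:M : 'M[C]_n).
Proof.
have u : (1%:M : 'M[C]_n) \is unitarymx by apply/unitarymxP; rewrite trC1 mulmx1.
by rewrite -(hexp0 rc u) (pwE _ _ _ u) scaler0.
Qed.

Lemma pw_pd t (y : 'M[C]_n) : pd y -> pd (pw t y).
Proof.
by move=> /(pd_hexp rc)[U [d [uU ->]]]; rewrite (pwE _ _ _ uU); exact: hexp_pd.
Qed.

Lemma lognorm_pw t (y : 'M[C]_n) : pd y -> lognorm (pw t y) = t ^+ 2 * lognorm y.
Proof.
move=> /(pd_hexp rc)[U [d [uU ->]]]; rewrite (pwE _ _ _ uU) !lognormE // mulr_sumr.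
by apply: eq_bigr => j _; rewrite mxE exprMn.
Qed.

Lemma lognorm_ge0 (y : 'M[C]_n) : pd y -> 0 <= lognorm y.
Proof.
move=> /(pd_hexp rc)[U [d [uU ->]]]; rewrite lognormE //.
by apply: sumr_ge0 => j _; exact: sqr_ge0.
Qed.

(** Continuity of the energy in the Thompson metric, again by Jensen, with the constant $e^{dl}-1$
    for [c]. *)
Lemma lognorm_near B dl (y z : 'M[C]_n) : pd y -> pd z -> near B y 1%:M -> near dl y z ->
  0 <= dl -> lognorm y <= lognorm z + 2 * B * (expR dl - 1) *+ n.
Proof.
move=> py pz hB [h1 h2] dl0.
have [U [L [uU yE]]] := pd_hexp rc py; have [V [H [uV zE]]] := pd_hexp rc pz.
have LB : forall j, `|L 0 j| <= B.
  by move: hB; rewrite yE; exact: near1_eig.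
have x0 : 0 <= expR dl - 1 by rewrite subr_ge0 -expR0 ler_expR.
have sc : pd (cR (expR dl) *: z).
  split; first by rewrite trCZ conj_real_complex (proj1 pz).
  by move=> x x0'; rewrite qfZ mulr_gt0 ?cR_gt0 ?expR_gt0 //; exact: (proj2 pz).
have hi := lepd_inv py sc h1.
have zi : invmx (cR (expR dl) *: z) = cR (expR (- dl)) *: invmx z.
  apply: invmx_eq; rewrite -scalemxAl -scalemxAr scalerA -real_complexM -expRD subrr.
  by rewrite expR0 rmorph1 scale1r mulmxV //; exact: pd_unit.
rewrite yE zE !lognormE //.
apply: (le_trans (@lognorm_jensen _ _ rc n U V L H (fun=> expR dl - 1) uU uV _ _)).
- move=> j L0; rewrite addrC subrK.
  have := hi (row j U); rewrite zi qfZ zE yE !invmx_hexp // qf_row_hexp // => h.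
  have := ler_wpM2l (expR_ge0 dl) (lexx (1:R)) => _.
  have e0 : 0 <= cR (expR dl) by rewrite cR_ge0 expR_ge0.
  have := ler_wpM2l e0 h; rewrite mulrA -!real_complexM -expRD subrr expR0 rmorph1 mul1r.
  by rewrite mxE mulrC.
- move=> j L0; rewrite addrC subrK.
  have := h2 (row j U); rewrite qfZ zE yE qf_row_hexp // -real_complexM => h.
  by rewrite mulrC.
have -> : 2 * B * (expR dl - 1) *+ n = \sum_(j < n) 2 * B * (expR dl - 1).
  by rewrite sumr_const card_ord.
rewrite lerD2l; apply: ler_sum => j _.
by apply: ler_wpM2r => //; apply: ler_wpM2l.
Qed.

Lemma hexp_near (U : 'M[C]_n) (d d' : 'rV[R]_n) r : U \is unitarymx ->
  (forall j, `|d 0 j - d' 0 j| <= r) -> near r (hexp U d) (hexp U d').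
Proof.
move=> uU h.
have main (a b : 'rV[R]_n) : (forall j, a 0 j - b 0 j <= r) ->
    lepd (hexp U a) (cR (expR r) *: hexp U b).
  move=> ab x; rewrite qfZ !qf_hexp -real_complexM lecR mulr_sumr.
  apply: ler_sum => j _; rewrite mulrA -expRD.
  by apply: ler_wpM2r; [exact: nsq_ge0|rewrite ler_expR -lerBlDr].
split; apply: main => j; have := h j; rewrite ler_norml => /andP[]; lra.
Qed.

Lemma pw_near_self t B (y : 'M[C]_n) : pd y -> near B y 1%:M -> t <= 1 ->
  near ((1 - t) * B) (pw t y) y.
Proof.
move=> /(pd_hexp rc)[U [d [uU ->]]] h t1; rewrite (pwE _ _ _ uU).
apply: (hexp_near uU) => j; rewrite mxE.
have := near1_eig uU h j.
have -> : t * d 0 j - d 0 j = - ((1 - t) * d 0 j) by ring.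
rewrite normrN normrM (@ger0_norm _ (1 - t)) ?subr_ge0 // => hj.
by apply: ler_wpM2l => //; rewrite subr_ge0.
Qed.

(* Picard iteration for the strict contraction y |-> (Phi y)^t, t < 1. *)
Theorem approx_fixed_point (proper : forall B, exists rho, forall y,
    pd y -> isom y -> busemann3 y <= B -> near rho y 1%:M) :
  forall eta, 0 < eta -> exists2 y, pd y /\ isom y & near eta (Phi y) y.
Proof.
move=> eta eta0.
pose V := \sum_i `|v1 0 i| + \sum_i `|v2 0 i| + \sum_i `|v3 0 i|.
have S0 (v : 'rV[R]_n) : 0 <= \sum_i `|v 0 i| by apply: sumr_ge0.
have SV (v : 'rV[R]_n) i : `|v 0 i| <= \sum_i `|v 0 i|.
  by rewrite (bigD1 i) //= lerDl; apply: sumr_ge0.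
have V0 : 0 <= V by rewrite /V !addr_ge0.
have hV1 i : `|v1 0 i| <= V.
  by apply: (le_trans (SV v1 i)); rewrite /V -addrA lerDl addr_ge0.
have hV2 i : `|v2 0 i| <= V.
  by apply: (le_trans (SV v2 i)); rewrite /V addrAC lerDr addr_ge0.
have hV3 i : `|v3 0 i| <= V.
  by apply: (le_trans (SV v3 i)); rewrite /V lerDr addr_ge0.
have [K hK] : exists K, forall y, pd y ->
    lognorm (Phi y) <= lognorm y - 4 * busemann3 y + K.
  by eexists => y py; exact: Phi_lognorm hV1 hV2 hV3 V0 py.
have [rho0 hrho0] := proper ((K + 1) / 4).
pose rho := Num.max rho0 0.
have rho_ge0 : 0 <= rho by rewrite /rho le_max lexx orbT.
have p1 := @pd1 C n.
have hrho y : pd y -> isom y -> busemann3 y <= (K + 1) / 4 -> near rho y 1%:M.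
  move=> py hy hb; apply: near_w (hrho0 y py hy hb) => //.
  by rewrite /rho le_max lexx.
have [r0 r00 hr0] := pd_near1 rc (Phi_pd p1).
(* A start within [rho] of the identity, followed by three moves of length at most [2 * V]. *)
pose W := rho + 6 * V.
have W0 : 0 <= W by rewrite addr_ge0 // mulr_ge0.
have h2 : ((0 : R) <= 2^-1) && ((2^-1 : R) < 1) by rewrite invr_ge0 ler0n invf_lt1 ?ltr1n ?ltr0n.
have [m hm] := geometric_small h2 (divr_gt0 eta0 (ltr0n R 2)) W0.
pose t : R := 1 - 2^-1 ^+ m.
have p2 : 0 < 2^-1 ^+ m :> R by rewrite exprn_gt0 // invr_gt0.
have p2' : 2^-1 ^+ m <= 1 :> R by rewrite exprn_ile1 //; lra.
have t0 : 0 <= t by rewrite subr_ge0.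
have t1 : t < 1 by rewrite /t; lra.
pose psi y := pw t (Phi y).
have psi_pd y : pd y -> pd (psi y) by move=> py; exact/pw_pd/Phi_pd.
have psi_iso y : pd y -> isom y -> isom (psi y).
  by move=> py hy; apply: pw_isom; [exact: Phi_pd|exact: Phi_isom].
have psi_near r y z : pd y -> pd z -> near r y z -> near (t * r) (psi y) (psi z).
  by move=> py pz h; apply: pw_near; [exact: Phi_pd|exact: Phi_pd|exact: Phi_near].
(* The radius [r0 / (1 - t)] of a ball around the identity that [psi] maps into itself. *)
pose B := r0 / 2^-1 ^+ m.
have B0 : 0 <= B by rewrite divr_ge0 // ltW.
have tB : t * (B + r0) <= B.
  have eB : B * 2^-1 ^+ m = r0 by rewrite /B divfK // gt_eqF.
  have aux (x b : R) : 0 < x -> 0 <= b -> (1 - x) * (b + b * x) <= b.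
    by move=> x0 b0; have := mulr_ge0 b0 (sqr_ge0 x); nra.
  by rewrite -[X in B + X]eB; apply: aux.
pose y_ j := iter j psi 1%:M.
have y_pd j : pd (y_ j) by elim: j => [|j IH]; [exact: pd1|exact: psi_pd].
have y_iso j : isom (y_ j).
  by elim: j => [|j IH]; [exact: isom1|exact: psi_iso].
have y_B j : near B (y_ j) 1%:M.
  elim: j => [|j IH]; first by apply: near_w (near_refl rc _) => //; exact: pd1.
  have h := near_trans (Phi_near (y_pd j) p1 IH) hr0.
  have := pw_near m (Phi_pd (y_pd j)) p1 h; rewrite pw1 -/t => h3.
  by apply: near_w tB h3 => //; exact: y_pd j.+1.
have y_step j : near (t ^+ j * B) (y_ j) (y_ j.+1).
  elim: j => [|j IH]; first by rewrite expr0 mul1r; apply: near_sym; exact: (y_B 1%N).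
  by rewrite exprS -mulrA; exact: (psi_near _ _ _ (y_pd j) (y_pd j.+1) IH).
(* Small enough to use half of [eta] and to change the energy by at most 1. *)
pose dl := Num.min (eta / 2) (ln (1 + (2 * B *+ n + 1)^-1)).
have nB : 0 < 2 * B *+ n + 1 by rewrite ltr_wpDl // mulrn_wge0 // mulr_ge0.
have lnp : 0 < ln (1 + (2 * B *+ n + 1)^-1) :> R.
  by apply: ln_gt0; rewrite ltrDl invr_gt0.
have dl0 : 0 < dl by rewrite /dl lt_min lnp divr_gt0.
have t01 : 0 <= t < 1 by rewrite t0.
have [j hj] := geometric_small t01 dl0 B0.
have ps := y_pd j.+1.
have hs : near dl (y_ j) (y_ j.+1).
  by apply: near_w (ltW hj) (y_step j).
have hdl : expR dl - 1 <= (2 * B *+ n + 1)^-1.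
  rewrite lerBlDl -[leRHS]lnK ?posrE ?ler_expR; last by rewrite ltr_pwDl // invr_ge0 ltW.
  by rewrite /dl ge_min lexx orbT.
have l1 := lognorm_near (y_pd j) ps (y_B j) hs (ltW dl0).
have l2 : lognorm (y_ j.+1) <= lognorm (Phi (y_ j)).
  rewrite [y_ j.+1]/(psi (y_ j)) lognorm_pw; last exact: Phi_pd.
  rewrite -[leRHS]mul1r; apply: ler_wpM2r; first exact/lognorm_ge0/Phi_pd.
  by rewrite exprn_ile1 // ltW.
have l3 := hK _ (y_pd j).
have l4 : 2 * B * (expR dl - 1) *+ n <= 1.
  rewrite -mulrnAl; apply: (@le_trans _ _ (2 * B *+ n * (2 * B *+ n + 1)^-1)).
    by apply: ler_wpM2l => //; rewrite mulrn_wge0 // mulr_ge0.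
  by rewrite ler_pdivrMr // mul1r lerDl.
(* $E(y_j) \le E(y_{j+1}) + 1 \le E(\Phi y_j) + 1 \le E(y_j) - 4b(y_j) + K + 1$, where the middle
   step uses $t^2 \le 1$. *)
have hb : busemann3 (y_ j) <= (K + 1) / 4.
  have l5 := le_trans l1 (lerD (le_trans l2 l3) l4).
  move: l5; move: (lognorm _) (busemann3 _) => a b l5; lra.
have hW := hrho _ (y_pd j) (y_iso j) hb.
have q1 := phi_pd rc u1 v1 (y_pd j); have q2 := phi_pd rc u2 v2 q1.
have m1 := phi_move rc u1 (y_pd j) hV1; have m2 := phi_move rc u2 q1 hV2.
have m3 := phi_move rc u3 q2 hV3.
have hW2 : near W (Phi (y_ j)) 1%:M.
  have := near_trans (near_trans m3 (near_trans m2 m1)) hW.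
  have -> // : 2 * V + (2 * V + 2 * V) + rho = W by rewrite /W; ring.
exists (y_ j); first by split.
(* $\Phi y_j$ is within $(1-t)W < \eta/2$ of its power $y_{j+1}$, which is within [dl] of $y_j$. *)
have := near_trans (near_sym (pw_near_self (Phi_pd (y_pd j)) hW2 (ltW t1))) (near_sym hs).
apply: near_w => //; first exact: Phi_pd.
have -> : 1 - t = 2^-1 ^+ m by rewrite /t; ring.
have : dl <= eta / 2 by rewrite /dl ge_min lexx.
by move: hm; lra.
Qed.

(** Along the orbit of an approximate fixed point $gg^*$ the frame $g$ is multiplied in turn by $a_i
    e^{-v_i}$. Since $ga_1$ is also a frame of $gg^*$, dividing by it leaves the product [M]. *)
Theorem approx_triangle (proper : forall B, exists rho, forall y,
    pd y -> isom y -> busemann3 y <= B -> near rho y 1%:M) eta : 0 < eta ->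
  exists a b, [/\ a \is unitarymx, isom a, b \is unitarymx, isom b &
    let M := expd (- v1) *m a *m expd (- v2) *m b *m expd (- v3) in
    near eta (M *m M^t*) 1%:M].
Proof.
move=> eta0; have [y [py hy] h] := approx_fixed_point proper eta0.
have [lg eg] := cholP py; have hg := chol_isom py hy.
move: (chol y) lg eg hg => g lg eg hg.
have ug := isom_unit hg.
have iN v : isom (expd v) -> isom (expd (- v)).
  by move=> hv; rewrite -invmx_expd; exact: isom_invmx.
have [a1 [ua1 ia1 E1]] := phi_factor v1 u1 i1 hg.
have hg1 : isom (g *m a1 *m expd (- v1)) by apply: isomM; [exact: isomM|exact: iN].
have [a2 [ua2 ia2 E2]] := phi_factor v2 u2 i2 hg1.
have hg2 : isom (g *m a1 *m expd (- v1) *m a2 *m expd (- v2)).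
  by apply: isomM; [exact: isomM|exact: iN].
have [a3 [ua3 ia3 E3]] := phi_factor v3 u3 i3 hg2.
exists a2, a3; split=> // M.
move: h; rewrite -eg /Phi E1 E2 E3 => /(near_congr (invmx (g *m a1))).
have uga : g *m a1 \in unitmx by rewrite unitmx_mul ug unitarymx_unit.
have -> : g *m a1 *m expd (- v1) *m a2 *m expd (- v2) *m a3 *m expd (- v3) = g *m a1 *m M.
  by rewrite /M !mulmxA.
have -> : g *m g^t* = g *m a1 *m (g *m a1)^t*.
  by rewrite trCM !mulmxA -(mulmxA g) (unitary_mulC ua1) mulmx1.
have c (P X : 'M[C]_n) : P \in unitmx ->
    invmx P *m (P *m X *m (P *m X)^t*) *m (invmx P)^t* = X *m X^t*.
  by move=> uP; rewrite (trCM P) -!mulmxA mulKmx // -trCM mulVmx // trC1 mulmx1.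
rewrite (c _ _ uga).
have := c _ 1%:M uga; by rewrite !mulmx1 trC1 !mulmx1 => ->.
Qed.

End Iteration.

End FixedPoint.

(** * Volumes of flag subspaces: Fischer's inequality and duality *)

Section Volume.
Variables (R : realType) (C : numClosedFieldType) (rc : real_part R C).
Local Notation cR := (cR rc).
Local Notation rp := (rp rc).
Local Notation nsq := (nsq rc).
Local Notation near := (near rc).
Local Notation ldiag := (ldiag rc).
Local Notation hexp := (hexp rc).
Local Notation expd := (expd rc).
Local Notation busemann := (busemann rc).
Variables (n : nat) (s : 'I_n -> bool).
Local Notation J := (antidiag C s).
Local Notation isom := (isom s).

(* log of the squared volume, for the form y, spanned by the first m rows of P *)
Definition lvol (P y : 'M[C]_n) (m : nat) : R :=
  \sum_(i < n | (i < m)%N) ldiag (chol (P *m y *m P^t*)) i.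

Lemma chol_congr_ltp (P y : 'M[C]_n) : P \in unitmx -> pd y ->
  ltp (chol (P *m y *m P^t*)) /\
  chol (P *m y *m P^t*) *m (chol (P *m y *m P^t*))^t* = P *m y *m P^t*.
Proof. by move=> uP py; apply: cholP; exact: pd_congr. Qed.

Lemma nsq_le_qf (x : 'rV[C]_n) (L : 'M[C]_n) i :
  cR (nsq ((x *m L) 0 i)) <= qf (L *m L^t*) x.
Proof.
have -> : L *m L^t* = L *m 1%:M *m L^t* by rewrite mulmx1.
rewrite qf_congr (qf1_nsq rc) lecR (bigD1 i) //= lerDl.
by apply: sumr_ge0 => j _; exact: nsq_ge0.
Qed.

Lemma ldiag_nsq (L : 'M[C]_n) i : ltp L -> nsq (L i i) = expR (ldiag L i).
Proof.
case=> _ /(_ i)/(gt0_real_complex rc)[l0 lE].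
by rewrite /ldiag {1}lE nsq_cR mulr_natl mulr2n expRD lnK // expr2.
Qed.

(** With [ldiag_attained]: the squared diagonal entry is the minimum of the form over the vectors
    whose last nonzero coordinate is the [i]-th and equals 1. *)
Lemma ldiag_min (L : 'M[C]_n) i (x : 'rV[C]_n) : ltp L -> x 0 i = 1 ->
  (forall j : 'I_n, (i < j)%N -> x 0 j = 0) ->
  cR (expR (ldiag L i)) <= qf (L *m L^t*) x.
Proof.
move=> pL xi xj; rewrite -ldiag_nsq //.
have -> : L i i = (x *m L) 0 i.
  rewrite mxE (bigD1 i) //= big1 ?addr0 ?xi ?mul1r // => j.
  rewrite neq_ltn => /orP[ji|ij]; last by rewrite xj ?mul0r.
  by rewrite (is_trig_mxP (proj1 pL)) ?mulr0.
exact: nsq_le_qf.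
Qed.

Lemma ldiag_attained (L : 'M[C]_n) i : ltp L ->
  exists x : 'rV[C]_n, [/\ x 0 i = 1, forall j : 'I_n, (i < j)%N -> x 0 j = 0 &
    qf (L *m L^t*) x = cR (expR (ldiag L i))].
Proof.
move=> pL; have uL := ltp_unit pL.
have [tI dI] := trig_inv (proj1 pL) (fun i => lt0r_neq0 (proj2 pL i)).
exists (L i i *: (delta_mx 0 i *m invmx L)); split.
- by rewrite mxE -rowE mxE dI mulfV // gt_eqF // (proj2 pL).
- by move=> j ij; rewrite mxE -rowE mxE (is_trig_mxP tI) ?mulr0.
have -> : L *m L^t* = L *m 1%:M *m L^t* by rewrite mulmx1.
rewrite qf_congr -scalemxAl mulmxKV // qfZr (nsqE rc) ldiag_nsq //.
rewrite (_ : qf 1%:M _ = 1) ?mulr1 // qf1 (bigD1 i) //= big1 ?addr0.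
  by rewrite mxE !eqxx normr1 expr1n.
by move=> j ji; rewrite mxE (negbTE ji) andbF normr0 expr0n.
Qed.

(* The diagonal entry of the Cholesky factor is the distance of a row to the span
   of the previous ones, so it grows when rows in front are dropped. *)
Lemma ldiag_shift (P M y : 'M[C]_n) (a b : nat) (i j : 'I_n) :
  P \in unitmx -> M \in unitmx -> pd y ->
  (i < b)%N -> j = (a + i)%N :> nat ->
  (forall i' j' : 'I_n, (i' < b)%N -> j' = (a + i')%N :> nat -> row j' P = row i' M) ->
  (a + b <= n)%N ->
  ldiag (chol (P *m y *m P^t*)) j <= ldiag (chol (M *m y *m M^t*)) i.
Proof.
move=> uP uM py ib ja h ab.
have [lP eP] := chol_congr_ltp uP py; have [lM eM] := chol_congr_ltp uM py.
have [x [xi xj qx]] := ldiag_attained i lM.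
rewrite -ler_expR -(lecR rc) -qx eM qf_congr.
(* [x] moved [a] places to the right, so that it selects from [P] the rows that [x] selects from
   [M]. *)
pose z : 'rV[C]_n := \row_k (if insub (k - a)%N is Some k' then
   (if (a <= k)%N then x 0 k' else 0) else 0).
have zE : x *m M = z *m P.
  apply/rowP => c; rewrite !mxE.
  rewrite [RHS](bigID (fun k : 'I_n => (a <= k)%N)) /= [X in _ = _ + X]big1 ?addr0; last first.
    move=> k ak; rewrite mxE (negbTE ak); case: insubP => [k' _ _|_]; by rewrite mul0r.
  rewrite [LHS](bigID (fun k : 'I_n => (k < b)%N)) /= [X in _ + X = _]big1 ?addr0; last first.
    by move=> k; rewrite -leqNgt => bk; rewrite xj ?mul0r // (leq_trans ib).
  rewrite [RHS](bigID (fun k : 'I_n => (k < a + b)%N)) /= [X in _ = _ + X]big1 ?addr0; last first.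
    move=> k /andP[ak]; rewrite -leqNgt => bk; rewrite mxE ak.
    case: insubP => [k' _ k'E|_]; last by rewrite mul0r.
    by rewrite xj ?mul0r // k'E; apply: leq_trans ib _; lia.
  have lt1 (k : 'I_n) : (k < b)%N -> (a + k < n)%N by lia.
  have lt2 (k : 'I_n) : (k - a < n)%N by have := ltn_ord k; lia.
  pose up (k : 'I_n) : 'I_n := insubd k (a + k)%N.
  pose dn (k : 'I_n) : 'I_n := Ordinal (lt2 k).
  have upE (k : 'I_n) : (k < b)%N -> val (up k) = (a + k)%N.
    by move=> kb; rewrite val_insubd lt1.
  rewrite [RHS](reindex_onto up dn); last first.
    move=> k /andP[ak kb]; apply/val_inj; rewrite upE /=; lia.
  apply: eq_big => k.
    have [kb|kb] := ltnP k b.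
      rewrite upE // leq_addr ltn_add2l kb /=.
      by apply/esym/eqP/val_inj; rewrite /= upE //; lia.
    apply/esym/negbTE/negP => /andP[/andP[h1 h2] /eqP/(congr1 val)].
    rewrite /= /dn /= => h3.
    have : val (up k) = (a + k)%N by lia.
    lia.
  move=> kb; rewrite mxE upE // leq_addr.
  have -> : insub (a + k - a)%N = Some k.
    by rewrite addnC addnK valK.
  congr (_ * _); have := h k (up k) kb (upE k kb) => /rowP/(_ c).
  by rewrite !mxE.
rewrite zE; have -> : qf y (z *m P) = qf (chol (P *m y *m P^t*) *m (chol (P *m y *m P^t*))^t*) z.
  by rewrite eP qf_congr.
apply: (ldiag_min lP).
  rewrite mxE ja leq_addr (_ : (a + i - a)%N = i); last by lia.
  by rewrite valK xi.
move=> k jk; rewrite mxE; case: insubP => [k' _ k'E|//].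
by case: leqP => // ak; rewrite xj // k'E; lia.
Qed.

(** Fischer's inequality for one block, term by term from [ldiag_shift]. *)
Lemma lvol_block (P M y : 'M[C]_n) (a b : nat) :
  P \in unitmx -> M \in unitmx -> pd y ->
  (forall i' j' : 'I_n, (i' < b)%N -> j' = (a + i')%N :> nat -> row j' P = row i' M) ->
  (a + b <= n)%N ->
  lvol P y (a + b) <= lvol P y a + lvol M y b.
Proof.
move=> uP uM py h ab.
rewrite /lvol (bigID (fun i : 'I_n => (i < a)%N)) /=.
rewrite [X in X + _ <= _](eq_bigl (fun i : 'I_n => (i < a)%N)); last first.
  by move=> i /=; apply/andP/idP => [[]//|ia]; split=> //; lia.
rewrite lerD2l.
have lt2 (k : 'I_n) : (k - a < n)%N by have := ltn_ord k; lia.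
pose up (k : 'I_n) : 'I_n := insubd k (a + k)%N.
pose dn (k : 'I_n) : 'I_n := Ordinal (lt2 k).
have upE (k : 'I_n) : (k < b)%N -> val (up k) = (a + k)%N.
  by move=> kb; rewrite val_insubd; case: ltnP => //; lia.
rewrite (reindex_onto up dn) /=; last first.
  by move=> k /andP[h1 h2]; apply/val_inj; rewrite upE /=; lia.
rewrite (eq_bigl (fun k : 'I_n => (k < b)%N)) => [|k].
  by apply: ler_sum => k kb; apply: (ldiag_shift uP uM py kb (upE k kb) h ab).
have [kb|kb] := ltnP k b.
  rewrite upE // ltn_add2l kb /= -leqNgt leq_addr /=.
  by apply/eqP/val_inj; rewrite /= upE //; lia.
apply/negbTE/negP => /andP[/andP[h1 h2] /eqP/(congr1 val)] /= h3.
have h4 : val (up k) = (a + k)%N by lia.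
by move: h1; rewrite h4; lia.
Qed.

Lemma lvol0 P y : lvol P y 0 = 0.
Proof. by rewrite /lvol big_pred0. Qed.

(** Invariance of $J$ forces $(\det y)^2 = 1$, and $\det y$ is positive. *)
Lemma isom_det (y : 'M[C]_n) : pd y -> isom y -> \sum_i ldiag (chol y) i = 0.
Proof.
move=> py hy; have [ly ey] := cholP py.
have := det_ltp rc ly; rewrite ey => dE.
have : \det y ^+ 2 = 1.
  have := congr1 determinant hy; rewrite !det_mulmx det_tr mulrAC => h.
  have dJ : \det J != 0.
    by have [u _] := mulmx1_unit (antidiag_mulT C s); rewrite -unitfE -unitmxE.
  by apply: (mulIf dJ); rewrite mul1r -[RHS]h expr2.
rewrite dE -rmorphXn -(rmorph1 cR) => /cR_inj.
rewrite -expRM_natl -[X in _ = X -> _]expR0 => /expR_inj /eqP.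
by rewrite mulf_eq0 pnatr_eq0 /= => /eqP.
Qed.

Lemma lvol_full P : P \in unitmx -> exists c, forall y, pd y -> isom y ->
  lvol P y n = c.
Proof.
move=> uP; exists (\sum_i ldiag (chol (P *m P^t*)) i) => y py hy.
rewrite /lvol (eq_bigl xpredT) => [|i]; last exact: ltn_ord.
have [lP eP] := chol_congr_ltp uP py; have [l1 e1] := cholP (pd_mulC uP).
have [ly ey] := cholP py.
apply: expR_inj; apply: (@cR_inj _ _ rc).
rewrite -(det_ltp rc lP) -(det_ltp rc l1) eP e1 !det_mulmx.
by rewrite -{1}ey (det_ltp rc ly) isom_det // expR0 rmorph1 mulr1.
Qed.

(** Up to order and sign, the basis dual to the rows of [P] with respect to $J$. *)
Definition theta (P : 'M[C]_n) := J *m (invmx P)^T *m J^T.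

Lemma theta_unit P : P \in unitmx -> theta P \in unitmx.
Proof.
move=> uP; have [u1 u2] := mulmx1_unit (antidiag_mulT C s).
by rewrite /theta !unitmx_mul u1 u2 unitmx_tr unitmx_inv uP.
Qed.

(* The first n - m rows of theta P span the J-orthogonal of the first m rows of P,
   and y is its own J-dual. *)
Lemma lvol_theta P : P \in unitmx -> exists c, forall y m, pd y -> isom y ->
  (m <= n)%N -> lvol (theta P) y (n - m) <= lvol P y m + c.
Proof.
move=> uP; have [c hc] := lvol_full uP; exists (- c) => y m py hy mn.
have [lP eP] := chol_congr_ltp uP py.
set L := chol _ in lP eP.
have pT := antidiag_ltp s (ltp_inv lP).
have yE : J^T *m y *m J = (invmx y)^T.
  rewrite -[in LHS](invmxK y) (isom_inv (isom_invmx hy)) !mulmxA.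
  rewrite antidiag_Tmul mul1mx -mulmxA antidiag_Tmul mulmx1.
  by [].
have mid : (invmx P)^t* *m invmx y *m invmx P = (invmx L)^t* *m invmx L.
  have uL := ltp_unit lP; have uy := pd_unit py.
  rewrite -[LHS](@invmx_eq C n (P *m y *m P^t*)).
    rewrite -eP; apply: invmx_eq; rewrite !mulmxA -(mulmxA L) trC_inv.
    by rewrite mulmxV ?unitmx_trC // mulmx1 mulmxV.
  rewrite !mulmxA -(mulmxA _ (P^t*)) trC_inv mulmxV ?unitmx_trC // mulmx1.
  by rewrite -(mulmxA P) mulmxV // mulmx1 mulmxV.
have e1 : theta P *m y *m (theta P)^t* =
    J *m ((invmx P)^t* *m invmx y *m invmx P)^T *m J^T.
  rewrite /theta !trCM antidiag_trC antidiag_TtrC trC_tr !trmx_mul -yE.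
  by rewrite !mulmxA.
have e2 : J *m (invmx L)^T *m J^T *m (J *m (invmx L)^T *m J^T)^t* =
    J *m ((invmx L)^t* *m invmx L)^T *m J^T.
  rewrite !trCM antidiag_trC antidiag_TtrC trC_tr !trmx_mul.
  by rewrite !mulmxA -(mulmxA _ J^T J) antidiag_Tmul mulmx1.
have -> : lvol (theta P) y (n - m) =
    \sum_(i < n | (i < n - m)%N) ldiag (J *m (invmx L)^T *m J^T) i.
  by rewrite /lvol e1 mid -e2 chol_eq.
have dE i : ldiag (J *m (invmx L)^T *m J^T) i = - ldiag L (rev_ord i).
  rewrite -ldiag_inv // {1}/ldiag antidiag_conjE mulrAC -expr2 sqrr_sign mul1r.
  by [].
have := hc y py hy; rewrite /lvol -/L (eq_bigl xpredT) => [|i]; last exact: ltn_ord.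
rewrite (bigID (fun i : 'I_n => (i < m)%N)) /= => <-.
rewrite opprD addrA subrr add0r (eq_bigr (fun i => - ldiag L (rev_ord i))) //.
rewrite (reindex_inj rev_ord_inj) /= -sumrN le_eqVlt; apply/orP; left; apply/eqP.
apply: eq_big => i; last by rewrite rev_ordK.
by have := ltn_ord i; lia.
Qed.

(** Integer dual bases are computed up to a common factor, which this lemma absorbs in a
    constant. *)
Lemma lvol_scale P m (c : C) : P \in unitmx -> c != 0 ->
  exists d, forall y, pd y -> lvol (c *: P) y m = lvol P y m + d.
Proof.
move=> uP c0; exists (\sum_(i < n | (i < m)%N) 2 * ln (rp `|c|)) => y py.
have [lP eP] := chol_congr_ltp uP py.
have n0 : 0 < `|c| by rewrite normr_gt0.
have lc : ltp (`|c| *: chol (P *m y *m P^t*)).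
  case: lP => /is_trig_mxP tP dP; split.
    by apply/is_trig_mxP => i j ij; rewrite mxE tP ?mulr0.
  by move=> i; rewrite mxE mulr_gt0.
have -> : lvol (c *: P) y m =
    \sum_(i < n | (i < m)%N) ldiag (`|c| *: chol (P *m y *m P^t*)) i.
  rewrite /lvol -(chol_eq lc); congr (\sum_(i < n | _) ldiag (chol _) i).
  rewrite !trCZ -!scalemxAl -!scalemxAr !scalerA eP -normCK expr2.
  by rewrite conj_normC.
rewrite /lvol -big_split; apply: eq_bigr => i _.
have [p0 pE] := gt0_real_complex rc (proj2 lP i).
have [q0 qE] := gt0_real_complex rc n0.
rewrite /ldiag mxE {1}pE {1}qE -real_complexM cRK lnM ?posrE //.
by rewrite mulrDr addrC.
Qed.

End Volume.

(* Integer matrices and certificates by spanning blocks *)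
Delimit Scope Z_scope with ZZ.

Section IntegerScalars.
Variable F : numDomainType.

Definition zI (z : Z) : F := (int_of_Z z)%:~R.

Lemma zI0 : zI 0%ZZ = 0. Proof. by []. Qed.
Lemma zI1 : zI 1%ZZ = 1. Proof. by []. Qed.
Lemma zID a b : zI (a + b)%ZZ = zI a + zI b.
Proof. by rewrite /zI (rmorphD int_of_Z a b) rmorphD. Qed.
Lemma zIM a b : zI (a * b)%ZZ = zI a * zI b.
Proof. by rewrite /zI (rmorphM int_of_Z a b) rmorphM. Qed.
Lemma zIN a : zI (- a)%ZZ = - zI a.
Proof. by rewrite /zI (rmorphN int_of_Z a) rmorphN. Qed.
Lemma zI_ge0 a : (0 <= zI a) = (0 <=? a)%ZZ.
Proof. by rewrite /zI ler0z; apply/idP/idP; lia. Qed.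
Lemma zI_eq0 a : (zI a == 0) = (a =? 0)%ZZ.
Proof. by rewrite /zI intr_eq0; apply/idP/idP; lia. Qed.

End IntegerScalars.

Section IntegerMatrices.

Definition zmat := seq (seq Z).
Definition zget (A : zmat) (i j : nat) : Z := nth 0%ZZ (nth [::] A i) j.
Definition zmk (n : nat) (f : nat -> nat -> Z) : zmat :=
  [seq [seq f i j | j <- iota 0 n] | i <- iota 0 n].
Definition zmul (n : nat) (A B : zmat) : zmat :=
  zmk n (fun i j => foldr (fun k acc => (zget A i k * zget B k j + acc)%ZZ) 0%ZZ (iota 0 n)).
Definition zscal (n : nat) (d : Z) : zmat := zmk n (fun i j => if i == j then d else 0%ZZ).
Definition ztr (n : nat) (A : zmat) : zmat := zmk n (fun i j => zget A j i).

(* The Faddeev-LeVerrier recursion: after n steps A * M = - c. *)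
Fixpoint zleverrier (n k : nat) (A M : zmat) (c : Z) (j : Z) : zmat * Z :=
  if k is k'.+1 then
    let P := zmul n A M in
    let M' := zmk n (fun i l => (zget P i l + (if i == l then c else 0))%ZZ) in
    let AM := zmul n A M' in
    let t := foldr (fun i acc => (zget AM i i + acc)%ZZ) 0%ZZ (iota 0 n) in
    zleverrier n k' A M' (- (t / j))%ZZ (j + 1)%ZZ
  else (M, c).

Definition zinv (n : nat) (A : zmat) : zmat * Z :=
  zleverrier n n A (zmk n (fun _ _ => 0%ZZ)) 1%ZZ 1%ZZ.

(** The recursion acts as an oracle, since the product with its result is checked here. *)
Definition zinvertible (n : nat) (A : zmat) : bool :=
  let: (M, c) := zinv n A in
  (zmul n A M == zscal n (- c)%ZZ) && ~~ (c =? 0)%ZZ.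

Definition zanti (n : nat) (sg : nat -> bool) : zmat :=
  zmk n (fun i j => if j == (n - i.+1)%N then (if sg i then (-1)%ZZ else 1%ZZ) else 0%ZZ).

Definition zdual (n : nat) (sg : nat -> bool) (A : zmat) : zmat :=
  let J := zanti n sg in
  zmul n (zmul n J (ztr n (zinv n A).1)) (ztr n J).

Definition zisom (n : nat) (sg : nat -> bool) (A : zmat) : bool :=
  let J := zanti n sg in zmul n (zmul n A J) (ztr n A) == J.

(* A block is either a flag subspace (flag i, dimension k) or the J-orthogonal of a
   sum of such. *)
Inductive block := Flag of nat & nat | Perp of seq (nat * nat).

Variables (n : nat) (sg : nat -> bool) (fl : seq zmat).

Definition zflag i := nth [::] fl i.
Definition dims (s : seq (nat * nat)) := sumn [seq a.2 | a <- s].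
Definition stack (s : seq (nat * nat)) : zmat := flatten [seq take a.2 (zflag a.1) | a <- s].
(** A dual basis requires a full basis, so the stacked rows are completed by the first rows of a
    flag; [pad_index] searches for a flag that works. *)
Definition padded (s : seq (nat * nat)) (c : nat) : zmat :=
  stack s ++ take (n - dims s) (zflag c).
Definition pad_index (s : seq (nat * nat)) : nat :=
  find (fun c => zinvertible n (padded s c)) (iota 0 (size fl)).
Definition perp (s : seq (nat * nat)) : zmat := zdual n sg (padded s (pad_index s)).

Definition block_mat b := match b with Flag i _ => zflag i | Perp s => perp s end.
Definition block_dim b := match b with Flag _ k => k | Perp s => (n - dims s)%N end.
(** In a self-dual flag the subspaces of dimensions [k] and [n - k] have the same volume up to a
    constant factor, so dimensions are folded to at most $n/2$. Dimension 0 has volume 1 and is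
    dropped. *)
Definition atom (a : nat * nat) : seq (nat * nat) :=
  let k := minn a.2 (n - a.2) in if k is 0%N then [::] else [:: (a.1, k)].
Definition block_atoms b :=
  match b with Flag i k => atom (i, k) | Perp s => flatten [seq atom a | a <- s] end.
Definition ok_atom (a : nat * nat) := (a.1 < size fl)%N && (a.2 <= n)%N.
Definition ok_perp s :=
  [&& all ok_atom s, (dims s <= n)%N & zinvertible n (padded s (pad_index s))].
Definition ok_block b :=
  match b with Flag i k => ok_atom (i, k) | Perp s => ok_perp s end.

Definition bstack (bs : seq block) : zmat :=
  flatten [seq take (block_dim b) (block_mat b) | b <- bs].
Definition bdims bs := sumn [seq block_dim b | b <- bs].

Definition ok_cert (bs : seq block) : bool :=
  [&& all ok_block bs, bdims bs == n & zinvertible n (bstack bs)].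
Definition cert_atoms bs := flatten [seq block_atoms b | b <- bs].

Definition ok_flag A := [&& size A == n, zisom n sg A & zinvertible n A].

End IntegerMatrices.

(** * Soundness of the integer certificates *)

Section Certificates.
Variables (R : realType) (C : numClosedFieldType) (rc : real_part R C).
Local Notation lvol := (lvol rc).
Variables (n : nat) (sg : nat -> bool).
Let s (i : 'I_n) := sg i.
Local Notation J := (antidiag C s).
Local Notation isom := (@isom C n s).
Local Notation theta := (@theta C n s).

Definition toM (A : zmat) : 'M[C]_n := \matrix_(i, j) zI C (zget A i j).

Lemma zget_mk f (i j : 'I_n) : zget (zmk n f) i j = f i j.
Proof.
rewrite /zget /zmk (nth_map 0%N) ?size_iota // (nth_map 0%N) ?size_iota //.
by rewrite !nth_iota.
Qed.

Lemma toM_mul A B : toM (zmul n A B) = toM A *m toM B.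
Proof.
apply/matrixP => i j; rewrite mxE zget_mk mxE.
have e (g : nat -> C) : \sum_(k < n) g k = \sum_(k <- iota 0 n) g k.
  by rewrite -(big_mkord xpredT g) /index_iota subn0.
have -> : \sum_k toM A i k * toM B k j =
    \sum_(k <- iota 0 n) zI C (zget A i k) * zI C (zget B k j).
  rewrite -(e (fun k => zI C (zget A i k) * zI C (zget B k j))).
  by apply: eq_bigr => k _; rewrite !mxE.
elim: (iota 0 n) => [|k l IH]; first by rewrite big_nil.
by rewrite big_cons /= zID zIM IH.
Qed.

Lemma toM_scal d : toM (zscal n d) = (zI C d)%:M.
Proof.
apply/matrixP => i j; rewrite !mxE zget_mk -val_eqE /=.
by case: eqP => _; rewrite ?mulr1n ?mulr0n.
Qed.

Lemma toM_tr A : toM (ztr n A) = (toM A)^T.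
Proof. by apply/matrixP => i j; rewrite !mxE zget_mk. Qed.

Lemma toM_anti : toM (zanti n sg) = J.
Proof.
apply/matrixP => i j; rewrite !mxE zget_mk -val_eqE /=.
case: eqP => _; rewrite ?mulr1n ?mulr0n //.
by rewrite /s; case: (sg i); rewrite ?expr1 ?expr0.
Qed.

Lemma zinvertibleP A : zinvertible n A -> toM A \in unitmx /\
  exists2 d : C, d != 0 & toM (zinv n A).1 = d *: invmx (toM A).
Proof.
rewrite /zinvertible; case: (zinv n A) => M c /andP[/eqP h c0] /=.
have := congr1 toM h; rewrite toM_mul toM_scal zIN => h2.
have d0 : - zI C c != 0 by rewrite oppr_eq0 zI_eq0.
have h3 : toM A *m ((- zI C c)^-1 *: toM M) = 1%:M.
  by rewrite -scalemxAr h2 scale_scalar_mx mulVf.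
have [u _] := mulmx1_unit h3; split; first exact: u.
exists (- zI C c) => //.
by rewrite (invmx_eq h3) scalerA mulfV // scale1r.
Qed.

Lemma zdualP A : zinvertible n A -> exists2 d : C, d != 0 &
  toM (zdual n sg A) = d *: theta (toM A).
Proof.
move=> /zinvertibleP[u [d d0 e]]; exists d => //.
rewrite /zdual !toM_mul !toM_tr toM_anti e /theta linearZ /=.
by rewrite -scalemxAr -scalemxAl.
Qed.

Lemma zisomP A : zisom n sg A -> isom (toM A).
Proof.
by move=> /eqP/(congr1 toM); rewrite !toM_mul toM_tr toM_anti.
Qed.

(** Inequality up to an additive constant that is uniform over the positive elements of the
    group. *)
Definition blt (f g : 'M[C]_n -> R) :=
  exists c, forall y, pd y -> isom y -> f y <= g y + c.

Lemma blt_trans g f h : blt f g -> blt g h -> blt f h.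
Proof.
move=> [c hc] [d hd]; exists (d + c) => y py iy.
by apply: (le_trans (hc y py iy)); rewrite addrA lerD2r; exact: hd.
Qed.

Lemma bltD f g f' g' : blt f g -> blt f' g' ->
  blt (fun y => f y + f' y) (fun y => g y + g' y).
Proof.
move=> [c hc] [d hd]; exists (c + d) => y py iy.
by rewrite addrACA; apply: lerD; [exact: hc|exact: hd].
Qed.

Lemma blt_le f g : (forall y, pd y -> f y <= g y) -> blt f g.
Proof. by move=> h; exists 0 => y py _; rewrite addr0; exact: h. Qed.

Lemma row_toM_cat pre A b post (i j : 'I_n) : (b <= size A)%N -> (i < b)%N ->
  j = (size pre + i)%N :> nat ->
  row j (toM (pre ++ take b A ++ post)) = row i (toM A).
Proof.
move=> bA ib jE; apply/rowP => k; rewrite !mxE /zget; congr (zI C (nth _ _ _)).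
rewrite nth_cat jE ltnNge leq_addr /= addKn nth_cat size_takel // ib.
by rewrite nth_take.
Qed.

(** Fischer's inequality for many blocks; [pre] collects the rows already split off, and [post] is
    padding. *)
Lemma lvol_stack (bs : seq (zmat * nat)) pre post :
  toM (pre ++ flatten [seq take b.2 b.1 | b <- bs] ++ post) \in unitmx ->
  all (fun b => (b.2 <= size b.1)%N && (toM b.1 \in unitmx)) bs ->
  (size pre + sumn [seq b.2 | b <- bs] <= n)%N ->
  forall y, pd y ->
  lvol (toM (pre ++ flatten [seq take b.2 b.1 | b <- bs] ++ post)) y
    (size pre + sumn [seq b.2 | b <- bs]) <=
  lvol (toM (pre ++ flatten [seq take b.2 b.1 | b <- bs] ++ post)) y (size pre)
   + \sum_(b <- bs) lvol (toM b.1) y b.2.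
Proof.
elim: bs pre => [|[A b] bs IH] pre /= u h sz y py.
  by rewrite addn0 big_nil addr0.
have /andP[/andP[bA uA] {}h] := h.
have E : pre ++ (take b A ++ flatten [seq take b.2 b.1 | b <- bs]) ++ post =
   (pre ++ take b A) ++ flatten [seq take b.2 b.1 | b <- bs] ++ post.
  by rewrite !catA.
have sE : (size (pre ++ take b A) = size pre + b)%N by rewrite size_cat size_takel.
rewrite big_cons /= addnA -sE E.
have := IH (pre ++ take b A); rewrite -E => /(_ u) h2.
apply: (le_trans (h2 _ _ _ py)).
- exact: h.
- by rewrite sE -addnA.
rewrite addrA lerD2r sE.
apply: (lvol_block rc u uA py) => [i j ib jE|]; last first.
  by apply: leq_trans sz; rewrite addnA leq_addr.
by rewrite -catA; apply: row_toM_cat.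
Qed.

Lemma lvol_stack0 (bs : seq (zmat * nat)) post :
  toM (flatten [seq take b.2 b.1 | b <- bs] ++ post) \in unitmx ->
  all (fun b => (b.2 <= size b.1)%N && (toM b.1 \in unitmx)) bs ->
  (sumn [seq b.2 | b <- bs] <= n)%N ->
  forall y, pd y ->
  lvol (toM (flatten [seq take b.2 b.1 | b <- bs] ++ post)) y (sumn [seq b.2 | b <- bs])
  <= \sum_(b <- bs) lvol (toM b.1) y b.2.
Proof.
move=> u h sz y py; have := @lvol_stack bs [::] post u h sz y py.
by rewrite /= add0n lvol0 add0r.
Qed.

Section Flags.
Variable fl : seq zmat.
Hypothesis okfl : all (ok_flag n sg) fl.
Local Notation zflag := (zflag fl).

Definition fvol (a : nat * nat) (y : 'M[C]_n) := lvol (toM (zflag a.1)) y a.2.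

Lemma flag_ok i : (i < size fl)%N ->
  [/\ size (zflag i) = n, isom (toM (zflag i)) & toM (zflag i) \in unitmx].
Proof.
move=> /(mem_nth [::]) /(allP okfl) /and3P[/eqP h1 h2 h3]; split=> //.
  exact: zisomP.
by have [] := zinvertibleP h3.
Qed.

Lemma theta_id (g : 'M[C]_n) : isom g -> theta g = g.
Proof. by move=> h; rewrite /theta -(isom_inv (isom_invmx h)) invmxK. Qed.

(** A flag given by an element of the group is fixed by [theta], so [lvol_theta] exchanges the
    dimensions [m] and [n - m]. *)
Lemma fvol_atom a : ok_atom n fl a ->
  blt (fvol a) (fun y => \sum_(b <- atom n a) fvol b y).
Proof.
case: a => i k /andP[/= il kn].
have [_ ig ug] := flag_ok il.
have sym m : (m <= n)%N -> blt (fvol (i, (n - m)%N)) (fvol (i, m)).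
  move=> mn; have [c hc] := lvol_theta rc s ug.
  by exists c => y py iy; rewrite /fvol /= -{1}(theta_id ig); exact: hc.
rewrite /atom /=; have [kk|kk] := leqP k (n - k).
  case: k kn kk => [|k] kn kk.
    by apply: blt_le => y _; rewrite big_nil /fvol lvol0.
  by apply: blt_le => y _; rewrite big_seq1.
have h := sym (n - k)%N (leq_subr _ _); rewrite subKn // in h.
case: (n - k)%N h => [|m] h.
  apply: (blt_trans h); apply: blt_le => y _.
  by rewrite big_nil /fvol lvol0.
by apply: (blt_trans h); apply: blt_le => y _; rewrite big_seq1.
Qed.

Lemma blt_sum (T : Type) (r : seq T) (f g : T -> 'M[C]_n -> R) (P : pred T) :
  all P r -> (forall a, P a -> blt (f a) (g a)) ->
  blt (fun y => \sum_(a <- r) f a y) (fun y => \sum_(a <- r) g a y).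
Proof.
move=> + h; elim: r => [|a r IH] /= => [_|/andP[Pa Pr]].
  by apply: blt_le => y _; rewrite !big_nil.
have [c hc] := bltD (h a Pa) (IH Pr).
by exists c => y py iy; rewrite !big_cons; exact: hc.
Qed.

Lemma stackE (t : seq (nat * nat)) :
  stack fl t = flatten [seq take b.2 b.1 | b <- [seq (zflag a.1, a.2) | a <- t]].
Proof. by rewrite -map_comp. Qed.

Lemma fvol_atoms t : all (ok_atom n fl) t ->
  blt (fun y => \sum_(a <- t) fvol a y)
      (fun y => \sum_(b <- flatten [seq atom n a | a <- t]) fvol b y).
Proof.
move=> h; have [c hc] := blt_sum h (fun a => @fvol_atom a).
by exists c => y py iy; rewrite big_flatten big_map; exact: hc.
Qed.

(** Duality leads back to the stacked subspaces, and Fischer's inequality separates them. *)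
Lemma lvol_perp t : ok_perp n fl t -> toM (perp n sg fl t) \in unitmx /\
  blt (fun y => lvol (toM (perp n sg fl t)) y (n - dims t))
      (fun y => \sum_(b <- flatten [seq atom n a | a <- t]) fvol b y).
Proof.
move=> /and3P[ha hd hi]; have [u _] := zinvertibleP hi.
have [d d0 eD] := zdualP hi; have uT := theta_unit s u.
rewrite /perp eD; split.
  by rewrite unitmxZ ?unitfE.
apply: blt_trans (fvol_atoms ha).
have [c1 h1] := lvol_scale rc (n - dims t) uT d0.
have [c2 h2] := lvol_theta rc s u.
exists (c2 + c1) => y py iy; rewrite h1 // addrA lerD2r.
apply: (le_trans (h2 y (dims t) py iy hd)); rewrite lerD2r.
rewrite /padded stackE in u *.
have dE : sumn [seq b.2 | b <- [seq (zflag a.1, a.2) | a <- t]] = dims t.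
  by rewrite -map_comp.
have h := lvol_stack0 u; rewrite dE in h.
have := h _ hd y py; rewrite big_map all_map; apply.
by apply: sub_all ha => a /andP[a1 a2] /=; have [-> _ ->] := flag_ok a1; rewrite a2.
Qed.

Lemma size_zmk f : size (zmk n f) = n.
Proof. by rewrite size_map size_iota. Qed.

Lemma lvol_block_atoms b : ok_block n fl b ->
  [/\ toM (block_mat n sg fl b) \in unitmx,
   (block_dim n b <= size (block_mat n sg fl b))%N &
   blt (fun y => lvol (toM (block_mat n sg fl b)) y (block_dim n b))
      (fun y => \sum_(a <- block_atoms n b) fvol a y)].
Proof.
case: b => [i k|t] /= h.
  have /andP[/= h1 h2] := h; have [sz _ u] := flag_ok h1; split=> //.
    by rewrite sz.
  exact: fvol_atom h.
have [u hb] := lvol_perp h; split=> //.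
by rewrite /perp /zdual /zmul size_zmk leq_subr.
Qed.

(** The volume of the whole space is constant on the group and, as the blocks form a basis, at most
    the product of their volumes; that product stays away from 0. *)
Lemma cert_sound bs : ok_cert n sg fl bs ->
  blt (fun=> 0) (fun y => \sum_(a <- cert_atoms n bs) fvol a y).
Proof.
move=> /and3P[ha /eqP hd hi]; have [u _] := zinvertibleP hi.
have [c hc] := lvol_full rc s u.
have hb : blt (fun y => \sum_(b <- bs) lvol (toM (block_mat n sg fl b)) y (block_dim n b))
   (fun y => \sum_(b <- bs) \sum_(a <- block_atoms n b) fvol a y).
  by apply: (blt_sum ha) => b /lvol_block_atoms[].
apply: blt_trans (_ : blt _ (fun y => \sum_(b <- bs) \sum_(a <- block_atoms n b) fvol a y)) _; last first.
  by apply: blt_le => y _; rewrite big_flatten big_map.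
apply: blt_trans hb; exists (- c) => y py iy.
rewrite subr_ge0 -(hc y py iy).
have E : bstack n sg fl bs = flatten
    [seq take b.2 b.1 | b <- [seq (block_mat n sg fl b, block_dim n b) | b <- bs]] ++ [::].
  by rewrite cats0 -map_comp.
rewrite E in u *.
have dE : sumn [seq b.2 | b <- [seq (block_mat n sg fl b, block_dim n b) | b <- bs]] = n.
  by rewrite -[RHS]hd -map_comp.
have h := lvol_stack0 u; rewrite dE in h.
have := h _ (leqnn n) y py; rewrite big_map all_map; apply.
by apply: sub_all ha => b /lvol_block_atoms[h1 h2 _] /=; rewrite h1 h2.
Qed.

End Flags.

End Certificates.

(** * The cone and its double description *)

Section IntegerVectors.

Definition zdot (u r : seq Z) : Z :=
  foldr (fun k acc => (nth 0 u k * nth 0 r k + acc)%ZZ) 0%ZZ (iota 0 9).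

Definition zvmk (f : nat -> Z) : seq Z := [seq f k | k <- iota 0 9].

(** For [p] and [q] on opposite sides of [h], the positive combination on which [h] vanishes, made
    primitive to keep the numbers small. The division is checked, with the undivided vector as
    fallback. *)
Definition zcomb (h p q : seq Z) : seq Z :=
  let a := zdot h p in let b := zdot h q in
  let raw := zvmk (fun k => (a * nth 0 q k - b * nth 0 p k)%ZZ) in
  let g := foldr Z.gcd 0%ZZ raw in
  let c := zvmk (fun k => (nth 0 raw k / g)%ZZ) in
  if (0 <? g)%ZZ && (zvmk (fun k => (g * nth 0 c k)%ZZ) == raw) then c else raw.

Definition zmask (U : seq (seq Z)) (r : seq Z) : seq bool := [seq zdot u r == 0%ZZ | u <- U].

(* written with if so that call-by-value evaluation stops early *)
Fixpoint msub3 (a b c : seq bool) : bool :=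
  match a, b, c with
  | x :: a', y :: b', z :: c' =>
      if x then (if y then (if z then msub3 a' b' c' else false) else msub3 a' b' c')
      else msub3 a' b' c'
  | _, _, _ => true
  end.

Fixpoint hasb (T : Type) (f : T -> bool) (l : seq T) : bool :=
  if l is x :: l' then (if f x then true else hasb f l') else false.

Definition ray := (seq Z * seq bool)%type.

(** The combinatorial test: no third ray lies on all the hyperplanes that contain both [p] and
    [q]. *)
Definition adjacent (rs : seq ray) (p q : ray) : bool :=
  ~~ hasb (fun r => if msub3 p.2 q.2 r.2 then
     (if r.1 == p.1 then false else if r.1 == q.1 then false else true) else false) rs.

(** No tight set contains that of another ray, which is the property that decides the last case of
    [zero_section]. *)
Definition antichain (rs : seq ray) : bool :=
  ~~ hasb (fun r => hasb (fun t => if msub3 r.2 r.2 t.2 then r.1 != t.1 else false) rs) rs.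

Definition dd_step (U : seq (seq Z)) (rs : seq ray) (h : seq Z) : seq ray :=
  let pos := [seq r <- rs | (0 <? zdot h r.1)%ZZ] in
  let neg := [seq r <- rs | (zdot h r.1 <? 0)%ZZ] in
  let new := flatten [seq [seq zcomb h p.1 q.1 | q <- neg & adjacent rs p q] | p <- pos] in
  [seq (r.1, (zdot h r.1 == 0%ZZ) :: r.2) | r <- rs & (0 <=? zdot h r.1)%ZZ] ++
  [seq (c, zmask (h :: U) c) | c <- new].

Fixpoint dd_run (U : seq (seq Z)) (rs : seq ray) (hs : seq (seq Z)) : option (seq ray) :=
  if hs is h :: hs' then
    if antichain rs then dd_run (h :: U) (dd_step U rs h) hs' else None
  else Some rs.

Definition perms3 (t : seq Z * seq Z * seq Z) : seq (seq Z) :=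
  let: (a, b, c) := t in
  undup [:: a ++ b ++ c; a ++ c ++ b; b ++ a ++ c; b ++ c ++ a; c ++ a ++ b; c ++ b ++ a].

Definition vec3 (a b c : Z) : seq Z := [:: a; b; c].
Local Notation "( a , b , c | d , e , f | g , h , i )" :=
  (vec3 a%ZZ b%ZZ c%ZZ, vec3 d%ZZ e%ZZ f%ZZ, vec3 g%ZZ h%ZZ i%ZZ) (at level 0).

Definition chamber_ineqs : seq (seq Z) :=
  flatten [seq perms3 t | t <- [::
    (1, -1, 0 | 0, 0, 0 | 0, 0, 0); (0, 1, -1 | 0, 0, 0 | 0, 0, 0);
    (0, 0, 1 | 0, 0, 0 | 0, 0, 0)]].

(* listed in an order that keeps the intermediate cones small *)
Definition triangle_types : seq (seq Z * seq Z * seq Z) := [::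
    (1, 1, 0 | 0, 1, -1 | 0, -1, 1); (0, 1, 0 | 0, 1, 0 | 0, 0, -1);
    (1, 1, 0 | 0, 1, 1 | 0, -1, -1); (1, 0, 0 | 0, 0, 1 | 0, 0, -1);
    (1, 0, 0 | 0, 1, 0 | 0, -1, 0); (1, 0, 0 | 1, 0, 0 | -1, 0, 0);
    (1, 1, 0 | 1, -1, 0 | -1, 1, 0); (1, 1, 0 | 1, 1, 0 | -1, -1, 0);
    (1, 1, 0 | 1, 0, 1 | -1, 0, -1); (1, 1, 1 | 1, -1, 1 | -1, 1, -1);
    (1, 1, 1 | 1, -1, -1 | -1, 1, 1); (1, 1, -1 | 1, -1, 1 | -1, 1, 1);
    (1, 1, 0 | 1, 0, -1 | -1, 0, 1); (1, 0, 1 | 1, 0, 1 | 0, -1, -1);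
    (1, 0, 1 | 1, 0, -1 | -1, 1, 0); (1, 0, 1 | 1, 0, -1 | 0, -1, 1);
    (1, 1, 1 | 1, 1, -1 | -1, -1, 1); (1, 1, 1 | 1, 1, 1 | -1, -1, -1)].

Definition triangle_ineqs : seq (seq Z) := flatten [seq perms3 t | t <- triangle_types].

Definition ineqs := chamber_ineqs ++ triangle_ineqs.

Definition chamber_rays : seq (seq Z) :=
  flatten [seq perms3 t | t <- [::
    (1, 0, 0 | 0, 0, 0 | 0, 0, 0); (1, 1, 0 | 0, 0, 0 | 0, 0, 0);
    (1, 1, 1 | 0, 0, 0 | 0, 0, 0)]].

(** The expected extremal rays up to permutation of the sides; the result of the double description
    is compared with this list. *)
Definition rays : seq (seq Z) :=
  flatten [seq perms3 t | t <- [::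
    (1, 0, 0 | 1, 0, 0 | 0, 0, 0); (1, 1, 0 | 1, 0, 0 | 1, 0, 0);
    (1, 1, 0 | 1, 1, 0 | 0, 0, 0); (1, 1, 1 | 1, 1, 0 | 1, 0, 0);
    (1, 1, 1 | 1, 1, 0 | 1, 1, 0); (1, 1, 1 | 1, 1, 1 | 0, 0, 0);
    (2, 0, 0 | 1, 1, 0 | 1, 1, 0); (2, 0, 0 | 1, 1, 1 | 1, 1, 1);
    (2, 1, 0 | 1, 1, 1 | 1, 1, 0); (2, 1, 1 | 1, 1, 0 | 1, 1, 0);
    (2, 2, 0 | 1, 1, 1 | 1, 1, 1); (2, 2, 0 | 2, 1, 1 | 1, 1, 0);
    (3, 1, 1 | 2, 2, 0 | 1, 1, 1)]].

Definition dd_final : option (seq ray) :=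
  dd_run chamber_ineqs [seq (r, zmask chamber_ineqs r) | r <- chamber_rays] triangle_ineqs.

Definition rays_only (o : option (seq ray)) : bool :=
  if o is Some rs then all (fun r => r.1 \in rays) rs else false.

Lemma dd_final_rays : rays_only dd_final.
Proof. by vm_compute. Qed.

Lemma rays_onlyP o : rays_only o ->
  exists2 out, o = Some out & forall r, r \in out -> r.1 \in rays.
Proof. by case: o => // out /allP h; exists out. Qed.

Lemma ineqs_size : size ineqs = 102%N. Proof. by vm_compute. Qed.
Lemma rays_size : size rays = 51%N. Proof. by vm_compute. Qed.

Definition zsum (l : seq (seq Z)) : seq Z :=
  foldr (fun u acc => zvmk (fun k => (nth 0 u k + nth 0 acc k)%ZZ)) (zvmk (fun=> 0%ZZ)) l.

(** A relative interior point of the facet of [h]; dually, [edge_form r] is a form that exposes the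
    ray [r]. Both properties are verified by computation in [facet_pointP] and [edge_formP]. *)
Definition facet_point (h : seq Z) : seq Z := zsum [seq r <- rays | zdot h r == 0%ZZ].
Definition edge_form (r : seq Z) : seq Z := zsum [seq h <- ineqs | zdot h r == 0%ZZ].

Lemma rays_ineqs : all (fun h => all (fun r => (0 <=? zdot h r)%ZZ) rays) ineqs.
Proof. by vm_compute. Qed.

Lemma facet_pointP : all (fun h => (zdot h (facet_point h) == 0%ZZ) &&
   all (fun g => (g == h) || (0 <? zdot g (facet_point h))%ZZ) ineqs) ineqs.
Proof. by vm_compute. Qed.

Lemma edge_formP : all (fun r => (zdot (edge_form r) r == 0%ZZ) &&
   all (fun t => (t == r) || (0 <? zdot (edge_form r) t)%ZZ) rays) rays.
Proof. by vm_compute. Qed.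

Lemma ineqs_uniq : uniq ineqs. Proof. by vm_compute. Qed.
Lemma rays_uniq : uniq rays. Proof. by vm_compute. Qed.

End IntegerVectors.

(** * Correctness of a double description step *)

Section DoubleDescription.
Variable R : realType.
Local Notation zR := (zI R).
Implicit Types (v y : 'M[R]_3) (u r p q h : seq Z).

Definition ev (u : seq Z) (v : 'M[R]_3) : R :=
  \sum_(i < 3) \sum_(j < 3) zR (nth 0%ZZ u (3 * i + j)) * v i j.

Definition emb (r : seq Z) : 'M[R]_3 := \matrix_(i, j) zR (nth 0%ZZ r (3 * i + j)).

Lemma evD u v w : ev u (v + w) = ev u v + ev u w.
Proof.
rewrite /ev -big_split; apply: eq_bigr => i _.
by rewrite -big_split; apply: eq_bigr => j _; rewrite mxE mulrDr.
Qed.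

Lemma evZ u c v : ev u (c *: v) = c * ev u v.
Proof.
rewrite /ev mulr_sumr; apply: eq_bigr => i _.
by rewrite mulr_sumr; apply: eq_bigr => j _; rewrite mxE mulrCA.
Qed.

Lemma evB u v w : ev u (v - w) = ev u v - ev u w.
Proof. by rewrite evD -scaleN1r evZ mulN1r. Qed.

Lemma ev0 u : ev u 0 = 0.
Proof. by rewrite -(scale0r 0) evZ mul0r. Qed.

Lemma ev_emb u r : ev u (emb r) = zR (zdot u r).
Proof.
rewrite /ev /zdot; rewrite !big_ord_recl !big_ord0 !mxE /= /bump /= !zID !zIM zI0.
by rewrite !addr0 !addrA.
Qed.

Definition pos (U : seq (seq Z)) v := forall u, u \in U -> 0 <= ev u v.

Inductive cone (rs : seq (seq Z)) : 'M[R]_3 -> Prop :=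
| Cone0 : cone rs 0
| ConeS c r v : 0 <= c -> r \in rs -> cone rs v -> cone rs (c *: emb r + v).

Lemma coneD rs v w : cone rs v -> cone rs w -> cone rs (v + w).
Proof.
elim=> [|c r v' c0 rin _ IH] hw; first by rewrite add0r.
by rewrite -addrA; apply: ConeS => //; exact: IH.
Qed.

Lemma coneZ rs c v : 0 <= c -> cone rs v -> cone rs (c *: v).
Proof.
move=> c0; elim=> [|d r v' d0 rin _ IH]; first by rewrite scaler0; exact: Cone0.
by rewrite scalerDr scalerA; apply: ConeS => //; exact: mulr_ge0.
Qed.

Lemma cone1 rs c r : 0 <= c -> r \in rs -> cone rs (c *: emb r).
Proof. by move=> c0 h; rewrite -[X in cone _ X]addr0; apply: ConeS => //; exact: Cone0. Qed.

Lemma cone_pos U rs v : (forall r, r \in rs -> pos U (emb r)) -> cone rs v -> pos U v.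
Proof.
move=> h; elim=> [|c r w c0 rin _ IH] u uU; first by rewrite ev0.
by rewrite evD evZ addr_ge0 ?mulr_ge0 ?IH // h.
Qed.

Definition tight_sub (U : seq (seq Z)) v w :=
  forall u, u \in U -> ev u v = 0 -> ev u w = 0.

(** A form that vanishes at a sum of elements of the cone vanishes at each summand, so only rays of
    the smallest face containing [v] occur. The induction keeps the remaining part [w] below [v]. *)
Lemma cone_split U rs v : (forall r, r \in rs -> pos U (emb r)) -> cone rs v ->
  cone [seq r <- rs | [forall k : 'I_(size U),
     (ev (nth [::] U k) v == 0) ==> (ev (nth [::] U k) (emb r) == 0)]] v.
Proof.
move=> h hv; set rs' := [seq r <- rs | _].
suff : forall w, cone rs w -> tight_sub U v w -> pos U (v - w) -> cone rs' w.
  apply=> // u uU; rewrite subrr ev0 //.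
move=> w; elim=> [|c r w' c0 rin cw IH] ts pv; first exact: Cone0.
have [c00|c0'] := eqVneq c 0.
  by move: ts pv; rewrite c00 scale0r add0r => ts pv; exact: IH.
have cp : 0 < c by rewrite lt_def c0'.
have hr u : u \in U -> 0 <= ev u (emb r) by move=> uU; exact: (h r rin).
have hw u : u \in U -> 0 <= ev u w' by move=> uU; exact: (cone_pos h cw).
have z u : u \in U -> ev u v = 0 -> ev u (emb r) = 0 /\ ev u w' = 0.
  move=> uU v0; have := ts u uU v0; rewrite evD evZ.
  have := mulr_ge0 c0 (hr u uU); have := hw u uU => a b s.
  have e1 : c * ev u (emb r) = 0 by lra.
  split; last by lra.
  by apply/eqP; move/eqP: e1; rewrite mulf_eq0 (negbTE c0').
apply: ConeS => //.
  rewrite mem_filter rin andbT; apply/forallP => k; apply/implyP => /eqP k0.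
  by have [-> _] := z _ (mem_nth [::] (ltn_ord k)) k0.
apply: IH.
  by move=> u uU v0; have [] := z u uU v0.
move=> u uU; have := pv u uU; rewrite !evB evD evZ.
by have := mulr_ge0 c0 (hr u uU); lra.
Qed.

Lemma msub3P U p q r : msub3 (zmask U p) (zmask U q) (zmask U r) ->
  forall u, u \in U -> zdot u p = 0%ZZ -> zdot u q = 0%ZZ -> zdot u r = 0%ZZ.
Proof.
elim: U => [|a U IH] //= h u; rewrite inE => /orP[/eqP->|uU] pu qu.
  by move: h; rewrite pu qu !eqxx; case: eqP.
apply: IH uU pu qu; move: h; do 2 (case: eqP => // _).
by case: eqP.
Qed.

Lemma msub3_intro U p q r :
  (forall u, u \in U -> zdot u p = 0%ZZ -> zdot u q = 0%ZZ -> zdot u r = 0%ZZ) ->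
  msub3 (zmask U p) (zmask U q) (zmask U r).
Proof.
elim: U => [|a U IH] //= h.
have h2 : msub3 (zmask U p) (zmask U q) (zmask U r).
  by apply: IH => u uU; apply: h; rewrite inE uU orbT.
case: eqP => // pa; case: eqP => // qa.
by rewrite (h a) ?mem_head ?eqxx.
Qed.

Lemma hasbE (T : Type) (f : T -> bool) l : hasb f l = has f l.
Proof. by elim: l => //= x l ->; case: (f x). Qed.

Lemma zR_eq0 z : (zR z = 0) <-> z = 0%ZZ.
Proof.
split=> [/eqP|->]; last by rewrite zI0.
by rewrite zI_eq0 => /Z.eqb_eq.
Qed.

Lemma nth_zvmk f k : (k < 9)%N -> nth 0%ZZ (zvmk f) k = f k.
Proof. by move=> k9; rewrite /zvmk (nth_map 0%N) ?size_iota // nth_iota. Qed.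

Lemma idx9 (i j : 'I_3) : (3 * i + j < 9)%N.
Proof. by have := ltn_ord i; have := ltn_ord j; lia. Qed.

Lemma zcombP h p q : (0 < zR (zdot h p)) -> (zR (zdot h q) < 0) ->
  exists2 g : R, 0 < g & g *: emb (zcomb h p q) =
    zR (zdot h p) *: emb q - zR (zdot h q) *: emb p.
Proof.
move=> hp hq; rewrite /zcomb; set raw := zvmk _; set g := foldr _ _ _.
have e : emb raw = zR (zdot h p) *: emb q - zR (zdot h q) *: emb p.
  apply/matrixP => i j; rewrite !mxE nth_zvmk ?idx9 //.
  by rewrite zID zIN !zIM.
case: ifP => [/andP[g0 /eqP h2]|_]; last by exists 1; rewrite ?scale1r.
exists (zR g); first by rewrite lt_def zI_ge0 zI_eq0; apply/andP; split; lia.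
have hk k : (k < 9)%N -> (g * nth 0%ZZ (zvmk (fun k => (nth 0 raw k / g)%ZZ)) k)%ZZ = nth 0%ZZ raw k.
  by move=> k9; have := congr1 (fun s => nth 0%ZZ s k) h2; rewrite nth_zvmk.
by rewrite -e; apply/matrixP => i j; rewrite !mxE -zIM hk ?idx9.
Qed.

Section Step.
Variables (U : seq (seq Z)) (rs : seq (seq Z)) (h : seq Z).
Hypothesis pointed : forall y, (forall u, u \in U -> ev u y = 0) -> y = 0.
Hypothesis rsU : forall r, r \in rs -> pos U (emb r).
Hypothesis gen : forall v, pos U v -> cone rs v.
Hypothesis anti : forall r t, r \in rs -> t \in rs ->
  tight_sub U (emb r) (emb t) -> r = t.
Let tri := [seq (r, zmask U r) | r <- rs].
Let rs' := [seq x.1 | x <- dd_step U tri h].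

Lemma mem_rs'1 r : r \in rs -> 0 <= ev h (emb r) -> r \in rs'.
Proof.
move=> rin; rewrite ev_emb zI_ge0 => h0.
rewrite /rs' /dd_step map_cat mem_cat; apply/orP; left.
apply/mapP; exists (r, (zdot h r == 0%ZZ) :: zmask U r) => //.
apply/mapP; exists (r, zmask U r) => //; rewrite mem_filter h0 /=.
by apply/mapP; exists r.
Qed.

Lemma mem_rs'2 p q : p \in rs -> q \in rs -> 0 < ev h (emb p) -> ev h (emb q) < 0 ->
  adjacent tri (p, zmask U p) (q, zmask U q) -> zcomb h p q \in rs'.
Proof.
move=> pin qin hp hq ad; rewrite /rs' /dd_step map_cat mem_cat; apply/orP; right.
rewrite -map_comp; apply/mapP; exists (zcomb h p q) => //.
apply/flattenP; exists [seq zcomb h (p, zmask U p).1 x.1 | x <- [seq x <- tri | (zdot h x.1 <? 0)%ZZ] & adjacent tri (p, zmask U p) x].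
  apply/mapP; exists (p, zmask U p) => //; rewrite mem_filter; apply/andP; split.
    by move: hp; rewrite ev_emb lt_def zI_ge0 zI_eq0 /=; lia.
  by apply/mapP; exists p.
apply/mapP; exists (q, zmask U q) => //; rewrite !mem_filter ad /=; apply/andP; split.
  by move: hq; rewrite ev_emb ltNge zI_ge0 /=; lia.
by apply/mapP; exists q.
Qed.

(** The ratio test: [t] is the least quotient [ev u v / ev u y] over the inequalities positive at
    [y], and a minimizing one becomes tight. Pointedness provides such an inequality. *)
Lemma subtract v y : pos U v -> pos U y -> y != 0 -> tight_sub U v y ->
  exists t, [/\ 0 < t, pos U (v - t *: y), tight_sub U v (v - t *: y) &
   exists2 u, u \in U & ev u v != 0 /\ ev u (v - t *: y) = 0].
Proof.
move=> pv py y0 ts.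
have /hasP[u0 u0U u0y] : has (fun u => 0 < ev u y) U.
  apply/negPn/negP => /hasPn hn; move/eqP: y0; apply; apply: pointed => u uU.
  by apply/eqP; rewrite eq_le py // andbT leNgt hn.
pose f u := ev u v / ev u y.
have : exists2 u, u \in U & 0 < ev u y /\ forall w, w \in U -> 0 < ev w y -> f u <= f w.
  have : exists2 u, u \in [seq u <- U | 0 < ev u y] &
      forall w, w \in [seq u <- U | 0 < ev u y] -> f u <= f w.
    have : [seq u <- U | 0 < ev u y] != [::].
      apply/eqP => e; have : u0 \in [seq u <- U | 0 < ev u y] by rewrite mem_filter u0y u0U.
      by rewrite e.
    move: [seq u <- U | _] => l; elim: l => // a l IH _.
    case: l IH => [_|b l IH].
      by exists a; rewrite ?mem_head // => w; rewrite inE => /eqP->.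
    have [//|u uin hu] := IH.
    have [ua|au] := leP (f u) (f a).
      exists u; first by rewrite inE uin orbT.
      by move=> w; rewrite inE => /orP[/eqP->//|]; exact: hu.
    exists a; first exact: mem_head.
    move=> w; rewrite inE => /orP[/eqP->//|wl].
    exact: le_trans (ltW au) (hu w wl).
  case=> u; rewrite mem_filter => /andP[uy uU] hu; exists u => //; split=> // w wU wy.
  by apply: hu; rewrite mem_filter wy.
case=> u uU [uy hu]; exists (f u).
have vu : 0 < ev u v.
  rewrite lt_def pv // andbT; apply/negP => /eqP v0.
  by move: uy; rewrite (ts u uU v0) ltxx.
split.
- by rewrite /f divr_gt0.
- move=> w wU; rewrite evB evZ subr_ge0.
  have [wy|] := ltP 0 (ev w y).
    by rewrite -ler_pdivlMr //; exact: hu.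
  move=> wy; have -> : ev w y = 0 by apply/eqP; rewrite eq_le wy py.
  by rewrite mulr0; exact: pv.
- by move=> w wU w0; rewrite evB evZ w0 (ts w wU w0) mulr0 subrr.
exists u => //; split; first by rewrite gt_eqF.
by rewrite evB evZ /f divfK ?subrr // gt_eqF.
Qed.

(** The induction measure: it drops when [v] moves to a smaller face. *)
Definition loose v := count (fun u => ev u v != 0) U.

Lemma loose_lt v w u : tight_sub U v w -> u \in U -> ev u v != 0 -> ev u w = 0 ->
  (loose w < loose v)%N.
Proof.
move=> ts uU uv uw; rewrite /loose.
have : {subset [predI (fun u => ev u w != 0) & mem U] <= (fun u => ev u v != 0)}.
  move=> x /andP[xw xU]; apply/negP => /eqP xv; move/eqP: xw; apply; exact: ts.
move=> sb; elim: (U) uU sb => // a l IH; rewrite inE /= => /orP[/eqP <-|ul] sb.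
  rewrite uw uv eqxx /= add0n add1n ltnS; rewrite -!size_filter.
  apply: (@leq_trans (size [seq x <- l | (ev x w != 0) && (ev x v != 0)])).
    rewrite !size_filter; apply/eq_leq/eq_in_count => x xl /=.
    case E: (ev x w != 0) => //=; apply/esym/sb; apply/andP; split; first exact: E.
    by rewrite /= inE xl orbT.
  rewrite !size_filter; apply: sub_count => x /andP[_ //].
rewrite -addnS; apply: leq_add.
  case E: (ev a w != 0) => //.
  by have -> : ev a v != 0 by apply: sb; apply/andP; split; [exact: E|exact: mem_head].
apply: IH => // x /andP[xw xl]; apply: sb; apply/andP; split=> //.
by rewrite /= inE; move: xl => /= ->; rewrite orbT.
Qed.

Lemma face_ray v y : pos U v -> v != 0 -> pos U y -> y != 0 -> tight_sub U v y ->
  ev h v = 0 -> ev h y = 0 ->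
  (forall w, pos U w -> ev h w = 0 -> tight_sub U v w -> (loose w < loose v)%N -> w = 0) ->
  exists2 t, 0 < t & v = t *: y.
Proof.
move=> pv v0 py y0 ts hv hy hmin.
have [t [t0 pt tt [u uU [uv uw]]]] := subtract pv py y0 ts.
exists t => //; apply/eqP; rewrite -subr_eq0; apply/eqP; apply: hmin => //.
  by rewrite evB evZ hv hy mulr0 subrr.
exact: loose_lt tt uU uv uw.
Qed.

Lemma pos_comb (p q : 'M[R]_3) a b : pos U p -> pos U q -> 0 <= a -> 0 <= b -> pos U (a *: p + b *: q).
Proof. by move=> hp hq a0 b0 u uU; rewrite evD !evZ addr_ge0 // mulr_ge0 // ?hp ?hq. Qed.

(* If the smallest face containing v meets the hyperplane h = 0 only in the ray of v,
   that face contains exactly one ray on each side of the hyperplane, and these two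
   rays are adjacent. *)
Lemma zero_section v : pos U v -> ev h v = 0 -> cone rs' v.
Proof.
have [k] := ubnP (loose v); elim: k v => // k IH v lv pv hv.
have [->|v0] := eqVneq v 0; first exact: Cone0.
(* Either some nonzero vector of the section lies in a smaller face, and [v] splits into two vectors
   with fewer loose inequalities, or [v] is minimal. *)
have [[y [py hy ts ly y0]]|hmin] := pselect (exists y, [/\ pos U y, ev h y = 0,
    tight_sub U v y, (loose y < loose v)%N & y != 0]).
  have [t [t0 pt tt [u uU [uv uw]]]] := subtract pv py y0 ts.
  have -> : v = t *: y + (v - t *: y) by rewrite addrC subrK.
  apply: coneD.
    apply: coneZ; [exact: ltW|apply: IH => //].
    by apply: leq_trans ly _; rewrite -ltnS.
  apply: IH => //; last by rewrite evB evZ hv hy mulr0 subrr.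
  by apply: leq_trans (loose_lt tt uU uv uw) _; rewrite -ltnS.
have {}hmin w : pos U w -> ev h w = 0 -> tight_sub U v w -> (loose w < loose v)%N -> w = 0.
  move=> pw hw ts lw; apply/eqP/negPn/negP => w0.
  by apply: hmin; exists w.
have fr y : pos U y -> y != 0 -> tight_sub U v y -> ev h y = 0 -> exists2 t, 0 < t & v = t *: y.
  by move=> py y0 ts hy; exact: face_ray hv hy hmin.
have := cone_split rsU (gen pv).
set S := [seq r <- rs | _] => cS.
have SP r : r \in S -> r \in rs /\ tight_sub U v (emb r).
  rewrite mem_filter => /andP[/forallP ht rin]; split=> // u uU uv.
  have ui : (index u U < size U)%N by rewrite index_mem.
  have := ht (Ordinal ui); rewrite /= nth_index // uv eqxx /= => /eqP.
  by [].
have done0 r : r \in rs -> tight_sub U v (emb r) -> ev h (emb r) = 0 -> emb r != 0 -> cone rs' v.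
  move=> rin ts hr r0; have [t t0 ->] := fr _ (rsU rin) r0 ts hr.
  by apply: cone1; [exact: ltW|apply: mem_rs'1 => //; rewrite hr].
have [/hasP[r rS /andP[/eqP hr r0]]|/hasPn nz] :=
    boolP (has (fun r => (ev h (emb r) == 0) && (emb r != 0)) S).
  by have [rin ts] := SP r rS; exact: done0 hr r0.
(* With all rays of the face on one side, every term of a combination in the hyperplane would
   vanish. Hence there are rays on both sides. *)
have h0 : forall w, cone S w -> (forall r, r \in S -> 0 <= ev h (emb r)) -> ev h w = 0 -> w = 0.
  move=> w cw hp; have nn : forall x, cone S x -> 0 <= ev h x.
    by move=> x; elim=> [|c r x' c0 rS _ IHx]; rewrite ?ev0 // evD evZ addr_ge0 // mulr_ge0 // hp.
  elim: cw => // c r x c0 rS cx IHx; rewrite evD evZ => e.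
  have a1 : 0 <= c * ev h (emb r) by rewrite mulr_ge0 // hp.
  have a2 := nn x cx.
  rewrite IHx; last by lra.
  have : c * ev h (emb r) = 0 by lra.
  move/eqP; rewrite mulf_eq0 => /orP[/eqP->|]; first by rewrite scale0r addr0.
  by have := nz r rS; rewrite negb_and => /orP[/negbTE->//|]; rewrite negbK => /eqP->; rewrite scaler0 addr0.
have h0' : forall w, cone S w -> (forall r, r \in S -> ev h (emb r) <= 0) -> ev h w = 0 -> w = 0.
  move=> w cw hp; have nn : forall x, cone S x -> ev h x <= 0.
    move=> x; elim=> [|c r x' c0 rS _ IHx]; rewrite ?ev0 // evD evZ.
    by have := mulr_ge0 c0 (_ : 0 <= - ev h (emb r)); rewrite oppr_ge0 => /(_ (hp r rS)); lra.
  elim: cw => // c r x c0 rS cx IHx; rewrite evD evZ => e.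
  have a1 : c * ev h (emb r) <= 0.
    by have := mulr_ge0 c0 (_ : 0 <= - ev h (emb r)); rewrite oppr_ge0 => /(_ (hp r rS)); lra.
  have a2 := nn x cx.
  rewrite IHx; last by lra.
  have : c * ev h (emb r) = 0 by lra.
  move/eqP; rewrite mulf_eq0 => /orP[/eqP->|]; first by rewrite scale0r addr0.
  by have := nz r rS; rewrite negb_and => /orP[/negbTE->//|]; rewrite negbK => /eqP->; rewrite scaler0 addr0.
have /hasP[q qS hq] : has (fun r => ev h (emb r) < 0) S.
  apply/negPn/negP => /hasPn hn; move/eqP: v0; apply; apply: h0 => // r rS.
  by rewrite leNgt hn.
have /hasP[p pS hp] : has (fun r => 0 < ev h (emb r)) S.
  apply/negPn/negP => /hasPn hn; move/eqP: v0; apply; apply: h0' => // r rS.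
  by rewrite leNgt hn.
have [pin tp] := SP p pS; have [qin tq] := SP q qS.
(* By minimality, the combination of any two rays of the face on opposite sides lies on the ray of
   [v]. *)
have comb a b : a \in rs -> b \in rs -> 0 < ev h (emb a) -> ev h (emb b) < 0 ->
    tight_sub U v (emb a) -> tight_sub U v (emb b) ->
    exists2 t, 0 < t & ev h (emb a) *: emb b - ev h (emb b) *: emb a = t *: v.
  move=> ain bin ha hb ta tb; set y := _ - _.
  have yE : y = ev h (emb a) *: emb b + (- ev h (emb b)) *: emb a by rewrite scaleNr.
  have py : pos U y.
    by rewrite yE; apply: pos_comb; [exact: rsU|exact: rsU|exact: ltW|rewrite oppr_ge0 ltW].
  have hy : ev h y = 0 by rewrite evB !evZ mulrC subrr.
  have ty : tight_sub U v y.
    by move=> u uU uv; rewrite evB !evZ (ta u uU uv) (tb u uU uv) !mulr0 subrr.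
  have y0 : y != 0.
    apply/negP => /eqP e0.
    have z : emb a = 0.
      apply: pointed => u uU; have := congr1 (ev u) e0; rewrite ev0 yE evD !evZ.
      have := mulr_ge0 (ltW ha) (rsU bin uU).
      have hb' : 0 < - ev h (emb b) by rewrite oppr_gt0.
      have := mulr_ge0 (ltW hb') (rsU ain uU) => m1 m2 e.
      have : - ev h (emb b) * ev u (emb a) = 0 by lra.
      by move/eqP; rewrite mulf_eq0 gt_eqF //= => /eqP.
    by move: ha; rewrite z ev0 ltxx.
  have [t t0 ->] := fr y py y0 ty hy.
  by exists t^-1; rewrite ?invr_gt0 // scalerA mulVf ?scale1r // gt_eqF.
have [t t0 tE] := comb p q pin qin hp hq tp tq.
have evt u : ev h (emb p) * ev u (emb q) - ev h (emb q) * ev u (emb p) = t * ev u v.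
  by rewrite -!evZ -evB tE.
have [ad|nad] := boolP (adjacent tri (p, zmask U p) (q, zmask U q)).
  have rin := mem_rs'2 pin qin hp hq ad.
  move: (hp) (hq); rewrite !ev_emb => hp' hq'.
  have [g g0 gE] := zcombP hp' hq'.
  have -> : v = (t^-1 * g) *: emb (zcomb h p q).
    by rewrite -scalerA gE -!ev_emb tE scalerA mulVf ?scale1r // gt_eqF.
  by apply: cone1 => //; rewrite mulr_ge0 ?invr_ge0 // ltW.
move: nad; rewrite /adjacent negbK hasbE => /hasP[[r mr] /mapP[r' rin' [-> ->]]] /=.
case: ifP => // ms; have := msub3P ms.
case: eqP => // rp; case: eqP => // rq ms' _.
have tr : tight_sub U v (emb r').
  move=> u uU uv; have pu := tp u uU uv; have qu := tq u uU uv.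
  by move: pu qu; rewrite !ev_emb => /zR_eq0 pu /zR_eq0 qu; apply/zR_eq0; exact: ms'.
have [r0|r0] := eqVneq (emb r') 0.
  have : p = r' by apply: anti => // u uU _; rewrite r0 ev0.
  by move=> e; case: rp.
have [hr|hr|hr] := ltgtP (ev h (emb r')) 0; last exact: done0 hr r0.
- have [t3 t30 t3E] := comb p r' pin rin' hp hr tp tr.
  have evt3 u : ev h (emb p) * ev u (emb r') - ev h (emb r') * ev u (emb p) = t3 * ev u v.
    by rewrite -!evZ -evB t3E.
  (* Eliminating [v] between two such relations expresses [r'] through [p] and [q]. The sign of [dl]
     decides which of the tight sets of [r'] and [q] contains the other, against [anti]. *)
  pose dl := t * ev h (emb r') - t3 * ev h (emb q).
  have key u : t * ev h (emb p) * ev u (emb r') =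
      t3 * ev h (emb p) * ev u (emb q) + dl * ev u (emb p).
    have e1 := evt u; have e2 := evt3 u; rewrite /dl.
    have : t * (ev h (emb p) * ev u (emb r') - ev h (emb r') * ev u (emb p)) =
       t3 * (ev h (emb p) * ev u (emb q) - ev h (emb q) * ev u (emb p)).
      by rewrite e1 e2 mulrCA.
    by lra.
  have [d0|d0] := leP 0 dl.
    case: rq; apply: anti => // u uU ru; have := key u; rewrite ru mulr0 => e.
    have a1 := mulr_ge0 (mulr_ge0 (ltW t30) (ltW hp)) (rsU qin uU).
    have a2 := mulr_ge0 d0 (rsU pin uU).
    have : t3 * ev h (emb p) * ev u (emb q) = 0 by lra.
    by move/eqP; rewrite mulf_eq0 gt_eqF ?mulr_gt0 //= => /eqP.
  case: rq; symmetry; apply: anti => // u uU qu; have := key u; rewrite qu mulr0 add0r => e.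
  have a1 := mulr_ge0 (mulr_ge0 (ltW t0) (ltW hp)) (rsU rin' uU).
  have d0' : 0 <= - dl by rewrite oppr_ge0 ltW.
  have a2 := mulr_ge0 d0' (rsU pin uU).
  have : t * ev h (emb p) * ev u (emb r') = 0 by lra.
  by move/eqP; rewrite mulf_eq0 gt_eqF ?mulr_gt0 //= => /eqP.
have [t2 t20 t2E] := comb r' q rin' qin hr hq tr tq.
have evt2 u : ev h (emb r') * ev u (emb q) - ev h (emb q) * ev u (emb r') = t2 * ev u v.
  by rewrite -!evZ -evB t2E.
have hq' : 0 < - ev h (emb q) by rewrite oppr_gt0.
pose dl := t2 * ev h (emb p) - t * ev h (emb r').
have key u : t * (- ev h (emb q)) * ev u (emb r') =
    t2 * (- ev h (emb q)) * ev u (emb p) + dl * ev u (emb q).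
  have e1 := evt u; have e2 := evt2 u; rewrite /dl.
  have : t2 * (ev h (emb p) * ev u (emb q) - ev h (emb q) * ev u (emb p)) =
     t * (ev h (emb r') * ev u (emb q) - ev h (emb q) * ev u (emb r')).
    by rewrite e1 e2 mulrCA.
  by lra.
have [d0|d0] := leP 0 dl.
  case: rp; apply: anti => // u uU ru; have := key u; rewrite ru mulr0 => e.
  have a1 := mulr_ge0 (mulr_ge0 (ltW t20) (ltW hq')) (rsU pin uU).
  have a2 := mulr_ge0 d0 (rsU qin uU).
  have : t2 * (- ev h (emb q)) * ev u (emb p) = 0 by lra.
  by move/eqP; rewrite mulf_eq0 gt_eqF ?mulr_gt0 //= => /eqP.
case: rp; symmetry; apply: anti => // u uU pu; have := key u; rewrite pu mulr0 add0r => e.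
have a1 := mulr_ge0 (mulr_ge0 (ltW t0) (ltW hq')) (rsU rin' uU).
have d0' : 0 <= - dl by rewrite oppr_ge0 ltW.
have a2 := mulr_ge0 d0' (rsU qin uU).
have : t * (- ev h (emb q)) * ev u (emb r') = 0 by lra.
by move/eqP; rewrite mulf_eq0 gt_eqF ?mulr_gt0 //= => /eqP.
Qed.

(** Grouping a conic decomposition by the sign of [h] gives [v = a + b] with [a] already in the new
    cone. Subtracting [s *: a] with [s = ev h v / ev h a] leads to the hyperplane, where
    [zero_section] applies; [s <= 1] keeps the difference in the old cone. *)
Lemma dd_step_gen v : pos (h :: U) v -> cone rs' v.
Proof.
move=> pv; have hv : 0 <= ev h v by apply: pv; exact: mem_head.
have {}pv : pos U v by move=> u uU; apply: pv; rewrite inE uU orbT.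
have : exists a b, [/\ v = a + b, pos U a, pos U b, 0 <= ev h a & ev h b <= 0 /\ cone rs' a].
  elim: (gen pv) => [|c r w c0 rin _ [a [b [-> pa pb ha [hb ca]]]]].
    by exists 0, 0; split; rewrite ?addr0 ?ev0 //; [move=> u _; rewrite ev0|move=> u _; rewrite ev0|split=> //; exact: Cone0].
  have pr : pos U (c *: emb r) by move=> u uU; rewrite evZ mulr_ge0 // rsU.
  have pD x y : pos U x -> pos U y -> pos U (x + y).
    by move=> px py u uU; rewrite evD addr_ge0 ?px ?py.
  have [hr|hr] := leP 0 (ev h (emb r)).
    exists (c *: emb r + a), b; split=> //; first by rewrite addrA.
    - exact: pD.
    - by rewrite evD evZ addr_ge0 // mulr_ge0.
    - by split=> //; apply: ConeS => //; exact: mem_rs'1.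
  exists a, (c *: emb r + b); split=> //; first by rewrite addrCA.
    exact: pD.
  split=> //; rewrite evD evZ; have := mulr_ge0 c0 (_ : 0 <= - ev h (emb r)).
  by rewrite oppr_ge0 => /(_ (ltW hr)); lra.
case=> a [b [vE pa pb ha [hb ca]]].
have [ha0|ha0] := eqVneq (ev h a) 0.
  apply: zero_section => //; move: hv; rewrite vE evD ha0 add0r => hv.
  by apply/eqP; rewrite eq_le hb.
have ha' : 0 < ev h a by rewrite lt_def ha0.
pose s := ev h v / ev h a.
have s0 : 0 <= s by rewrite divr_ge0.
have s1 : s <= 1 by rewrite ler_pdivrMr // mul1r vE evD gerDl.
have -> : v = s *: a + (v - s *: a) by rewrite addrC subrK.
apply: coneD; first exact: coneZ.
have vE2 : v - s *: a = (1 - s) *: a + b.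
  by rewrite vE scalerBl scale1r addrAC.
apply: zero_section.
  move=> u uU; rewrite vE2 evD evZ addr_ge0 ?pb // mulr_ge0 ?pa // subr_ge0.
  by [].
by rewrite evB evZ /s divfK ?subrr // gt_eqF.
Qed.

Lemma dd_step_pos r : r \in rs' -> pos (h :: U) (emb r).
Proof.
rewrite /rs' /dd_step map_cat mem_cat => /orP[|].
  case/mapP=> x /mapP[y]; rewrite mem_filter => /andP[y0 /mapP[z zin yE]] -> -> /= u; rewrite {}yE /= in y0 *.
  rewrite inE => /orP[/eqP->|uU]; last exact: rsU.
  by rewrite ev_emb zI_ge0.
rewrite -map_comp => /mapP[c /flattenP[l /mapP[p]]].
rewrite mem_filter => /andP[p0 /mapP[p' pin pE]] -> /mapP[q].
rewrite !mem_filter => /andP[_ /andP[q0 /mapP[q' qin qE]]] -> -> /=.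
move: p0 q0; rewrite pE qE /= => p0 q0.
have p1 : 0 < zR (zdot h p') by rewrite lt_def zI_ge0 zI_eq0; lia.
have q1 : zR (zdot h q') < 0 by rewrite ltNge zI_ge0; lia.
have [g g0 gE] := zcombP p1 q1 => u uin.
rewrite -(pmulr_rge0 _ g0) -evZ gE evB !evZ.
move: uin; rewrite inE => /orP[/eqP->|uU]; first by rewrite !ev_emb mulrC subrr.
by rewrite subr_ge0 (@le_trans _ _ 0) // ?mulr_ge0 ?rsU // ?(ltW p1) // mulr_le0_ge0 ?rsU // ltW.
Qed.

End Step.

End DoubleDescription.

Lemma mem_ineqs u : (u \in ineqs) = (u \in chamber_ineqs) || (u \in triangle_ineqs).
Proof. exact: mem_cat. Qed.

Lemma all_in2 (T : eqType) (f : T -> T -> bool) (l1 l2 : seq T) :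
  all (fun h => all (f h) l2) l1 -> forall h r, h \in l1 -> r \in l2 -> f h r.
Proof. by move=> /allP hl h r /hl /allP hr; exact: hr. Qed.

Definition tagged (U rs : seq (seq Z)) : seq ray := [seq (r, zmask U r) | r <- rs].

Lemma dd_final_tagged :
  dd_final = dd_run chamber_ineqs (tagged chamber_ineqs chamber_rays) triangle_ineqs.
Proof. by rewrite /dd_final /tagged. Qed.

Local Opaque ineqs rays dd_final.

(** * Facets and edges of the cone *)

Section TriangleCone.
Variable R : realType.
Local Notation zR := (zI R).
Implicit Types (v w y : 'M[R]_3) (u r p q h : seq Z).

Lemma dd_step_tagged U rs h :
  dd_step U (tagged U rs) h = tagged (h :: U) [seq x.1 | x <- dd_step U (tagged U rs) h].
Proof.
rewrite /dd_step /tagged map_cat map_cat; congr (_ ++ _).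
  rewrite -!map_comp; apply/eq_in_map => x.
  by rewrite mem_filter => /andP[_ /mapP[z _ ->]] /=.
by rewrite -!map_comp; apply: eq_map => x.
Qed.

Lemma antichainP U rs : antichain (tagged U rs) ->
  forall r t, r \in rs -> t \in rs -> tight_sub U (emb R r) (emb R t) -> r = t.
Proof.
move=> ac r t rin tin ts; apply/eqP/negPn/negP => ne; move/negP: ac; apply.
rewrite hasbE; apply/hasP; exists (r, zmask U r); first by apply/mapP; exists r.
rewrite hasbE; apply/hasP; exists (t, zmask U t); first by apply/mapP; exists t.
rewrite msub3_intro ?ne // => u uU ur _.
by apply/zR_eq0; rewrite -ev_emb; apply: ts => //; rewrite ev_emb; apply/zR_eq0.
Qed.

Lemma dd_runP hs U rs out :
  (forall y, (forall u, u \in U -> ev u y = 0) -> y = 0) ->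
  (forall r, r \in rs -> pos U (emb R r)) ->
  (forall v, pos U v -> cone rs v) ->
  dd_run U (tagged U rs) hs = Some out ->
  forall v, pos (catrev hs U) v -> cone [seq x.1 | x <- out] v.
Proof.
elim: hs U rs => [|h hs IH] U rs pt rsU gn /=.
  by move=> [<-]; rewrite -map_comp map_id.
case: ifP => // ac; rewrite dd_step_tagged => run.
have an := antichainP ac.
apply: (IH _ _ _ _ _ run).
- by move=> y hy; apply: pt => u uU; apply: hy; rewrite inE uU orbT.
- by move=> r; exact: (dd_step_pos rsU).
- by move=> v; exact: (dd_step_gen pt rsU gn an).
Qed.

Lemma evE u v : ev u v =
  zR (nth 0%ZZ u 0) * v 0 0 + zR (nth 0%ZZ u 1) * v 0 1 + zR (nth 0%ZZ u 2) * v 0 2 +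
  (zR (nth 0%ZZ u 3) * v 1 0 + zR (nth 0%ZZ u 4) * v 1 1 + zR (nth 0%ZZ u 5) * v 1 2) +
  (zR (nth 0%ZZ u 6) * v 2 0 + zR (nth 0%ZZ u 7) * v 2 1 + zR (nth 0%ZZ u 8) * v 2 2).
Proof.
rewrite /ev !big_ord_recl !big_ord0 !addr0 !addrA /=.
have -> : lift ord0 ord0 = 1 :> 'I_3 by apply: val_inj.
by have -> : lift ord0 (lift ord0 ord0) = 2 :> 'I_3 by apply: val_inj.
Qed.

Lemma zIm1 : zR (-1)%ZZ = -1. Proof. by rewrite (zIN R 1%ZZ) zI1. Qed.

Lemma ord3 (i : 'I_3) : [\/ i = 0, i = 1 | i = 2].
Proof.
case: i => [[|[|[|]]] h] //.
- by apply: Or31; apply: val_inj.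
- by apply: Or32; apply: val_inj.
- by apply: Or33; apply: val_inj.
Qed.

Lemma mx3P v w : (forall i, [/\ v i 0 = w i 0, v i 1 = w i 1 & v i 2 = w i 2]) -> v = w.
Proof.
by move=> h; apply/matrixP => i j; have [a b c] := h i; case: (ord3 j) => ->.
Qed.

(** The product of the three chambers is simplicial and the two lists are in matching order, so the
    coefficients are the values of the inequalities. *)
Lemma chamber_cone v : pos chamber_ineqs v -> cone chamber_rays v.
Proof.
move=> hv; have hk k : (k < size chamber_ineqs)%N -> 0 <= ev (nth [::] chamber_ineqs k) v.
  by move=> k9; apply: hv; exact: mem_nth.
have g0 := hk 0%N isT; have g1 := hk 1%N isT; have g2 := hk 2%N isT.
have g3 := hk 3%N isT; have g4 := hk 4%N isT; have g5 := hk 5%N isT.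
have g6 := hk 6%N isT; have g7 := hk 7%N isT; have g8 := hk 8%N isT.
have -> : v = ev (nth [::] chamber_ineqs 0) v *: emb R (nth [::] chamber_rays 0) +
 (ev (nth [::] chamber_ineqs 1) v *: emb R (nth [::] chamber_rays 1) +
 (ev (nth [::] chamber_ineqs 2) v *: emb R (nth [::] chamber_rays 2) +
 (ev (nth [::] chamber_ineqs 3) v *: emb R (nth [::] chamber_rays 3) +
 (ev (nth [::] chamber_ineqs 4) v *: emb R (nth [::] chamber_rays 4) +
 (ev (nth [::] chamber_ineqs 5) v *: emb R (nth [::] chamber_rays 5) +
 (ev (nth [::] chamber_ineqs 6) v *: emb R (nth [::] chamber_rays 6) +
 (ev (nth [::] chamber_ineqs 7) v *: emb R (nth [::] chamber_rays 7) +
  ev (nth [::] chamber_ineqs 8) v *: emb R (nth [::] chamber_rays 8)))))))).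
  rewrite !evE /chamber_ineqs /chamber_rays /= !zI0 !zI1 !zIm1.
  rewrite ?(mul0r, add0r, addr0, mul1r, mulN1r).
  apply: mx3P => i; rewrite !mxE.
  by case: (ord3 i) => ->; rewrite /= !zI0 !zI1; split; ring.
do 8 (apply: coneD; first by apply: cone1 => //; exact: mem_nth).
by apply: cone1 => //; exact: mem_nth.
Qed.

Lemma chamber_pointed y : (forall u, u \in chamber_ineqs -> ev u y = 0) -> y = 0.
Proof.
move=> hy; have hk k : (k < size chamber_ineqs)%N -> ev (nth [::] chamber_ineqs k) y = 0.
  by move=> k9; apply: hy; exact: mem_nth.
have g0 := hk 0%N isT; have g1 := hk 1%N isT; have g2 := hk 2%N isT.
have g3 := hk 3%N isT; have g4 := hk 4%N isT; have g5 := hk 5%N isT.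
have g6 := hk 6%N isT; have g7 := hk 7%N isT; have g8 := hk 8%N isT.
move: g0 g1 g2 g3 g4 g5 g6 g7 g8.
rewrite !evE /chamber_ineqs /= !zI0 !zI1 !zIm1 ?(mul0r, add0r, addr0, mul1r, mulN1r) => *.
by apply: mx3P => i; rewrite !mxE; case: (ord3 i) => ->; split; lra.
Qed.

Lemma cone_sub (rs rs' : seq (seq Z)) v : {subset rs <= rs'} -> cone rs v -> cone rs' v.
Proof.
move=> sb; elim=> [|c r w c0 rin _ IH]; first exact: Cone0.
by apply: ConeS => //; exact: sb.
Qed.

Lemma chamber_rays_pos : all (fun h => all (fun r => (0 <=? zdot h r)%ZZ) chamber_rays) chamber_ineqs.
Proof. by vm_compute. Qed.

Definition tcone : set 'M[R]_3 := [set v | pos ineqs v].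

Lemma tcone_cone v : tcone v <-> cone rays v.
Proof.
split; last first.
  apply: cone_pos => r rin u uin; rewrite ev_emb zI_ge0.
  by have /allP/(_ u uin)/allP := rays_ineqs; exact.
move=> hv; have [out E hout] := rays_onlyP dd_final_rays.
have cv : cone [seq x.1 | x <- out] v.
  apply: (dd_runP chamber_pointed _ chamber_cone (etrans (esym dd_final_tagged) E)).
    move=> r rin u uin; rewrite ev_emb zI_ge0.
    exact: (all_in2 chamber_rays_pos uin rin).
  move=> u uin; have := hv u; rewrite mem_ineqs; apply.
  by move: uin; rewrite (catrevE triangle_ineqs) mem_cat (mem_rev triangle_ineqs) orbC; exact: id.
by apply: cone_sub cv => r /mapP[x xin ->]; exact: hout.
Qed.

Lemma ev_is_linear u : linear (ev u : 'M[R]_3 -> R^o).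
Proof. by move=> c v w; rewrite evD evZ. Qed.
HB.instance Definition _ u := GRing.isLinear.Build R 'M[R]_3 R^o _ (ev u) (ev_is_linear u).

Definition evl u : 'Hom('M[R]_3, R^o) := linfun (ev u : 'M[R]_3 -> R^o).

Lemma evlE u v : evl u v = ev u v. Proof. by rewrite lfunE. Qed.

Lemma tcone_polyhedral : polyhedral_cone tcone.
Proof.
exists [seq evl u | u <- ineqs]; apply/seteqP; split=> v.
  by move=> hv f /mapP[u uin ->]; rewrite evlE; exact: hv.
by move=> hv u uin; rewrite -evlE; apply: hv; exact: map_f.
Qed.

Lemma tconeD v w : tcone v -> tcone w -> tcone (v + w).
Proof. by move=> hv hw u uin; rewrite evD addr_ge0 ?hv ?hw. Qed.

Lemma tconeZ c v : 0 <= c -> tcone v -> tcone (c *: v).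
Proof. by move=> c0 hv u uin; rewrite evZ mulr_ge0 ?hv. Qed.

(** A form positive at [v] survives a small displacement, and a form that vanishes along [w]
    survives any. *)
Lemma pos_perturb (U : seq (seq Z)) v w :
  (forall u, u \in U -> 0 < ev u v \/ 0 <= ev u v /\ ev u w = 0) ->
  exists2 e, 0 < e & pos U (v + e *: w).
Proof.
elim: U => [|a U IH] h; first by exists 1.
have [|e e0 he] := IH; first by move=> u uU; apply: h; rewrite inE uU orbT.
have hU : forall e', 0 < e' -> e' <= e -> pos U (v + e' *: w).
  move=> e' e'0 e'e u uU; have := he u uU; rewrite !evD !evZ => he'.
  have vu : 0 <= ev u v by have [|/ltW|[]] // := h u; rewrite inE uU orbT.
  have [w0|/ltW w0] := leP 0 (ev u w).
    by rewrite addr_ge0 // mulr_ge0 // ltW.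
  have : e * ev u w <= e' * ev u w by rewrite ler_wnM2r.
  by lra.
have [av|[av aw]] := h a (mem_head _ _); last first.
  exists e => // u; rewrite inE => /orP[/eqP->|]; last exact: he.
  by rewrite evD evZ aw mulr0 addr0.
pose d := ev a v / (1 + `|ev a w|).
have d0 : 0 < d by rewrite divr_gt0 // ltr_pwDl.
have m0 : 0 < Num.min e d by rewrite lt_min e0.
exists (Num.min e d) => // u; rewrite inE => /orP[/eqP->|uU]; last first.
  by apply: hU => //; rewrite ge_min lexx.
rewrite evD evZ.
have : Num.min e d * `|ev a w| <= ev a v.
  apply: (@le_trans _ _ (d * `|ev a w|)); first by rewrite ler_wpM2r // ge_min lexx orbT.
  rewrite /d mulrAC ler_pdivrMr ?ltr_pwDl // ler_wpM2l ?(ltW av) //.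
  by rewrite lerDr.
have := ler_norm (- (Num.min e d * ev a w)); rewrite normrN normrM gtr0_norm //.
by lra.
Qed.

Lemma span_dim_uniq (V : vectType R) (S : set V) d e : span_dim S d -> span_dim S e -> d = e.
Proof.
move=> [U [<- SU hU]] [W [<- SW hW]].
by apply/eqP; rewrite eqn_leq !dimvS ?hU ?hW.
Qed.

(** Every [w] in [U] is a multiple of the difference of two elements of [S]. *)
Lemma span_dim_open (S : set 'M[R]_3) (U : {vspace 'M[R]_3}) (p : 'M[R]_3) :
  S `<=` [set v | v \in U] -> S p ->
  (forall w, w \in U -> exists2 e : R, 0 < e & S (p + e *: w)) -> span_dim S (\dim U).
Proof.
move=> SU Sp h; exists U; split=> // W SW; apply/subvP => w wU.
have [e e0 he] := h w wU.
have -> : w = e^-1 *: ((p + e *: w) - p).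
  by rewrite addrAC subrr add0r scalerA mulVf ?scale1r // gt_eqF.
by rewrite memvZ // memvB //; exact: SW.
Qed.

Definition tfacet h : set 'M[R]_3 := tcone `&` [set v | ev h v = 0].

Lemma facet_pt h : h \in ineqs ->
  ev h (emb R (facet_point h)) = 0 /\
  forall g, g \in ineqs -> g != h -> 0 < ev g (emb R (facet_point h)).
Proof.
move=> hin; have /allP/(_ h hin)/andP[/eqP h0 /allP hg] := facet_pointP.
split; first by rewrite ev_emb h0 zI0.
move=> g gin ne; have := hg g gin; rewrite (negbTE ne) /= => g0.
by rewrite ev_emb lt_def zI_ge0 zI_eq0; apply/andP; split; lia.
Qed.

Lemma ineqs_other h : exists2 g, g \in ineqs & g != h.
Proof.
have := ineqs_uniq; have := ineqs_size; case: ineqs => [|a [|b l]] // _ /= /andP[ab _].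
have [e|ne] := eqVneq a h; last by exists a; rewrite ?mem_head.
exists b; first by rewrite !inE eqxx orbT.
by move: ab; rewrite e inE negb_or eq_sym => /andP[].
Qed.

Lemma tfacet_pt h : h \in ineqs -> tfacet h (emb R (facet_point h)).
Proof.
move=> hin; have [h0 hg] := facet_pt hin; split=> // u uin.
by have [->|ne] := eqVneq u h; [rewrite h0|exact/ltW/hg].
Qed.

Lemma dim_lker_evl h : h \in ineqs -> \dim (lker (evl h)) = 8%N.
Proof.
move=> hin; have [g gin ne] := ineqs_other h.
have [_ /(_ h hin)] := facet_pt gin; rewrite eq_sym => /(_ ne) hg.
have := limg_ker_dim (evl h) fullv; rewrite capfv dimvf /dim /=.
have -> : \dim (limg (evl h)) = 1%N.
  apply/eqP; rewrite eqn_leq; apply/andP; split.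
    by apply: leq_trans (dimvS (subvf _)) _; rewrite dimvf.
  rewrite lt0n dimv_eq0; apply/negP => /eqP z.
  have : evl h (emb R (facet_point g)) \in limg (evl h) by exact: memv_img (memvf _).
  by rewrite z memv0 evlE gt_eqF.
by rewrite addn1 => -[].
Qed.

(** Relative interior points of two distinct facets add up to an interior point. *)
Lemma tcone_interior : exists p : 'M[R]_3, forall h, h \in ineqs -> 0 < ev h p.
Proof.
have [h hin _] := ineqs_other [::]; have [g gin ne] := ineqs_other h.
have [h0 hh] := facet_pt hin; have [g0 hg] := facet_pt gin.
exists (emb R (facet_point h) + emb R (facet_point g)) => u uin; rewrite evD.
have [->|uh] := eqVneq u h; first by rewrite h0 add0r hg // eq_sym.
by rewrite ltr_pwDl ?hh //; exact: (tfacet_pt gin).1.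
Qed.

Lemma span_tcone : span_dim tcone 9.
Proof.
have [p hp] := tcone_interior.
have d9 : \dim (fullv : {vspace 'M[R]_3}) = 9%N by rewrite dimvf.
rewrite -d9; apply: (@span_dim_open _ _ p).
- by move=> v _ /=; exact: memvf.
- by move=> u uin; exact/ltW/hp.
by move=> w _; apply: pos_perturb => u uin; left; exact: hp.
Qed.

Lemma span_tfacet h : h \in ineqs -> span_dim (tfacet h) 8.
Proof.
move=> hin; rewrite -(dim_lker_evl hin); have [h0 hh] := facet_pt hin.
apply: (@span_dim_open _ _ (emb R (facet_point h))).
- by move=> v [_ /= hv]; rewrite memv_ker evlE hv.
- exact: tfacet_pt.
move=> w; rewrite memv_ker evlE => /eqP w0.
have [|e e0 he] := @pos_perturb ineqs (emb R (facet_point h)) w.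
  move=> u uin; have [->|ne] := eqVneq u h; first by right; rewrite h0 w0.
  by left; exact: hh.
by exists e => //; split=> //=; rewrite evD evZ h0 w0 mulr0 addr0.
Qed.

Lemma tfacet_facet h : h \in ineqs -> facet tcone (tfacet h).
Proof.
move=> hin; split; last by exists 8; split; [exact: span_tcone|exact: span_tfacet].
exists (evl h); first by move=> v hv; rewrite evlE; exact: hv.
by apply/seteqP; split=> v [hv] /=; rewrite evlE.
Qed.

(** If [F] lies in some [tfacet h], both span the same hyperplane and [f] vanishes on it. Otherwise
    a sum of points of [F], one off each facet, is interior to the cone; there [f] vanishes while it
    is nonnegative nearby, so [f = 0] and [F] has dimension 9. *)
Lemma facet_tfacet F : facet tcone F -> exists2 h, h \in ineqs & F = tfacet h.
Proof.
move=> [[f fpos FE] [d [sP sF]]].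
have d8 : span_dim F 8 by have := span_dim_uniq sP span_tcone; case=> <-.
have Fcone v : F v -> tcone v by rewrite FE => -[].
have Fz v : F v -> f v = 0 by rewrite FE => -[].
have fD x y : f (x + y) = f x + f y by exact: linearD.
have fZ c x : f (c *: x) = c * f x by exact: linearZ.
have [[h hin Fh]|nh] := pselect (exists2 h, h \in ineqs & F `<=` tfacet h).
  exists h => //; apply/seteqP; split=> // v [hv /= v0].
  have [U [dU FU hU]] := d8.
  have /hU Uh : F `<=` [set v | v \in lker (evl h)].
    by move=> w /Fh[_ /= w0]; rewrite memv_ker evlE w0.
  have UE : U = lker (evl h) by apply/eqP; rewrite eqEdim Uh dU dim_lker_evl.
  have /hU Uf : F `<=` [set v | v \in lker f].
    by move=> w /Fz w0; rewrite /= memv_ker w0.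
  rewrite FE; split=> //=; apply/eqP; rewrite -memv_ker; move/subvP: Uf; apply.
  by rewrite UE memv_ker evlE v0.
have [s [Fs hs]] : exists s, F s /\ forall h, h \in ineqs -> 0 < ev h s.
  have F0 : F 0 by rewrite FE; split; [move=> u _; rewrite ev0|exact: linear0].
  have : forall l : seq (seq Z), {subset l <= ineqs} -> exists s, F s /\ forall h, h \in l -> 0 < ev h s.
    elim=> [|a l IH] sl; first by exists 0.
    have [|s [Fs hs]] := IH; first by move=> x xl; apply: sl; rewrite inE xl orbT.
    have ain : a \in ineqs by apply: sl; exact: mem_head.
    have [w [Fw aw]] : exists w, F w /\ 0 < ev a w.
      apply: contra_notP nh => hn; exists a => // w Fw; split; first exact: Fcone.
      apply/eqP; rewrite /= eq_le (Fcone _ Fw) // andbT leNgt; apply/negP => lt.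
      by apply: hn; exists w.
    exists (s + w); split.
      rewrite FE; split; first by apply: tconeD; exact: Fcone.
      by rewrite /= fD (Fz _ Fs) (Fz _ Fw) addr0.
    move=> h; rewrite evD inE => /orP[/eqP->|hl].
      by rewrite ltr_wpDl // (Fcone _ Fs).
    rewrite ltr_pwDl ?hs // (Fcone _ Fw) //; apply: sl.
    by rewrite inE hl orbT.
  by move=> /(_ ineqs); apply.
have f0 w : 0 <= (f w : R).
  have [|e e0 he] := @pos_perturb ineqs s w; first by move=> u uin; left; exact: hs.
  have := fpos _ he; rewrite fD fZ (Fz _ Fs) add0r.
  by rewrite pmulr_rge0.
have fz w : f w = 0.
  apply/eqP; rewrite eq_le f0 andbT -oppr_ge0.
  by have := f0 (- w); rewrite linearN.
have : F = tcone by rewrite FE; apply/seteqP; split=> [v []//|v hv]; split=> //=.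
by move=> e; have := span_dim_uniq d8; rewrite e => /(_ _ span_tcone).
Qed.

Lemma card_nth (T : Type) (l : seq (seq Z)) (g : seq Z -> set T) (S : set (set T)) n :
  size l = n -> uniq l ->
  {in l &, forall h h', g h = g h' -> h = h'} ->
  (forall h, h \in l -> S (g h)) -> (forall F, S F -> exists2 h, h \in l & F = g h) ->
  (S #= `I_n)%card.
Proof.
move=> sz ul gi gS Sg.
have -> : S = (fun i => g (nth [::] l i)) @` `I_n.
  apply/seteqP; split=> F.
    move=> /Sg[h hin ->]; exists (index h l); last by rewrite nth_index.
    by rewrite /= -sz index_mem.
  by move=> [i /= ilt <-]; apply: gS; rewrite mem_nth // sz.
apply: inj_card_eq => i j; rewrite !inE => il jl /gi e; apply/eqP.
by rewrite -(nth_uniq [::] _ _ ul) ?sz // e // mem_nth ?sz.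
Qed.

Lemma card_facets : ([set F | facet tcone F] #= `I_102)%card.
Proof.
apply: (card_nth ineqs_size ineqs_uniq (g := tfacet)).
- move=> h h' hin hin' e; apply/eqP/negPn/negP => ne.
  have := tfacet_pt hin; rewrite e => -[_ /= z].
  by have [_ /(_ h' hin')] := facet_pt hin; rewrite eq_sym ne z ltxx => /(_ isT).
- by move=> h hin; exact: tfacet_facet.
exact: facet_tfacet.
Qed.

Definition tedge r : set 'M[R]_3 := tcone `&` [set v | ev (edge_form r) v = 0].

Lemma edge_form_pt r : r \in rays ->
  ev (edge_form r) (emb R r) = 0 /\
  forall t, t \in rays -> t != r -> 0 < ev (edge_form r) (emb R t).
Proof.
move=> rin; have /allP/(_ r rin)/andP[/eqP r0 /allP rt] := edge_formP.
split; first by rewrite ev_emb r0 zI0.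
move=> t tin ne; have := rt t tin; rewrite (negbTE ne) /= => t0.
by rewrite ev_emb lt_def zI_ge0 zI_eq0; apply/andP; split; lia.
Qed.

Lemma edge_form_ge0 r v : r \in rays -> tcone v -> 0 <= ev (edge_form r) v.
Proof.
move=> rin /tcone_cone; elim=> [|c t w c0 tin _ IH]; first by rewrite ev0.
rewrite evD evZ addr_ge0 // mulr_ge0 //; have [r0 rt] := edge_form_pt rin.
by have [->|ne] := eqVneq t r; [rewrite r0|exact/ltW/rt].
Qed.

Lemma ray_tcone r : r \in rays -> tcone (emb R r).
Proof. by move=> rin; apply/tcone_cone; rewrite -[emb R r]scale1r; exact: cone1. Qed.

Lemma rays_other r : exists2 t, t \in rays & t != r.
Proof.
have := rays_uniq; have := rays_size; case: rays => [|a [|b l]] // _ /= /andP[ab _].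
have [e|ne] := eqVneq a r; last by exists a; rewrite ?mem_head.
exists b; first by rewrite !inE eqxx orbT.
by move: ab; rewrite e inE negb_or eq_sym => /andP[].
Qed.

(** [edge_form r] is positive on every other ray, so only [r] contributes to a combination on which
    it vanishes. *)
Lemma tedgeP r v : r \in rays -> tedge r v -> exists2 c, 0 <= c & v = c *: emb R r.
Proof.
move=> rin [/tcone_cone]; elim=> [|c t w c0 tin cw IH] /=.
  by exists 0; rewrite ?scale0r.
have [r0 rt] := edge_form_pt rin.
have w0 := edge_form_ge0 rin (proj2 (tcone_cone w) cw).
have t0 := edge_form_ge0 rin (ray_tcone tin).
have ct := mulr_ge0 c0 t0.
rewrite evD evZ => e; have [|d d0 ->] := IH; first by rewrite /=; lra.
have [->|ne] := eqVneq t r.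
  by exists (c + d); rewrite ?addr_ge0 // scalerDl.
have : c * ev (edge_form r) (emb R t) = 0 by lra.
move/eqP; rewrite mulf_eq0 (gt_eqF (rt t tin ne)) orbF => /eqP->.
by exists d; rewrite // scale0r add0r.
Qed.

Lemma ray_neq0 r : r \in rays -> emb R r != 0.
Proof.
move=> rin; have [t tin ne] := rays_other r; apply/eqP => e.
by have [_ /(_ r rin)] := edge_form_pt tin; rewrite e ev0 ltxx eq_sym ne => /(_ isT).
Qed.

Lemma tedge_ray r : r \in rays -> tedge r (emb R r).
Proof. by move=> rin; split; [exact: ray_tcone|exact: (edge_form_pt rin).1]. Qed.

Lemma tedge_edge r : r \in rays -> edge tcone (tedge r).
Proof.
move=> rin; split.
  exists (evl (edge_form r)); first by move=> v hv; rewrite evlE; exact: edge_form_ge0.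
  by apply/seteqP; split=> v [hv] /=; rewrite evlE.
exists <[emb R r]>%VS; split; first by rewrite dim_vline ray_neq0.
  by move=> v /(tedgeP rin)[c _ ->] /=; apply/vlineP; exists c.
move=> W hW; apply/subvP => v /vlineP[c ->]; rewrite memvZ //.
by apply: hW; exact: tedge_ray.
Qed.

(** In a conic decomposition of a nonzero vector of [F], the form [f] vanishes at every ray with
    positive coefficient. So [F] contains a listed ray, which spans it. *)
Lemma edge_tedge F : edge tcone F -> exists2 r, r \in rays & F = tedge r.
Proof.
move=> [[f fpos FE] [U [dU FU hU]]].
have [[v [Fv v0]]|nv] := pselect (exists v, F v /\ v != 0); last first.
  have /hU : F `<=` [set v | v \in 0%VS].
    move=> v Fv; rewrite /= memv0; apply/negPn/negP => v0.
    by apply: nv; exists v.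
  by move/dimvS; rewrite dU dimv0.
have [r rin Fr] : exists2 r, r \in rays & F (emb R r).
  move: Fv v0; rewrite FE => -[/tcone_cone]; elim=> [|c r w c0 rin cw IH] /=.
    by rewrite eqxx.
  rewrite linearD linearZ /= => e.
  have fr : 0 <= (f (emb R r) : R) := fpos _ (ray_tcone rin).
  have fw : 0 <= (f w : R) := fpos _ (proj2 (tcone_cone w) cw).
  have e' : c * f (emb R r) + f w = 0 := e.
  have cf := mulr_ge0 c0 fr.
  have [c00|c0'] := eqVneq c 0.
    by rewrite c00 scale0r add0r => w0; apply: IH => //=; lra.
  move=> _; exists r => //; split; first exact: ray_tcone.
  have : c * f (emb R r) = 0 by lra.
  by move/eqP; rewrite mulf_eq0 (negbTE c0') => /eqP.
exists r => //.
have UE : U = <[emb R r]>%VS.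
  apply/esym/eqP; rewrite eqEdim dim_vline ray_neq0 // dU leqnn andbT.
  by rewrite -memvE; exact: FU.
apply/seteqP; split=> {v Fv v0} v.
  move=> Fv'; have : v \in U by exact: FU.
  rewrite UE => /vlineP[k vE]; split; last first.
    by rewrite /= vE evZ (edge_form_pt rin).1 mulr0.
  by move: Fv'; rewrite FE => -[].
move=> /(tedgeP rin)[c c0 ->]; move: Fr; rewrite FE => -[h1 /= h2]; split; first exact: tconeZ.
have fZ x : f (c *: x) = c * f x by exact: linearZ.
by rewrite /= fZ h2 mulr0.
Qed.

Lemma card_edges : ([set F | edge tcone F] #= `I_51)%card.
Proof.
apply: (card_nth rays_size rays_uniq (g := tedge)).
- move=> r t rin tin e; apply/eqP/negPn/negP => ne.
  have := tedge_ray rin; rewrite e => -[_ /= z].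
  by have [_ /(_ r rin)] := edge_form_pt tin; rewrite ne z ltxx => /(_ isT).
- by move=> r rin; exact: tedge_edge.
exact: edge_tedge.
Qed.

End TriangleCone.

(** * Existence of triangles *)

Section RayCertificates.

Definition slots : seq (nat * nat) := [seq (i, k) | i <- iota 0 3, k <- iota 1 3].

(** The coefficient in side [a.1] of the vector $(1,\dots,1,0,\dots,0)$ with [a.2] ones; [zslot a]
    is the vector whose only nonzero coefficient, 1, is this one. *)
Definition zweight (r : seq Z) (a : nat * nat) : Z :=
  (nth 0%ZZ r (3 * a.1 + a.2.-1) - (if (a.2 == 3)%N then 0 else nth 0%ZZ r (3 * a.1 + a.2)))%ZZ.

(* The pairs (m, bs) of blocks whose dimensions add up to n; the sum of the volumes is m
   times the linear form of the ray. *)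
Definition templates (n i j k : nat) : seq (nat * seq block) :=
  [:: (1, [:: Flag i 1; Flag j (n - 1)]); (1, [:: Flag i 2; Flag j (n - 2)]);
      (1, [:: Flag i 3; Flag j (n - 3)]);
      (1, [:: Flag i (n - 2); Flag j 1; Flag k 1]);
      (1, [:: Flag i (n - 3); Flag j 2; Flag k 1]);
      (2, [:: Perp [:: (i, 3); (j, 2)]; Perp [:: (i, 3); (k, 2)]; Flag j 2; Flag k 2]);
      (1, [:: Flag i 3; Flag j 2; Flag k 2]);
      (1, [:: Perp [:: (j, n - 2); (i, 1)]; Flag k (n - 2); Flag i 1]);
      (1, [:: Perp [:: (j, n - 3); (i, 1)]; Flag k (n - 3); Flag i 1]);
      (1, [:: Perp [:: (j, 3); (i, 1)]; Flag k 2; Flag i 2]);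
      (1, [:: Perp [:: (i, n - 3); (j, 2)]; Flag i 1; Flag k (n - 2)]);
      (1, [:: Perp [:: (i, 2); (j, 3)]; Flag k 3; Flag i 2]);
      (1, [:: Perp [:: (j, n - 3); (i, 2)]; Perp [:: (i, n - 2); (j, 1)]; Flag k (n - 2)]);
      (1, [:: Perp [:: (i, n - 3); (j, 2)]; Perp [:: (j, n - 2); (i, 1)]; Flag i 1;
              Flag k (n - 3)])]%N.

Definition candidates (n : nat) : seq (nat * seq block) :=
  flatten [seq templates n t.1.1 t.1.2 t.2 | t <-
    [:: (0, 1, 2); (0, 2, 1); (1, 0, 2); (1, 2, 0); (2, 0, 1); (2, 1, 0)]]%N.

Variables (n : nat) (sg : nat -> bool) (fl : seq zmat).

Definition matches (r : seq Z) (c : nat * seq block) : bool :=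
  let at_ := cert_atoms n c.2 in
  [&& (0 < c.1)%N, all (fun a => a \in slots) at_ &
    all (fun a => Z.of_nat (count_mem a at_) == (Z.of_nat c.1 * zweight r a)%ZZ) slots].

Definition ray_ok (r : seq Z) : bool :=
  hasb (fun c => if matches r c then ok_cert n sg fl c.2 else false) (candidates n).

(* the J-orthogonal of all the coordinate vectors but one *)
Definition coord_perp (j : nat) : seq (nat * nat) := [:: (0, n - 1 - j); (1, j)]%N.

Definition coord_ok (j : nat) : bool :=
  let D := perp n sg fl (coord_perp j) in
  [&& ok_perp n fl (coord_perp j), (n - dims (coord_perp j) == 1)%N,
     all (fun a => a \in slots) (flatten [seq atom n a | a <- coord_perp j]),
     zget D 0 j != 0%ZZ & all (fun k => (k == j) || (zget D 0 k == 0%ZZ)) (iota 0 n)].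

Definition flags_ok : bool :=
  [&& (5 < n)%N, size fl == 3, all (ok_flag n sg) fl, all ray_ok rays & all coord_ok (iota 0 n)].

Definition zslot (a : nat * nat) : seq Z :=
  zvmk (fun q => if ((q %/ 3 == a.1) && (q %% 3 < a.2))%N then 1%ZZ else 0%ZZ).

Lemma zweight_slot : all (fun a => all (fun b =>
  zweight (zslot a) b == (if b == a then 1 else 0)%ZZ) slots) slots.
Proof. by vm_compute. Qed.

End RayCertificates.

(** The coordinate flag, its opposite and an integral unipotent element, general enough for the
    certificates to be invertible; likewise for [flags7]. *)
Definition flags6 : seq zmat := [:: zscal 6 1; zanti 6 (fun i => 2 < i)%N;
  [:: [:: 1; 1; 5; 2; -2; -4]; [:: 0; 1; 3; 3; -4; -7]; [:: 0; 0; 1; 3; -6; -7];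
      [:: 0; 0; 0; 1; -3; -2]; [:: 0; 0; 0; 0; 1; -1]; [:: 0; 0; 0; 0; 0; 1]]%ZZ].

Definition flags7 : seq zmat := [:: zscal 7 1; zanti 7 (fun=> false);
  [:: [:: 1; 3; 3; 2; -2; 2; -2]; [:: 0; 1; 3; 6; -10; 12; -14];
      [:: 0; 0; 1; 6; -18; 28; -40]; [:: 0; 0; 0; 1; -6; 12; -20];
      [:: 0; 0; 0; 0; 1; -3; 6]; [:: 0; 0; 0; 0; 0; 1; -3]; [:: 0; 0; 0; 0; 0; 0; 1]]%ZZ].

Lemma flags6_ok : flags_ok 6 (fun i => 2 < i)%N flags6.
Proof. by vm_compute. Qed.

Lemma flags7_ok : flags_ok 7 (fun=> false) flags7.
Proof. by vm_compute. Qed.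

Lemma sum_count (V : zmodType) (T : eqType) (l S : seq T) (f : T -> V) :
  uniq S -> all (fun a => a \in S) l ->
  \sum_(a <- l) f a = \sum_(b <- S) f b *+ count_mem b l.
Proof.
move=> uS; elim: l => [|a l IH] /= => [_|/andP[aS lS]].
  by rewrite big_nil big1_seq.
rewrite big_cons IH //; under [RHS]eq_bigr do rewrite mulrnDr.
rewrite big_split /=; congr (_ + _).
rewrite (bigD1_seq a) //= eqxx mulr1n big1 ?addr0 // => b ba.
by rewrite eq_sym (negbTE ba) mulr0n.
Qed.

Lemma has_exists (T : Type) (f : T -> bool) (l : seq T) : has f l -> exists x, f x.
Proof. by elim: l => //= x l IH /orP[fx|/IH//]; exists x. Qed.

(** * Properness of the Busemann sum and triangles for interior points *)

Section InteriorTriangles.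
Variables (R : realType) (C : numClosedFieldType) (rc : real_part R C).
Local Notation cR := (cR rc).
Local Notation rp := (rp rc).
Local Notation expd := (expd rc).
Local Notation hexp := (hexp rc).
Local Notation near := (near rc).
Local Notation ldiag := (ldiag rc).
Local Notation lvol := (lvol rc).
Variables (n : nat) (sg : nat -> bool) (fl : seq zmat).
Hypothesis flok : flags_ok n sg fl.
Let s (i : 'I_n) := sg i.
Local Notation J := (antidiag C s).
Local Notation isom := (@isom C n s).
Local Notation blt := (@blt R C n sg).
Local Notation fvol := (@fvol R C rc n fl).
Implicit Types (u v w : 'M[R]_3) (y : 'M[C]_n).

Let n5 : (5 < n)%N. Proof. by case/and5P: flok. Qed.
Let n0 : (0 < n)%N. Proof. exact: leq_ltn_trans (leq0n _) n5. Qed.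
Let n3 : (3 <= n)%N. Proof. exact: leq_trans (ltnW n5). Qed.
Let szf : size fl = 3. Proof. by case/and5P: flok => _ /eqP. Qed.
Let okfl : all (ok_flag n sg) fl. Proof. by case/and5P: flok. Qed.

Definition weight v (a : nat * nat) : R :=
  v (inord a.1) (inord a.2.-1) - (if a.2 == 3 then 0 else v (inord a.1) (inord a.2)).

Lemma weightD v w a : weight (v + w) a = weight v a + weight w a.
Proof. by rewrite /weight !mxE; case: ifP => _; ring. Qed.

Lemma weightZ c v a : weight (c *: v) a = c * weight v a.
Proof. by rewrite /weight !mxE; case: ifP => _; ring. Qed.

Lemma slotsP a : a \in slots -> [/\ (a.1 < 3)%N, (0 < a.2)%N & (a.2 < 4)%N].
Proof. move=> ain; have h : all (fun a => [&& a.1 < 3, 0 < a.2 & a.2 < 4])%N slots by [].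
by have /and3P[] := allP h a ain. Qed.

Lemma weight_emb r a : a \in slots -> weight (emb R r) a = zI R (zweight r a).
Proof.
case: a => i k /slotsP[/= i3]; rewrite /weight /zweight.
case: k => [|[|[|[|k]]]] // _ _; rewrite /= !mxE !inordK //.
- by rewrite zID zIN.
- by rewrite zID zIN.
- by rewrite Z.sub_0_r subr0.
Qed.

(** Half the sum of the Busemann functions, up to a constant ([busemann3_Fv]), as a linear form in
    [v]. *)
Definition Fv v y := \sum_(a <- slots) weight v a * fvol a y.

Lemma Fv_ray r : r \in rays -> blt (fun=> 0) (Fv (emb R r)).
Proof.
have /allP h : all (ray_ok n sg fl) rays by case/and5P: flok.
move=> /h; rewrite /ray_ok hasbE => /has_exists[[m bs]].
case: ifP => // /and3P[m0 hs /allP hw] oc; rewrite /= in m0 hs hw oc.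
have [c hc] := cert_sound rc okfl oc; exists (c / m%:R) => y py iy.
have m0' : 0 < m%:R :> R by rewrite ltr0n.
have := hc y py iy; rewrite (sum_count (S := slots)) //.
have -> : \sum_(b <- slots) fvol b y *+ count_mem b (cert_atoms n bs) = m%:R * Fv (emb R r) y.
  rewrite /Fv mulr_sumr; apply: eq_big_seq => b bs'.
  rewrite -[LHS]mulr_natl weight_emb // mulrA; congr (_ * _).
  have zn k : k%:R = zI R (Z.of_nat k).
    by rewrite /zI (_ : int_of_Z _ = k%:Z) //; lia.
  by rewrite !zn -zIM; congr zI; apply/eqP; exact: hw.
by move=> {}h; rewrite -(ler_pM2l m0') mulr0 mulrDr mulrCA mulfV ?mulr1 // gt_eqF.
Qed.

Lemma FvD v w y : Fv (v + w) y = Fv v y + Fv w y.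
Proof. by rewrite /Fv -big_split; apply: eq_bigr => a _; rewrite weightD mulrDl. Qed.

Lemma FvZ c v y : Fv (c *: v) y = c * Fv v y.
Proof. by rewrite /Fv mulr_sumr; apply: eq_bigr => a _; rewrite weightZ mulrA. Qed.

Lemma Fv0 y : Fv 0 y = 0.
Proof. by rewrite -[0 in LHS](scale0r 0) FvZ mul0r. Qed.

Lemma Fv_tcone v : tcone v -> blt (fun=> 0) (Fv v).
Proof.
move=> /tcone_cone; elim=> [|k r w k0 rin _ [d hd]].
  by exists 0 => y _ _; rewrite Fv0 addr0.
have [c hc] := Fv_ray rin; exists (k * c + d) => y py iy.
rewrite FvD FvZ; have := mulr_ge0 k0 (hc y py iy); have := hd y py iy.
by lra.
Qed.

Lemma Fv_slot a y : a \in slots -> Fv (emb R (zslot a)) y = fvol a y.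
Proof.
move=> ain; rewrite /Fv (bigD1_seq a) //= [X in _ + X]big1_seq ?addr0.
  by rewrite weight_emb // (eqP (all_in2 zweight_slot ain ain)) eqxx mul1r.
move=> b /andP[ba bin]; rewrite weight_emb //.
by rewrite (eqP (all_in2 zweight_slot ain bin)) (negbTE ba) mul0r.
Qed.

(** For small [e] the vector [v - e *: emb R (zslot a)] is still in the cone, and the lower bound
    there says that [e] times [fvol a] is at most [Fv v] plus a constant. *)
Lemma Fv_interior v a : (forall h, h \in ineqs -> 0 < ev h v) -> a \in slots ->
  exists k c, 0 <= k /\ forall y, pd y -> isom y -> fvol a y <= k * Fv v y + c.
Proof.
move=> hv ain; have [|e e0 he] := @pos_perturb R ineqs v (- emb R (zslot a)).
  by move=> u uin; left; exact: hv.
have [c hc] := Fv_tcone he; exists e^-1, (e^-1 * c); split; first by rewrite invr_ge0 ltW.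
move=> y py iy; have := hc y py iy.
rewrite FvD FvZ -scaleN1r FvZ Fv_slot // => h.
by rewrite -mulrDr -(ler_pM2l e0) mulrA mulfV ?mul1r ?gt_eqF //; lra.
Qed.

(** The first row of [D] is a multiple of the [j]-th coordinate vector, so [y j j] is a squared
    length up to a factor, and [lvol_perp] bounds it by flag volumes. *)
Lemma entry_bound j : exists c, forall y, pd y -> isom y ->
  y j j <= cR (expR (\sum_(a <- flatten [seq atom n a | a <- coord_perp n j]) fvol a y + c)).
Proof.
have /allP/(_ j) : all (coord_ok n sg fl) (iota 0 n) by case/and5P: flok.
rewrite mem_iota add0n ltn_ord => /(_ isT) /and5P[hp /eqP h1 _ hj /allP hk].
have [uD [c hc]] := lvol_perp rc okfl hp; rewrite h1 in hc.
move: uD hc; set D := toM C n _ => uD hc.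
pose i0 := Ordinal n0.
have rD : row i0 D = D i0 j *: delta_mx 0 j.
  apply/rowP => k; rewrite !mxE eqxx /=; have := hk k; rewrite mem_iota add0n ltn_ord.
  move=> /(_ isT) /orP[/eqP/val_inj->|/eqP]; first by rewrite eqxx mulr1.
  case: eqP => [->|_] e; first by rewrite mulr1.
  by rewrite e zI0 mulr0.
have dj : D i0 j != 0 by rewrite mxE zI_eq0; apply/negP => /Z.eqb_eq e; rewrite e in hj.
have dn : 0 < rp (`|D i0 j| ^+ 2).
  by rewrite -(cR_gt0 rc) rpK ?exprn_gt0 ?normr_gt0 // rpredX // normr_real.
exists (c - ln (rp (`|D i0 j| ^+ 2))) => y py iy.
have [lL eL] := chol_congr_ltp uD py.
have e1 : lvol D y 1 = ldiag (chol (D *m y *m D^t*)) i0.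
  rewrite /lvol (bigD1 i0) //= big1 ?addr0 // => i /andP[i1].
  by rewrite -val_eqE /=; case: (val i) i1.
have := hc y py iy; rewrite e1 addrA -(ler_expR (ldiag _ _)) -(lecR rc) => hb.
rewrite expRB lnK // real_complexM real_complexV rpK ?rpredX ?normr_real //.
rewrite ler_pdivlMr ?exprn_gt0 ?normr_gt0 //.
apply: le_trans hb; rewrite -(ldiag_nsq rc i0 lL).
have -> : cR (nsq rc (chol (D *m y *m D^t*) i0 i0)) = (D *m y *m D^t*) i0 i0.
  rewrite -[in RHS]eL mxE (bigD1 i0) //= big1 ?addr0.
    by rewrite !mxE -nsqE normCK.
  move=> k k0; have /is_trig_mxP tL := proj1 lL; rewrite tL ?mul0r //.
  by rewrite lt0n; move: k0; rewrite -val_eqE.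
have -> : (D *m y *m D^t*) i0 i0 = qf y (row i0 D).
  rewrite /qf -row_mul [in RHS]mxE [in LHS]mxE; apply: eq_bigr => k _.
  by rewrite !mxE.
rewrite rD; have -> : qf y (D i0 j *: delta_mx 0 j) = `|D i0 j| ^+ 2 * y j j.
  rewrite /qf linearZ /= map_mxZ -scalemxAl -scalemxAl -scalemxAr scalerA mxE normCK; congr (_ * _).
  by rewrite -rowE trmx_delta map_delta_mx -colE !mxE.
by rewrite mulrC.
Qed.

(** Self-duality gives $\mathrm{tr}\,y^{-1} = \mathrm{tr}\,y$, so one bound on the trace controls
    the eigenvalues from both sides. *)
Lemma near1_trace y (t : R) : pd y -> isom y -> \tr y <= cR (expR t) -> near t y 1%:M.
Proof.
move=> py iy ht; have [U [d [uU yE]]] := pd_hexp rc py.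
have trh (e : 'rV[R]_n) : \tr (hexp U e) = cR (\sum_j expR (e 0 j)).
  rewrite /hexp mxtrace_mulC mulmxA unitary_mulC // mul1mx real_complex_sum.
  by apply: eq_bigr => j _; rewrite !mxE eqxx mulr1n.
have trV : \tr (invmx y) = \tr y.
  have [u1 u2] := mulmx1_unit (antidiag_mulT C s).
  rewrite (isom_inv iy) mxtrace_mulC mulmxA antidiag_Tmul mul1mx.
  by rewrite mxtrace_tr.
have b (e : 'rV[R]_n) j : \tr (hexp U e) <= cR (expR t) -> e 0 j <= t.
  rewrite trh lecR => h; rewrite -ler_expR; apply: le_trans h.
  by rewrite (bigD1 j) //= lerDl sumr_ge0 // => i _; exact: expR_ge0.
rewrite yE -(hexp0 rc uU); apply: hexp_near => // j.
rewrite mxE subr0 ler_norml; apply/andP; split; last by apply: b; rewrite -yE.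
rewrite lerNl; have := b (- d) j; rewrite mxE; apply.
by rewrite -(invmx_hexp rc d uU) -yE trV.
Qed.

(** A bound on [Fv v] bounds the flag volumes above, these bound the diagonal entries, and the trace
    bounds the distance to the identity. *)
Lemma Fv_proper v : (forall h, h \in ineqs -> 0 < ev h v) ->
  forall B, exists rho, forall y, pd y -> isom y -> Fv v y <= B -> near rho y 1%:M.
Proof.
move=> hv B.
have slotb : forall l : seq (nat * nat), all (fun a => a \in slots) l -> exists c, forall y, pd y -> isom y ->
    Fv v y <= B -> \sum_(a <- l) fvol a y <= c.
  elim=> [|a l IH] /= => [_|/andP[ain lin]]; first by exists 0 => y _ _ _; rewrite big_nil.
  have [c hc] := IH lin; have [k [d [k0 hd]]] := Fv_interior hv ain.
  exists (k * B + d + c) => y py iy yB; rewrite big_cons lerD //; last exact: hc.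
  by apply: (le_trans (hd y py iy)); rewrite lerD2r ler_wpM2l.
have entryb : forall j : 'I_n, exists c, forall y, pd y -> isom y -> Fv v y <= B -> y j j <= cR (expR c).
  move=> j; have [c hc] := entry_bound j.
  have /allP/(_ j) : all (coord_ok n sg fl) (iota 0 n) by case/and5P: flok.
  rewrite mem_iota add0n ltn_ord => /(_ isT) /and5P[_ _ hs _ _].
  have [d hd] := slotb _ hs; exists (d + c) => y py iy yB.
  apply: (le_trans (hc y py iy)); rewrite lecR ler_expR lerD2r.
  exact: hd.
pose c j := projT1 (cid (entryb j)).
have cP j y : pd y -> isom y -> Fv v y <= B -> y j j <= cR (expR (c j)).
  by rewrite /c; case: cid => c' /= h; exact: h.
exists (ln (\sum_j expR (c j))) => y py iy yB; apply: near1_trace => //.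
rewrite lnK; last first.
  rewrite posrE (bigD1 (Ordinal n0)) //= ltr_pwDl ?expR_gt0 // sumr_ge0 //.
by rewrite real_complex_sum; apply: ler_sum => j _; exact: cP.
Qed.

(** The weights $x, y, z, -z, -y, -x$, with a 0 in the middle for [n = 7]. *)
Definition wt (u : 'rV[R]_3) : 'rV[R]_n := \row_j
  (if (j < 3)%N then u 0 (inord j) else
   if (rev_ord j < 3)%N then - u 0 (inord (rev_ord j)) else 0).

Lemma rev_small (j : 'I_n) : (j < 3)%N -> (rev_ord j < 3)%N = false.
Proof. by move=> j3 /=; apply/negbTE; rewrite -leqNgt; have := n5; lia. Qed.

Lemma wt_rev (u : 'rV[R]_3) (j : 'I_n) : wt u 0 (rev_ord j) = - wt u 0 j.
Proof.
rewrite !mxE rev_ordK; have [j3|j3] := boolP (j < 3)%N; first by rewrite rev_small.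
by case: ifP => _; rewrite ?opprK ?oppr0.
Qed.

Lemma isom_expd (d : 'rV[R]_n) : (forall j, d 0 (rev_ord j) = - d 0 j) -> isom (expd d).
Proof.
move=> hd; rewrite /isom expd_tr; apply/matrixP => i j.
rewrite /expd mul_diag_mx mul_mx_diag !mxE.
case: eqP => [->|_]; last by rewrite !mulr0n mulr0 mul0r.
by rewrite !mulr1n hd mulrAC -real_complexM -expRD subrr expR0 rmorph1 mul1r.
Qed.

Lemma decreasing_wt (u : 'rV[R]_3) : chamber u -> decreasing (wt u).
Proof.
case=> c1 c2 c3.
have e1 : u 0 0 = u 0 (inord 0) by congr (u 0 _); apply: val_inj; rewrite /= inordK.
have e2 : u 0 1 = u 0 (inord 1) by congr (u 0 _); apply: val_inj; rewrite /= inordK.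
have e3 : u 0 2 = u 0 (inord 2) by congr (u 0 _); apply: val_inj; rewrite /= inordK.
rewrite {}e1 {}e2 {}e3 in c1 c2 c3.
have d : forall a b : nat, (a <= b)%N -> (b < 3)%N -> u 0 (inord b) <= u 0 (inord a).
  by case=> [|[|[|a]]] [|[|[|b]]] // _ _; lra.
have p : forall a : nat, (a < 3)%N -> 0 <= u 0 (inord a).
  by case=> [|[|[|a]]] // _; lra.
move=> i j ij; rewrite !mxE /=.
have [j3|j3] := ltnP j 3; first by rewrite (leq_ltn_trans ij j3); exact: d.
have [i3|i3] := ltnP i 3.
  case: ifP => rj; last exact: p.
  by have := p _ rj; have := p _ i3; lra.
case: (ltnP (n - j.+1) 3) => rj; case: (ltnP (n - i.+1) 3) => ri.
- by rewrite lerN2; apply: d => //; lia.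
- by rewrite oppr_le0; exact: p.
- by exfalso; lia.
- by [].
Qed.

Lemma ldiag_mul (L M : 'M[C]_n) j : ltp L -> ltp M -> ldiag (L *m M) j = ldiag L j + ldiag M j.
Proof.
move=> [tL pL] [tM pM]; have [_ d] := trig_mul tL tM; rewrite /ldiag d.
have [a0 ->] := gt0_real_complex rc (pL j); have [b0 ->] := gt0_real_complex rc (pM j).
by rewrite -real_complexM !cRK lnM ?posrE // mulrDr.
Qed.

Lemma ldiag_rev (L : 'M[C]_n) j : ltp L -> isom L -> ldiag L (rev_ord j) = - ldiag L j.
Proof.
move=> pL iL; rewrite -ldiag_inv // (isom_inv iL) /ldiag antidiag_conjE.
by rewrite mulrAC -expr2 sqrr_sign mul1r.
Qed.

(** The unitary factor of $h = tk$ with $t$ lower triangular, so that [k] and [h] define the same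
    flag. *)
Definition kk (i : nat) : 'M[C]_n :=
  let h := toM C n (zflag fl i) in invmx (chol (h *m h^t*)) *m h.

Lemma kkP i : (i < 3)%N -> exists t, [/\ ltp t, kk i \is unitarymx, isom (kk i) &
  toM C n (zflag fl i) = t *m kk i].
Proof.
move=> i3; have := flag_ok C okfl (i := i); rewrite szf i3 => /(_ isT)[_ ih uh]; rewrite /kk.
move: (toM C n _) ih uh => h ih uh.
have [lt et] := cholP (pd_mulC uh).
have it : isom (chol (h *m h^t*)).
  apply: chol_isom; first exact: pd_mulC.
  by have := isom_congr ih (isom1 C s); rewrite mulmx1.
move: (chol _) lt et it => t lt et it; have ut := ltp_unit lt; exists t; split=> //.
- apply/unitarymxP; rewrite trCM mulmxA -(mulmxA (invmx t)) -et mulmxA mulVmx // mul1mx.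
  by rewrite -trCM mulVmx // trC1.
- by apply: isomM => //; exact: isom_invmx.
- by rewrite mulmxA mulmxV // mul1mx.
Qed.

Lemma fvol_kk i m : (i < 3)%N -> (m <= n)%N -> exists c, forall y, pd y ->
  fvol (i, m) y = c + \sum_(j < n | (j < m)%N) ldiag (chol (kk i *m y *m (kk i)^t*)) j.
Proof.
move=> i3 mn; have [t [lt uk ik hE]] := kkP i3.
exists (\sum_(j < n | (j < m)%N) ldiag t j) => y py.
rewrite /fvol /lvol /= hE -big_split; apply: eq_bigr => j _.
have [lL eL] := cholP (pd_congr (unitarymx_unit uk) py).
have -> : t *m kk i *m y *m (t *m kk i)^t* =
   (t *m chol (kk i *m y *m (kk i)^t*)) *m (t *m chol (kk i *m y *m (kk i)^t*))^t*.
  rewrite [in RHS]trCM -[RHS]mulmxA [X in _ = t *m X]mulmxA eL trCM !mulmxA.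
  by [].
by rewrite chol_eq ?ldiag_mul //; exact: ltp_mul.
Qed.

(** Weights and [ldiag] both change sign under reversal of the order, so the last three indices
    repeat the first three; summation by parts produces the volumes. *)
Lemma busemann_wt i (u : 'rV[R]_3) : (i < 3)%N -> exists c, forall y, pd y -> isom y ->
  busemann rc (kk i) (wt u) y =
   2 * ((u 0 0 - u 0 1) * fvol (i, 1) y + (u 0 1 - u 0 2) * fvol (i, 2) y + u 0 2 * fvol (i, 3) y) + c.
Proof.
move=> i3.
have [c1 h1] := fvol_kk i3 (leq_trans (isT : 1 <= 3)%N n3).
have [c2 h2] := fvol_kk i3 (leq_trans (isT : 2 <= 3)%N n3).
have [c3 h3] := fvol_kk i3 n3.
have [t [lt uk ik hE]] := kkP i3.
exists (- 2 * ((u 0 0 - u 0 1) * c1 + (u 0 1 - u 0 2) * c2 + u 0 2 * c3)) => y py iy.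
rewrite h1 // h2 // h3 // /busemann.
have pk := pd_congr (unitarymx_unit uk) py.
have [lL eL] := cholP pk; have iL := chol_isom pk (isom_congr ik iy).
move: (chol _) lL iL {eL} => L lL iL.
pose g (k : nat) : R := if insub k is Some j then ldiag L j else 0.
have gE (j : 'I_n) : ldiag L j = g j by rewrite /g valK.
have sE m : (m <= n)%N -> \sum_(j < n | (j < m)%N) ldiag L j = \sum_(k < m) g k.
  by move=> mn; rewrite (big_ord_widen _ _ mn); apply: eq_bigr => j _.
rewrite !sE //; try exact: leq_trans n3.
have -> : \sum_j wt u 0 j * ldiag L j = 2 * \sum_(j < n | (j < 3)%N) u 0 (inord j) * g j.
  rewrite (bigID (fun j : 'I_n => (j < 3)%N)) /= mulrDl mul1r; congr (_ + _).
    by apply: eq_bigr => j j3; rewrite mxE j3 gE.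
  rewrite (bigID (fun j : 'I_n => (rev_ord j < 3)%N)) /= [X in _ + X]big1 ?addr0; last first.
    by move=> j /andP[j3 rj]; rewrite mxE (negbTE j3) (negbTE rj) mul0r.
  rewrite (reindex_inj rev_ord_inj) /=; apply: eq_big => [j|j /andP[_ rj]].
    have := rev_ordK j => /(congr1 val) /= ->; case: (ltnP j 3) => [j3|]; last by rewrite andbF.
    by have := rev_small j3 => /= ->.
  have j3 : (j < 3)%N by have := rev_ordK j => /(congr1 val) /= <-.
  by rewrite wt_rev ldiag_rev // mulrNN mxE j3 gE.
rewrite -(big_ord_widen _ (fun j => u 0 (inord j) * g j) n3).
have e1 : u 0 0 = u 0 (inord 0) by congr (u 0 _); apply: val_inj; rewrite /= inordK.
have e2 : u 0 1 = u 0 (inord 1) by congr (u 0 _); apply: val_inj; rewrite /= inordK.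
have e3 : u 0 2 = u 0 (inord 2) by congr (u 0 _); apply: val_inj; rewrite /= inordK.
rewrite e1 e2 e3 !big_ord_recl !big_ord0 /= /bump /=.
by rewrite !addn0 !add1n; ring.
Qed.

Lemma row_wt v i (k : 'I_3) : (row i v) 0 k = v i k. Proof. by rewrite mxE. Qed.

Lemma busemann3_Fv v : exists c, forall y, pd y -> isom y ->
  busemann3 rc (kk 0) (kk 1) (kk 2) (wt (row 0 v)) (wt (row 1 v)) (wt (row 2 v)) y =
  2 * Fv v y + c.
Proof.
have [c0 h0] := @busemann_wt 0 (row 0 v) isT.
have [c1 h1] := @busemann_wt 1 (row 1 v) isT.
have [c2 h2] := @busemann_wt 2 (row 2 v) isT.
exists (c0 + c1 + c2) => y py iy; rewrite /busemann3 h0 // h1 // h2 // !row_wt.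
have e0 : inord 0 = 0 :> 'I_3 by apply: val_inj; rewrite /= inordK.
have e1 : inord 1 = 1 :> 'I_3 by apply: val_inj; rewrite /= inordK.
have e2 : inord 2 = 2 :> 'I_3 by apply: val_inj; rewrite /= inordK.
rewrite /Fv /slots /= !big_cons big_nil /weight /= e0 e1 e2.
by ring.
Qed.

Lemma tcone_chamber v i : tcone v -> chamber (row i v).
Proof.
move=> hv; have hk k : (k < size chamber_ineqs)%N -> 0 <= ev (nth [::] chamber_ineqs k) v.
  by move=> k9; apply: hv; rewrite mem_ineqs mem_nth.
have g0 := hk 0%N isT; have g1 := hk 1%N isT; have g2 := hk 2%N isT.
have g3 := hk 3%N isT; have g4 := hk 4%N isT; have g5 := hk 5%N isT.
have g6 := hk 6%N isT; have g7 := hk 7%N isT; have g8 := hk 8%N isT.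
move: g0 g1 g2 g3 g4 g5 g6 g7 g8.
rewrite !evE /chamber_ineqs /= !zI0 !zI1 !zIm1 ?(mul0r, add0r, addr0, mul1r, mulN1r) => *; rewrite /chamber /= !row_wt.
by case: (ord3 i) => ->; split; lra.
Qed.

Theorem interior_triangle v : (forall h, h \in ineqs -> 0 < ev h v) ->
  forall eta, 0 < eta -> exists a b, [/\ a \is unitarymx, isom a, b \is unitarymx, isom b &
    let M := expd (- wt (row 0 v)) *m a *m expd (- wt (row 1 v)) *m b *m expd (- wt (row 2 v)) in
    near eta (M *m M^t*) 1%:M].
Proof.
move=> hv eta eta0; have hc i : chamber (row i v).
  by apply: tcone_chamber => u uin; exact/ltW/hv.
have [t0 [_ u0 i0 _]] := kkP (isT : 0 < 3)%N.
have [t1 [_ u1 i1 _]] := kkP (isT : 1 < 3)%N.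
have [t2 [_ u2 i2 _]] := kkP (isT : 2 < 3)%N.
apply: (approx_triangle u0 u1 u2 i0 i1 i2 (decreasing_wt (hc 0)) (decreasing_wt (hc 1))
  (decreasing_wt (hc 2)) (isom_expd (wt_rev _)) (isom_expd (wt_rev _)) (isom_expd (wt_rev _)) _ eta0).
move=> B; have [c hcE] := busemann3_Fv v.
have [rho hr] := Fv_proper hv ((B - c) / 2); exists rho => y py iy; rewrite hcE // => h.
by apply: hr => //; lra.
Qed.

End InteriorTriangles.

(** * Continuity of matrix-valued maps *)

Section MatrixContinuity.
Variables (R : realType) (C : numClosedFieldType) (rc : real_part R C).
Local Notation cR := (cR rc).
Local Notation rp := (rp rc).
Local Notation nsq := (nsq rc).

Definition re (z : C) : R := rp ('Re z).
Definition im (z : C) : R := rp ('Im z).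

Lemma cR_re z : cR (re z) = 'Re z. Proof. by rewrite rpK ?Creal_Re. Qed.
Lemma cR_im z : cR (im z) = 'Im z. Proof. by rewrite rpK ?Creal_Im. Qed.

Lemma re_imE z : z = cR (re z) + 'i * cR (im z).
Proof. by rewrite cR_re cR_im -Crect. Qed.

Lemma reD x y : re (x + y) = re x + re y.
Proof. by apply: (@cR_inj _ _ rc); rewrite rmorphD /= !cR_re raddfD. Qed.
Lemma imD x y : im (x + y) = im x + im y.
Proof. by apply: (@cR_inj _ _ rc); rewrite rmorphD /= !cR_im raddfD. Qed.
Lemma reM x y : re (x * y) = re x * re y - im x * im y.
Proof. by apply: (@cR_inj _ _ rc); rewrite rmorphB !rmorphM /= !cR_re !cR_im ReM. Qed.
Lemma imM x y : im (x * y) = re x * im y + re y * im x.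
Proof. by apply: (@cR_inj _ _ rc); rewrite rmorphD !rmorphM /= !cR_re !cR_im ImM. Qed.
Lemma re_conj x : re (x^*) = re x.
Proof. by apply: (@cR_inj _ _ rc); rewrite !cR_re Re_conj. Qed.
Lemma im_conj x : im (x^*) = - im x.
Proof. by apply: (@cR_inj _ _ rc); rewrite rmorphN /= !cR_im Im_conj. Qed.
Lemma re_cR x : re (cR x) = x.
Proof. by apply: (@cR_inj _ _ rc); rewrite cR_re; apply/Creal_ReP; exact: cR_real. Qed.
Lemma im_cR x : im (cR x) = 0.
Proof. by apply: (@cR_inj _ _ rc); rewrite cR_im rmorph0; apply/Creal_ImP; exact: cR_real. Qed.

Lemma nsq_re_im z : nsq z = re z ^+ 2 + im z ^+ 2.
Proof. by apply: (@cR_inj _ _ rc); rewrite -nsqE normC2_Re_Im rmorphD !rmorphXn /= cR_re cR_im. Qed.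

Section Continuous.
Variable T : topologicalType.

(** The abstract field [C] carries no topology, so continuity is that of the real and imaginary
    parts. *)
Definition ccont (f : T -> C) := continuous (re \o f) /\ continuous (im \o f).
Definition mcont m n (F : T -> 'M[C]_(m, n)) := forall i j, ccont (fun x => F x i j).

Lemma cont_ext (f g : T -> R) : f =1 g -> continuous f -> continuous g.
Proof. by move=> /funext->. Qed.

Lemma contD (f g : T -> R) : continuous f -> continuous g -> continuous (fun x => f x + g x).
Proof. by move=> cf cg x; apply: cvgD; [exact: cf|exact: cg]. Qed.

Lemma contM (f g : T -> R) : continuous f -> continuous g -> continuous (fun x => f x * g x).
Proof. by move=> cf cg x; apply: cvgM; [exact: cf|exact: cg]. Qed.

Lemma contN (f : T -> R) : continuous f -> continuous (fun x => - f x).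
Proof. by move=> cf x; apply: cvgN; exact: cf. Qed.

Lemma cont_cst (c : R) : continuous (fun _ : T => c).
Proof. by move=> x; exact: cvg_cst. Qed.

Lemma ccont_cst c : ccont (fun=> c).
Proof. by split=> x; exact: cvg_cst. Qed.

Lemma ccontD f g : ccont f -> ccont g -> ccont (fun x => f x + g x).
Proof.
move=> [f1 f2] [g1 g2]; split.
  by apply: (@cont_ext (fun x => re (f x) + re (g x))) => x; [rewrite /= reD|apply: cvgD; [exact: f1|exact: g1]].
by apply: (@cont_ext (fun x => im (f x) + im (g x))) => x; [rewrite /= imD|apply: cvgD; [exact: f2|exact: g2]].
Qed.

Lemma ccontM f g : ccont f -> ccont g -> ccont (fun x => f x * g x).
Proof.
move=> [f1 f2] [g1 g2]; split.
  apply: (@cont_ext (fun x => re (f x) * re (g x) - im (f x) * im (g x))) => x.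
    by rewrite /= reM.
  by apply: cvgB; apply: cvgM; [exact: f1|exact: g1|exact: f2|exact: g2].
apply: (@cont_ext (fun x => re (f x) * im (g x) + re (g x) * im (f x))) => x.
  by rewrite /= imM.
by apply: cvgD; apply: cvgM; [exact: f1|exact: g2|exact: g1|exact: f2].
Qed.

Lemma ccont_conj f : ccont f -> ccont (fun x => (f x)^*).
Proof.
move=> [f1 f2]; split.
  by apply: (@cont_ext (fun x => re (f x))) => // x; rewrite /= re_conj.
apply: (@cont_ext (fun x => - im (f x))) => x; first by rewrite /= im_conj.
by apply: cvgN; exact: f2.
Qed.

Lemma ccont_cR (f : T -> R) : continuous f -> ccont (fun x => cR (f x)).
Proof.
move=> cf; split; first by apply: (cont_ext _ cf) => x; rewrite /= re_cR.
by apply: (@cont_ext (fun=> 0)) => x; [rewrite /= im_cR|exact: cvg_cst].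
Qed.

Lemma ccont_sum (I : Type) (r : seq I) (f : I -> T -> C) :
  (forall i, ccont (f i)) -> ccont (fun x => \sum_(i <- r) f i x).
Proof.
move=> cf; elim: r => [|i r IH].
  have -> : (fun x => \sum_(i <- [::]) f i x) = fun=> 0 by apply/funext => x; rewrite big_nil.
  exact: ccont_cst.
have -> : (fun x => \sum_(j <- i :: r) f j x) = fun x => f i x + \sum_(j <- r) f j x.
  by apply/funext => x; rewrite big_cons.
exact: ccontD.
Qed.

Lemma mcont_cst m n (A : 'M[C]_(m, n)) : mcont (fun=> A).
Proof. by move=> i j; exact: ccont_cst. Qed.

Lemma mcontM m n p (F : T -> 'M[C]_(m, n)) (G : T -> 'M[C]_(n, p)) :
  mcont F -> mcont G -> mcont (fun x => F x *m G x).
Proof.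
move=> cF cG i j.
have -> : (fun x => (F x *m G x) i j) = fun x => \sum_k F x i k * G x k j.
  by apply/funext => x; rewrite mxE.
by apply: ccont_sum => k; exact: ccontM.
Qed.

Lemma mcontB m n (F G : T -> 'M[C]_(m, n)) : mcont F -> mcont G -> mcont (fun x => F x - G x).
Proof.
move=> cF cG i j.
have -> : (fun x => (F x - G x) i j) = fun x => F x i j + (-1) * G x i j.
  by apply/funext => x; rewrite !mxE mulN1r.
by apply: ccontD => //; apply: ccontM => //; exact: ccont_cst.
Qed.

Lemma mcont_tr m n (F : T -> 'M[C]_(m, n)) : mcont F -> mcont (fun x => (F x)^T).
Proof.
move=> cF i j; have -> : (fun x => (F x)^T i j) = fun x => F x j i by apply/funext => x; rewrite mxE.
exact: cF.
Qed.

Lemma mcont_trC m n (F : T -> 'M[C]_(m, n)) : mcont F -> mcont (fun x => (F x)^t*).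
Proof.
move=> cF i j; have -> : (fun x => (F x)^t* i j) = fun x => (F x j i)^*.
  by apply/funext => x; rewrite !mxE.
exact: ccont_conj.
Qed.

Lemma mcont_expd n (f : T -> 'rV[R]_n) : (forall j, continuous (fun x => f x 0 j)) ->
  mcont (fun x => expd rc (f x)).
Proof.
move=> cf i j.
have -> : (fun x => expd rc (f x) i j) = fun x => (if i == j then 1 else 0) * cR (expR (f x 0 i)).
  by apply/funext => x; rewrite !mxE; case: eqP => [->|_]; rewrite ?mul1r ?mul0r ?mulr1n ?mulr0n.
apply: ccontM; first exact: ccont_cst.
apply: ccont_cR => x.
by apply: (@continuous_comp _ _ _ (fun x => f x 0 i) expR); [exact: cf|exact: continuous_expR].
Qed.

Definition hs2 m n (A : 'M[C]_(m, n)) : R := \sum_i \sum_j nsq (A i j).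

Lemma cont_sum (I : Type) (r : seq I) (f : I -> T -> R) :
  (forall i, continuous (f i)) -> continuous (fun x => \sum_(i <- r) f i x).
Proof.
move=> cf; elim: r => [|i r IH].
  by apply: (@cont_ext (fun=> 0)) => x; [rewrite big_nil|exact: cvg_cst].
apply: (@cont_ext (fun x => f i x + \sum_(j <- r) f j x)) => x; first by rewrite big_cons.
by apply: cvgD; [exact: cf|exact: IH].
Qed.

Lemma cont_hs2 m n (F : T -> 'M[C]_(m, n)) : mcont F -> continuous (fun x => hs2 (F x)).
Proof.
move=> cF; apply: cont_sum => i; apply: cont_sum => j.
have [c1 c2] := cF i j.
apply: (@cont_ext (fun x => re (F x i j) * re (F x i j) + im (F x i j) * im (F x i j))) => x.
  by rewrite nsq_re_im !expr2.
by apply: cvgD; apply: cvgM; [exact: c1|exact: c1|exact: c2|exact: c2].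
Qed.

End Continuous.

Lemma hs2_ge0 m n (A : 'M[C]_(m, n)) : 0 <= hs2 A.
Proof. by apply: sumr_ge0 => i _; apply: sumr_ge0 => j _; exact: nsq_ge0. Qed.

Lemma hs2_eq0 m n (A : 'M[C]_(m, n)) : hs2 A = 0 -> A = 0.
Proof.
move=> h; apply/matrixP => i j; rewrite mxE.
have h1 : \sum_j nsq (A i j) = 0.
  apply/eqP; move/eqP: h; rewrite psumr_eq0 => [/allP/(_ i)|k _]; first by rewrite mem_index_enum => /(_ isT).
  by apply: sumr_ge0 => l _; exact: nsq_ge0.
have h2 : nsq (A i j) = 0.
  apply/eqP; move/eqP: h1; rewrite psumr_eq0 => [/allP/(_ j)|k _]; last exact: nsq_ge0.
  by rewrite mem_index_enum => /(_ isT).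
by apply/eqP; rewrite -normr_eq0 -sqrf_eq0 (nsqE rc) h2 rmorph0.
Qed.

Lemma hs2_0 m n : hs2 (0 : 'M[C]_(m, n)) = 0.
Proof. by rewrite /hs2 big1 // => i _; rewrite big1 // => j _; rewrite mxE nsq0. Qed.

Lemma hs2_tr m n (A : 'M[C]_(m, n)) : cR (hs2 A) = \tr (A *m A^t*).
Proof.
rewrite /hs2 real_complex_sum; apply: eq_bigr => i _; rewrite real_complex_sum mxE.
by apply: eq_bigr => j _; rewrite !mxE -nsqE normCK.
Qed.

(** For negative [d] the point is $1 - e^{-r} \le e^r - 1$, that is, $e^r + e^{-r} \ge 2$. *)
Lemma expR_dist (d r : R) : `|d| <= r -> (expR d - 1) ^+ 2 <= (expR r - 1) ^+ 2.
Proof.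
rewrite ler_norml => /andP[d1 d2].
have r0 : 0 <= r by lra.
have e1 : expR d <= expR r by rewrite ler_expR.
have e2 : 1 <= expR r by rewrite -expR0 ler_expR.
have [d0|d0] := leP 0 d.
  have e3 : 1 <= expR d by rewrite -expR0 ler_expR.
  by rewrite ler_sqr ?nnegrE; lra.
have e3 : expR d < 1 by rewrite -[ltRHS]expR0 ltr_expR.
have e4 : expR (- r) <= expR d by rewrite ler_expR.
have : expR r * expR (- r) = 1 by rewrite -expRD subrr expR0.
have e0 := expR_gt0 (- r); have e0' := expR_gt0 r => e5.
rewrite -[leLHS]sqrrN ler_sqr ?nnegrE; try lra.
suff : 2 <= expR r + expR (- r) by lra.
have := sqr_ge0 (expR r - 1) => h.
have : 0 <= expR (- r) * (expR r - 1) ^+ 2 by rewrite mulr_ge0 // ltW.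
have -> : expR (- r) * (expR r - 1) ^+ 2 =
  (expR r * expR (- r)) * expR r - 2 * (expR r * expR (- r)) + expR (- r) by ring.
by rewrite e5; lra.
Qed.

Lemma near1_hs2 n (Y : 'M[C]_n) (r : R) : pd Y -> near rc r Y 1%:M ->
  hs2 (Y - 1%:M) <= n%:R * (expR r - 1) ^+ 2.
Proof.
move=> pY; have [U [d [uU YE]]] := pd_hexp rc pY; rewrite YE => /(near1_eig uU) hd.
rewrite -(lecR rc) hs2_tr.
have -> : hexp rc U d - 1%:M = U^t* *m (expd rc d - 1%:M) *m U.
  by rewrite mulmxBr mulmxBl mulmx1 unitary_trCmul.
rewrite !trCM trmxCK mulmxA mxtrace_mulC !mulmxA.
rewrite -(mulmxA _ U) unitary_mulC // mulmx1.
rewrite mxtrace_mulC !mulmxA -(mulmxA _ U) unitary_mulC // mulmx1.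
rewrite trCB trC1 expd_trC.
have -> : \tr ((expd rc d - 1%:M) *m (expd rc d - 1%:M)) = cR (\sum_j (expR (d 0 j) - 1) ^+ 2).
  have -> : expd rc d - 1%:M = diag_mx (\row_j (cR (expR (d 0 j) - 1))).
    apply/matrixP => i j; rewrite !mxE rmorphB rmorph1.
    by case: eqP => _; rewrite ?mulr1n ?mulr0n ?subr0.
  rewrite mulmx_diag mxtrace_diag real_complex_sum; apply: eq_bigr => j _.
  by rewrite !mxE -real_complexM expr2.
rewrite lecR; apply: (@le_trans _ _ (\sum_(j < n) (expR r - 1) ^+ 2)).
  by apply: ler_sum => j _; apply: expR_dist.
by rewrite sumr_const card_ord mulr_natl.
Qed.

End MatrixContinuity.

(** * Closed triangles as unitary products *)

Section TriangleProduct.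
Variables (R : realType) (C : numClosedFieldType) (rc : real_part R C) (n : nat).
Local Notation expd := (expd rc).
Implicit Types (w : 'rV[R]_n) (a b X Y : 'M[C]_n).

Definition tproduct w0 w1 w2 a b := expd w0 *m a *m expd w1 *m b *m expd w2.

Lemma tproduct_unit w0 w1 w2 a b : a \is unitarymx -> b \is unitarymx ->
  tproduct w0 w1 w2 a b \in unitmx.
Proof.
move=> /unitarymx_unit ua /unitarymx_unit ub.
by rewrite /tproduct 4!unitmx_mul !expd_unit ua ub.
Qed.

Lemma mul_expd_trC w X Y : X *m expd w *m (Y *m expd (- w))^t* = X *m Y^t*.
Proof. by rewrite trCM expd_trC -mulmxA (mulmxA (expd w)) expdN mul1mx. Qed.

Lemma mul_unitary_trC a X Y : a \is unitarymx -> X *m a *m (Y *m a)^t* = X *m Y^t*.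
Proof. by move=> ua; rewrite trCM -mulmxA (mulmxA a) unitary_mulC // mul1mx. Qed.

Lemma tproduct_dual w0 w1 w2 a b : a \is unitarymx -> b \is unitarymx ->
  tproduct w0 w1 w2 a b *m (tproduct (- w0) (- w1) (- w2) a b)^t* = 1%:M.
Proof.
move=> ua ub; rewrite /tproduct mul_expd_trC mul_unitary_trC // mul_expd_trC.
by rewrite mul_unitary_trC // expd_trC expdN.
Qed.

(** The product with the opposite weights is the inverse adjoint, so one is unitary with the other.
    The flows supply the negative sign. *)
Lemma tproductN_unitary w0 w1 w2 a b : a \is unitarymx -> b \is unitarymx ->
  tproduct (- w0) (- w1) (- w2) a b \is unitarymx -> tproduct w0 w1 w2 a b \is unitarymx.
Proof.
move=> ua ub; have := tproduct_dual w0 w1 w2 ua ub.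
move: (tproduct (- w0) _ _ _ _) (tproduct w0 _ _ _ _) => M U h uM.
suff -> : U = M by [].
by have := congr1 (mulmx^~ M) h; rewrite -mulmxA unitary_trCmul // mulmx1 mul1mx.
Qed.

Lemma tproductE w0 w1 w2 a b : b \is unitarymx ->
  expd w0 *m a *m expd w1 = tproduct w0 w1 w2 a b *m expd (- w2) *m b^t*.
Proof.
move=> ub; rewrite /tproduct -(mulmxA _ (expd w2)) expdN mulmx1.
by rewrite -(mulmxA _ b) unitary_mulC // mulmx1.
Qed.

(** Together with the reversal [tproduct_rev], this rotation generates all permutations of the
    sides. *)
Lemma tproduct_rot w0 w1 w2 a b : a \is unitarymx -> tproduct w0 w1 w2 a b \is unitarymx ->
  tproduct w1 w2 w0 b ((tproduct w0 w1 w2 a b)^t*) = a^t*.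
Proof.
move=> ua uu.
have Nw : expd (- w0) *m expd w0 = 1%:M by rewrite -{2}(opprK w0) expdN.
have tE : tproduct w0 w1 w2 a b = expd w0 *m (a *m (expd w1 *m b *m expd w2)).
  by rewrite /tproduct !mulmxA.
have e : expd w1 *m b *m expd w2 = a^t* *m expd (- w0) *m tproduct w0 w1 w2 a b.
  rewrite tE; move: (expd w1 *m b *m expd w2) => Y.
  by rewrite -mulmxA (mulmxA (expd (- w0))) Nw mul1mx mulmxA unitary_trCmul // mul1mx.
move: e uu {tE}; move: (tproduct w0 w1 w2 a b) => T e uT.
have h := unitary_mulC uT; rewrite /tproduct e.
rewrite -(mulmxA _ T (T^t*)) h mulmx1 -mulmxA Nw.
exact: mulmx1.
Qed.

Lemma tproduct_rev w0 w1 w2 a b :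
  tproduct w2 w1 w0 (b^t*) (a^t*) = (tproduct w0 w1 w2 a b)^t*.
Proof. by rewrite /tproduct !trCM !expd_trC !mulmxA. Qed.

End TriangleProduct.

(** * Passage to the boundary of the cone by compactness *)

Section Sufficiency.
Variables (R : realType) (C : numClosedFieldType) (rc : real_part R C).
Local Notation cR := (cR rc).
Local Notation expd := (expd rc).
Local Notation hs2 := (hs2 rc).
Variables (n : nat) (sg : nat -> bool) (fl : seq zmat).
Hypothesis flok : flags_ok n sg fl.
Let s (i : 'I_n) := sg i.
Local Notation J := (antidiag C s).
Local Notation isom := (@isom C n s).
Local Notation wt := (@wt R n).

(** Real coordinates: [None] is the perturbation parameter; otherwise the first flag selects the
    matrix and the second the imaginary part. A real row vector makes the box compact. *)
Let F : finType := option (bool * bool * ('I_n * 'I_n))%type.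
Let T := 'rV[R]_#|F|.

Definition coord (x : T) (f : F) : R := x 0 (enum_rank f).
Definition cmat (b : bool) (x : T) : 'M[C]_n :=
  \matrix_(i, j) (cR (coord x (Some (b, false, (i, j)))) + 'i * cR (coord x (Some (b, true, (i, j))))).

Lemma continuous_coord f : continuous (coord^~ f).
Proof. by move=> x; exact: coord_continuous. Qed.

Lemma mcont_cmat b : mcont rc (cmat b).
Proof.
move=> i j; have -> : (fun x => cmat b x i j) = fun x => cR (coord x (Some (b, false, (i, j)))) +
    'i * cR (coord x (Some (b, true, (i, j)))) by apply/funext => x; rewrite mxE.
apply: ccontD; first by apply: ccont_cR; exact: continuous_coord.
apply: ccontM; first exact: ccont_cst.
by apply: ccont_cR; exact: continuous_coord.
Qed.

Definition encode (t : R) (a b : 'M[C]_n) : T := \row_k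
  match enum_val k with
  | None => t
  | Some (q, false, (i, j)) => re rc ((if q then b else a) i j)
  | Some (q, true, (i, j)) => im rc ((if q then b else a) i j)
  end.

Lemma coord_encode t a b : coord (encode t a b) None = t.
Proof. by rewrite /coord mxE enum_rankK. Qed.

Lemma cmat_encode q t a b : cmat q (encode t a b) = if q then b else a.
Proof. by apply/matrixP => i j; rewrite mxE /coord !mxE !enum_rankK /= -re_imE. Qed.

Variables (v p : 'M[R]_3).
Hypotheses (hv : tcone v) (hp : forall h, h \in ineqs -> 0 < ev h p).

(** The parameter enters squared, so that the displacement points into the cone whatever its
    sign. *)
Definition shifted (x : T) := v + coord x None ^+ 2 *: p.
Definition side k (x : T) := expd (- wt (row k (shifted x))).
Definition product (x : T) :=
  tproduct rc (- wt (row 0 (shifted x))) (- wt (row 1 (shifted x)))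
    (- wt (row 2 (shifted x))) (cmat false x) (cmat true x).
(** Its zeros are exact triangles for [v]. Points [v + t ^+ 2 *: p] interior to the cone make its
    infimum 0, and compactness of the box yields a zero. *)
Definition defect (x : T) : R := coord x None ^+ 2
  + hs2 (product x *m (product x)^t* - 1%:M)
  + hs2 (cmat false x *m (cmat false x)^t* - 1%:M)
  + hs2 (cmat true x *m (cmat true x)^t* - 1%:M)
  + hs2 (cmat false x *m J *m (cmat false x)^T - J)
  + hs2 (cmat true x *m J *m (cmat true x)^T - J).

Lemma continuous_wt_shifted k j : continuous (fun x : T => (- wt (row k (shifted x))) 0 j).
Proof.
have c l : continuous (fun x : T => shifted x k l).
  have -> : (fun x : T => shifted x k l) = (fun x => v k l + coord x None * coord x None * p k l).
    by apply/funext => x; rewrite !mxE expr2.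
  apply: contD; first exact: cont_cst.
  apply: contM; last exact: cont_cst.
  by apply: contM; exact: continuous_coord.
have -> : (fun x : T => (- wt (row k (shifted x))) 0 j) =
    (fun x => - (if (j < 3)%N then shifted x k (inord j) else
      if (rev_ord j < 3)%N then - shifted x k (inord (rev_ord j)) else 0)).
  by apply/funext => x; rewrite !mxE; case: ifP => // _; case: ifP => // _; rewrite !mxE.
apply: contN; case: (j < 3)%N; first exact: c.
case: (rev_ord j < 3)%N; last exact: cont_cst.
by apply: contN; exact: c.
Qed.

Lemma mcont_side k : mcont rc (side k).
Proof. by apply: mcont_expd => j; exact: continuous_wt_shifted. Qed.

Lemma mcont_product : mcont rc product.
Proof.
have c0 := mcont_side 0; have c1 := mcont_side 1; have c2 := mcont_side 2.
have d0 := mcont_cmat false; have d1 := mcont_cmat true.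
exact: (mcontM (mcontM (mcontM (mcontM c0 d0) c1) d1) c2).
Qed.

Lemma continuous_defect : continuous defect.
Proof.
have uc (f : T -> 'M[C]_n) : mcont rc f -> continuous (fun x => hs2 (f x *m (f x)^t* - 1%:M)).
  move=> cf; apply: cont_hs2; apply: mcontB; last exact: mcont_cst.
  by apply: mcontM => //; exact: mcont_trC.
have ic (f : T -> 'M[C]_n) : mcont rc f -> continuous (fun x => hs2 (f x *m J *m (f x)^T - J)).
  move=> cf; apply: cont_hs2; apply: mcontB; last exact: mcont_cst.
  apply: mcontM; last exact: mcont_tr.
  by apply: mcontM => //; exact: mcont_cst.
apply: contD; last by apply: ic; exact: mcont_cmat.
apply: contD; last by apply: ic; exact: mcont_cmat.
apply: contD; last by apply: uc; exact: mcont_cmat.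
apply: contD; last by apply: uc; exact: mcont_cmat.
apply: contD; last by apply: uc; exact: mcont_product.
by apply: contM; exact: continuous_coord.
Qed.

Definition box : set T := [set x | forall k, `[-1, 1]%classic (x ord0 k)].

Lemma unitary_entry (a : 'M[C]_n) i j : a \is unitarymx ->
  -1 <= re rc (a i j) <= 1 /\ -1 <= im rc (a i j) <= 1.
Proof.
move=> ua; have h : nsq rc (a i j) <= 1.
  rewrite -(unitary_row_nsq rc i ua) (bigD1 j) //= lerDl.
  by apply: sumr_ge0 => k _; exact: nsq_ge0.
have k (x : R) : x ^+ 2 <= 1 -> -1 <= x <= 1.
  by move=> hx; rewrite -ler_norml -(@expr_le1 _ 2) ?normr_ge0 // real_normK ?num_real.
move: h; rewrite nsq_re_im => h.
have := sqr_ge0 (im rc (a i j)); have := sqr_ge0 (re rc (a i j)) => h1 h2.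
by split; apply: k; lra.
Qed.

Lemma encode_box t a b : 0 <= t <= 1 -> a \is unitarymx -> b \is unitarymx -> box (encode t a b).
Proof.
move=> /andP[t0 t1] ua ub k; rewrite /= in_itv /= mxE.
case: (enum_val k) => [[[q [|]] [i j]]|].
- by have [] := @unitary_entry (if q then b else a) i j; first by case: q.
- by have [] := @unitary_entry (if q then b else a) i j; first by case: q.
- by rewrite t1 andbT; lra.
Qed.

Lemma defect_small e : 0 < e -> exists2 x, box x & defect x < e.
Proof.
move=> e0; pose t : R := Num.min 1 (e / 4).
have t0 : 0 < t by rewrite lt_min ltr01 divr_gt0.
have t1 : t <= 1 by rewrite ge_min lexx.
have te : t <= e / 4 by rewrite ge_min lexx orbT.
pose r : R := Num.min 1 (e / (2 * n.+1%:R)).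
have n1 : 0 < n.+1%:R :> R by rewrite ltr0n.
have r0 : 0 < r by rewrite lt_min ltr01 divr_gt0 // mulr_gt0.
have r1 : r <= 1 by rewrite ge_min lexx.
have re' : r <= e / (2 * n.+1%:R) by rewrite ge_min lexx orbT.
have hi : forall h, h \in ineqs -> 0 < ev h (v + t ^+ 2 *: p).
  by move=> h hin; rewrite evD evZ ltr_wpDl ?hv // mulr_gt0 ?exprn_gt0 ?hp.
(* With [eta = ln (1 + r)], the squared distance of the product from unitarity is at most
   [n * r ^+ 2]. *)
have [|a [b [ua ia ub ib hM]]] := interior_triangle rc flok hi (eta := ln (1 + r)).
  by rewrite ln_gt0 // ltrDl.
exists (encode t a b); first by apply: encode_box; rewrite ?t1 ?(ltW t0).
have uz (A : 'M[C]_n) : A \is unitarymx -> hs2 (A *m A^t* - 1%:M) = 0.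
  by move=> uA; rewrite unitary_mulC // subrr hs2_0.
have iz (A : 'M[C]_n) : isom A -> hs2 (A *m J *m A^T - J) = 0.
  by move=> iA; rewrite iA subrr hs2_0.
have Ea : cmat false (encode t a b) = a := cmat_encode false t a b.
have Eb : cmat true (encode t a b) = b := cmat_encode true t a b.
rewrite /defect Ea Eb coord_encode (uz a ua) (uz b ub) (iz a ia) (iz b ib) !addr0.
rewrite /product /shifted Ea Eb coord_encode.
have uM := tproduct_unit rc (- wt (row 0 (v + t ^+ 2 *: p))) (- wt (row 1 (v + t ^+ 2 *: p)))
  (- wt (row 2 (v + t ^+ 2 *: p))) ua ub.
have := near1_hs2 (pd_mulC uM) hM.
have e1 : expR (ln (1 + r)) - 1 = r.
  have p1 : 0 < 1 + r by lra.
  by rewrite lnK ?posrE // addrAC subrr add0r.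
rewrite e1 => h.
have h1 : t ^+ 2 <= e / 4.
  by rewrite expr2; apply: le_trans te; rewrite -[leRHS]mul1r ler_wpM2r // ltW.
have h2 : n%:R * r ^+ 2 <= e / 2.
  have hh : n.+1%:R * (e / (2 * n.+1%:R)) = e / 2.
    have k (x y : R) : y != 0 -> y * (x / (2 * y)) = x / 2 by move=> hy; field.
    by rewrite k // gt_eqF.
  have rr : r ^+ 2 <= r by rewrite expr2 -[leRHS]mul1r ler_wpM2r // ltW.
  rewrite -hh; apply: (@le_trans _ _ (n.+1%:R * r ^+ 2)).
    by rewrite ler_wpM2r ?sqr_ge0 // ler_nat.
  by rewrite ler_wpM2l ?(ltW n1) //; exact: le_trans rr re'.
by lra.
Qed.

Theorem triangle_exists : exists a b, [/\ a \is unitarymx, isom a, b \is unitarymx, isom b &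
  tproduct rc (wt (row 0 v)) (wt (row 1 v)) (wt (row 2 v)) a b \is unitarymx].
Proof.
have cb : compact box by apply: (@rV_compact _ _ (fun=> `[(-1 : R), 1]%classic)) => i; exact: segment_compact.
have [x0 bx0 _] := defect_small ltr01.
have [|c cbox hc] := compact_EVT_min (ex_intro _ x0 bx0) cb (f := defect).
  by apply: continuous_subspaceT; exact: continuous_defect.
have dc : defect c <= 0.
  rewrite leNgt; apply/negP => d0; have [x bx] := defect_small d0.
  by rewrite ltNge hc // inE.
have g0 m k (A : 'M[C]_(m, k)) := hs2_ge0 rc A.
move: dc; rewrite /defect.
have := g0 _ _ (product c *m (product c)^t* - 1%:M).
have := g0 _ _ (cmat false c *m (cmat false c)^t* - 1%:M).
have := g0 _ _ (cmat true c *m (cmat true c)^t* - 1%:M).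
have := g0 _ _ (cmat false c *m J *m (cmat false c)^T - J).
have := g0 _ _ (cmat true c *m J *m (cmat true c)^T - J).
have := sqr_ge0 (coord c None).
set z1 := _ ^+ 2; set z2 := hs2 _; set z3 := hs2 _; set z4 := hs2 _; set z5 := hs2 _; set z6 := hs2 _.
move=> p1 p2 p3 p4 p5 p6 ph.
have E1 : z1 = 0 by lra. have E2 : z2 = 0 by lra. have E3 : z3 = 0 by lra.
have E4 : z4 = 0 by lra. have E5 : z5 = 0 by lra. have E6 : z6 = 0 by lra.
have {}E1 : coord c None = 0 by apply/eqP; rewrite -sqrf_eq0; apply/eqP.
have {}E2 := hs2_eq0 E2; have {}E3 := hs2_eq0 E3; have {}E4 := hs2_eq0 E4.
have {}E5 := hs2_eq0 E5; have {}E6 := hs2_eq0 E6.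
have uE (A : 'M[C]_n) : A *m A^t* - 1%:M = 0 -> A \is unitarymx.
  by move=> /eqP; rewrite subr_eq0 => /eqP h; apply/unitarymxP.
have iE (A : 'M[C]_n) : A *m J *m A^T - J = 0 -> isom A.
  by move=> /eqP; rewrite subr_eq0 => /eqP.
have ua : cmat false c \is unitarymx by exact: uE.
have ub : cmat true c \is unitarymx by exact: uE.
have ia : isom (cmat false c) by exact: iE.
have ib : isom (cmat true c) by exact: iE.
have uM : product c \is unitarymx by exact: uE.
exists (cmat false c), (cmat true c); split; [exact: ua|exact: ia|exact: ub|exact: ib|].
apply: (tproductN_unitary ua ub).
by move: uM; rewrite /product /shifted E1 expr0n /= scale0r addr0.
Qed.

End Sufficiency.

(** * Schubert positions and necessity of the inequalities *)

Section Gram.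
Variables (R : realType) (C : numClosedFieldType) (rc : real_part R C).
Local Notation cR := (cR rc).
Local Notation expd := (expd rc).
Local Notation nsq := (nsq rc).
Local Notation ldiag := (ldiag rc).

Definition gram r n (S : 'M[C]_(r, n)) := S *m S^t*.
Definition lv r (Y : 'M[C]_r) : R := \sum_k ldiag (chol Y) k.

Lemma qf_gram r n (S : 'M[C]_(r, n)) x : qf (gram S) x = qf 1%:M (x *m S).
Proof. by rewrite /qf /gram trCM mulmx1 !mulmxA. Qed.

Lemma gram_pd r n (S : 'M[C]_(r, n)) : row_free S -> pd (gram S).
Proof.
move=> fS; split; first by rewrite /gram trCM trmxCK.
move=> x x0; rewrite qf_gram; have [_] := pd1 C n; apply.
by apply: contra x0 => /eqP h; rewrite -(mulmx_free_eq0 _ fS) h.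
Qed.

Lemma det_lv r (Y : 'M[C]_r) : pd Y -> \det Y = cR (expR (lv Y)).
Proof. by move=> /cholP[lY eY]; rewrite -(det_ltp rc lY) eY. Qed.

Lemma lv_congr r (T Y : 'M[C]_r) : T \in unitmx -> pd Y ->
  lv (T *m Y *m T^t*) = lv (T *m T^t*) + lv Y.
Proof.
move=> uT pY; apply: expR_inj; apply: (@cR_inj _ _ rc).
rewrite expRD real_complexM -!det_lv //; [|exact: pd_mulC|exact: pd_congr].
by rewrite !det_mulmx mulrAC.
Qed.

Lemma lv_gramM r n (T : 'M[C]_r) (S : 'M[C]_(r, n)) : T \in unitmx -> row_free S ->
  lv (gram (T *m S)) = lv (T *m T^t*) + lv (gram S).
Proof.
move=> uT fS; rewrite -lv_congr //; last exact: gram_pd.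
by rewrite /gram trCM !mulmxA.
Qed.

Lemma lv_gram_unitary r n (S : 'M[C]_(r, n)) (u : 'M[C]_n) : u \is unitarymx ->
  lv (gram (S *m u)) = lv (gram S).
Proof. by move=> uu; rewrite /gram trCM -mulmxA (mulmxA u) unitary_mulC // mul1mx. Qed.

(** Each squared diagonal entry of a Cholesky factor is a minimum over vectors supported on the
    first coordinates, so a comparison of the forms there compares the determinants. *)
Lemma gram_le r n p (S : 'M[C]_(r, n)) (S' : 'M[C]_(r, p)) (c : 'I_r -> R) :
  row_free S -> row_free S' ->
  (forall (m : 'I_r) (x : 'rV[C]_r), (forall l : 'I_r, (m < l)%N -> x 0 l = 0) ->
     qf 1%:M (x *m S) <= cR (expR (c m)) * qf 1%:M (x *m S')) ->
  lv (gram S) <= \sum_m c m + lv (gram S').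
Proof.
move=> fS fS' h; have [l1 e1] := cholP (gram_pd fS); have [l2 e2] := cholP (gram_pd fS').
rewrite /lv -big_split /=; apply: ler_sum => m _.
have [x [xm xl qx]] := ldiag_attained rc m l2.
have := ldiag_min rc l1 xm xl; rewrite e1 qf_gram => h1.
rewrite e2 qf_gram in qx.
have := h m x xl; rewrite qx -real_complexM -expRD => h2.
by have := le_trans h1 h2; rewrite lecR ler_expR.
Qed.

Lemma qf1_expd_le n (x : 'rV[C]_n) (d : 'rV[R]_n) (c : R) :
  (forall k, x 0 k != 0 -> d 0 k <= c) ->
  qf 1%:M (x *m expd d) <= cR (expR (2 * c)) * qf 1%:M x.
Proof.
move=> h; rewrite !(qf1_nsq rc) -real_complexM lecR mulr_sumr; apply: ler_sum => k _.
have -> : (x *m expd d) 0 k = x 0 k * cR (expR (d 0 k)).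
  by rewrite /expd mul_mx_diag !mxE.
have -> : nsq (x 0 k * cR (expR (d 0 k))) = expR (2 * d 0 k) * nsq (x 0 k).
  apply: (@cR_inj _ _ rc); rewrite -nsqE normrM exprMn !(nsqE rc) real_complexM mulrC; congr (_ * _).
  by rewrite nsq_cR expRM_natl.
have [->|xk] := eqVneq (x 0 k) 0; first by rewrite nsq0 !mulr0.
by rewrite ler_wpM2r ?nsq_ge0 // ler_expR ler_pM2l // h.
Qed.

(** The intersections are large enough for a greedy choice. The new vector is put in front, whence
    the reversed index, which [adapted_basis] undoes. *)
Lemma adapted_rows n (L : 'M[C]_n) (A : nat -> 'M[C]_n) k :
  (forall m, (m < k)%N -> (m < \rank (L :&: A m))%N) ->
  exists2 B : 'M[C]_(k, n), row_free B &
    forall i : 'I_k, (row i B <= L :&: A (rev_ord i))%MS.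
Proof.
elim: k => [|k IH] h.
  by exists 0; [rewrite /row_free mxrank0|case].
have [|B fB hB] := IH; first by move=> m mk; apply: h; exact: ltnW.
have /row_subPn[i hi] : ~~ (L :&: A k <= B)%MS.
  apply/negP => /mxrankS; rewrite (eqP fB) leqNgt => /negP; apply; exact: h.
pose x := row i (L :&: A k)%MS.
exists (col_mx x B : 'M[C]_(1 + k, n)).
  rewrite /row_free eqn_leq rank_leq_row /=.
  have : (B < x + B)%MS.
    rewrite ltmxE addsmxSr /=; apply: contra hi; apply: submx_trans.
    exact: addsmxSl.
  by move/rank_ltmx; rewrite (eqP fB) addsmxE.
move=> j; case: (@split_ordP 1 k j) => l ->.
  rewrite [row _ _]rowKu row_id.
  by rewrite (_ : nat_of_ord (rev_ord _) = k) ?row_sub //= ord1 /= subn1.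
rewrite [row _ _]rowKd; have := hB l.
by rewrite (_ : nat_of_ord (rev_ord (rshift 1 l)) = rev_ord l) //= !subSS.
Qed.

Lemma adapted_basis n (L : 'M[C]_n) (A : nat -> 'M[C]_n) :
  (forall m, (m < \rank L)%N -> (m < \rank (L :&: A m))%N) ->
  exists2 T : 'M[C]_(\rank L), T \in unitmx &
    forall i : 'I_(\rank L), (row i (T *m row_base L) <= A i)%MS.
Proof.
move=> /adapted_rows[B fB hB].
pose B' := rowsub (@rev_ord _) B.
have rB' i : row i B' = row (rev_ord i) B by apply/rowP => j; rewrite !mxE.
have fB' : row_free B'.
  rewrite /row_free eqn_leq rank_leq_row -{1}(eqP fB) mxrankS //.
  by apply/row_subP => i; rewrite -(rev_ordK i) -rB' row_sub.
have /submxP[T TE] : (B' <= row_base L)%MS.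
  rewrite eq_row_base; apply/row_subP => i; rewrite rB'.
  by apply: submx_trans (hB _) _; exact: capmxSl.
exists T.
  rewrite -row_free_unit /row_free -(mxrankMfree T (row_base_free L)) -TE.
  exact: fB'.
move=> i; rewrite -TE rB'; have := hB (rev_ord i); rewrite rev_ordK.
by move/submx_trans; apply; exact: capmxSr.
Qed.

End Gram.

(** * Intersections of subspaces with flags *)

Section Subspaces.
Variables (F : fieldType) (n : nat).
Implicit Types (A B G M L Q E : 'M[F]_n) (x : 'rV[F]_n).

Lemma copid_diag i : copid_mx i = diag_mx (\row_k (i <= k)%:R) :> 'M[F]_n.
Proof.
apply/matrixP => k l; rewrite !mxE -val_eqE /=; case: eqP => [kl|_] /=; last by rewrite ?mulr0n ?subrr ?subr0 ?oppr0 ?addr0.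
by rewrite ltnNge; case: leqP => _ /=; rewrite ?mulr1n ?mulr0n ?subr0 ?subrr.
Qed.

Lemma copid_le i j : (i <= j)%N -> (copid_mx j <= (copid_mx i : 'M[F]_n))%MS.
Proof.
move=> ij; have -> : copid_mx j = copid_mx j *m copid_mx i :> 'M[F]_n.
  rewrite !copid_diag mulmx_diag; congr diag_mx; apply/rowP => k; rewrite !mxE.
  by case: leqP => jk; rewrite ?mul0r // (leq_trans ij jk) mulr1.
exact: submxMl.
Qed.

Lemma copid_coord i x (k : 'I_n) : (x <= copid_mx i)%MS -> (k < i)%N -> x 0 k = 0.
Proof.
move=> /submxP[y ->] ki; rewrite copid_diag mul_mx_diag !mxE.
by rewrite leqNgt ki mulr0.
Qed.

Lemma cap_rank A B : (\rank A + \rank B <= n + \rank (A :&: B))%N.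
Proof. by rewrite -mxrank_sum_cap leq_add2r rank_leq_col. Qed.

Lemma cap_rank_in A B G : (A <= G)%MS -> (B <= G)%MS ->
  (\rank A + \rank B <= \rank G + \rank (A :&: B))%N.
Proof.
by move=> AG BG; rewrite -mxrank_sum_cap leq_add2r mxrankS // addsmx_sub AG.
Qed.

Lemma exists_outside A M : (\rank M < \rank A)%N -> exists x, (x <= A)%MS /\ ~~ (x <= M)%MS.
Proof.
move=> h; have /row_subPn[i hi] : ~~ (A <= M)%MS.
  by apply/negP => /mxrankS; rewrite leqNgt h.
by exists (row i A); rewrite row_sub.
Qed.

Lemma rank_extend M x : ~~ (x <= M)%MS -> \rank (M + x)%MS = (\rank M).+1.
Proof.
move=> hx; apply/eqP; rewrite eqn_leq; apply/andP; split.
  apply: leq_trans (mxrank_adds_leqif M x) _.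
  by rewrite -[X in (_ <= X)%N]addn1 leq_add2l rank_leq_row.
apply: rank_ltmx; rewrite ltmxE addsmxSl /=; apply: contra hx.
by apply: submx_trans; exact: addsmxSr.
Qed.

(** Write $x = q + m$ along $Q + M$: the vector $q$ is new in the intersection, since $q \in M$
    would put $x$ in $M$. *)
Lemma rank_cap_extend M x Q : ~~ (x <= M)%MS -> (x <= Q + M)%MS ->
  (\rank (M :&: Q) < \rank ((M + x) :&: Q))%N.
Proof.
move=> hx /sub_addsmxP[[u w] /= xE]; apply: rank_ltmx; rewrite ltmxE.
rewrite capmxS ?addsmxSl //=; apply/negP => h.
have : (u *m Q <= (M + x) :&: Q)%MS.
  rewrite sub_capmx submxMl andbT.
  have -> : u *m Q = x - w *m M by rewrite xE addrK.
  by rewrite addmx_sub ?addsmxSr // eqmx_opp (submx_trans (submxMl _ _)) ?addsmxSl.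
move=> /submx_trans/(_ h); rewrite sub_capmx => /andP[uM _].
by move/negP: hx; apply; rewrite xE addmx_sub ?submxMl.
Qed.

Lemma rank_cap_le M (N : 'M[F]_n) Q : (M <= N)%MS -> (\rank (M :&: Q) <= \rank (N :&: Q))%N.
Proof. by move=> MN; rewrite mxrankS // capmxS. Qed.

(* the vectors whose adjunction to M makes it meet E *)
Definition hull M E := if (M :&: E)%MS == 0 then (E + M)%MS else 1%:M.

Lemma hullP M E x : ~~ (x <= M)%MS -> (x <= hull M E)%MS -> (0 < \rank ((M + x) :&: E))%N.
Proof.
move=> hx; rewrite /hull; case: eqP => [_ h|/eqP h _].
  exact: leq_ltn_trans (leq0n _) (rank_cap_extend hx h).
by apply: leq_trans (rank_cap_le E (addsmxSl M x)); rewrite lt0n mxrank_eq0.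
Qed.

Lemma hull_rank M E : (minn n (\rank E + \rank M) <= \rank (hull M E))%N.
Proof.
rewrite /hull; case: eqP => h; last by rewrite mxrank1 geq_minl.
by rewrite mxrank_disjoint_sum ?geq_minr // capmxC.
Qed.

Lemma hull_sub M E G : (M <= G)%MS -> (E <= G)%MS ->
  (minn (\rank G) (\rank E + \rank M) <= \rank (hull M E :&: G))%N.
Proof.
move=> MG EG; rewrite /hull; case: eqP => h.
  rewrite (capmx_idPl _) ?addsmx_sub ?MG ?EG // mxrank_disjoint_sum ?geq_minr //.
  by rewrite capmxC.
by rewrite cap1mx geq_minl.
Qed.

(* Two opposite complete flags F_0 > F_1 > .. and G_0 < G_1 < .. admit a subspace in the
   Schubert position of any index set j_0 > j_1 > .. with respect to both of them. *)
Lemma opposite_schubert (Fl Gl : nat -> 'M[F]_n) (j : nat -> nat) r :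
  (forall a, \rank (Fl a) = n - a)%N -> (forall a, (a < n)%N -> \rank (Gl a) = a.+1) ->
  (forall a b, (a <= b)%N -> (Fl b <= Fl a)%MS) -> (forall a b, (a <= b)%N -> (Gl a <= Gl b)%MS) ->
  (forall m m', (m < m')%N -> (m' < r)%N -> (j m' < j m)%N) ->
  (forall m, (m < r)%N -> (j m < n)%N) ->
  exists L : 'M[F]_n, [/\ \rank L = r,
    forall m, (m < r)%N -> (m < \rank (L :&: Fl (j m)))%N,
    forall m, (m < r)%N -> (r - m <= \rank (L :&: Gl (j m)))%N &
    (0 < r)%N -> (L <= Fl (j r.-1))%MS].
Proof.
move=> rF rG nF nG; elim: r => [|r IH] jd jn.
  by exists 0; split=> //; rewrite mxrank0.
have [|m mr|L [rL hF hG LF]] := IH.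
- by move=> m m' mm' m'r; apply: jd => //; exact: ltnW.
- by apply: jn; exact: ltnW.
have jle m m' : (m <= m')%N -> (m' <= r)%N -> (j m' + (m' - m) <= j m)%N.
  elim: m' => [|m' IHm] mm' m'r; first by move: mm'; rewrite leqn0 => /eqP->; rewrite addn0.
  move: mm'; rewrite leq_eqVlt => /orP[/eqP<-|mm']; first by rewrite subnn addn0.
  have := IHm mm' (ltnW m'r); have := jd m' m'.+1 (ltnSn _) m'r; rewrite ltnS in mm'; lia.
have FG m : (m <= r)%N -> (r - m < \rank (Fl (j r) :&: Gl (j m)))%N.
  move=> mr; have := cap_rank (Fl (j r)) (Gl (j m)).
  rewrite rF rG ?jn ?ltnS //; have := jle m r mr (leqnn _).
  have := jn r (ltnSn _); lia.
(* The new vector is taken in the smallest [Gl (j c)] that offers one in [Fl (j r)] outside [L]; for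
   larger indices the intersection with [Fl (j r)] already lies in [L]. *)
pose P c := (c <= r)%N && ~~ ((Fl (j r) :&: Gl (j c)) <= L)%MS.
have P0 : exists c, P c.
  exists 0%N; rewrite /P /=; apply/negP => /mxrankS; rewrite rL leqNgt => /negP; apply.
  by have := FG 0%N (leq0n _); rewrite subn0.
have Pb c : P c -> (c <= r)%N by case/andP.
have [c /andP[cr /row_subPn[l hl]] cmax] := ex_maxnP P0 Pb.
set t := row l _ in hl; have : (t <= Fl (j r) :&: Gl (j c))%MS by exact: row_sub.
rewrite sub_capmx => /andP[tF tG].
have rLt := rank_extend hl.
have LtF : ((L + t)%MS <= Fl (j r))%MS.
  rewrite addsmx_sub tF andbT; case: (posnP r) => [r0|rp].
    by move/eqP: rL; rewrite r0 mxrank_eq0 => /eqP->; exact: sub0mx.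
  apply: submx_trans (LF rp) (nF _ _ _); apply: ltnW; apply: jd => //.
  by rewrite prednK.
exists (L + t)%MS; split=> //.
- by rewrite rLt rL.
- move=> m; rewrite ltnS leq_eqVlt => /orP[/eqP->|mr].
    by rewrite (capmx_idPl LtF) rLt rL.
  by apply: leq_trans (hF m mr) _; rewrite rank_cap_le ?addsmxSl.
move=> m; rewrite ltnS => mr; have [mc|cm] := leqP m c.
  have tG' : (t <= Gl (j m) + L)%MS.
    apply: submx_trans (addsmxSl _ _); apply: submx_trans tG (nG _ _ _).
    by have := jle m c mc cr; lia.
  apply: leq_trans (rank_cap_extend hl tG'); rewrite subSn // ltnS.
  move: mr; rewrite leq_eqVlt => /orP[/eqP->|]; last exact: hG.
  by rewrite subnn.
have : ~~ P m by apply/negP => /cmax; rewrite leqNgt cm.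
rewrite /P mr /= negbK => h; rewrite subSn //; apply: leq_trans (FG m mr) _.
apply: mxrankS; rewrite sub_capmx (submx_trans h (addsmxSl _ _)).
exact: capmxSr.
Qed.

End Subspaces.

(** * Horn inequalities from Schubert positions *)

Section Necessity.
Variables (R : realType) (C : numClosedFieldType) (rc : real_part R C).
Local Notation cR := (cR rc).
Local Notation expd := (expd rc).
Local Notation lv := (lv rc).
Variables (n : nat) (sg : nat -> bool) (fl : seq zmat).
Hypothesis flok : flags_ok n sg fl.
Let n5 : (5 < n)%N. Proof. by case/and5P: flok. Qed.
Local Notation wt := (@wt R n).
Local Notation tproduct := (@tproduct R C rc n).
Implicit Types (u v : 'rV[R]_3) (a b : 'M[C]_n).

Definition wtn u (j : nat) : R :=
  if (j < 3)%N then u 0 (inord j) else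
  if (n - j.+1 < 3)%N then - u 0 (inord (n - j.+1)) else 0.

Lemma wtE u j : wt u 0 j = wtn u j. Proof. by rewrite mxE. Qed.

Lemma wtn_rev u k : (0 < k <= n)%N -> wtn u (n - k) = - wtn u k.-1.
Proof.
case: k => // k /= kn.
by rewrite -(wtE u (Ordinal kn)) -(wt_rev flok u (Ordinal kn)) wtE.
Qed.

Lemma unit_row_free r (T : 'M[C]_r) (S : 'M[C]_(r, n)) : T \in unitmx -> row_free S ->
  row_free (T *m S).
Proof. by rewrite -row_free_unit => fT fS; rewrite /row_free mxrankMfree. Qed.

Lemma row_free_mulr r (S : 'M[C]_(r, n)) (g : 'M[C]_n) : g \in unitmx -> row_free S ->
  row_free (S *m g).
Proof. by rewrite -row_free_unit => fg fS; rewrite /row_free mxrankMfree. Qed.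

(** In the basis given by [T], the first [m] vectors and the [m]-th involve only coordinates where
    [d] is at most [c m], so $e^d$ multiplies the squared volume by at most $e^{2\sum c_m}$. *)
Lemma gram_expd_le r (T : 'M[C]_r) (S : 'M[C]_(r, n)) (d : 'rV[R]_n) (c : 'I_r -> R) :
  T \in unitmx -> row_free S ->
  (forall (m : 'I_r) (x : 'rV[C]_r), (forall l : 'I_r, (m < l)%N -> x 0 l = 0) ->
     forall k, (x *m (T *m S)) 0 k != 0 -> d 0 k <= c m) ->
  lv (gram (S *m expd d)) <= \sum_m 2 * c m + lv (gram S).
Proof.
move=> uT fS h; have fT := unit_row_free uT fS.
have fS' := row_free_mulr (expd_unit rc d) fS.
have := @gram_le _ _ rc r n n (T *m (S *m expd d)) (T *m S) (fun m => 2 * c m)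
  (unit_row_free uT fS') fT.
rewrite !lv_gramM // addrCA lerD2l; apply=> m x hx.
by rewrite (mulmxA T) mulmxA; apply: qf1_expd_le => k; exact: h.
Qed.

Lemma horn_arith (l0 l1 l2 s1 s2 s3 : R) : l1 <= 2 * s1 + l0 -> l2 <= 2 * s2 + l1 ->
  l0 <= - (2 * s3) + l2 -> s3 <= s1 + s2.
Proof. by lra. Qed.

Section Horn.
Variables (v1 v2 v3 : 'rV[R]_3) (a b u : 'M[C]_n).
Hypotheses (c1 : chamber v1) (c2 : chamber v2) (c3 : chamber v3).
Hypotheses (ua : a \is unitarymx) (ub : b \is unitarymx).
Hypothesis uu : u \is unitarymx.
Local Notation D1 := (expd (wt v1)).
Local Notation D2 := (expd (wt v2)).
Hypothesis uE : D1 *m a *m D2 = u *m expd (- wt v3) *m b^t*.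

(** The flags of vectors supported on the last coordinates, for the three diagonal factors, all
    pulled back to the source of the product. [Et] and [Ft] are indexed by codimension, [Gt] by
    dimension. *)
Definition Et i : 'M[C]_n := copid_mx i.
Definition Ft j : 'M[C]_n := copid_mx j *m invmx (D1 *m a).
Definition Gt k : 'M[C]_n := copid_mx (n - k) *m u^t*.

Let uD1a : D1 *m a \in unitmx.
Proof. by rewrite unitmx_mul expd_unit unitarymx_unit. Qed.

Let uut : u^t* \in unitmx.
Proof. by rewrite unitmx_trC unitarymx_unit. Qed.

Lemma rank_Et i : \rank (Et i) = (n - i)%N.
Proof.
have [ni|ni] := leqP i n; first exact: rank_copid_mx.
rewrite (_ : Et i = 0) ?mxrank0; first by apply/esym/eqP; rewrite subn_eq0 ltnW.
rewrite /Et copid_diag; apply/matrixP => k l; rewrite !mxE.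
by rewrite leqNgt (ltn_trans (ltn_ord k) ni) mul0rn.
Qed.

Lemma rank_Ft i : \rank (Ft i) = (n - i)%N.
Proof. by rewrite mxrankMfree ?row_free_unit ?unitmx_inv // rank_Et. Qed.

Lemma rank_Gt k : (k <= n)%N -> \rank (Gt k) = k.
Proof.
by move=> kn; rewrite mxrankMfree ?row_free_unit // (rank_Et (n - k)) subKn.
Qed.

Lemma Ft_le i j : (i <= j)%N -> (Ft j <= Ft i)%MS.
Proof. by move=> ij; apply: submxMr; exact: copid_le. Qed.

Lemma Gt_le k l : (k <= l)%N -> (Gt k <= Gt l)%MS.
Proof. by move=> kl; apply: submxMr; apply: copid_le; exact: leq_sub2l. Qed.

Lemma coord_rows r (B : 'M[C]_(r, n)) (t : nat -> nat) :
  (forall i : 'I_r, (row i B <= Et (t i))%MS) ->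
  (forall m m', (m <= m')%N -> (m' < r)%N -> (t m' <= t m)%N) ->
  forall (m : 'I_r) (x : 'rV[C]_r), (forall l : 'I_r, (m < l)%N -> x 0 l = 0) ->
  forall k : 'I_n, (x *m B) 0 k != 0 -> (t m <= k)%N.
Proof.
move=> hB ht m x hx k; apply: contraR; rewrite -ltnNge => km; apply/eqP.
rewrite mxE big1 // => l _; have [lm|ml] := leqP l m; last by rewrite hx // mul0r.
have := copid_coord (hB l) (leq_trans km (ht _ _ lm (ltn_ord m))).
by rewrite mxE => ->; rewrite mulr0.
Qed.

(** Follow the squared volume of [L] through $e^{v_1}$ and $e^{v_2}$, where adapted bases bound its
    growth, and back through $e^{v_3}$, which changes its logarithm by at most $-2\sum w_3$. Unitary
    factors leave it unchanged. *)
Theorem horn (L : 'M[C]_n) (i j k : nat -> nat) :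
  (forall m, (m < \rank L)%N -> (m < \rank (L :&: Et (i m)))%N) ->
  (forall m, (m < \rank L)%N -> (m < \rank (L :&: Ft (j m)))%N) ->
  (forall m, (m < \rank L)%N -> (m < \rank (L :&: Gt (k m)))%N) ->
  (forall m m', (m <= m')%N -> (m' < \rank L)%N ->
     [&& i m' <= i m, j m' <= j m & k m <= k m']%N) ->
  (forall m, (m < \rank L)%N -> [&& i m < n, j m < n & 0 < k m <= n]%N) ->
  \sum_(m < \rank L) wtn v3 (k m).-1 <= \sum_(m < \rank L) (wtn v1 (i m) + wtn v2 (j m)).
Proof.
move=> hE hF hG mono bd.
have im m m' : (m <= m')%N -> (m' < \rank L)%N -> (i m' <= i m)%N.
  by move=> h1 h2; have /and3P[] := mono m m' h1 h2.
have jm m m' : (m <= m')%N -> (m' < \rank L)%N -> (j m' <= j m)%N.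
  by move=> h1 h2; have /and3P[] := mono m m' h1 h2.
have km m m' : (m <= m')%N -> (m' < \rank L)%N -> (n - k m' <= n - k m)%N.
  by move=> h1 h2; have /and3P[_ _ h] := mono m m' h1 h2; exact: leq_sub2l.
have [T1 uT1 B1] := adapted_basis hE.
have [T2 uT2 B2] := adapted_basis hF.
have [T3 uT3 B3] := adapted_basis hG.
have fS : row_free (row_base L) := row_base_free L.
move: (row_base L) B1 B2 B3 fS => S B1 B2 B3 fS.
have s1 : lv (gram (S *m D1)) <= \sum_(m < \rank L) 2 * wtn v1 (i m) + lv (gram S).
  apply: (gram_expd_le (c := fun m => wtn v1 (i m)) uT1 fS) => m x hx l xl.
  have il := coord_rows B1 im hx xl; have /and3P[bi _ _] := bd m (ltn_ord m).
  by have := decreasing_wt flok c1 (i := Ordinal bi) (j := l) il; rewrite !wtE.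
have s2 : lv (gram (S *m D1 *m a *m D2)) <=
    \sum_(m < \rank L) 2 * wtn v2 (j m) + lv (gram (S *m D1)).
  rewrite -[X in _ <= _ + X](lv_gram_unitary rc (S *m D1) ua).
  have fS1 : row_free (S *m D1 *m a) by rewrite -mulmxA; exact: row_free_mulr.
  apply: (gram_expd_le (c := fun m => wtn v2 (j m)) uT2 fS1) => m x hx l xl.
  have B2' (q : 'I_(\rank L)) : (row q (T2 *m (S *m D1 *m a)) <= Et (j q))%MS.
    have := submxMr (D1 *m a) (B2 q); rewrite /Ft mulmxKV // -row_mul.
    by rewrite !mulmxA.
  have jl := coord_rows B2' jm hx xl; have /and3P[_ bj _] := bd m (ltn_ord m).
  by have := decreasing_wt flok c2 (i := Ordinal bj) (j := l) jl; rewrite !wtE.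
have s3 : lv (gram S) <= \sum_(m < \rank L) (- (2 * wtn v3 (k m).-1)) + lv (gram (S *m D1 *m a *m D2)).
  rewrite -(mulmxA S) -(mulmxA S) uE (mulmxA S) (mulmxA S).
  have ubt : b^t* \is unitarymx by rewrite trmxC_unitary.
  rewrite (lv_gram_unitary rc _ ubt) -(lv_gram_unitary rc S uu).
  have fSu : row_free (S *m u) by rewrite row_free_mulr // unitarymx_unit.
  have fS3 := row_free_mulr (expd_unit rc (- wt v3)) fSu.
  have := gram_expd_le (d := wt v3) (c := fun m : 'I_(\rank L) => - wtn v3 (k m).-1) uT3 fS3.
  rewrite -(mulmxA _ (expd (- wt v3))) -{2}(opprK (wt v3)) expdD addNr expd0 mulmx1.
  under eq_bigr do rewrite mulrN.
  apply=> m x hx l xl.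
  have B3' (q : 'I_(\rank L)) : (row q (T3 *m (S *m u)) <= Et (n - k q))%MS.
    have := submxMr u (B3 q); rewrite /Gt -(mulmxA _ (u^t*)) unitary_trCmul // mulmx1.
    by rewrite -row_mul !mulmxA.
  have yl : (x *m (T3 *m (S *m u))) 0 l != 0.
    apply: contra xl => /eqP yl; rewrite (mulmxA T3) (mulmxA x) /expd mul_mx_diag !mxE.
    by rewrite mxE in yl; rewrite yl mul0r.
  have nl := coord_rows (t := fun m => (n - k m)%N) B3' km hx yl.
  have /and3P[_ _ bk] := bd m (ltn_ord m); rewrite -(wtn_rev v3 bk).
  have nk : (n - k m < n)%N by rewrite (leq_ltn_trans nl).
  by have := decreasing_wt flok c3 (i := Ordinal nk) (j := l) nl; rewrite opprK !wtE.
have S1 : \sum_(m < \rank L) 2 * wtn v1 (i m) = 2 * \sum_(m < \rank L) wtn v1 (i m) by rewrite mulr_sumr.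
have S2 : \sum_(m < \rank L) 2 * wtn v2 (j m) = 2 * \sum_(m < \rank L) wtn v2 (j m) by rewrite mulr_sumr.
have S3 : \sum_(m < \rank L) (- (2 * wtn v3 (k m).-1)) = - (2 * \sum_(m < \rank L) wtn v3 (k m).-1).
  by rewrite sumrN mulr_sumr.
rewrite S1 in s1; rewrite S2 in s2; rewrite S3 in s3.
by rewrite big_split; exact: horn_arith s1 s2 s3.
Qed.

Lemma horn_rank r (L : 'M[C]_n) (i j k : nat -> nat) : \rank L = r ->
  (forall m, (m < r)%N -> [&& m < \rank (L :&: Et (i m)), m < \rank (L :&: Ft (j m))
     & m < \rank (L :&: Gt (k m))]%N) ->
  (forall m m', (m <= m')%N -> (m' < r)%N -> [&& i m' <= i m, j m' <= j m & k m <= k m']%N) ->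
  (forall m, (m < r)%N -> [&& i m < n, j m < n & 0 < k m <= n]%N) ->
  \sum_(m < r) wtn v3 (k m).-1 <= \sum_(m < r) (wtn v1 (i m) + wtn v2 (j m)).
Proof.
move=> <- h mono bd; apply: horn => // m mr; by have /and3P[] := h m mr.
Qed.

End Horn.

Lemma pairs2 (P : nat -> nat -> Prop) : P 0%N 0%N -> P 0%N 1%N -> P 1%N 1%N ->
  forall m m', (m <= m')%N -> (m' < 2)%N -> P m m'.
Proof. by move=> ? ? ? [|[|m]] [|[|m']]. Qed.

Lemma pairs3 (P : nat -> nat -> Prop) : P 0%N 0%N -> P 0%N 1%N -> P 0%N 2%N -> P 1%N 1%N -> P 1%N 2%N -> P 2%N 2%N ->
  forall m m', (m <= m')%N -> (m' < 3)%N -> P m m'.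
Proof. by move=> ? ? ? ? ? ? [|[|[|m]]] [|[|[|m']]]. Qed.

Lemma strict_pairs2 (P : nat -> nat -> Prop) : P 0%N 1%N ->
  forall m m', (m < m')%N -> (m' < 2)%N -> P m m'.
Proof. by move=> ? [|[|m]] [|[|m']]. Qed.

Lemma strict_pairs3 (P : nat -> nat -> Prop) : P 0%N 1%N -> P 0%N 2%N -> P 1%N 2%N ->
  forall m m', (m < m')%N -> (m' < 3)%N -> P m m'.
Proof. by move=> ? ? ? [|[|[|m]]] [|[|[|m']]]. Qed.

Section Positions.
Variables (E F G : nat -> 'M[C]_n) (w1 w2 w3 : nat -> R).
Hypothesis rE : forall i, \rank (E i) = (n - i)%N.
Hypothesis rF : forall i, \rank (F i) = (n - i)%N.
Hypothesis rG : forall k, (k <= n)%N -> \rank (G k) = k.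
Hypothesis nF : forall i j, (i <= j)%N -> (F j <= F i)%MS.
Hypothesis nG : forall i j, (i <= j)%N -> (G i <= G j)%MS.
Hypothesis hornH : forall r (L : 'M[C]_n) (i j k : nat -> nat), \rank L = r ->
  (forall m, (m < r)%N -> [&& m < \rank (L :&: E (i m)), m < \rank (L :&: F (j m))
     & m < \rank (L :&: G (k m))]%N) ->
  (forall m m', (m <= m')%N -> (m' < r)%N -> [&& i m' <= i m, j m' <= j m & k m <= k m']%N) ->
  (forall m, (m < r)%N -> [&& i m < n, j m < n & 0 < k m <= n]%N) ->
  \sum_(m < r) w3 (k m).-1 <= \sum_(m < r) (w1 (i m) + w2 (j m)).

Lemma meets (L X : 'M[C]_n) (x : 'rV[C]_n) : x != 0 -> (x <= L)%MS -> (x <= X)%MS ->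
  (0 < \rank (L :&: X))%N.
Proof.
move=> x0 xL xX; rewrite lt0n mxrank_eq0; apply: contra x0 => /eqP h.
by rewrite -submx0 -h sub_capmx xL.
Qed.

Lemma exists_nonzero (A : 'M[C]_n) : (0 < \rank A)%N -> exists2 x : 'rV[C]_n, x != 0 & (x <= A)%MS.
Proof.
move=> h; have [|x [xA x0]] := @exists_outside _ _ A 0; first by rewrite mxrank0.
by exists x => //; rewrite -submx0.
Qed.

Lemma rank_line (x : 'rV[C]_n) : x != 0 -> \rank <<x>>%MS = 1%N.
Proof. by move=> x0; rewrite mxrank_gen rank_rV x0. Qed.

Lemma rank_cap_sub (L X : 'M[C]_n) : (L <= X)%MS -> \rank (L :&: X) = \rank L.
Proof. by move=> LG; rewrite (capmx_idPl LG). Qed.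

(** The three subspaces have a common line, by counting dimensions. *)
Lemma weyl p q : (p + q < n)%N -> w3 (p + q) <= w1 p + w2 q.
Proof.
move=> pq; have h1 := cap_rank (E p) (F q).
have h2 := cap_rank (E p :&: F q)%MS (G (p + q).+1).
rewrite rE rF in h1; rewrite rG // in h2.
have [|x x0] := @exists_nonzero (E p :&: F q :&: G (p + q).+1)%MS; first by lia.
rewrite !sub_capmx => /andP[/andP[xE xF] xG].
have xx : (x <= <<x>>)%MS by rewrite genmxE.
have := @hornH 1 <<x>>%MS (fun=> p) (fun=> q) (fun=> (p + q).+1) (rank_line x0).
rewrite !big_ord_recl !big_ord0 !addr0 /=; apply.
- by case=> // _; rewrite !(meets x0 xx).
- by move=> m m' _ _; rewrite !leqnn.
- by move=> m _; rewrite pq !andbT; lia.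
Qed.

(** [opposite_schubert] takes care of [F] and [G]; the position required with respect to [E] is that
    of every subspace of dimension [r]. *)
Lemma lidskii r (j : nat -> nat) : (r <= n)%N ->
  (forall m m', (m < m')%N -> (m' < r)%N -> (j m' < j m)%N) ->
  (forall m, (m < r)%N -> (j m < n)%N) ->
  \sum_(m < r) w3 (j (r.-1 - m)%N) <= \sum_(m < r) (w1 (r.-1 - m) + w2 (j m)).
Proof.
move=> rn jd jn.
have [||L [rL hF hG _]] := @opposite_schubert _ n F (fun m => G m.+1) j r rF _ nF _ jd jn.
- by move=> a an; rewrite rG.
- by move=> a b ab; exact: nG.
have jw m m' : (m <= m')%N -> (m' < r)%N -> (j m' <= j m)%N.
  rewrite leq_eqVlt => /orP[/eqP->//|mm'] m'r; exact/ltnW/jd.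
apply: (@hornH r L (fun m => r.-1 - m)%N j (fun m => (j (r.-1 - m)%N).+1) rL).
- move=> m mr; rewrite hF // andTb; apply/andP; split.
    by have := cap_rank L (E (r.-1 - m)); rewrite rL rE; lia.
  have rm : (r.-1 - m < r)%N by lia.
  by have := hG _ rm; lia.
- by move=> m m' mm' m'r; rewrite jw // ltnS; apply/and3P; split=> //; [lia|apply: jw; lia].
- by move=> m mr; rewrite jn // ltnS leq0n jn; [rewrite andbT; lia|lia].
Qed.

(** The name lists the three index sets, counted from 1 and for [n = 6]. A line in [E 2 :&: G 3] is
    enlarged inside [G 3] to a plane that meets [F 2]; such a plane meets [G 2] by dimension. *)
Lemma horn_13_13_23 : w3 1 + w3 2 <= w1 2 + w2 2 + (w1 0 + w2 0).
Proof.
have n5' := n5; have e2 : n.-1.-1 = (n - 2)%N by clear -n5'; lia.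
have e3 : (n - 2).-1 = (n - 3)%N by clear -n5'; lia.
have [|e e0] := @exists_nonzero (E 2 :&: G 3)%MS.
  by have := cap_rank (E 2) (G 3); rewrite rE rG; clear -n5'; lia.
rewrite sub_capmx => /andP[eE eG]; pose M := <<e>>%MS.
have rM : \rank M = 1%N := rank_line e0.
have eM : (e <= M)%MS by rewrite genmxE.
have MG : (M <= G 3)%MS by rewrite genmxE.
have [|w []] := @exists_outside _ _ (hull M (F 2) :&: G 3)%MS M.
  have := cap_rank (hull M (F 2)) (G 3); have := hull_rank M (F 2).
  by rewrite rM rF rG; clear -n5'; lia.
rewrite sub_capmx => /andP[wF wG] wM; have rL := rank_extend wM; rewrite rM in rL.
have LG : ((M + w)%MS <= G 3)%MS by rewrite addsmx_sub MG.
have := @hornH 2 _ (nth 0 [:: 2; 0])%N (nth 0 [:: 2; 0])%N (nth 0 [:: 2; 3])%N rL.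
rewrite !big_ord_recl !big_ord0 !addr0 /=; apply.
- case=> [|[|//]] _ /=.
    rewrite (meets e0 (submx_trans eM (addsmxSl _ _)) eE) (hullP wM wF) /=.
    have := cap_rank_in LG (nG (isT : 2 <= 3)%N).
    by rewrite rL !rG; clear -n5'; lia.
  rewrite (rank_cap_sub LG) rL.
  have := cap_rank (M + w)%MS (E 0); have := cap_rank (M + w)%MS (F 0).
  by rewrite rL rE rF; clear -n5'; lia.
- by apply: pairs2.
- by case=> [|[|//]] _ /=; clear -n5'; lia.
Qed.

(** The line [G 1] is enlarged inside [G n.-1] by one vector that makes it meet both [E 2] and
    [F (n - 3)]. *)
Lemma horn_13_14_15 : w3 0 + w3 (n - 2) <= w1 2 + w2 (n - 3) + (w1 0 + w2 0).
Proof.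
have n5' := n5; have e2 : n.-1.-1 = (n - 2)%N by clear -n5'; lia.
have e3 : (n - 2).-1 = (n - 3)%N by clear -n5'; lia.
pose M := G 1.
have rM : \rank M = 1%N by rewrite rG //; clear -n5'; lia.
have MG : (M <= G n.-1)%MS by apply: nG; clear -n5'; lia.
have [|w []] := @exists_outside _ _ (hull M (E 2) :&: hull M (F (n - 3)) :&: G n.-1)%MS M.
  have := cap_rank (hull M (E 2) :&: hull M (F (n - 3)))%MS (G n.-1).
  have := cap_rank (hull M (E 2)) (hull M (F (n - 3))).
  have := hull_rank M (E 2); have := hull_rank M (F (n - 3)).
  by rewrite rM rE rF rG; clear -n5'; lia.
rewrite !sub_capmx => /andP[/andP[wE wF] wG] wM; have rL := rank_extend wM; rewrite rM in rL.
have LG : ((M + w)%MS <= G n.-1)%MS by rewrite addsmx_sub MG.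
have := @hornH 2 _ (nth 0 [:: 2; 0])%N (nth 0 [:: n - 3; 0])%N (nth 0 [:: 1; n.-1])%N rL.
rewrite !big_ord_recl !big_ord0 !addr0 /= e2.
apply.
- case=> [|[|//]] _ /=.
    rewrite (hullP wM wE) (hullP wM wF) /=.
    apply: leq_trans (rank_cap_le (G 1) (addsmxSl M w)).
    by rewrite (rank_cap_sub (submx_refl _)) rM.
  rewrite (rank_cap_sub LG) rL.
  have := cap_rank (M + w)%MS (E 0); have := cap_rank (M + w)%MS (F 0).
  by rewrite rL rE rF; clear -n5'; lia.
- by apply: pairs2 => /=; clear -n5'; lia.
- by case=> [|[|//]] _ /=; clear -n5'; lia.
Qed.

(** A line in [F (n - 3) :&: G (n - 2)] is enlarged inside [G (n - 2)] to a plane that meets [E 2]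
    and [G 2]. *)
Lemma horn_13_14_24 : w3 1 + w3 (n - 3) <= w1 2 + w2 (n - 3) + (w1 0 + w2 0).
Proof.
have n5' := n5; have e2 : n.-1.-1 = (n - 2)%N by clear -n5'; lia.
have e3 : (n - 2).-1 = (n - 3)%N by clear -n5'; lia.
have [|f f0] := @exists_nonzero (F (n - 3) :&: G (n - 2))%MS.
  by have := cap_rank (F (n - 3)) (G (n - 2)); rewrite rF rG; clear -n5'; lia.
rewrite sub_capmx => /andP[fF fG]; pose M := <<f>>%MS.
have rM : \rank M = 1%N := rank_line f0.
have fM : (f <= M)%MS by rewrite genmxE.
have MG : (M <= G (n - 2))%MS by rewrite genmxE.
have G2 : (G 2 <= G (n - 2))%MS by apply: nG; clear -n5'; lia.
have [|w []] := @exists_outside _ _ (hull M (E 2) :&: (hull M (G 2) :&: G (n - 2)))%MS M.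
  have := cap_rank (hull M (E 2)) (hull M (G 2) :&: G (n - 2))%MS.
  have := hull_rank M (E 2); have := hull_sub MG G2.
  by rewrite rM rE !rG; clear -n5'; lia.
rewrite !sub_capmx => /andP[wE /andP[wG2 wG]] wM; have rL := rank_extend wM; rewrite rM in rL.
have LG : ((M + w)%MS <= G (n - 2))%MS by rewrite addsmx_sub MG.
have := @hornH 2 _ (nth 0 [:: 2; 0])%N (nth 0 [:: n - 3; 0])%N (nth 0 [:: 2; n - 2])%N rL.
rewrite !big_ord_recl !big_ord0 !addr0 /= e3.
apply.
- case=> [|[|//]] _ /=.
    by rewrite (hullP wM wE) (hullP wM wG2) (meets f0 (submx_trans fM (addsmxSl _ _)) fF).
  rewrite (rank_cap_sub LG) rL.
  have := cap_rank (M + w)%MS (E 0); have := cap_rank (M + w)%MS (F 0).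
  by rewrite rL rE rF; clear -n5'; lia.
- by apply: pairs2 => /=; clear -n5'; lia.
- by case=> [|[|//]] _ /=; clear -n5'; lia.
Qed.

(** Inside [G n.-1], the line [G 1] is enlarged to a plane that meets [F (n - 2)], and then to a
    space that meets [E (n - 3)] and contains a plane of [F 2]. *)
Lemma horn_124_135_145 : w3 0 + (w3 (n - 3) + w3 (n - 2)) <=
  w1 (n - 3) + w2 (n - 2) + (w1 1 + w2 2 + (w1 0 + w2 0)).
Proof.
have n5' := n5; have e2 : n.-1.-1 = (n - 2)%N by clear -n5'; lia.
have e3 : (n - 2).-1 = (n - 3)%N by clear -n5'; lia.
pose M1 := G 1; pose H := G n.-1.
have rM1 : \rank M1 = 1%N by rewrite rG //; clear -n5'; lia.
have rH : \rank H = n.-1 by rewrite rG //; clear -n5'; lia.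
have M1H : (M1 <= H)%MS by apply: nG; clear -n5'; lia.
have [|f []] := @exists_outside _ _ (hull M1 (F (n - 2)) :&: H)%MS M1.
  have := cap_rank (hull M1 (F (n - 2))) H; have := hull_rank M1 (F (n - 2)).
  by rewrite rM1 rF rH; clear -n5'; lia.
rewrite sub_capmx => /andP[fF fH] fM1; have := rank_extend fM1; rewrite rM1.
have hF := hullP fM1 fF.
have := addsmxSl M1 f; have : ((M1 + f)%MS <= H)%MS by rewrite addsmx_sub M1H.
move: (M1 + f)%MS hF => M hF MH M1M rM.
have hQ : (0 < \rank (M :&: F 2))%N.
  by apply: leq_trans hF _; rewrite mxrankS // capmxS // nF //; clear -n5'; lia.
have hE := hull_rank M (E (n - 3)); rewrite rM rE in hE.
have [e [eH eM eE eQ]] : exists e : 'rV[C]_n, [/\ (e <= H)%MS, ~~ (e <= M)%MS,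
    (e <= hull M (E (n - 3)))%MS & (1 < \rank ((M + e) :&: F 2))%N].
  (* If [M] meets [F 2] only in a line, then [F 2 + M] is a hyperplane, and the three conditions on
     [e] still leave a space larger than [M]. *)
  have [Q2|Q1] := ltnP 1 (\rank (M :&: F 2)).
    have [|e []] := @exists_outside _ _ (hull M (E (n - 3)) :&: H)%MS M.
      by have := cap_rank (hull M (E (n - 3))) H; rewrite rH rM; clear -n5' hE; lia.
    rewrite sub_capmx => /andP[eE eH] eM; exists e; split=> //.
    exact: leq_trans Q2 (rank_cap_le _ (addsmxSl _ _)).
  have rQ : \rank (F 2 + M)%MS = n.-1.
    by have := mxrank_sum_cap (F 2) M; rewrite capmxC rF rM; clear -n5' Q1 hQ; lia.
  have [|e []] := @exists_outside _ _ ((F 2 + M) :&: hull M (E (n - 3)) :&: H)%MS M.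
    have := cap_rank ((F 2 + M) :&: hull M (E (n - 3)))%MS H.
    have := cap_rank (F 2 + M)%MS (hull M (E (n - 3))).
    by rewrite rH rM rQ; clear -n5' hE; lia.
  rewrite !sub_capmx => /andP[/andP[eQ eE] eH] eM; exists e; split=> //.
  exact: leq_ltn_trans hQ (rank_cap_extend eM eQ).
have rL := rank_extend eM; rewrite rM in rL.
have LH : ((M + e)%MS <= H)%MS by rewrite addsmx_sub MH.
have := @hornH 3 _ (nth 0 [:: n - 3; 1; 0])%N (nth 0 [:: n - 2; 2; 0])%N
  (nth 0 [:: 1; n - 2; n.-1])%N rL.
rewrite !big_ord_recl !big_ord0 !addr0 /= e3.
rewrite e2.
apply.
- case=> [|[|[|//]]] _ /=.
  + rewrite (hullP eM eE) /= (leq_trans hF (rank_cap_le _ (addsmxSl _ _))) /=.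
    apply: leq_trans (rank_cap_le (G 1) (submx_trans M1M (addsmxSl M e))).
    by rewrite (rank_cap_sub (submx_refl _)) rM1.
  + rewrite eQ; have := cap_rank (M + e)%MS (E 1).
    have nn : (n - 2 <= n.-1)%N by clear -n5'; lia.
    have := cap_rank_in LH (nG nn).
    by rewrite rL rE rH rG; clear -n5'; lia.
  rewrite (rank_cap_sub LH) rL.
  have := cap_rank (M + e)%MS (E 0); have := cap_rank (M + e)%MS (F 0).
  by rewrite rL rE rF; clear -n5'; lia.
- by apply: pairs3 => /=; clear -n5'; lia.
- by case=> [|[|[|//]]] _ /=; clear -n5'; lia.
Qed.

End Positions.

(** The singular value problem in $GL_n$, to which triangles in either group lead on forgetting
    $J$. *)
Definition triangle (u1 u2 u3 : 'rV[R]_3) := exists a b, [/\ a \is unitarymx, b \is unitarymx &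
  tproduct (wt u1) (wt u2) (wt u3) a b \is unitarymx].

Lemma triangle_rot u1 u2 u3 : triangle u1 u2 u3 -> triangle u2 u3 u1.
Proof.
move=> [a [b [ua ub uu]]]; exists b, ((tproduct (wt u1) (wt u2) (wt u3) a b)^t*).
by rewrite tproduct_rot // !trmxC_unitary.
Qed.

Lemma triangle_rev u1 u2 u3 : triangle u1 u2 u3 -> triangle u3 u2 u1.
Proof.
move=> [a [b [ua ub uu]]]; exists (b^t*), (a^t*).
by rewrite tproduct_rev !trmxC_unitary.
Qed.

Local Notation zR := (zI R).

Definition lin3 (h : seq Z) (u : 'rV[R]_3) : R :=
  zR (nth 0%ZZ h 0) * u 0 0 + zR (nth 0%ZZ h 1) * u 0 1 + zR (nth 0%ZZ h 2) * u 0 2.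

Definition valid (t : seq Z * seq Z * seq Z) := forall u1 u2 u3,
  chamber u1 -> chamber u2 -> chamber u3 -> triangle u1 u2 u3 ->
  0 <= lin3 t.1.1 u1 + lin3 t.1.2 u2 + lin3 t.2 u3.

Lemma wtn_lo u : [/\ wtn u 0 = u 0 0, wtn u 1 = u 0 1 & wtn u 2 = u 0 2].
Proof.
by rewrite /wtn /=; split; congr (u 0 _); apply: val_inj; rewrite /= inordK.
Qed.

Lemma wtn_hi u : wtn u (n - 2) = - u 0 1 /\ wtn u (n - 3) = - u 0 2.
Proof.
have [_ e1 e2] := wtn_lo u.
by rewrite !wtn_rev /= ?e1 ?e2 //; have := n5; lia.
Qed.

Lemma triangle_horn u1 u2 u3 : chamber u1 -> chamber u2 -> chamber u3 -> triangle u1 u2 u3 ->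
  exists E F G : nat -> 'M[C]_n, [/\ forall i, \rank (E i) = (n - i)%N,
   forall i, \rank (F i) = (n - i)%N, forall k, (k <= n)%N -> \rank (G k) = k,
   (forall i j, (i <= j)%N -> (F j <= F i)%MS) /\ (forall i j, (i <= j)%N -> (G i <= G j)%MS) &
   forall r (L : 'M[C]_n) (i j k : nat -> nat), \rank L = r ->
  (forall m, (m < r)%N -> [&& m < \rank (L :&: E (i m)), m < \rank (L :&: F (j m))
     & m < \rank (L :&: G (k m))]%N) ->
  (forall m m', (m <= m')%N -> (m' < r)%N -> [&& i m' <= i m, j m' <= j m & k m <= k m']%N) ->
  (forall m, (m < r)%N -> [&& i m < n, j m < n & 0 < k m <= n]%N) ->
  \sum_(m < r) wtn u3 (k m).-1 <= \sum_(m < r) (wtn u1 (i m) + wtn u2 (j m))].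
Proof.
move=> c1 c2 c3 [a [b [ua ub uu]]]; exists Et, (Ft u1 a), (Gt (tproduct (wt u1) (wt u2) (wt u3) a b)).
have uE := tproductE rc (wt u1) (wt u2) (wt u3) a ub.
split; [exact: rank_Et|exact: rank_Ft|exact: rank_Gt| |].
  by split; [exact: Ft_le|exact: Gt_le].
exact: (horn_rank c1 c2 c3 ua ub uu uE).
Qed.

Lemma valid_weyl p q t : (p + q < n)%N ->
  (forall u1 u2 u3, lin3 t.1.1 u1 + lin3 t.1.2 u2 + lin3 t.2 u3 =
     wtn u1 p + wtn u2 q - wtn u3 (p + q)) -> valid t.
Proof.
move=> pq h u1 u2 u3 c1 c2 c3 /(triangle_horn c1 c2 c3)[E [F [G [rE rF rG _ hh]]]].
by rewrite h subr_ge0; apply: (weyl (E := E) (F := F) (G := G)).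
Qed.

Lemma valid_lidskii2 p q t : (p < q)%N -> (q < n)%N ->
  (forall u1 u2 u3, lin3 t.1.1 u1 + lin3 t.1.2 u2 + lin3 t.2 u3 =
     wtn u1 0 + wtn u1 1 + (wtn u2 p + wtn u2 q) - (wtn u3 p + wtn u3 q)) -> valid t.
Proof.
move=> pq qn h u1 u2 u3 c1 c2 c3 /(triangle_horn c1 c2 c3)[E [F [G [rE rF rG [nF nG] hh]]]].
rewrite h; have := lidskii (E := E) (F := F) (G := G) rE rF rG nF nG hh (r := 2) (j := nth 0 [:: q; p]%N).
rewrite !big_ord_recl !big_ord0 !addr0 /= => hl.
suff : wtn u3 p + wtn u3 q <= wtn u1 1 + wtn u2 q + (wtn u1 0 + wtn u2 p) by lra.
have n5' := n5; apply: hl; [lia|exact: strict_pairs2|].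
by case=> [|[|//]] //= _; exact: ltn_trans pq qn.
Qed.

Lemma valid_lidskii3 p q s t : (p < q)%N -> (q < s)%N -> (s < n)%N ->
  (forall u1 u2 u3, lin3 t.1.1 u1 + lin3 t.1.2 u2 + lin3 t.2 u3 =
     wtn u1 0 + wtn u1 1 + wtn u1 2 + (wtn u2 p + wtn u2 q + wtn u2 s)
      - (wtn u3 p + wtn u3 q + wtn u3 s)) -> valid t.
Proof.
move=> pq qs sn h u1 u2 u3 c1 c2 c3 /(triangle_horn c1 c2 c3)[E [F [G [rE rF rG [nF nG] hh]]]].
rewrite h; have := lidskii (E := E) (F := F) (G := G) rE rF rG nF nG hh (r := 3) (j := nth 0 [:: s; q; p]%N).
rewrite !big_ord_recl !big_ord0 !addr0 /= => hl.
suff : wtn u3 p + (wtn u3 q + wtn u3 s) <=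
  wtn u1 2 + wtn u2 s + (wtn u1 1 + wtn u2 q + (wtn u1 0 + wtn u2 p)) by lra.
have n5' := n5; apply: hl; [lia| |].
  by apply: strict_pairs3 => //=; exact: ltn_trans pq qs.
have qn := ltn_trans qs sn.
by case=> [|[|[|//]]] //= _; exact: ltn_trans pq qn.
Qed.

Fixpoint each (T : Type) (P : T -> Prop) (l : seq T) : Prop :=
  if l is x :: l' then P x /\ each P l' else True.

Lemma each_in (T : eqType) (P : T -> Prop) (l : seq T) x : each P l -> x \in l -> P x.
Proof.
by elim: l => //= y l IH [Py hl]; rewrite inE => /orP[/eqP->//|]; exact: IH.
Qed.

Lemma valid_13_13_23 t : (forall u1 u2 u3, lin3 t.1.1 u1 + lin3 t.1.2 u2 + lin3 t.2 u3 =
     wtn u1 0 + wtn u1 2 + (wtn u2 0 + wtn u2 2) - (wtn u3 1 + wtn u3 2)) -> valid t.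
Proof.
move=> h u1 u2 u3 c1 c2 c3 /(triangle_horn c1 c2 c3)[E [F [G [rE rF rG [nF nG] hh]]]].
rewrite h; suff : wtn u3 1 + wtn u3 2 <= wtn u1 2 + wtn u2 2 + (wtn u1 0 + wtn u2 0) by lra.
by apply: (horn_13_13_23 (E := E) (F := F) (G := G)).
Qed.

Lemma valid_13_14_15 t : (forall u1 u2 u3, lin3 t.1.1 u1 + lin3 t.1.2 u2 + lin3 t.2 u3 =
     wtn u1 0 + wtn u1 2 + (wtn u2 0 + wtn u2 (n - 3)) - (wtn u3 0 + wtn u3 (n - 2))) -> valid t.
Proof.
move=> h u1 u2 u3 c1 c2 c3 /(triangle_horn c1 c2 c3)[E [F [G [rE rF rG [nF nG] hh]]]].
rewrite h; suff : wtn u3 0 + wtn u3 (n - 2) <= wtn u1 2 + wtn u2 (n - 3) + (wtn u1 0 + wtn u2 0) by lra.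
by apply: (horn_13_14_15 (E := E) (F := F) (G := G)).
Qed.

Lemma valid_13_14_24 t : (forall u1 u2 u3, lin3 t.1.1 u1 + lin3 t.1.2 u2 + lin3 t.2 u3 =
     wtn u1 0 + wtn u1 2 + (wtn u2 0 + wtn u2 (n - 3)) - (wtn u3 1 + wtn u3 (n - 3))) -> valid t.
Proof.
move=> h u1 u2 u3 c1 c2 c3 /(triangle_horn c1 c2 c3)[E [F [G [rE rF rG [nF nG] hh]]]].
rewrite h; suff : wtn u3 1 + wtn u3 (n - 3) <= wtn u1 2 + wtn u2 (n - 3) + (wtn u1 0 + wtn u2 0) by lra.
by apply: (horn_13_14_24 (E := E) (F := F) (G := G)).
Qed.

Lemma valid_124_135_145 t : (forall u1 u2 u3, lin3 t.1.1 u1 + lin3 t.1.2 u2 + lin3 t.2 u3 =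
     wtn u1 0 + wtn u1 1 + wtn u1 (n - 3) + (wtn u2 0 + wtn u2 2 + wtn u2 (n - 2)) - (wtn u3 0 + wtn u3 (n - 3) + wtn u3 (n - 2))) -> valid t.
Proof.
move=> h u1 u2 u3 c1 c2 c3 /(triangle_horn c1 c2 c3)[E [F [G [rE rF rG [nF nG] hh]]]].
rewrite h; suff : wtn u3 0 + (wtn u3 (n - 3) + wtn u3 (n - 2)) <=
    wtn u1 (n - 3) + wtn u2 (n - 2) + (wtn u1 1 + wtn u2 2 + (wtn u1 0 + wtn u2 0)) by lra.
by apply: (horn_124_135_145 (E := E) (F := F) (G := G)).
Qed.

(** Four types are Weyl inequalities, ten are Lidskii inequalities, and four come from the special
    positions above. The indices [n - 2] and [n - 3] contribute $-y$ and $-z$. *)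
Lemma all_valid : each valid triangle_types.
Proof.
have n5' := n5.
have wE u : ((wtn u 0 = u 0 0) * (wtn u 1 = u 0 1) * (wtn u 2 = u 0 2) *
    (wtn u (n - 2) = - u 0 1) * (wtn u (n - 3) = - u 0 2))%type.
  by have [-> -> ->] := wtn_lo u; have [-> ->] := wtn_hi u.
repeat split.
- apply: (@valid_lidskii2 1 (n - 3)); [lia|lia|move=> u1 u2 u3].
  by rewrite !wE /lin3 /= ?zI0 ?zI1 ?zIm1; ring.
- apply: (@valid_weyl 1 1); [lia|move=> u1 u2 u3].
  by rewrite !wE /lin3 /= ?zI0 ?zI1 ?zIm1; ring.
- apply: (@valid_lidskii2 1 2); [lia|lia|move=> u1 u2 u3].
  by rewrite !wE /lin3 /= ?zI0 ?zI1 ?zIm1; ring.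
- apply: (@valid_weyl 0 2); [lia|move=> u1 u2 u3].
  by rewrite !wE /lin3 /= ?zI0 ?zI1 ?zIm1; ring.
- apply: (@valid_weyl 0 1); [lia|move=> u1 u2 u3].
  by rewrite !wE /lin3 /= ?zI0 ?zI1 ?zIm1; ring.
- apply: (@valid_weyl 0 0); [lia|move=> u1 u2 u3].
  by rewrite !wE /lin3 /= ?zI0 ?zI1 ?zIm1; ring.
- apply: (@valid_lidskii2 0 (n - 2)); [lia|lia|move=> u1 u2 u3].
  by rewrite !wE /lin3 /= ?zI0 ?zI1 ?zIm1; ring.
- apply: (@valid_lidskii2 0 1); [lia|lia|move=> u1 u2 u3].
  by rewrite !wE /lin3 /= ?zI0 ?zI1 ?zIm1; ring.
- apply: (@valid_lidskii2 0 2); [lia|lia|move=> u1 u2 u3].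
  by rewrite !wE /lin3 /= ?zI0 ?zI1 ?zIm1; ring.
- apply: (@valid_lidskii3 0 2 (n - 2)); [lia|lia|lia|move=> u1 u2 u3].
  by rewrite !wE /lin3 /= ?zI0 ?zI1 ?zIm1; ring.
- apply: (@valid_lidskii3 0 (n - 3) (n - 2)); [lia|lia|lia|move=> u1 u2 u3].
  by rewrite !wE /lin3 /= ?zI0 ?zI1 ?zIm1; ring.
- by apply: valid_124_135_145 => u1 u2 u3; rewrite !wE /lin3 /= ?zI0 ?zI1 ?zIm1; ring.
- apply: (@valid_lidskii2 0 (n - 3)); [lia|lia|move=> u1 u2 u3].
  by rewrite !wE /lin3 /= ?zI0 ?zI1 ?zIm1; ring.
- by apply: valid_13_13_23 => u1 u2 u3; rewrite !wE /lin3 /= ?zI0 ?zI1 ?zIm1; ring.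
- by apply: valid_13_14_15 => u1 u2 u3; rewrite !wE /lin3 /= ?zI0 ?zI1 ?zIm1; ring.
- by apply: valid_13_14_24 => u1 u2 u3; rewrite !wE /lin3 /= ?zI0 ?zI1 ?zIm1; ring.
- apply: (@valid_lidskii3 0 1 (n - 3)); [lia|lia|lia|move=> u1 u2 u3].
  by rewrite !wE /lin3 /= ?zI0 ?zI1 ?zIm1; ring.
- apply: (@valid_lidskii3 0 1 2); [lia|lia|lia|move=> u1 u2 u3].
  by rewrite !wE /lin3 /= ?zI0 ?zI1 ?zIm1; ring.
Qed.

(** A permuted form at the given sides is the original form at permuted sides, which again bound a
    triangle. *)
Lemma perm_valid (t : seq Z * seq Z * seq Z) (v : 'M[R]_3) h :
  size t.1.1 = 3 -> size t.1.2 = 3 -> size t.2 = 3 -> valid t ->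
  (forall i, chamber (row i v)) -> triangle (row 0 v) (row 1 v) (row 2 v) ->
  h \in perms3 t -> 0 <= ev h v.
Proof.
case: t => [[x y] z] sx sy sz vt hc tv; rewrite [perms3 _]/perms3 mem_undup.
rewrite /= in sx sy sz.
have t1 := triangle_rot tv; have t2 := triangle_rot t1.
have s0 := triangle_rev tv; have s1 := triangle_rev t1; have s2 := triangle_rev t2.
have evc (p q r : seq Z) : size p = 3 -> size q = 3 -> size r = 3 ->
    ev (p ++ q ++ r) v = lin3 p (row 0 v) + lin3 q (row 1 v) + lin3 r (row 2 v).
  case: p => [|p0 [|p1 [|p2 [|]]]] // _; case: q => [|q0 [|q1 [|q2 [|]]]] // _.
  case: r => [|r0 [|r1 [|r2 [|]]]] // _.
  by rewrite evE /lin3 /= !mxE.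
rewrite !inE.
have c0 := hc 0; have c1 := hc 1; have c2 := hc 2.
have v1 := vt _ _ _ c0 c1 c2 tv; have v2 := vt _ _ _ c1 c2 c0 t1.
have v3 := vt _ _ _ c2 c0 c1 t2; have v4 := vt _ _ _ c2 c1 c0 s0.
have v5 := vt _ _ _ c0 c2 c1 s1; have v6 := vt _ _ _ c1 c0 c2 s2.
rewrite /= in v1 v2 v3 v4 v5 v6.
by do 5 (case/orP; first by move=> /eqP->; rewrite evc //; lra);
   move=> /eqP->; rewrite evc //; lra.
Qed.

Lemma triangle_types_size : all (fun t => [&& size t.1.1 == 3, size t.1.2 == 3 & size t.2 == 3]%N)
  triangle_types.
Proof. by []. Qed.

Lemma chamber_pos (v : 'M[R]_3) : (forall i, chamber (row i v)) -> pos chamber_ineqs v.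
Proof.
move=> hc u; have [a0 b0 d0] := hc 0; have [a1 b1 d1] := hc 1; have [a2 b2 d2] := hc 2.
rewrite !mxE in a0 b0 d0 a1 b1 d1 a2 b2 d2.
rewrite /chamber_ineqs /= !inE.
by do 8 (case/orP; first by move=> /eqP->; rewrite evE /= ?zI0 ?zI1 ?zIm1; lra);
   move=> /eqP->; rewrite evE /= ?zI0 ?zI1 ?zIm1; lra.
Qed.

Theorem triangle_tcone (v : 'M[R]_3) : (forall i, chamber (row i v)) ->
  triangle (row 0 v) (row 1 v) (row 2 v) -> tcone v.
Proof.
move=> hc tv h; rewrite mem_ineqs => /orP[|]; first exact: chamber_pos.
move=> /flattenP[l /mapP[t tin ->] hin].
have /allP/(_ t tin)/and3P[/eqP s1 /eqP s2 /eqP s3] := triangle_types_size.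
exact: (perm_valid s1 s2 s3 (each_in all_valid tin) hc tv hin).
Qed.

End Necessity.

(** * Triangles in G/K and the symplectic group *)

Section RealPart.
Variable R : realType.

Lemma real_complex_le (x y : R) : (real_complex R x <= real_complex R y) = (x <= y).
Proof. exact: complex.lecR. Qed.

Lemma real_complex_ReK (z : R[i]) : z \is Num.real -> real_complex R (complex.Re z) = z.
Proof. by move=> h; rewrite RRe_real. Qed.

Definition complex_real_part : real_part R R[i] :=
  @RealPart R R[i] (real_complex R) (@complex.Re R) real_complex_le real_complex_ReK.

End RealPart.

Section Cosets.
Variables (F : comUnitRingType) (n : nat) (G K : set 'M[F]_n).
Hypothesis GM : forall g h, G g -> G h -> G (g *m h).
Hypothesis GV : forall g, G g -> g \in unitmx /\ G (invmx g).
Hypothesis KG : forall k, K k -> G k.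
Hypothesis K1 : K 1%:M.
Hypothesis KM : forall g h, K g -> K h -> K (g *m h).
Hypothesis KV : forall k, K k -> K (invmx k).
Variables (T : Type) (e : T -> 'M[F]_n).
Hypothesis Ge : forall v, G (e v).
Implicit Types (g h k : 'M[F]_n) (X : set 'M[F]_n).
Let translate g X : set 'M[F]_n := [set g *m h | h in X].

Let K_unit k : K k -> k \in unitmx. Proof. by move=> /KG /GV[]. Qed.

Let translateM g h X : translate g (translate h X) = translate (g *m h) X.
Proof.
apply/seteqP; split=> x /=.
  by move=> [y [z Xz <-] <-]; exists z; rewrite ?mulmxA.
by move=> [z Xz <-]; exists (h *m z); [exists z|rewrite mulmxA].
Qed.

Let translateK k : K k -> translate k K = K.
Proof.
move=> Kk; apply/seteqP; split=> x /=; first by move=> [y Ky <-]; exact: KM.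
move=> Kx; exists (invmx k *m x); first by apply: KM => //; exact: KV.
by rewrite mulKVmx // K_unit.
Qed.

Let translate_mem g : translate g K g.
Proof. by exists 1%:M; [exact: K1|rewrite mulmx1]. Qed.

Let coset_distance g h v x : G g -> G h -> G x ->
    translate x (translate g K) = K -> translate x (translate h K) = translate (e v) K ->
  exists k l, [/\ K k, K l & h = g *m k *m e v *m l].
Proof.
move=> Gg Gh Gx; rewrite !translateM => E1 E2.
have Kxg : K (x *m g) by rewrite -E1; exact: translate_mem.
have : translate (e v) K (x *m h) by rewrite -E2; exact: translate_mem.
move=> [l Kl hE]; exists (invmx (x *m g)), l; split=> //; first exact: KV.
have uxg := K_unit Kxg; have [ux _] := GV Gx.
have -> : g *m invmx (x *m g) = invmx x.
  by apply: (can_inj (mulmxK uxg)); rewrite mulmxKV // mulmxA mulVmx // mul1mx.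
by rewrite -mulmxA hE mulKmx.
Qed.

(* The triangle has the vertices K, e v0 K and e v0 k e v1 K. *)
Lemma coset_triangleP v0 v1 v2 :
  (exists x1 x2 x3 : set 'M[F]_n,
    [/\ [set translate g K | g in G] x1, [set translate g K | g in G] x2
      & [set translate g K | g in G] x3] /\
    [/\ exists2 g, G g & translate g x1 = K /\ translate g x2 = translate (e v0) K,
        exists2 g, G g & translate g x2 = K /\ translate g x3 = translate (e v1) K
      & exists2 g, G g & translate g x3 = K /\ translate g x1 = translate (e v2) K])
  <-> exists k l, [/\ K k, K l & K (e v0 *m k *m e v1 *m l *m e v2)].
Proof.
split.
  move=> [x1 [x2 [x3 [[[g1 G1 <-] [g2 G2 <-] [g3 G3 <-]]]]]].
  move=> [[y1 Gy1 [A1 B1]] [y2 Gy2 [A2 B2]] [y3 Gy3 [A3 B3]]].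
  have [k1 [l1 [Kk1 Kl1 E2]]] := coset_distance G1 G2 Gy1 A1 B1.
  have [k2 [l2 [Kk2 Kl2 E3]]] := coset_distance G2 G3 Gy2 A2 B2.
  have [k3 [l3 [Kk3 Kl3 E1]]] := coset_distance G3 G1 Gy3 A3 B3.
  exists (l1 *m k2), (l2 *m k3); split; [exact: KM|exact: KM|].
  have [u1 _] := GV G1.
  set X := (X in K X).
  (* Going once round the triangle returns to [g1]. *)
  have E : k1 *m X *m l3 = 1%:M.
    apply: (can_inj (mulKmx u1)); rewrite mulmx1 [RHS]E1 E3 E2 /X !mulmxA.
    by [].
  have uk := K_unit Kk1; have ul := K_unit Kl3.
  have -> : X = invmx k1 *m invmx l3.
    by rewrite -[LHS](mulKmx uk) -[k1 *m X](mulmxK ul) E mul1mx.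
  by apply: KM; exact: KV.
move=> [k [l [Kk Kl Km]]].
have [u0 _] := GV (Ge v0).
have uk := K_unit Kk; have ul := K_unit Kl; have um := K_unit Km.
have GE : G (e v0 *m k *m e v1) by apply: GM (Ge _); apply: GM (Ge _) _; exact: KG.
have [ue Gi] := GV GE.
exists K, (translate (e v0) K), (translate (e v0 *m k *m e v1) K).
have sK : translate 1%:M K = K by exact: translateK.
have G1 := KG K1.
split.
  by split; [exists 1%:M|exists (e v0); first exact: Ge|eexists; first exact: GE].
split.
- by exists 1%:M => //; split=> //; rewrite translateM mul1mx.
- exists (invmx k *m invmx (e v0)).
    by apply: GM; [exact/KG/KV|exact: (GV (Ge _)).2].
  split; rewrite translateM.
    by rewrite mulmxKV //; exact/translateK/KV.
  by congr translate; rewrite -!mulmxA (mulKmx u0); exact: mulKmx.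
exists (invmx l *m invmx (e v0 *m k *m e v1)).
  by apply: GM => //; exact/KG/KV.
split; first by rewrite translateM mulmxKV //; exact/translateK/KV.
have -> : invmx l *m invmx (e v0 *m k *m e v1) =
    e v2 *m invmx (e v0 *m k *m e v1 *m l *m e v2).
  move: (e v0 *m k *m e v1) ue um => E ue um.
  apply: (can_inj (mulmxK um)); rewrite mulmxKV // !mulmxA mulmxKV //.
  by rewrite mulVmx // mul1mx.
by rewrite -translateM translateK //; exact: KV.
Qed.

End Cosets.

Lemma unitary1 (C : numClosedFieldType) n : (1%:M : 'M[C]_n) \is unitarymx.
Proof. by apply/unitarymxP; rewrite mul1mx trmx1 map_mx1. Qed.

Lemma unitary_invmx (C : numClosedFieldType) n (u : 'M[C]_n) :
  u \is unitarymx -> invmx u \is unitarymx.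
Proof. by move=> uu; rewrite invmx_unitary // trmxC_unitary. Qed.

Section DeltaTriangles.
Variables (R : realType) (n : nat) (G : set 'M[R[i]]_n.+1) (a : 'rV[R]_3 -> 'M[R]_n.+1).
Hypothesis G1 : G 1%:M.
Hypothesis GM : forall g h, G g -> G h -> G (g *m h).
Hypothesis GV : forall g, G g -> g \in unitmx /\ G (invmx g).
Hypothesis Ga : forall v, G (expa a v).
Local Notation K := (max_compact G).
Local Notation e := (expa a).

Lemma D3P v : D3 G a v <-> (forall i, chamber (row i v)) /\ exists k l,
  [/\ K k, K l & K (e (row 0 v) *m k *m e (row 1 v) *m l *m e (row 2 v))].
Proof.
have KG k : K k -> G k by case.
have K1 : K 1%:M by split; [exact: G1|exact: unitary1].
have KM g h : K g -> K h -> K (g *m h).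
  by move=> [g1 g2] [h1 h2]; split; [exact: GM|exact: (mul_unitarymx g2 h2)].
have KV g : K g -> K (invmx g).
  by move=> [g1 g2]; split; [exact: (GV g1).2|exact: unitary_invmx].
have P := @coset_triangleP R[i] n.+1 G K GM GV KG K1 KM KV _ e Ga (row 0 v) (row 1 v) (row 2 v).
split.
  move=> [x1 [x2 [x3 [S [[c1 d1] [c2 d2] [c3 d3]]]]]].
  split; first by move=> i; case: (ord3 i) => ->.
  by apply: P.1; exists x1, x2, x3; split; [exact: S|split; [exact: d1|exact: d2|exact: d3]].
move=> [hc /(P.2)[x1 [x2 [x3 [S [d1 d2 d3]]]]]].
exists x1, x2, x3; split; first exact: S.
by split; split; [exact: hc|exact: d1|exact: hc|exact: d2|exact: hc|exact: d3].
Qed.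

End DeltaTriangles.

Section DiagonalExponential.
Variable R : realType.

Lemma diag_mxX m (d : 'rV[R]_m.+1) k :
  (diag_mx d : 'M[R]_m.+1) ^+ k = diag_mx (\row_j d 0 j ^+ k).
Proof.
elim: k => [|k IH].
  rewrite expr0; apply/matrixP => i j; rewrite !mxE expr0.
  by case: eqP.
rewrite exprS IH; have -> : forall A B : 'M[R]_m.+1, A * B = A *m B by [].
by rewrite mulmx_diag; congr diag_mx; apply/rowP => j; rewrite !mxE exprS.
Qed.

(** Convergence of matrices is entrywise, and the diagonal entries are scalar exponential series. *)
Lemma mexp_diag m (d : 'rV[R]_m.+1) : mexp (diag_mx d) = diag_mx (\row_j expR (d 0 j)).
Proof.
rewrite /mexp; apply: cvg_lim; first exact: norm_hausdorff.
have sE : series (fun k : nat => k`!%:R^-1 *: (diag_mx d : 'M[R]_m.+1) ^+ k) =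
    (fun N => diag_mx (\row_j series (exp_coeff (d 0 j)) N)).
  apply/funext => N; rewrite /series /=.
  elim: N => [|N IH].
    rewrite big_nil; apply/matrixP => i j; rewrite !mxE big_nil.
    by rewrite mul0rn.
  rewrite big_nat_recr //= IH diag_mxX; apply/matrixP => i j; rewrite !mxE big_nat_recr //=.
  by case: eqP => _; rewrite ?mulr1n ?mulr0n ?mulr0 ?addr0 // /exp_coeff /= [in RHS]mulrC.
rewrite sE; apply/cvg_mx_entourageP => A entA; apply: filter_forall => i; apply: filter_forall => j.
have [->|ij] := eqVneq i j; rewrite near_map.
  have : series (exp_coeff (d 0 j)) @ \oo --> expR (d 0 j) by exact: is_cvg_series_exp_coeff.
  move/cvg_entourageP => /(_ A entA); rewrite near_map; apply: filterS => N.
  by rewrite !mxE eqxx !mulr1n inE.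
apply: filterE => N; rewrite !mxE (negbTE ij) !mulr0n inE.
exact: entourage_refl.
Qed.

End DiagonalExponential.

(* the order x, y, z, -z, -y, -x of the weights *)
Definition reorder (i : 'I_6) : 'I_6 := inord (if (i < 3)%N then i else 8 - i).

Lemma reorderE (i : 'I_6) : reorder i = (if (i < 3)%N then i : nat else 8 - i)%N :> nat.
Proof.
rewrite inordK //; case: i => i /= hi.
by case: i hi => [|[|[|[|[|[|]]]]]].
Qed.

Lemma reorderK : involutive reorder.
Proof.
move=> i; apply: val_inj; rewrite /= !reorderE; case: i => i /= hi.
by case: i hi => [|[|[|[|[|[|]]]]]].
Qed.

Section Reorder.
Variable C : numClosedFieldType.
Let sg (i : nat) := (2 < i)%N.
Let s (i : 'I_6) := sg i.
Local Notation J := (antidiag C s).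
Local Notation isom := (@isom C 6 s).
Implicit Types (A B g : 'M[C]_6).

Definition resort A : 'M[C]_6 := mxsub reorder reorder A.

Lemma resortK : involutive resort.
Proof. by move=> A; apply/matrixP => i j; rewrite !mxE !reorderK. Qed.

Lemma resortM A B : resort (A *m B) = resort A *m resort B.
Proof.
apply/matrixP => i j; rewrite !mxE (reindex_inj (inv_inj reorderK)).
by apply: eq_bigr => k _; rewrite !mxE.
Qed.

Lemma resort1 : resort 1%:M = 1%:M.
Proof.
by apply/matrixP => i j; rewrite !mxE (inj_eq (inv_inj reorderK)).
Qed.

Lemma resortM5 A B D A' B' D' g h : resort A = A' -> resort B = B' -> resort D = D' ->
  resort (A *m g *m B *m h *m D) = A' *m resort g *m B' *m resort h *m D'.
Proof. by move=> <- <- <-; rewrite !resortM. Qed.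

Lemma resort_tr A : resort A^T = (resort A)^T.
Proof. by apply/matrixP => i j; rewrite !mxE. Qed.

Lemma resort_unitary A : A \is unitarymx -> resort A \is unitarymx.
Proof.
move=> /unitarymxP h; apply/unitarymxP; rewrite -resort1 -h resortM; congr (_ *m _).
by apply/matrixP => i j; rewrite !mxE.
Qed.

Lemma resort_symp :
  resort (@block_mx C 3 3 3 3 0 1%:M (- 1%:M) 0) = J.
Proof.
apply/matrixP => i j; rewrite [LHS]mxE.
transitivity (if (reorder i < 3)%N then (reorder j == reorder i + 3 :> nat)%N%:R
    else - (reorder i == reorder j + 3 :> nat)%N%:R : C).
  move: (reorder i) (reorder j) => {}i {}j.
  case: (@split_ordP 3 3 i) => k ->; case: (@split_ordP 3 3 j) => l ->.
  - rewrite [LHS]block_mxEul mxE /=.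
    by case: k l => [[|[|[|]]] ?] // [[|[|[|]]] ?].
  - rewrite [LHS]block_mxEur mxE /= -val_eqE.
    by case: k l => [[|[|[|]]] ?] // [[|[|[|]]] ?].
  - rewrite [LHS]block_mxEdl !mxE /= -val_eqE.
    by case: k l => [[|[|[|]]] ?] // [[|[|[|]]] ?].
  rewrite [LHS]block_mxEdr mxE /=.
  by case: k l => [[|[|[|]]] ?] // [[|[|[|]]] ?] //=; rewrite oppr0.
rewrite !reorderE mxE -[_ == rev_ord i]val_eqE /s /sg /=.
case: i j => [[|[|[|[|[|[|]]]]]] ?] // [[|[|[|[|[|[|]]]]]] ?] //=;
  by rewrite ?expr0 ?expr1 ?mulr0n ?mulr1n ?oppr0.
Qed.

(** The group of $J$ is closed under transposition, which reconciles $g^T \Omega g = \Omega$ with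
    $gJg^T = J$. *)
Lemma resort_isom g :
  g^T *m (@block_mx C 3 3 3 3 0 1%:M (- 1%:M) 0) *m g = @block_mx C 3 3 3 3 0 1%:M (- 1%:M) 0
  <-> isom (resort g).
Proof.
have tr X : isom X <-> X^T *m J *m X = J.
  split=> [/isom_tr|h]; first by rewrite /isom trmxK.
  by rewrite -(trmxK X); apply: isom_tr; rewrite /isom trmxK.
rewrite tr -resort_symp -resort_tr -!resortM; split=> [->//|].
exact: inv_inj resortK _ _.
Qed.

Lemma resort_unit g : resort g \in unitmx -> g \in unitmx.
Proof.
move=> u; have h : g *m resort (invmx (resort g)) = 1%:M.
  by rewrite -[X in X *m _]resortK -resortM mulmxV // resort1.
by have [] := mulmx1_unit h.
Qed.

Lemma resort_invmx g : g \in unitmx -> resort (invmx g) = invmx (resort g).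
Proof. by move=> u; apply/esym/invmx_eq; rewrite -resortM mulmxV // resort1. Qed.

End Reorder.

Section SymplecticGroup.
Variable R : realType.
Local Notation C := R[i].
Local Notation rc := (complex_real_part R).
Let sg (i : nat) := (2 < i)%N.
Let s (i : 'I_6) := sg i.
Local Notation isom := (@isom C 6 s).

Lemma Sp6_isom (g : 'M[C]_6) : @Sp6 R g <-> isom (resort g).
Proof. exact: resort_isom. Qed.

Lemma resort_expa v : resort (expa (n := 5) (@cartan_Sp6 R) v) = expd rc (wt 6 v).
Proof.
rewrite /expa /cartan_Sp6 (@mexp_diag R 5); apply/matrixP => i j.
rewrite [LHS]mxE [LHS]mxE [X in real_complex R X]mxE [X in real_complex R (X *+ _)]mxE.
rewrite (inj_eq (inv_inj reorderK)) /expd [RHS]mxE [X in _ = X *+ _]mxE.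
have -> : row_mx v (- v) 0 (reorder i) = wt 6 v 0 i.
  rewrite mxE; move: (reorderE i); case: (@split_ordP 3 3 (reorder i)) => k ->.
    rewrite /=; case: ltnP => [_ e|h]; last by case: k i h => [[|[|[|]]] ?] // [[|[|[|[|[|[|]]]]]] ?].
    by move: e => /= e; rewrite [RHS]mxE -e ltn_ord inord_val.
  rewrite mxE /=; case: ltnP => [h e|_ e].
    by move: h; rewrite -e.
  have re : (6 - i.+1)%N = k by case: k i e => [[|[|[|]]] ?] // [[|[|[|[|[|[|]]]]]] ?].
  have i3 : (i < 3)%N = false by case: k i e {re} => [[|[|[|]]] ?] // [[|[|[|[|[|[|]]]]]] ?].
  by rewrite [RHS]mxE i3 /= re ltn_ord inord_val.
by case: eqP => _; rewrite ?mulr1n ?mulr0n ?rmorph0.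
Qed.

Lemma D3_C3_tcone : D3_C3 R = @tcone R.
Proof.
have G1 : @Sp6 R 1%:M by apply/Sp6_isom; rewrite resort1; exact: isom1.
have GM g h : @Sp6 R g -> @Sp6 R h -> @Sp6 R (g *m h).
  by move=> /Sp6_isom ig /Sp6_isom ih; apply/Sp6_isom; rewrite resortM; exact: isomM.
have GV g : @Sp6 R g -> g \in unitmx /\ @Sp6 R (invmx g).
  move=> /Sp6_isom ig; have u := resort_unit (isom_unit ig); split=> //.
  by apply/Sp6_isom; rewrite resort_invmx //; exact: isom_invmx.
have Ga v : @Sp6 R (expa (n := 5) (@cartan_Sp6 R) v).
  by apply/Sp6_isom; rewrite resort_expa; apply: isom_expd; exact: (wt_rev flags6_ok).
have tE k l (v : 'M[R]_3) : resort (expa (n := 5) (@cartan_Sp6 R) (row 0 v) *m k *m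
     expa (n := 5) (@cartan_Sp6 R) (row 1 v) *m l *m
     expa (n := 5) (@cartan_Sp6 R) (row 2 v)) =
   tproduct rc (wt 6 (row 0 v)) (wt 6 (row 1 v)) (wt 6 (row 2 v)) (resort k) (resort l).
  by apply: resortM5; exact: resort_expa.
apply/seteqP; split=> v.
  move=> /(D3P G1 GM GV Ga)[hc [k [l [[_ uk] [_ ul] [_ um]]]]].
  apply: (triangle_tcone flags6_ok hc (rc := rc)).
  exists (resort k), (resort l); split.
  - exact: resort_unitary uk.
  - exact: resort_unitary ul.
  by rewrite -tE; exact: resort_unitary um.
move=> hv; apply/(D3P G1 GM GV Ga); split.
  by move=> i; exact: tcone_chamber hv.
have [p hp] := tcone_interior R.
have [a [b [ua ia ub ib um]]] := triangle_exists rc flags6_ok hv hp.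
exists (resort a), (resort b); split.
- by split; [apply/Sp6_isom; rewrite resortK|exact: resort_unitary ua].
- by split; [apply/Sp6_isom; rewrite resortK|exact: resort_unitary ub].
have {}tE := tE (resort a) (resort b) v; rewrite !resortK in tE.
split; last by rewrite -[X in [set` _] X]resortK tE; exact: resort_unitary um.
apply/Sp6_isom; rewrite tE /tproduct.
have ie u : isom (expd rc (wt 6 u)) by apply: isom_expd; exact: (wt_rev flags6_ok).
have h1 := isomM (ie (row 0 v)) ia; have h2 := isomM h1 (ie (row 1 v)).
have h3 := isomM h2 ib; exact: isomM h3 (ie (row 2 v)).
Qed.

End SymplecticGroup.

(** * The Clifford algebra and the spin group *)

Section GammaMatrices.

(* The basis of C^2 (x) C^2 (x) C^2 is indexed by i < 8, with bit 0 the most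
   significant bit of i. *)
Definition bit (m i : nat) : nat := ((i %/ 2 ^ (2 - m)) %% 2)%N.

(* The matrix gamma_k, k = 0, ..., 6, has in row i the only nonzero entry
   'i ^+ phase k i, in column flip k i. *)
Definition flip (k i : nat) : nat :=
  (if (k < 6)%N then if bit k./2 i == 0%N then i + 2 ^ (2 - k./2) else i - 2 ^ (2 - k./2)
   else i)%N.

Definition phase (k i : nat) : nat :=
  (2 * (bit 0 i * (0 < k./2) + bit 1 i * (1 < k./2) + bit 2 i * (2 < k./2))
   + (if odd k then 3 + 2 * bit k./2 i else 0))%N.

(** Identities between the index maps and the phases are finite and are left to computation on
    natural numbers. *)
Lemma all_lt8P (P : nat -> nat -> bool) :
  all (fun k => all (P k) (iota 0 8)) (iota 0 7) ->
  forall (k : 'I_7) (i : 'I_8), P k i.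
Proof.
move=> h k i; have /allP/(_ k) := h.
by rewrite mem_iota ltn_ord => /(_ isT)/allP/(_ i); rewrite mem_iota ltn_ord => /(_ isT).
Qed.

Definition fl (k : 'I_7) (i : 'I_8) : 'I_8 := inord (flip k i).

Lemma flE k i : fl k i = flip k i :> nat.
Proof.
by rewrite inordK //; apply: (@all_lt8P (fun k i => flip k i < 8)%N); vm_compute.
Qed.

Lemma flK k : involutive (fl k).
Proof.
move=> i; apply: val_inj; rewrite /= !flE; apply/eqP.
by apply: (@all_lt8P (fun k i => flip k (flip k i) == i)); vm_compute.
Qed.

Lemma all_lt8_2P (P : nat -> nat -> nat -> bool) :
  all (fun k => all (fun l => all (P k l) (iota 0 8)) (iota 0 7)) (iota 0 7) ->
  forall (k l : 'I_7) (i : 'I_8), P k l i.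
Proof.
move=> h k l i; have /allP/(_ k) := h.
rewrite mem_iota ltn_ord => /(_ isT)/allP/(_ l); rewrite mem_iota ltn_ord => /(_ isT)/allP/(_ i).
by rewrite mem_iota ltn_ord => /(_ isT).
Qed.

Lemma flC k l i : fl k (fl l i) = fl l (fl k i).
Proof.
apply: val_inj; rewrite /= !flE; apply/eqP.
by apply: (@all_lt8_2P (fun k l i => flip k (flip l i) == flip l (flip k i))); vm_compute.
Qed.

Variable C : numClosedFieldType.
Local Notation I := ('i : C).
Implicit Types (A B g h : 'M[C]_8) (u v w : 'rV[C]_7) (r : 'M[C]_7).

Lemma expI_mod p q : (p %% 4 == q %% 4)%N -> I ^+ p = I ^+ q.
Proof.
have I4 : I ^+ 4 = 1 by rewrite (exprM _ 2 2) sqrCi sqrrN expr1n.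
by move=> /eqP h; rewrite -(expr_mod p I4) h expr_mod.
Qed.

Lemma expI_neg p q : ((p + 2) %% 4 == q %% 4)%N -> I ^+ q = - I ^+ p.
Proof. by move=> h; rewrite -(expI_mod h) exprD sqrCi mulrN1. Qed.

Lemma expI_neq0 p : I ^+ p != 0.
Proof. by rewrite expf_neq0 // neq0Ci. Qed.

Definition gam (k : 'I_7) : 'M[C]_8 := \matrix_(i, j) (I ^+ phase k i *+ (j == fl k i)).

Lemma gam_mulE k A i j : (gam k *m A) i j = I ^+ phase k i * A (fl k i) j.
Proof.
rewrite mxE (bigD1 (fl k i)) //= mxE eqxx mulr1n big1 ?addr0 // => l /negbTE nl.
by rewrite mxE nl mulr0n mul0r.
Qed.

Lemma mul_gamE k A i j : (A *m gam k) i j = A i (fl k j) * I ^+ phase k (fl k j).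
Proof.
rewrite mxE (bigD1 (fl k j)) //= mxE flK eqxx mulr1n big1 ?addr0 // => l nl.
by rewrite mxE -(inj_eq (inv_inj (flK k))) flK eq_sym (negbTE nl) mulr0n mulr0.
Qed.

Lemma gam_anti k l :
  gam k *m gam l + gam l *m gam k = ((2 : C) *+ (k == l))%:M.
Proof.
apply/matrixP => i j; rewrite [LHS]mxE !gam_mulE ![gam _ _ _]mxE (flC l k) mxE.
rewrite !mulrnAr -!exprD [in j == _]eq_sym.
have [<-{l}|kl] := eqVneq k l.
  rewrite flK mulr1n (@expI_mod _ 0); first by rewrite expr0 -mulrnDl.
  rewrite flE; apply: (@all_lt8P (fun k i => (phase k i + phase k (flip k i)) %% 4 == 0 %% 4)%N).
  by vm_compute.
rewrite mulr0n mul0rn (@expI_neg (phase l i + phase k (fl l i))).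
  by rewrite mulNrn addrC addrN.
rewrite !flE; move: kl; rewrite -val_eqE; apply/implyP.
apply: (@all_lt8_2P (fun k l i => (k != l) ==>
   ((phase l i + phase k (flip l i) + 2) %% 4 == (phase k i + phase l (flip k i)) %% 4)%N)).
by vm_compute.
Qed.

Lemma gam_trC k : (gam k)^t* = gam k.
Proof.
apply/matrixP => i j; rewrite trCE !mxE rmorphMn rmorphXn /= conjCi.
have -> : (i == fl k j) = (j == fl k i).
  by rewrite -(inj_eq (inv_inj (flK k))) flK eq_sym.
case: eqP => // ->; congr (_ *+ _).
have <- : I ^+ 3 = - I by rewrite -[X in - X]expr1; exact: expI_neg.
rewrite -exprM; apply: expI_mod; rewrite flE.
apply: (@all_lt8P (fun k i => (3 * phase k (flip k i)) %% 4 == phase k i %% 4)%N).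
by vm_compute.
Qed.

(** Up to a factor, $\gamma_{2m}\gamma_{2m+1}$ is diagonal with the sign of bit [m]; these products
    separate the indices and kill the off-diagonal entries. Flips connect all indices, so the
    diagonal is constant. *)
Lemma gam_commutant A : (forall k, A *m gam k = gam k *m A) -> exists c, A = c%:M.
Proof.
move=> h.
have e (k : 'I_7) i j : A i j * I ^+ phase k j = I ^+ phase k i * A (fl k i) (fl k j).
  by have := congr1 (fun M : 'M[C]_8 => M i (fl k j)) (h k); rewrite mul_gamE gam_mulE flK.
have off i j : i != j -> A i j = 0.
  move=> ij.
  (* [m] is a bit in which [i] and [j] differ. *)
  have : exists m : 'I_3, ((phase m.*2 i + phase m.*2.+1 j + 2) %% 4 ==
      (phase m.*2 j + phase m.*2.+1 i) %% 4)%N.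
    move: ij; case: i j => [[|[|[|[|[|[|[|[|]]]]]]]] ?] // [[|[|[|[|[|[|[|[|]]]]]]]] ?] // _;
    by [exists (inord 0); rewrite inordK|exists (inord 1); rewrite inordK|exists (inord 2); rewrite inordK].
  move=> [m hm].
  have m0 : (m.*2 < 7)%N by case: m {hm} => [[|[|[|]]] ?].
  have m1 : (m.*2.+1 < 7)%N by case: m {hm m0} => [[|[|[|]]] ?].
  pose a := Ordinal m0; pose b := Ordinal m1.
  have flab x : fl b x = fl a x.
    apply: val_inj; rewrite /= !flE /flip /= uphalf_double doubleK.
    by clear; case: m => [[|[|[|]]] ?].
  have ea := e a i j; have eb := e b i j; rewrite !flab in eb.
  have {}hm : ((phase a i + phase b j + 2) %% 4 == (phase a j + phase b i) %% 4)%N := hm.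
  move: (phase a i) (phase a j) (phase b i) (phase b j) ea eb hm => p q p' q' ea eb hm.
  have : A i j * (I ^+ (p + q') - I ^+ (q + p')) = 0.
    rewrite mulrBr !exprD mulrCA eb [X in _ - X]mulrA ea.
    by rewrite [X in _ - X]mulrAC !mulrA subrr.
  rewrite (expI_neg hm) opprK -mulr2n => /eqP; rewrite mulf_eq0 mulrn_eq0 /=.
  by rewrite (negbTE (expI_neq0 _)) orbF => /eqP.
exists (A 0 0); apply/matrixP => i j; rewrite mxE; have [<-{j}|ij] := eqVneq i j; last by rewrite off.
rewrite mulr1n.
have d k x : A x x = A (fl k x) (fl k x).
  apply: (mulIf (expI_neq0 (phase k x))); rewrite e mulrC; congr (_ * _).
have z (x : 'I_8) (k : 'I_7) : (fl k x < x)%N -> A (fl k x) (fl k x) = A 0 0 -> A x x = A 0 0 by rewrite -d.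
have {z} : forall n (x : 'I_8), (x < n)%N -> A x x = A 0 0.
  elim=> // n IH x xn; have [x0|x0] := posnP x; first by congr (A _ _); apply: val_inj.
  have [k hk] : exists k : 'I_7, (fl k x < x)%N.
    case: x x0 {xn} => [[|[|[|[|[|[|[|[|]]]]]]]] ?] // _;
      by [exists (inord 0); rewrite flE inordK|exists (inord 2); rewrite flE inordK|exists (inord 4); rewrite flE inordK].
  by apply: (z _ _ hk); apply: IH; exact: leq_trans hk _.
by move=> /(_ 8 i (ltn_ord i)).
Qed.

End GammaMatrices.

(** * The action of the spin group on vectors and the lifting of real rotations *)

Section Adjoint.
Variable C : numClosedFieldType.
Local Notation I := ('i : C).
Local Notation conjC := (@Num.conj C).
Implicit Types (g h : 'M[C]_8) (u v w : 'rV[C]_7) (r q : 'M[C]_7).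

Let two_neq0 : (2 : C) != 0. Proof. by rewrite pnatr_eq0. Qed.

Definition cl v : 'M[C]_8 := \sum_(k < 7) v 0 k *: gam C k.

Lemma clD v w : cl (v + w) = cl v + cl w.
Proof. by rewrite /cl -big_split; apply: eq_bigr => k _; rewrite mxE scalerDl. Qed.

Lemma clZ a v : cl (a *: v) = a *: cl v.
Proof. by rewrite /cl scaler_sumr; apply: eq_bigr => k _; rewrite mxE scalerA. Qed.

Lemma cl_sum n (c : 'I_n -> C) (f : 'I_n -> 'rV[C]_7) :
  cl (\sum_i c i *: f i) = \sum_i c i *: cl (f i).
Proof.
elim/big_rec2: _ => [|i x y _ <-]; last by rewrite clD clZ.
by rewrite /cl big1 // => k _; rewrite mxE scale0r.
Qed.

Lemma cl_delta k : cl (delta_mx 0 k) = gam C k.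
Proof.
rewrite /cl (bigD1 k) //= mxE !eqxx scale1r big1 ?addr0 // => l /negbTE lk.
by rewrite mxE lk andbF scale0r.
Qed.

Lemma cl_anti v w : cl v *m cl w + cl w *m cl v = (2 * (v *m w^T) 0 0)%:M.
Proof.
rewrite /cl !mulmx_suml.
have -> : \sum_(k < 7) v 0 k *: gam C k *m (\sum_(l < 7) w 0 l *: gam C l) =
   \sum_(k < 7) \sum_(l < 7) (v 0 k * w 0 l) *: (gam C k *m gam C l).
  apply: eq_bigr => k _; rewrite mulmx_sumr; apply: eq_bigr => l _.
  by rewrite -scalemxAl -scalemxAr scalerA.
have -> : \sum_(k < 7) w 0 k *: gam C k *m (\sum_(l < 7) v 0 l *: gam C l) =
   \sum_(k < 7) \sum_(l < 7) (v 0 k * w 0 l) *: (gam C l *m gam C k).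
  rewrite exchange_big; apply: eq_bigr => k _; rewrite mulmx_sumr; apply: eq_bigr => l _.
  by rewrite -scalemxAl -scalemxAr scalerA mulrC.
rewrite -big_split /= -scalemx1 mxE mulr_sumr scaler_suml; apply: eq_bigr => k _.
rewrite -big_split (bigD1 k) //= -scalerDr gam_anti eqxx big1 ?addr0 => [|l lk].
  by rewrite [w^T _ _]mxE /= mulr1n -[X in _ *: X = _]scalemx1 scalerA mulrC.
by rewrite -scalerDr gam_anti eq_sym (negbTE lk) mulr0n raddf0 scaler0.
Qed.

Lemma cl_trC v : (cl v)^t* = cl (map_mx conjC v).
Proof.
rewrite /cl raddf_sum /= (big_morph (fun M : 'M[C]_8 => M ^ conjC) (id1 := 0) (op1 := +%R)).
- by apply: eq_bigr => k _; rewrite trCZ gam_trC mxE.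
- by move=> x y; rewrite map_mxD.
by rewrite map_mx0.
Qed.

Lemma cl_inj v w : cl v = cl w -> v = w.
Proof.
move=> h; apply/rowP => k.
have := cl_anti w (delta_mx 0 k); rewrite -h cl_anti => /matrixP/(_ 0 0).
rewrite !mxE eqxx !mulr1n => /(mulfI two_neq0).
have d (x : 'rV[C]_7) : \sum_j x 0 j * (delta_mx 0 k)^T j 0 = x 0 k.
  rewrite (bigD1 k) //= !mxE !eqxx mulr1 big1 ?addr0 // => l /negbTE lk.
  by rewrite !mxE lk andbF mulr0.
by rewrite !d.
Qed.

Definition unitvec v := (v *m v^T) 0 0 = 1.

Lemma cl_sqr v : unitvec v -> cl v *m cl v = 1%:M.
Proof.
move=> h; have := cl_anti v v; rewrite h mulr1 -!mulr2n -scalemx1 -scaler_nat.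
by move/(scalerI two_neq0).
Qed.

(* e = 1 for even products and e = -1 for odd ones, which act with a sign. *)
Definition adjsg (e : C) g r := forall w, g *m cl w = e *: (cl (w *m r^T) *m g).

Lemma adjsgM e f g h r q : adjsg e g r -> adjsg f h q -> adjsg (e * f) (g *m h) (r *m q).
Proof.
move=> hg hh w.
have -> : g *m h *m cl w = f *: (g *m cl (w *m q^T) *m h) by rewrite -mulmxA hh -scalemxAr mulmxA.
by rewrite hg -scalemxAl scalerA mulrC trmx_mul !mulmxA.
Qed.

Definition refl v : 'M[C]_7 := 1%:M - 2 *: (v^T *m v).

Lemma refl_tr v : (refl v)^T = refl v.
Proof. by rewrite /refl linearB linearZ /= trmx1 trmx_mul trmxK. Qed.

Lemma reflE v w : w *m refl v = w - (2 * (w *m v^T) 0 0) *: v.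
Proof.
rewrite /refl mulmxBr mulmx1 -scalemxAr mulmxA {1}[w *m v^T]mx11_scalar mul_scalar_mx.
by rewrite scalerA.
Qed.

Lemma refl_orth v : unitvec v -> refl v *m (refl v)^T = 1%:M.
Proof.
move=> h; rewrite refl_tr {2}/refl mulmxBr mulmx1 -scalemxAr mulmxA.
have -> : refl v *m v^T = - v^T.
  by rewrite -[LHS]trmxK trmx_mul refl_tr trmxK reflE h mulr1 scaler_nat mulr2n opprD addrA addrN add0r linearN.
by rewrite mulNmx scalerN opprK /refl subrK.
Qed.

(** From $vw + wv = 2(v,w)$ and $v^2 = 1$: conjugation by a unit vector is minus its reflection. *)
Lemma adjsg_cl v : unitvec v -> adjsg (-1) (cl v) (refl v).
Proof.
move=> h w; rewrite refl_tr reflE clD -scaleNr clZ mulmxDl scalerDr scaleN1r.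
rewrite -scalemxAl (cl_sqr h) scalerA mulN1r opprK scalemx1 -(cl_anti w v).
by rewrite addrA addNr add0r.
Qed.

Definition prodcl (s : seq 'rV[C]_7) : 'M[C]_8 := foldr (fun v M => cl v *m M) 1%:M s.

Lemma prodcl_cat s t : prodcl (s ++ t) = prodcl s *m prodcl t.
Proof. by elim: s => [|v s IH] /=; rewrite ?mul1mx // IH mulmxA. Qed.

Definition spin g := exists s, [/\ ~~ odd (size s), forall v, v \in s -> unitvec v & g = prodcl s].

Lemma spin1 : spin 1%:M. Proof. by exists [::]. Qed.

Lemma spinM g h : spin g -> spin h -> spin (g *m h).
Proof.
move=> [s [s1 s2 ->]] [t [t1 t2 ->]]; exists (s ++ t); split.
- by rewrite size_cat oddD (negbTE s1) (negbTE t1).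
- by move=> v; rewrite mem_cat => /orP[/s2|/t2].
by rewrite prodcl_cat.
Qed.

Lemma prodcl_rev s : (forall v, v \in s -> unitvec v) -> prodcl s *m prodcl (rev s) = 1%:M.
Proof.
elim: s => [|v s IH] h /=; first by rewrite mul1mx.
rewrite rev_cons -cats1 prodcl_cat /= mulmx1 mulmxA -(mulmxA (cl v)) IH ?mulmx1.
  by apply: cl_sqr; apply: h; rewrite mem_head.
by move=> w ws; apply: h; rewrite inE ws orbT.
Qed.

Lemma spinV g : spin g -> g \in unitmx /\ spin (invmx g).
Proof.
move=> [s [s1 s2 ->]]; have h := prodcl_rev s2; have [u _] := mulmx1_unit h.
split=> //; exists (rev s); split; rewrite ?size_rev //.
  by move=> v; rewrite mem_rev; exact: s2.
by apply: (can_inj (mulKmx u)); rewrite mulmxV // h.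
Qed.

Lemma prodcl_adj s : (forall v, v \in s -> unitvec v) ->
  exists r, adjsg ((-1) ^+ size s) (prodcl s) r /\ r *m r^T = 1%:M.
Proof.
elim: s => [|v s IH] h.
  by exists 1%:M; split; [move=> w; rewrite expr0 scale1r trmx1 mulmx1 mul1mx mulmx1|rewrite trmx1 mulmx1].
have hv : unitvec v by apply: h; rewrite mem_head.
have [r [h1 h2]] : exists r, adjsg ((-1) ^+ size s) (prodcl s) r /\ r *m r^T = 1%:M.
  by apply: IH => w ws; apply: h; rewrite inE ws orbT.
exists (refl v *m r); split; first by rewrite exprS; exact: adjsgM (adjsg_cl hv) h1.
by rewrite trmx_mul mulmxA -(mulmxA (refl v)) h2 mulmx1 refl_orth.
Qed.

Definition adj g r := forall w, g *m cl w = cl (w *m r^T) *m g.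

Lemma adjM g h r q : adj g r -> adj h q -> adj (g *m h) (r *m q).
Proof.
by move=> hg hh w; rewrite -mulmxA hh mulmxA hg trmx_mul !mulmxA.
Qed.

Lemma spin_adj g : spin g -> exists r, adj g r /\ r *m r^T = 1%:M.
Proof.
move=> [s [s1 s2 ->]]; have [r [h1 h2]] := prodcl_adj s2; exists r; split=> // w.
by rewrite h1 -signr_odd (negbTE s1) expr0 scale1r.
Qed.

Lemma adj_uniq g r q : g \in unitmx -> adj g r -> adj g q -> r = q.
Proof.
move=> gu hr hq; apply: trmx_inj; apply/row_matrixP => i; rewrite !rowE.
by apply: cl_inj; apply: (can_inj (mulmxK gu)); rewrite -hr -hq.
Qed.

Definition conj_fixed r := map_mx conjC r = r.

Lemma real_orth r : r *m r^T = 1%:M -> conj_fixed r -> r \is unitarymx.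
Proof.
by move=> h1 h2; apply/unitarymxP; rewrite -map_trmx h2.
Qed.

Lemma orth_unitary_real r : r *m r^T = 1%:M -> r \is unitarymx -> conj_fixed r.
Proof.
move=> h1 /unitarymxP h2; have [u _] := mulmx1_unit h1.
have : r *m r^T = r *m r^t* by rewrite h1 h2.
by move/(can_inj (mulKmx u)) => e; apply: trmx_inj; rewrite map_trmx -e.
Qed.

Lemma spin_det g : spin g -> `|\det g| = 1.
Proof.
move=> [s [_ s2 ->]]; elim: s s2 => [|v s IH] h /=; first by rewrite det1 normr1.
rewrite det_mulmx normrM IH ?mulr1 => [|w ws]; last by apply: h; rewrite inE ws orbT.
have hv : unitvec v by apply: h; rewrite mem_head.
have := congr1 (fun M : 'M[C]_8 => `|\det M|) (cl_sqr hv).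
rewrite /= det_mulmx det1 normr1 normrM -expr2 => /eqP.
by rewrite sqrp_eq1 ?normr_ge0 // => /eqP.
Qed.

(* If the rotation induced by g is real, then g g^* commutes with the gamma_k,
   hence is a scalar; the determinant shows that it is 1. *)
Lemma spin_unitary g r : spin g -> adj g r -> conj_fixed r -> g \is unitarymx.
Proof.
move=> sg ag rr; have [gu _] := spinV sg.
have rT : map_mx conjC r^T = r^T by rewrite -map_trmx rr.
have adC w : cl w *m g^t* = g^t* *m cl (w *m r^T).
  have := congr1 (fun M : 'M[C]_8 => M^t*) (ag (map_mx conjC w)).
  rewrite !trCM !cl_trC map_mxM rT.
  have -> : map_mx conjC (map_mx conjC w) = w by apply/rowP => k; rewrite !mxE conjCK.
  by [].
have ru : r^T \in unitmx.
  have [q [aq q1]] := spin_adj sg; rewrite -(adj_uniq gu ag aq) in q1.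
  by have [] := mulmx1_unit q1.
have [k|c cE] := @gam_commutant C (g *m g^t*).
  rewrite -cl_delta; set w := delta_mx 0 k.
  rewrite -[w](mulmxKV ru) -mulmxA -adC mulmxA ag mulmxA.
  by [].
apply/unitarymxP; rewrite cE; congr (_%:M).
have c0 : 0 <= c.
  have -> : c = (g *m g^t*) 0 0 by rewrite cE mxE eqxx.
  rewrite mxE; apply: sumr_ge0 => j _; rewrite trCE; exact: mul_conjC_ge0.
have : `|c ^+ 8| = 1.
  have <- : \det (g *m g^t*) = c ^+ 8 by rewrite cE det_scalar.
  rewrite det_mulmx det_map_mx det_tr normrM norm_conjC (spin_det sg) mulr1.
  by [].
by rewrite normrX (ger0_norm c0) => /eqP; rewrite pexpr_eq1 // => /eqP.
Qed.

Lemma cl_unitary v : unitvec v -> map_mx conjC v = v -> cl v \is unitarymx.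
Proof. by move=> h1 h2; apply/unitarymxP; rewrite cl_trC h2 cl_sqr. Qed.

Lemma prodcl_unitary s : (forall v, v \in s -> unitvec v /\ map_mx conjC v = v) ->
  prodcl s \is unitarymx.
Proof.
elim: s => [|v s IH] h /=; first by apply/unitarymxP; rewrite trC1 mulmx1.
have [h1 h2] := h v (mem_head _ _); apply: mul_unitarymx; first exact: cl_unitary.
by apply: IH => w ws; apply: h; rewrite inE ws orbT.
Qed.

(* Downward induction on m, for matrices fixing the first m basis vectors:
   a reflection takes row m to the m-th basis vector (Cartan-Dieudonne). *)
Lemma real_orth_lift m r : (m <= 7)%N -> r *m r^T = 1%:M -> conj_fixed r ->
  (forall i : 'I_7, (i < 7 - m)%N -> row i r = delta_mx 0 i) ->
  exists s, (forall v, v \in s -> unitvec v /\ map_mx conjC v = v) /\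
    adjsg ((-1) ^+ size s) (prodcl s) r.
Proof.
elim: m r => [|m IH] r m7 ro rr rf.
  exists [::]; split=> // w; rewrite /= expr0 scale1r mulmx1 mul1mx.
  suff -> : r = 1%:M by rewrite trmx1 mulmx1.
  by apply/row_matrixP => i; rewrite rf ?subn0 // rowE mulmx1.
have i7 : (7 - m.+1 < 7)%N by rewrite subnSK // leq_subr.
pose i := Ordinal i7.
have e_small (j : 'I_7) : (j < 7 - m)%N -> j = i \/ (j < 7 - m.+1)%N.
  rewrite -[(7 - m)%N]subnSK // ltnS leq_eqVlt => /orP[/eqP e|]; [left|by right].
  exact: val_inj.
have [ri|ri] := eqVneq (row i r) (delta_mx 0 i).
  apply: IH => //; first exact: ltnW.
  by move=> j /e_small[->//|]; exact: rf.
(* The reflection in [d] exchanges the unit vectors [row i r] and [delta_mx 0 i] and fixes the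
   earlier basis vectors, which are orthogonal to [d]. Reality of [d] allows it to be normalized. *)
have [d dE] : exists d, d = row i r - delta_mx 0 i by eexists.
have rows j k : (row j r *m (row k r)^T) 0 0 = (j == k)%:R.
  have /matrixP/(_ j k) := ro; rewrite [RHS]mxE => <-; rewrite !mxE; apply: eq_bigr => l _.
  by rewrite !mxE.
have dl (x : 'rV[C]_7) k : (x *m (delta_mx 0 k)^T) 0 0 = x 0 k.
  rewrite mxE (bigD1 k) //= !mxE !eqxx mulr1 big1 ?addr0 // => l /negbTE lk.
  by rewrite !mxE lk andbF mulr0.
have dC (x y : 'rV[C]_7) : (x *m y^T) 0 0 = (y *m x^T) 0 0.
  by rewrite -[in LHS](trmxK x) -trmx_mul mxE.
have dr : map_mx conjC d = d.
  rewrite dE; apply/rowP => k; rewrite !mxE rmorphB /= rmorph_nat.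
  by have /matrixP/(_ i k) := rr; rewrite mxE => ->.
have dd : (d *m d^T) 0 0 = 2 * (1 - r i i).
  rewrite dE linearB /= mulmxBr !mulmxBl !mxE.
  have E (x y : 'rV[C]_7) : \sum_j x 0 j * y^T j 0 = (x *m y^T) 0 0 by rewrite mxE.
  rewrite !E rows eqxx dl [X in _ - X - _]dC dl dl !mxE !eqxx /=.
  by ring.
have dp : 0 < (d *m d^T) 0 0.
  have -> : (d *m d^T) 0 0 = \sum_j `|d 0 j| ^+ 2.
    rewrite mxE; apply: eq_bigr => j _; rewrite mxE normCK; congr (_ * _).
    by have /rowP/(_ j) := dr; rewrite mxE => ->.
  have [k dk] : exists k, d 0 k != 0.
    by apply/rV0Pn; rewrite dE subr_eq0.
  rewrite (bigD1 k) //= ltr_wpDr //; first by apply: sumr_ge0 => j _; exact: exprn_ge0.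
  by rewrite exprn_gt0 // normr_gt0.
pose c := sqrtC ((d *m d^T) 0 0); have c2 : c ^+ 2 = (d *m d^T) 0 0 by rewrite sqrtCK.
have cp : 0 < c by rewrite sqrtC_gt0.
pose v := c^-1 *: d.
have vT : v^T = c^-1 *: d^T by rewrite linearZ.
have vu : unitvec v.
  rewrite /unitvec /v linearZ /= -scalemxAr -scalemxAl scalerA mxE -c2.
  by rewrite expr2; field; rewrite gt_eqF.
have vr : map_mx conjC v = v.
  by rewrite /v map_mxZ dr fmorphV; congr (_^-1 *: _); apply: CrealP; rewrite realE ltW.
have rv w : w *m refl v = w - (2 * (w *m d^T) 0 0 / (d *m d^T) 0 0) *: d.
  rewrite reflE vT -scalemxAr mxE scalerA -c2; congr (_ - _ *: _).
  by field; rewrite gt_eqF.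
have [s [s1 s2]] : exists s, (forall v, v \in s -> unitvec v /\ map_mx conjC v = v) /\
    adjsg ((-1) ^+ size s) (prodcl s) (r *m refl v).
  apply: IH; first exact: ltnW.
  - by rewrite trmx_mul mulmxA -(mulmxA r) refl_orth // mulmx1.
  - rewrite /conj_fixed map_mxM rr; congr (_ *m _).
    by rewrite /refl map_mxB map_mxZ map_mxM -map_trmx vr rmorph_nat map_mx1.
  move=> j /e_small[->|jm]; rewrite row_mul rv.
    have -> : 2 * (row i r *m d^T) 0 0 / (d *m d^T) 0 0 = 1.
      rewrite -[RHS](divff (negbT (gt_eqF dp))) {2}dd; congr (2 * _ / _).
      rewrite dE linearB /= mulmxBr mxE rows eqxx [X in _ + X]mxE dl mxE.
      by [].
    by rewrite scale1r dE opprB addrC subrK.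
  rewrite (rf _ jm).
  have ij : (j == i) = false by apply/eqP => e; move: jm; rewrite e ltnn.
  have d0 : d 0 j = 0.
    have := rows i j; rewrite (rf _ jm) dl eq_sym ij dE !mxE => ->.
    by rewrite ij andbF subr0.
  by rewrite dC dl d0 mulr0 mul0r scale0r subr0.
exists (rcons s v); split.
  by move=> w; rewrite mem_rcons inE => /orP[/eqP->|/s1].
rewrite size_rcons exprSr -cats1 prodcl_cat /= mulmx1.
have -> : r = (r *m refl v) *m refl v.
  by rewrite -mulmxA -[X in _ *m (_ *m X)]refl_tr refl_orth // mulmx1.
exact: adjsgM s2 (adjsg_cl vu).
Qed.

(** The volume element of the odd-dimensional Clifford algebra is central, and here a scalar, so it
    can change the parity of a product of vectors. *)
Lemma gam_prod : prodcl [seq delta_mx 0 k | k <- enum 'I_7] = (I ^+ 3)%:M.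
Proof.
have -> : prodcl [seq delta_mx 0 k | k <- enum 'I_7] =
    foldr (fun k M => gam C k *m M) 1%:M (enum 'I_7).
  by elim: (enum _) => //= k s ->; rewrite cl_delta.
have E (s : seq 'I_7) i j : foldr (fun k M => gam C k *m M) 1%:M s i j =
   I ^+ (foldr (fun k f i => phase k i + f (flip k i)) (fun=> 0) (map val s) i)%N
   *+ (j == foldr (fun k f i => f (fl k i)) id s i).
  elim: s i => [|k s IH] i /=; first by rewrite mxE expr0 eq_sym.
  by rewrite gam_mulE IH exprD mulrnAr flE.
apply/matrixP => i j; rewrite E mxE val_enum_ord.
have -> : foldr (fun k f i => f (fl k i)) id (enum 'I_7) i = i.
  apply: val_inj; rewrite /=.
  have F (s : seq 'I_7) x : foldr (fun k f i => f (fl k i)) id s x =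
      foldr (fun k f i => f (flip k i)) id (map val s) x :> nat.
    by elim: s x => [|k s IH] x //=; rewrite IH flE.
  rewrite F val_enum_ord; case: i => i /= hi; move: hi.
  by case: i => [|[|[|[|[|[|[|[|]]]]]]]].
rewrite eq_sym; congr (_ *+ _); apply: expI_mod; case: i => i /= hi; move: hi.
by case: i => [|[|[|[|[|[|[|[|]]]]]]]].
Qed.

(** A product of an odd number of vectors acts by $-r$; appending the seven basis vectors, whose
    product is a scalar, makes the number even without changing the action. *)
Lemma real_orth_spin r : r *m r^T = 1%:M -> conj_fixed r ->
  exists g, [/\ spin g, g \is unitarymx & adj g r \/ adj g (- r)].
Proof.
move=> ro rr; have [i|s [s1 s2]] := @real_orth_lift 7 r (leqnn 7) ro rr.
  by rewrite subnn.
have [so|so] := boolP (odd (size s)); last first.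
  exists (prodcl s); split; last by left=> w; rewrite s2 -signr_odd (negbTE so) expr0 scale1r.
    by exists s; split=> // v /s1[].
  exact: prodcl_unitary.
pose t := [seq delta_mx 0 k | k <- enum 'I_7] : seq 'rV[C]_7.
have t1 v : v \in t -> unitvec v /\ map_mx conjC v = v.
  move=> /mapP[k _ ->]; split.
    rewrite /unitvec mxE (bigD1 k) //= !mxE !eqxx mulr1 big1 ?addr0 // => l /negbTE lk.
    by rewrite !mxE lk andbF mulr0.
  by apply/rowP => l; rewrite !mxE rmorph_nat.
have st1 v : v \in s ++ t -> unitvec v /\ map_mx conjC v = v.
  by rewrite mem_cat => /orP[/s1|/t1].
exists (prodcl (s ++ t)); split; last first.
- right=> w; rewrite prodcl_cat gam_prod mul_mx_scalar -scalemxAl -scalemxAr s2.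
  by rewrite -signr_odd so expr1 [(- r)^T]linearN mulmxN -[- (w *m _)]scaleN1r clZ -scalemxAl.
- exact: prodcl_unitary.
exists (s ++ t); split=> //; last by move=> v /st1[].
by rewrite size_cat size_map size_enum_ord oddD so.
Qed.

End Adjoint.

(** * Weight vectors and the exponential of the Cartan subspace *)

Section WeightBasis.
Variables (R : realType) (C : numClosedFieldType) (rc : real_part R C).
Local Notation I := ('i : C).
Local Notation cR := (cR rc).
Local Notation conjC := (@Num.conj C).
Implicit Types (u : 'rV[R]_3) (v w : 'rV[C]_7).

(** The weights $(\pm x \pm y \pm z)/2$ of the spin representation. *)
Definition half_weight u (i : nat) : R := 2^-1 * \sum_(m < 3) (-1) ^+ bit m i * u 0 m.

Definition spin_exp u : 'M[C]_8 := diag_mx (\row_i cR (expR (half_weight u i))).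

Definition even_ord (m : 'I_3) : 'I_7 := inord m.*2.
Definition odd_ord (m : 'I_3) : 'I_7 := inord m.*2.+1.

Lemma even_ordE m : even_ord m = m.*2 :> nat.
Proof. by rewrite inordK //; case: m => [[|[|[|]]] ?]. Qed.

Lemma odd_ordE m : odd_ord m = m.*2.+1 :> nat.
Proof. by rewrite inordK //; case: m => [[|[|[|]]] ?]. Qed.

Lemma all_lt3P (P : nat -> nat -> bool) :
  all (fun m => all (P m) (iota 0 8)) (iota 0 3) -> forall (m : 'I_3) (i : 'I_8), P m i.
Proof.
move=> h m i; have /allP/(_ m) := h.
by rewrite mem_iota ltn_ord => /(_ isT)/allP/(_ i); rewrite mem_iota ltn_ord => /(_ isT).
Qed.

Lemma fl_odd m i : fl (odd_ord m) i = fl (even_ord m) i.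
Proof.
apply: val_inj; rewrite /= !flE odd_ordE even_ordE; apply/eqP.
by apply: (@all_lt3P (fun m i => flip m.*2.+1 i == flip m.*2 i)); vm_compute.
Qed.

Definition hyp_factor (m : 'I_3) (t : R) : 'M[C]_8 :=
  diag_mx (\row_(i < 8) cR (expR ((-1) ^+ bit m i * t))).

(** The complex unit vector $\cosh t\, e_{2m} - i \sinh t\, e_{2m+1}$. Its product with $e_{2m}$ is
    [hyp_factor], which exhibits the exponentials of the Cartan subspace as even products of unit
    vectors. *)
Definition hyp_vec (m : 'I_3) (t : R) : 'rV[C]_7 :=
  cR ((expR t + expR (- t)) / 2) *: delta_mx 0 (even_ord m)
  - (I * cR ((expR t - expR (- t)) / 2)) *: delta_mx 0 (odd_ord m).

Lemma deltaE (w : 'rV[C]_7) k : (w *m (delta_mx 0 k : 'rV[C]_7)^T) 0 0 = w 0 k.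
Proof.
rewrite mxE (bigD1 k) //= !mxE !eqxx mulr1 big1 ?addr0 // => l /negbTE lk.
by rewrite !mxE lk andbF mulr0.
Qed.

Lemma unitvec_delta k : unitvec (delta_mx 0 k : 'rV[C]_7).
Proof. by rewrite /unitvec deltaE mxE !eqxx. Qed.

Lemma even_odd m n : (even_ord m == odd_ord n) = false.
Proof.
apply/eqP => /(congr1 val); rewrite /= even_ordE odd_ordE => /(congr1 odd).
by rewrite /= !odd_double.
Qed.

Lemma even_even m n : (even_ord m == even_ord n) = (m == n).
Proof. by rewrite -val_eqE /= !even_ordE -!muln2 eqn_pmul2r. Qed.

Lemma odd_odd m n : (odd_ord m == odd_ord n) = (m == n).
Proof. by rewrite -val_eqE /= !odd_ordE eqSS -!muln2 eqn_pmul2r. Qed.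

Lemma pairing m (x y : C) w :
  (w *m (x *: delta_mx 0 (even_ord m) + y *: delta_mx 0 (odd_ord m) : 'rV[C]_7)^T) 0 0 =
  x * w 0 (even_ord m) + y * w 0 (odd_ord m).
Proof.
have -> : (x *: delta_mx 0 (even_ord m) + y *: delta_mx 0 (odd_ord m) : 'rV[C]_7)^T =
   x *: (delta_mx 0 (even_ord m) : 'rV[C]_7)^T + y *: (delta_mx 0 (odd_ord m) : 'rV[C]_7)^T.
  by rewrite linearD !linearZ.
by rewrite mulmxDr -!scalemxAr mxE [X in X + _]mxE [X in _ + X]mxE !deltaE.
Qed.

Lemma pair_even m n (x y : C) :
  (x *: delta_mx 0 (even_ord m) + y *: delta_mx 0 (odd_ord m) : 'rV[C]_7) 0 (even_ord n)
  = x *+ (m == n).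
Proof.
rewrite !mxE !eqxx /= even_even even_odd eq_sym mulr0 addr0.
by case: eqP; rewrite ?mulr1 ?mulr0.
Qed.

Lemma pair_odd m n (x y : C) :
  (x *: delta_mx 0 (even_ord m) + y *: delta_mx 0 (odd_ord m) : 'rV[C]_7) 0 (odd_ord n)
  = y *+ (m == n).
Proof.
rewrite !mxE !eqxx /= [odd_ord n == even_ord m]eq_sym odd_odd even_odd eq_sym mulr0 add0r.
by case: eqP; rewrite ?mulr1 ?mulr0.
Qed.

Lemma hyp_vec_unit m t : unitvec (hyp_vec m t).
Proof.
rewrite /unitvec /hyp_vec -scaleNr pairing pair_even pair_odd eqxx !mulr1n.
set a := cR _; set b := cR _.
have -> : - (I * b) * - (I * b) = - (b * b).
  by rewrite mulrNN mulrACA -expr2 sqrCi mulN1r.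
rewrite /a /b -!rmorphM -rmorphB -[RHS](rmorph1 cR); congr (cR _).
have : expR t * expR (- t) = 1 by rewrite -expRD subrr expR0.
move: (expR t) (expR (- t)) => x y xy.
have -> : (x + y) / 2 * ((x + y) / 2) - (x - y) / 2 * ((x - y) / 2) = x * y by field.
exact: xy.
Qed.

Lemma cl_pair m (x y : C) :
  cl (x *: delta_mx 0 (even_ord m) + y *: delta_mx 0 (odd_ord m)) =
  x *: gam C (even_ord m) + y *: gam C (odd_ord m).
Proof. by rewrite clD !clZ !cl_delta. Qed.

Lemma hyp_factorE m t : hyp_factor m t = cl (delta_mx 0 (even_ord m)) *m cl (hyp_vec m t).
Proof.
rewrite cl_delta /hyp_vec -scaleNr cl_pair.
apply/matrixP => i j; rewrite gam_mulE !mxE fl_odd flK -[j == i]eq_sym.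
case: eqP => _; last by rewrite !mulr0n !mulr0 addr0 mulr0.
rewrite !mulr1n.
rewrite mulrDr [X in X + _]mulrCA -exprD [X in _ + X]mulrCA -exprD !flE even_ordE odd_ordE.
rewrite (@expI_mod _ _ 0); last first.
  apply: (@all_lt3P (fun m i => ((phase m.*2 i + phase m.*2 (flip m.*2 i)) %% 4 == 0 %% 4)%N)).
  by vm_compute.
rewrite expr0 mulr1.
have -> : I ^+ (phase m.*2 i + phase m.*2.+1 (flip m.*2 i)) = I * (-1) ^+ bit m i.
  have <- : I ^+ (1 + 2 * bit m i) = I * (-1) ^+ bit m i by rewrite exprD exprM sqrCi.
  apply: expI_mod.
  apply: (@all_lt3P (fun m i => ((phase m.*2 i + phase m.*2.+1 (flip m.*2 i)) %% 4
    == (1 + 2 * bit m i) %% 4)%N)).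
  by vm_compute.
have -> : forall b c : C, - (I * b) * (I * c) = b * c.
  by move=> b c; rewrite mulNr mulrACA -expr2 sqrCi mulN1r opprK.
have b2 : (bit m i < 2)%N by rewrite ltn_pmod.
case: (bit m i) b2 => [|[|]] // _; rewrite ?expr0 ?expr1 ?mul1r ?mulN1r ?mulr1 ?mulrN1;
  rewrite -?rmorphN -rmorphD; congr (cR _); by field.
Qed.

Lemma hyp_factor_spin m t : spin (hyp_factor m t).
Proof.
exists [:: delta_mx 0 (even_ord m); hyp_vec m t]; split=> //.
  move=> v; rewrite !inE => /orP[] /eqP->; [exact: unitvec_delta|exact: hyp_vec_unit].
by rewrite /= mulmx1 hyp_factorE.
Qed.

Lemma spin_expE u : spin_exp u = hyp_factor 0 (u 0 0 / 2) *m hyp_factor 1 (u 0 1 / 2)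
   *m hyp_factor (inord 2) (u 0 (inord 2) / 2).
Proof.
rewrite /hyp_factor !mulmx_diag /spin_exp; congr diag_mx; apply/rowP => i.
rewrite !mxE -!rmorphM -!expRD; congr (cR (expR _)).
rewrite /half_weight !big_ord_recr big_ord0 /= add0r.
have -> : inord 2 = ord_max :> 'I_3 by apply: val_inj; rewrite /= inordK.
have -> : widen_ord (leqnSn 2) (widen_ord (leqnSn 1) ord_max) = 0 by apply: val_inj.
have -> : widen_ord (leqnSn 2) ord_max = 1 by apply: val_inj.
by rewrite /=; ring.
Qed.

Lemma spin_exp_spin u : spin (spin_exp u).
Proof. by rewrite spin_expE; do 2 ?apply: spinM; exact: hyp_factor_spin. Qed.

(** The isotropic weight vectors $(e_{2m} \pm i e_{2m+1})/\sqrt 2$. *)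
Definition tvec (m : 'I_3) (e : bool) : 'rV[C]_7 :=
  (sqrtC 2)^-1 *: delta_mx 0 (even_ord m)
  + ((sqrtC 2)^-1 * (I * (-1) ^+ e)) *: delta_mx 0 (odd_ord m).

Lemma sqrtV2 : (sqrtC 2)^-1 * (sqrtC 2)^-1 = 2^-1 :> C.
Proof. by rewrite -invfM -expr2 sqrtCK. Qed.

Lemma tvec_pairing m e n f : (tvec m e *m (tvec n f)^T) 0 0 = ((m == n) && (e != f))%:R.
Proof.
rewrite pairing pair_even pair_odd; case: eqP => _; last by rewrite !mulr0n !mulr0 addr0.
rewrite !mulr1n mulrACA sqrtV2 mulrACA -expr2 sqrCi mulN1r -signr_addb.
have h : 2^-1 + 2^-1 = 1 :> C by rewrite -div1r -splitr.
by case: e f => [] []; rewrite /= ?expr0 ?expr1 ?opprK ?mulrN1 ?mulr1 ?subrr ?h.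
Qed.

Lemma tvec_conj m e : map_mx conjC (tvec m e) = tvec m (~~ e).
Proof.
have s : ((sqrtC 2)^-1 : C)^* = (sqrtC 2)^-1.
  by apply: CrealP; rewrite rpredV realE sqrtC_ge0 ler0n.
apply/rowP => k; rewrite !mxE rmorphD !rmorphM /= s !rmorph_nat conjCi rmorph_sign.
by case: e; rewrite /= ?expr0 ?expr1 ?mulr1 ?mulrN1 ?opprK.
Qed.

Lemma half_weight_flip u m (i : 'I_8) :
  half_weight u i - half_weight u (fl (even_ord m) i) = (-1) ^+ bit m i * u 0 m.
Proof.
rewrite /half_weight -mulrBr -sumrB (bigD1 m) //= big1 ?addr0 => [|n nm].
  have -> : (-1 : R) ^+ bit m (fl (even_ord m) i) = - (-1) ^+ bit m i.
    have h : (bit m (fl (even_ord m) i) + bit m i = 1)%N.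
      rewrite flE even_ordE; apply/eqP.
      by apply: (@all_lt3P (fun m i => bit m (flip m.*2 i) + bit m i == 1)%N); vm_compute.
    have := congr1 (fun k => (-1 : R) ^+ k) h; rewrite exprD expr1 => e.
    by rewrite -[LHS]mulr1 -[X in _ * X](@sqrr_sign R (bit m i)) expr2 mulrA e mulN1r.
  by field.
have -> : bit n (fl (even_ord m) i) = bit n i; last by rewrite subrr.
rewrite flE even_ordE; move: nm; rewrite -val_eqE; case: m n => [[|[|[|]]] ?] // [[|[|[|]]] ?] // _;
  by clear; case: i => [[|[|[|[|[|[|[|[|]]]]]]]] ?].
Qed.

(** Row by row: either the flip of bit [m] changes the half weight by the required amount, or the
    two gammas cancel. *)
Lemma spin_exp_tvec u m e : spin_exp u *m cl (tvec m e) =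
  cR (expR ((-1) ^+ e * u 0 m)) *: (cl (tvec m e) *m spin_exp u).
Proof.
rewrite cl_pair; apply/matrixP => i j.
rewrite /spin_exp mul_diag_mx [RHS]mxE mul_mx_diag !mxE fl_odd.
case: eqP => [->|_]; last by rewrite !mulr0n !mulr0 addr0 mul0r !mulr0.
rewrite !mulr1n.
have [be|be] := eqVneq (bit m i) e.
  rewrite -{1}[half_weight u i](subrK (half_weight u (fl (even_ord m) i))).
  rewrite half_weight_flip expRD rmorphM be -!mulrA; congr (_ * _).
  by rewrite mulrC.
have -> : (sqrtC 2)^-1 * I ^+ phase (even_ord m) i +
   (sqrtC 2)^-1 * (I * (-1) ^+ e) * I ^+ phase (odd_ord m) i = 0.
  rewrite -mulrA -mulrDr.
  have -> : I * (-1) ^+ e * I ^+ phase (odd_ord m) i = - I ^+ phase (even_ord m) i.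
    have <- : I ^+ (1 + 2 * e) = I * (-1) ^+ e by rewrite exprD exprM sqrCi.
    rewrite -exprD; apply: expI_neg; rewrite odd_ordE even_ordE.
    have b2 : (bit m i < 2)%N by rewrite ltn_pmod.
    case: e be => /= be.
      have b0 : bit m i == 0%N by case: (bit m i) b2 be => [|[|]].
      move: b0; apply/implyP.
      apply: (@all_lt3P (fun m i => (bit m i == 0) ==>
        ((phase m.*2 i + 2) %% 4 == (1 + 2 * 1 + phase m.*2.+1 i) %% 4)%N)).
      by vm_compute.
    have b1 : bit m i == 1%N by case: (bit m i) b2 be => [|[|]].
    move: b1; apply/implyP.
    apply: (@all_lt3P (fun m i => (bit m i == 1%N) ==>
        ((phase m.*2 i + 2) %% 4 == (1 + 2 * 0 + phase m.*2.+1 i) %% 4)%N)).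
    by vm_compute.
  by rewrite addrN mulr0.
by rewrite !(mulr0, mul0r).
Qed.

Lemma spin_exp_last u : spin_exp u *m cl (delta_mx 0 ord_max) =
  cl (delta_mx 0 ord_max) *m spin_exp u.
Proof.
have fm i : fl ord_max i = i by apply: val_inj; rewrite /= flE.
rewrite cl_delta; apply/matrixP => i j.
rewrite /spin_exp mul_diag_mx mul_mx_diag !mxE fm; case: eqP => [->|_]; first by rewrite mulrC.
by rewrite !mulr0n mulr0 mul0r.
Qed.

Definition ord_fold (j : 'I_7) : 'I_3 := inord (minn j (6 - j)).

(* The rows of wbasis are weight vectors, in the order of the weights
   x, y, z, 0, -z, -y, -x. *)
Definition wbasis : 'M[C]_7 :=
  \matrix_(j < 7) (if j == 3 :> nat then delta_mx 0 ord_max else tvec (ord_fold j) (3 < j)%N).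

Local Notation J := (antidiag C (fun _ : 'I_7 => false)).

Lemma wbasis_J : wbasis *m wbasis^T = J.
Proof.
have tm m e : tvec m e 0 ord_max = 0.
  rewrite !mxE; have -> : (ord_max == even_ord m) = false.
    by rewrite -val_eqE /= even_ordE; case: m => [[|[|[|]]] ?].
  have -> : (ord_max == odd_ord m) = false.
    by rewrite -val_eqE /= odd_ordE; case: m => [[|[|[|]]] ?].
  by rewrite andbF !mulr0 addr0.
have mt m e : ((delta_mx 0 ord_max : 'rV[C]_7) *m (tvec m e)^T) 0 0 = 0.
  by rewrite -[X in X *m _]trmxK -trmx_mul mxE deltaE tm.
apply/matrixP => i j.
have -> : (wbasis *m wbasis^T) i j = (row i wbasis *m (row j wbasis)^T) 0 0.
  by rewrite !mxE; apply: eq_bigr => k _; rewrite !mxE.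
rewrite !rowK [RHS]mxE expr0.
have [i3|i3] := eqVneq (i : nat) 3; have [j3|j3] := eqVneq (j : nat) 3.
- rewrite deltaE mxE !eqxx /= -val_eqE /= i3 j3.
  by [].
- rewrite mt -val_eqE /= i3 (negbTE j3).
  by [].
- rewrite deltaE tm -val_eqE /= j3; case: i i3 => [[|[|[|[|[|[|[|]]]]]]] ?] //.
rewrite tvec_pairing; congr (_%:R); congr nat_of_bool.
rewrite -!val_eqE /= !inordK; case: i i3 => [[|[|[|[|[|[|[|]]]]]]] ?] //;
  by case: j j3 => [[|[|[|[|[|[|[|]]]]]]] ?].
Qed.

Lemma wbasis_conj : map_mx conjC wbasis = J *m wbasis.
Proof.
apply/row_matrixP => i; rewrite row_mul.
have -> : row i J = delta_mx 0 (rev_ord i).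
  by apply/rowP => k; rewrite !mxE expr0; case: eqP.
rewrite -rowE rowK -map_row rowK /=.
have [i3|i3] := eqVneq (i : nat) 3.
  rewrite i3 /= map_delta_mx.
  by [].
have -> : (7 - i.+1 == 3)%N = false by case: i i3 => [[|[|[|[|[|[|[|]]]]]]] ?].
rewrite tvec_conj; congr tvec.
  by apply: val_inj; rewrite /= !inordK; case: i i3 => [[|[|[|[|[|[|[|]]]]]]] ?].
by case: i i3 => [[|[|[|[|[|[|[|]]]]]]] ?].
Qed.

Lemma wbasis_unitary : wbasis \is unitarymx.
Proof.
apply/unitarymxP; rewrite -map_trmx wbasis_conj trmx_mul mulmxA wbasis_J.
exact: antidiag_mulT.
Qed.

Lemma spin_exp_adj u :
  adj (spin_exp u) (wbasis^T *m expd rc (wt 7 u) *m map_mx conjC wbasis).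
Proof.
move=> w; rewrite !trmx_mul trmxK expd_tr !mulmxA map_trmx.
set D := expd rc (wt 7 u); have uU := wbasis_unitary.
have wE : w = w *m wbasis^t* *m wbasis by rewrite -mulmxA (mulmx1C (unitarymxP uU)) mulmx1.
set c := w *m wbasis^t*.
have cE (x : 'rV[C]_7) : x *m wbasis = \sum_j x 0 j *: row j wbasis.
  by rewrite mulmx_sum_row.
rewrite {1}wE -/c !cE !cl_sum mulmx_sumr mulmx_suml; apply: eq_bigr => j _.
rewrite -scalemxAr -scalemxAl.
have -> : (c *m D) 0 j = c 0 j * cR (expR (wt 7 u 0 j)) by rewrite /D mul_mx_diag !mxE.
rewrite -scalerA; congr (_ *: _); rewrite rowK.
have [j3|j3] := eqVneq (j : nat) 3.
  by rewrite spin_exp_last [wt 7 u 0 j]mxE /= j3 /= expR0 rmorph1 scale1r.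
rewrite spin_exp_tvec; congr (cR (expR _) *: _); rewrite [RHS]mxE.
case: j j3 => [[|[|[|[|[|[|[|]]]]]]] hj] // _; rewrite /= ?expr0 ?expr1 ?mul1r ?mulN1r;
  by congr (_ 0 _) || congr (- _ 0 _).
Qed.

End WeightBasis.

(** * Transfer of triangles between the spin group and the group of J *)

Section SpinTriangles.
Variables (R : realType) (C : numClosedFieldType) (rc : real_part R C).
Local Notation conjC := (@Num.conj C).
Local Notation U := (wbasis C).
Local Notation cU := (map_mx (@Num.conj C) (wbasis C)).
Local Notation J := (antidiag C (fun _ : 'I_7 => false)).
Local Notation isom := (@isom C 7 (fun=> false)).
Local Notation e := (spin_exp rc).
Local Notation D u := (expd rc (wt 7 u)).
Implicit Types (u : 'rV[R]_3) (g h : 'M[C]_8) (r q a : 'M[C]_7).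

Lemma wbasisKC : cU *m U^T = 1%:M.
Proof.
have /unitarymxP/(congr1 trmx) := wbasis_unitary C.
by rewrite trmx_mul trmx1 -map_trmx trmxK.
Qed.

Lemma wbasisCK : U^T *m cU = 1%:M. Proof. exact: mulmx1C wbasisKC. Qed.

Lemma wbasisC_unitary : cU \is unitarymx.
Proof.
apply/unitarymxP; have -> : cU^t* = U^T; last exact: wbasisKC.
by apply/matrixP => i j; rewrite !mxE conjCK.
Qed.

Lemma wbasisT_unitary : U^T \is unitarymx.
Proof.
apply/unitarymxP; have -> : (U^T)^t* = cU; last exact: wbasisCK.
by apply/matrixP => i j; rewrite !mxE.
Qed.

(** Coordinates in the weight basis, where the form $\sum_k v_k^2$ becomes $J$. *)
Definition to_weights r := cU *m r *m U^T.
Definition of_weights a := U^T *m a *m cU.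

Lemma of_weightsK a : to_weights (of_weights a) = a.
Proof. by rewrite /to_weights /of_weights !mulmxA wbasisKC mul1mx -mulmxA wbasisKC mulmx1. Qed.

Lemma to_weightsM r q : to_weights (r *m q) = to_weights r *m to_weights q.
Proof. by rewrite /to_weights -!mulmxA (mulmxA U^T) wbasisCK mul1mx. Qed.

Lemma of_weightsM a b : of_weights (a *m b) = of_weights a *m of_weights b.
Proof. by rewrite /of_weights -!mulmxA (mulmxA cU) wbasisKC mul1mx. Qed.

Lemma to_weights_unitary r : r \is unitarymx -> to_weights r \is unitarymx.
Proof.
by move=> ur; apply: mul_unitarymx wbasisT_unitary; apply: mul_unitarymx wbasisC_unitary ur.
Qed.

Lemma of_weights_unitary a : a \is unitarymx -> of_weights a \is unitarymx.
Proof.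
by move=> ua; apply: mul_unitarymx wbasisC_unitary; apply: mul_unitarymx wbasisT_unitary ua.
Qed.

Lemma of_weights_orth a : isom a -> of_weights a *m (of_weights a)^T = 1%:M.
Proof.
move=> ia; have cJ : cU *m cU^T = J.
  rewrite wbasis_conj trmx_mul -!mulmxA (mulmxA U) wbasis_J.
  have -> : J^T = J :> 'M[C]_7.
    apply/matrixP => i j; rewrite !mxE; congr (_ *+ _); congr nat_of_bool.
    by rewrite -(inj_eq rev_ord_inj) rev_ordK eq_sym.
  have JJ : J *m J = 1%:M :> 'M[C]_7.
    rewrite -[RHS](antidiag_mulT C (fun _ : 'I_7 => false)); congr (_ *m _).
    apply/matrixP => i j; rewrite !mxE; congr (_ *+ _); congr nat_of_bool.
    by rewrite -(inj_eq rev_ord_inj) rev_ordK eq_sym.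
  by rewrite JJ mulmx1.
rewrite /of_weights !trmx_mul trmxK -!mulmxA (mulmxA cU) cJ (mulmxA a) (mulmxA _ _ U).
rewrite [a *m J *m _](ia : _ = _) -wbasis_conj.
exact: wbasisCK.
Qed.

Lemma to_weights5 a b c r q :
  to_weights (of_weights a *m r *m of_weights b *m q *m of_weights c) =
  a *m to_weights r *m b *m to_weights q *m c.
Proof.
rewrite (to_weightsM _ (of_weights c)) (to_weightsM _ q) (to_weightsM _ (of_weights b)).
by rewrite (to_weightsM _ r) !of_weightsK.
Qed.

Lemma of_weights5 a b c (r q : 'M[C]_7) (s t : C) :
  of_weights a *m (s *: of_weights r) *m of_weights b *m (t *: of_weights q) *m of_weights c =
  (s * t) *: of_weights (a *m r *m b *m q *m c).
Proof. by rewrite !of_weightsM -!scalemxAr -!scalemxAl scalerA mulrC. Qed.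

Lemma spin_exp_weights u : adj (e u) (of_weights (D u)).
Proof. exact: spin_exp_adj. Qed.

(** Taking adjoints shows that a unitary [g] also acts by the complex conjugate of [r]; uniqueness
    of the rotation makes [r] real. *)
Lemma adj_conj_fixed g r : g \in unitmx -> g \is unitarymx -> adj g r -> conj_fixed r.
Proof.
move=> gu ug ag; apply/esym/(adj_uniq gu ag) => w.
have /(congr1 (fun M : 'M[C]_8 => M^t*)) := ag (map_mx conjC w).
rewrite !trCM !cl_trC map_mxM.
have -> : map_mx conjC (map_mx conjC w) = w by apply/rowP => k; rewrite !mxE conjCK.
rewrite map_trmx => h.
have := congr1 (fun M => g *m M *m g) h; rewrite !mulmxA (unitarymxP ug) mul1mx => <-.
by rewrite -mulmxA unitary_trCmul // mulmx1.
Qed.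

Lemma spin_unitary_adj g : spin g -> g \is unitarymx -> exists r, adj g r /\ r \is unitarymx.
Proof.
move=> sg ug; have [r [ar ro]] := spin_adj sg; exists r; split=> //.
by apply: real_orth ro _; apply: adj_conj_fixed ar => //; exact: (spinV sg).1.
Qed.

Lemma spin_triangle u0 u1 u2 g h : spin g -> g \is unitarymx -> spin h -> h \is unitarymx ->
  e u0 *m g *m e u1 *m h *m e u2 \is unitarymx -> triangle rc 7 u0 u1 u2.
Proof.
move=> sg ug sh uh um.
have sm : spin (e u0 *m g *m e u1 *m h *m e u2).
  apply: spinM (spin_exp_spin rc u2); apply: spinM sh.
  by apply: spinM (spin_exp_spin rc u1); apply: spinM sg; exact: spin_exp_spin.
have [r [ar ur]] := spin_unitary_adj sg ug; have [q [aq uq]] := spin_unitary_adj sh uh.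
have [p [ap up]] := spin_unitary_adj sm um.
have am := adjM (adjM (adjM (adjM (spin_exp_weights u0) ar) (spin_exp_weights u1)) aq) (spin_exp_weights u2).
have pE := adj_uniq (spinV sm).1 ap am.
exists (to_weights r), (to_weights q); split; [exact: to_weights_unitary|exact: to_weights_unitary|].
by have := to_weights_unitary up; rewrite pE to_weights5.
Qed.

(** Each unitary lifts up to the sign of its rotation. The total rotation is then known up to sign,
    hence unitary and real, and [spin_unitary] applies. *)
Lemma triangle_spin u0 u1 u2 a b : a \is unitarymx -> isom a -> b \is unitarymx -> isom b ->
  tproduct rc (wt 7 u0) (wt 7 u1) (wt 7 u2) a b \is unitarymx ->
  exists g h, [/\ spin g, g \is unitarymx, spin h, h \is unitarymx &
    e u0 *m g *m e u1 *m h *m e u2 \is unitarymx].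
Proof.
move=> ua ia ub ib um.
have lift c : c \is unitarymx -> isom c -> exists (g : 'M[C]_8) (s : C),
    [/\ spin g, g \is unitarymx, s = 1 \/ s = -1 & adj g (s *: of_weights c)].
  move=> uc ic; have oc := of_weights_orth ic.
  have [g [sg ug [ag|ag]]] := real_orth_spin oc (orth_unitary_real oc (of_weights_unitary uc)).
    by exists g, 1; split=> //; [left|rewrite scale1r].
  by exists g, (-1); split=> //; [right|rewrite scaleN1r].
have [g [s [sg ug s1 ag]]] := lift a ua ia; have [h [t [sh uh t1 ah]]] := lift b ub ib.
exists g, h; split=> //.
have sm : spin (e u0 *m g *m e u1 *m h *m e u2).
  apply: spinM (spin_exp_spin rc u2); apply: spinM sh.
  by apply: spinM (spin_exp_spin rc u1); apply: spinM sg; exact: spin_exp_spin.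
have am := adjM (adjM (adjM (adjM (spin_exp_weights u0) ag) (spin_exp_weights u1)) ah) (spin_exp_weights u2).
apply: (spin_unitary sm am).
have [p [ap po]] := spin_adj sm; have pE := adj_uniq (spinV sm).1 ap am.
apply: orth_unitary_real; first by rewrite -pE.
rewrite of_weights5.
have st : s * t = 1 \/ s * t = -1.
  by case: s1 t1 => -> [] ->; rewrite ?mul1r ?mulN1r ?opprK; auto.
have := of_weights_unitary um; case: st => ->; rewrite ?scale1r // scaleN1r => /unitarymxP h1.
apply/unitarymxP; rewrite -scaleN1r trCZ -scalemxAl -scalemxAr h1 rmorphN1 scalerA mulrNN mulr1.
by rewrite scale1r.
Qed.

End SpinTriangles.

(** * Identification of the gamma matrices with the Pauli tensors *)

Section PauliTensors.

Definition bit_ord (m : nat) (i : 'I_8) : 'I_2 := inord (bit m i).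

Lemma bit_ordE m i : bit_ord m i = bit m i :> nat.
Proof. by rewrite inordK // ltn_pmod. Qed.

Lemma tens3E (F : comNzRingType) (A B D : 'M[F]_2) (i j : 'I_(2 * 2 * 2)) :
  (A *t B *t D) i j = A (bit_ord 0 i) (bit_ord 0 j) * B (bit_ord 1 i) (bit_ord 1 j)
    * D (bit_ord 2 i) (bit_ord 2 j).
Proof.
have bits (x : 'I_(2 * 2 * 2)) :
    x = mxtens_index (mxtens_index (bit_ord 0 x, bit_ord 1 x), bit_ord 2 x).
  apply: val_inj; rewrite /= !bit_ordE.
  by case: x => [[|[|[|[|[|[|[|[|]]]]]]]] ?].
by rewrite {1}(bits i) {1}(bits j) !tensmxE.
Qed.

Variable C : numClosedFieldType.
Local Notation I := ('i : C).

Definition pauli (t : nat) : 'M[C]_2 :=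
  if t == 1%N then pauli_x C
  else if t == 2%N then @block_mx C 1 1 1 1 0 (- I)%:M I%:M 0
  else if t == 3%N then pauli_z C else 1%:M.

Definition pauli_phase (t a : nat) : nat :=
  (if t == 2 then 2 * a + 3 else if t == 3 then 2 * a else 0)%N.

Definition pauli_supp (t a b : nat) : bool :=
  if (t == 1%N) || (t == 2%N) then a != b else a == b.

Lemma pauli_xE (F : nzRingType) (a b : 'I_2) : pauli_x F a b = (a != b)%:R.
Proof.
case: (@split_ordP 1 1 a) => k ->; case: (@split_ordP 1 1 b) => l ->; rewrite !ord1.
- by rewrite [LHS]block_mxEul mxE.
- by rewrite [LHS]block_mxEur mxE.
- by rewrite [LHS]block_mxEdl mxE.
by rewrite [LHS]block_mxEdr mxE.
Qed.

Lemma pauli_zE (F : nzRingType) (a b : 'I_2) : pauli_z F a b = (-1) ^+ a *+ (a == b).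
Proof.
case: (@split_ordP 1 1 a) => k ->; case: (@split_ordP 1 1 b) => l ->; rewrite !ord1.
- by rewrite [LHS]block_mxEul mxE.
- by rewrite [LHS]block_mxEur mxE.
- by rewrite [LHS]block_mxEdl mxE.
by rewrite [LHS]block_mxEdr !mxE /= expr1.
Qed.

Lemma pauliE t (a b : 'I_2) : pauli t a b = I ^+ pauli_phase t a *+ pauli_supp t a b.
Proof.
rewrite /pauli /pauli_phase /pauli_supp.
have [->|t1] := eqVneq t 1%N; first by rewrite pauli_xE expr0 /=.
have [_|t2] := eqVneq t 2%N.
  case: (@split_ordP 1 1 a) => k ->; case: (@split_ordP 1 1 b) => l ->; rewrite !ord1.
  - by rewrite [LHS]block_mxEul mxE.
  - by rewrite [LHS]block_mxEur mxE /= mulr1n -[I]expr1 -(@expI_neg _ 1 3).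
  - by rewrite [LHS]block_mxEdl mxE /= mulr1n -[LHS]expr1; apply: expI_mod.
  by rewrite [LHS]block_mxEdr mxE.
have [_|t3] := eqVneq t 3%N; first by rewrite pauli_zE /= exprM sqrCi.
by rewrite mxE expr0.
Qed.

(** The codes 0, 1, 2, 3 stand for the identity and the three Pauli matrices. *)
Definition gamma_table : seq (nat * nat * nat) :=
  [:: (1, 0, 0); (2, 0, 0); (3, 1, 0); (3, 2, 0); (3, 3, 1); (3, 3, 2); (3, 3, 3)]%N.

Definition gamma_tensors : seq 'M[C]_8 :=
  [seq pauli t.1.1 *t pauli t.1.2 *t pauli t.2 : 'M[C]_(2 * 2 * 2) | t <- gamma_table].

Lemma gamma_tensorsE (k : 'I_7) : gamma_tensors`_k = gam C k.
Proof.
rewrite (nth_map (0, 0, 0)%N) ?ltn_ord //; apply/matrixP => i j; rewrite tens3E !pauliE !bit_ordE mxE.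
set t := nth _ _ _.
have mnA (x y : C) (p q : bool) : (x *+ p) * (y *+ q) = (x * y) *+ (p && q).
  by case: p q => [] []; rewrite ?mulr1n ?mulr0n ?mulr0 ?mul0r.
rewrite !mnA -!exprD.
have -> : (j == fl k i) = [&& pauli_supp t.1.1 (bit 0 i) (bit 0 j) &
    pauli_supp t.1.2 (bit 1 i) (bit 1 j)] && pauli_supp t.2 (bit 2 i) (bit 2 j).
  rewrite -val_eqE /= flE /t.
  have /allP h := @all_lt8P (fun k i => all (fun j => (j == flip k i) ==
    (let t := nth (0, 0, 0)%N gamma_table k in
     [&& pauli_supp t.1.1 (bit 0 i) (bit 0 j) &
    pauli_supp t.1.2 (bit 1 i) (bit 1 j)] && pauli_supp t.2 (bit 2 i) (bit 2 j))) (iota 0 8)) isT k i.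
  have hj : (j : nat) \in iota 0 8 by rewrite mem_iota ltn_ord.
  exact: (eqP (h j hj)).
congr (_ *+ _); apply: expI_mod; rewrite /t.
apply: (@all_lt8P (fun k i => let t := nth (0, 0, 0)%N gamma_table k in
  ((pauli_phase t.1.1 (bit 0 i) + pauli_phase t.1.2 (bit 1 i) + pauli_phase t.2 (bit 2 i)) %% 4
   == phase k i %% 4)%N)).
by vm_compute.
Qed.

End PauliTensors.

Section SpinGroup.
Variable R : realType.
Local Notation C := R[i].
Local Notation rc := (complex_real_part R).
Local Notation E := (expa (n := 7) (@cartan_Spin7 R)).

Lemma gammasE : gammas R = gamma_tensors R[i].
Proof. by []. Qed.

Lemma cliffordE (v : 'rV[C]_7) : clifford v = cl v.
Proof. by apply: eq_bigr => k _; rewrite gammasE gamma_tensorsE. Qed.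

Lemma Spin7E (g : 'M[C]_8) : @Spin7 R g <-> spin g.
Proof.
have uE (v : 'rV[C]_7) : \sum_(k < 7) v 0 k ^+ 2 = 1 <-> unitvec v.
  rewrite /unitvec mxE; suff -> : \sum_j v 0 j * v^T j 0 = \sum_(k < 7) v 0 k ^+ 2 by [].
  by apply: eq_bigr => k _; rewrite mxE.
have pE (s : seq 'rV[C]_7) : \prod_(v <- s) clifford v = prodcl s.
  elim: s => [|v s IH]; first by rewrite big_nil.
  by rewrite big_cons IH cliffordE.
by split=> -[s [s1 s2 ->]]; exists s; split=> // v /s2/uE.
Qed.

Lemma cartan_Spin7E (u : 'rV[R]_3) : cartan_Spin7 u = diag_mx (\row_(i < 8) half_weight u i).
Proof.
apply/matrixP => i j; rewrite /cartan_Spin7 [LHS]mxE [X in _ * X]mxE [X in _ * (X + _)]mxE [X in _ * (X + _ + _)]mxE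
  [X in _ * (_ + X + _)]mxE [X in _ * (_ + _ + X)]mxE !tens3E !pauli_zE !mxE !bit_ordE.
have -> : (i == j) = [&& bit_ord 0 i == bit_ord 0 j, bit_ord 1 i == bit_ord 1 j
    & bit_ord 2 i == bit_ord 2 j].
  rewrite -!val_eqE /= !bit_ordE.
  by case: i j => [[|[|[|[|[|[|[|[|]]]]]]]] ?] // [[|[|[|[|[|[|[|[|]]]]]]]] ?].
rewrite /half_weight !big_ord_recr big_ord0 /= add0r.
have -> : widen_ord (leqnSn 2) (widen_ord (leqnSn 1) ord_max) = 0 by apply: val_inj.
have -> : widen_ord (leqnSn 2) ord_max = 1 by apply: val_inj.
have -> : ord_max = 2 :> 'I_3 by apply: val_inj.
case: (_ == _) (bit_ord 1 i == _) (bit_ord 2 i == _) => [] [] [];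
  by rewrite /= ?mulr1n ?mulr0n; ring.
Qed.

Lemma expa_Spin7 u : E u = spin_exp rc u.
Proof.
rewrite /expa cartan_Spin7E (@mexp_diag R 7); apply/matrixP => i j.
rewrite [LHS]mxE [X in real_complex R X]mxE [X in real_complex R (X *+ _)]mxE.
rewrite [X in expR X]mxE /spin_exp [RHS]mxE [X in _ = X *+ _]mxE.
by case: eqP => _; rewrite ?mulr1n ?mulr0n ?rmorph0.
Qed.

Lemma D3_B3_tcone : D3_B3 R = @tcone R.
Proof.
have G1 : @Spin7 R 1%:M by apply/Spin7E; exact: spin1.
have GM g h : @Spin7 R g -> @Spin7 R h -> @Spin7 R (g *m h).
  by move=> /Spin7E sg /Spin7E sh; apply/Spin7E; exact: spinM.
have GV g : @Spin7 R g -> g \in unitmx /\ @Spin7 R (invmx g).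
  by move=> /Spin7E/spinV[u s]; split; [exact: u|apply/Spin7E; exact: s].
have Ga v : @Spin7 R (E v).
  by apply/Spin7E; rewrite expa_Spin7; exact: spin_exp_spin.
apply/seteqP; split=> v.
  move=> /(D3P G1 GM GV Ga)[hc [k [l [[/Spin7E sk uk] [/Spin7E sl ul] [_ um]]]]].
  apply: (triangle_tcone flags7_ok hc (rc := rc)).
  rewrite !expa_Spin7 in um; exact: spin_triangle sk uk sl ul um.
move=> hv; apply/(D3P G1 GM GV Ga); split.
  by move=> i; exact: tcone_chamber hv.
have [p hp] := tcone_interior R.
have [a [b [ua ia ub ib um]]] := triangle_exists rc flags7_ok hv hp.
have [g [h [sg ug sh uh ugh]]] := triangle_spin ua ia ub ib um.
exists g, h; split.
- by split; [apply/Spin7E|exact: ug].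
- by split; [apply/Spin7E|exact: uh].
split; last by rewrite !expa_Spin7; exact: ugh.
apply/Spin7E; rewrite !expa_Spin7; have s u := spin_exp_spin rc u.
exact: (spinM (spinM (spinM (spinM (s _) sg) (s _)) sh) (s _)).
Qed.

End SpinGroup.

Theorem mainTheorem4 (R : realType) :
  [/\ D3_B3 R = D3_C3 R,
      polyhedral_cone (D3_B3 R),
      ([set F | facet (D3_B3 R) F] #= `I_102)%classic%card
    & ([set F | edge (D3_B3 R) F] #= `I_51)%classic%card].
Proof.
by rewrite D3_C3_tcone D3_B3_tcone; split; [|exact: tcone_polyhedral|exact: card_facets|exact: card_edges].
Qed.
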